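(* Let $\ell\in2\mathbb{Z}$ and $F\in\bar M^!_{2-\ell}(1)$. There is $\mu_F\in\mathbb{Z}$ such that for all integers $M\ge\mu_F$ there are holomorphic families $r\mapsto\mathsf{H}_{M,r}$ on $U_M=\mathbb{C}\setminus[12M,\infty)$ for which $\mathsf{H}_{M,r}\in H^!_{\ell+r}(v_r)$ and $\xi_{\ell+r}\mathsf{H}_{M,r}=F\,\bar\eta^{-2r}$ for all $r\in U_M$.
   Context: $\Gamma=\mathrm{SL}_2(\mathbb{Z})$, $\mathfrak{H}=\{z=x+iy:y>0\}$, $q=e^{2\pi iz}$, $\partial_z=\frac12(\partial_x-i\partial_y)$, $\partial_{\bar z}=\frac12(\partial_x+i\partial_y)$. Eta powers: $\log\eta(z)=\frac{\pi iz}{12}-\sum_{n\ge1}\sigma_{-1}(n)q^n$ with $\sigma_{-1}(n)=\sum_{d\mid n}d^{-1}$ (a branch of the logarithm of the Dedekind eta-function); $\eta^{2r}(z)=e^{2r\log\eta(z)}$ and $\bar\eta^{-2r}(z)=e^{-2r\,\overline{\log\eta(z)}}$ for $r\in\mathbb{C}$. The multiplier system $v_r:\Gamma\to\mathbb{C}^\ast$ is determined by $\eta^{2r}(\gamma z)=v_r(\gamma)(cz+d)^r\eta^{2r}(z)$ for $\gamma=\begin{pmatrix}a&b\\c&d\end{pmatrix}\in\Gamma$, where powers of $cz+d$ are computed with $\arg(cz+d)\in(-\pi,\pi]$. $v_0=1$ is trivial. Actions of $\Gamma$ on functions: $(F|_{v_r,p}\gamma)(z)=v_r(\gamma)^{-1}(cz+d)^{-p}F(\gamma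 z)$ for $p\equiv r\bmod2$ (i.e. $p-r\in2\mathbb{Z}$), with $\arg(cz+d)\in(-\pi,\pi]$; and $(F|^a_{v_r,k}\gamma)(z)=v_r(\gamma)^{-1}(c\bar z+d)^{-k}F(\gamma z)$ for $k\equiv-r\bmod2$, with $\arg(c\bar z+d)\in[-\pi,\pi)$. Exponential growth: $F(z)=O(e^{ay})$ as $y\to\infty$ for some $a>0$, uniformly for $x$ in compact sets. $\bar M^!_k(v_r)$: the antiholomorphic functions on $\mathfrak{H}$ that are invariant under $|^a_{v_r,k}$ of $\Gamma$ and have at most exponential growth. $\bar M^!_k(1)=\bar M^!_k(v_0)$. $H^!_p(v_r)$: the functions $H$ on $\mathfrak{H}$ with $\Delta_pH=0$, where $\Delta_p=-4y^2\partial_z\partial_{\bar z}+2ipy\,\partial_{\bar z}$, that are invariant under $|_{v_r,p}$ of $\Gamma$ and have at most exponential growth. $\xi_p=2iy^p\partial_{\bar z}$. A family $r\mapsto\mathsf{H}_r$ of such forms on an open set $U\subset\mathbb{C}$ is holomorphic if $r\mapsto\mathsf{H}_r(z)$ is holomorphic on $U$ for each $z$, and also each term $\mathsf{H}^\infty_\nu(r;z)$ of the Fourier expansion $\mathsf{H}_r(z)=\sum_{\nu\in\mathbb{Z}}\mathsf{H}^\infty_\nu(r;z)$, with $\mathsf{H}_\nu^\infty(r;z+x')=e^{2\pi i(\nu+r/12)x'}\mathsf{H}_\nu^\infty(r;z)$ for $x'\in\mathbb{R}$, is holomorphic in $r$ for each $z$. *)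

(* Defs.v *)
From Stdlib Require Export Reals ZArith.
From Stdlib Require Import Lra Psatz.
From Coquelicot Require Export Coquelicot.
Open Scope R_scope.
Open Scope C_scope.

(** Functions on the upper half-plane are total functions [C -> C] whose values
    off [upper] are ignored by every predicate below. *)
Definition upper (z : C) : Prop := (0 < Im z)%R.

Definition Cexp (z : C) : C :=
  ((exp (Re z) * cos (Im z))%R, (exp (Re z) * sin (Im z))%R).

(** The argument in (-PI, PI], and the argument in [-PI, PI); they differ only
    on the negative real axis. *)
Definition arg (w : C) : R :=
  if Rle_dec 0 (Im w) then acos (Re w / Cmod w) else (- acos (Re w / Cmod w))%R.
Definition arg_low (w : C) : R :=
  if Rlt_dec 0 (Im w) then acos (Re w / Cmod w) else (- acos (Re w / Cmod w))%R.

Definition cpow (w s : C) : C := Cexp (s * (ln (Cmod w), arg w)).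
Definition cpow_low (w s : C) : C := Cexp (s * (ln (Cmod w), arg_low w)).

Lemma acos_polar (w : C) : w <> 0 ->
  (Cmod w * cos (acos (Re w / Cmod w)) = Re w)%R /\
  (Cmod w * sin (acos (Re w / Cmod w)) = Rabs (Im w))%R.
Proof.
intros Hw.
assert (Hm : (0 < Cmod w)%R) by now apply Cmod_gt_0.
assert (Hsq : (Cmod w * Cmod w = Re w * Re w + Im w * Im w)%R).
{ unfold Cmod, Re, Im. rewrite sqrt_sqrt; [ring|].
  apply Rplus_le_le_0_compat; apply pow2_ge_0. }
assert (Hb : (-1 <= Re w / Cmod w <= 1)%R).
{ assert (Hq : (Re w / Cmod w * Cmod w = Re w)%R) by (field; lra).
  assert (Hi := Rle_0_sqr (Im w)). unfold Rsqr in Hi.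
  revert Hm Hsq Hq Hi. generalize (Re w / Cmod w)%R. intros t.
  generalize (Re w) (Im w) (Cmod w). intros x y m Hm Hsq Hq Hi.
  assert (Hm2 : (0 < m * m)%R) by nra.
  assert (Ht : (m * m * (t * t) <= m * m * 1)%R) by (subst x; nra).
  apply Rmult_le_reg_l in Ht; [|exact Hm2].
  split; nra. }
split.
- rewrite cos_acos by exact Hb. field. lra.
- rewrite sin_acos by exact Hb.
  rewrite <- (sqrt_Rsqr (Cmod w)) at 1 by lra.
  rewrite <- sqrt_mult_alt by apply Rle_0_sqr.
  rewrite <- sqrt_Rsqr_abs. f_equal. unfold Rsqr.
  replace (Cmod w * Cmod w * (1 - Re w / Cmod w * (Re w / Cmod w)))%R
    with (Cmod w * Cmod w - Re w * Re w)%R by (field; lra).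
  lra.
Qed.

Lemma arg_spec (w : C) : w <> 0 ->
  (- PI < arg w <= PI)%R /\
  w = ((Cmod w * cos (arg w))%R, (Cmod w * sin (arg w))%R).
Proof.
intros Hw. destruct (acos_polar w Hw) as [Hc Hs].
destruct (acos_bound (Re w / Cmod w)) as [H0 H1].
unfold arg. destruct (Rle_dec 0 (Im w)) as [Hi|Hi].
- split; [pose proof PI_RGT_0; lra|].
  rewrite Hc, Hs, Rabs_pos_eq by lra. now destruct w.
- split.
  + split; [|pose proof PI_RGT_0; lra].
    destruct H1 as [H1|H1]; [lra|exfalso].
    rewrite H1, sin_PI, Rmult_0_r in Hs. symmetry in Hs.
    apply Rabs_eq_0 in Hs. lra.
  + rewrite cos_neg, sin_neg, Ropp_mult_distr_r_reverse, Hc, Hs.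
    rewrite Rabs_left, Ropp_involutive by lra. now destruct w.
Qed.

Lemma arg_low_spec (w : C) : w <> 0 ->
  (- PI <= arg_low w < PI)%R /\
  w = ((Cmod w * cos (arg_low w))%R, (Cmod w * sin (arg_low w))%R).
Proof.
intros Hw. destruct (acos_polar w Hw) as [Hc Hs].
destruct (acos_bound (Re w / Cmod w)) as [H0 H1].
unfold arg_low. destruct (Rlt_dec 0 (Im w)) as [Hi|Hi].
- split.
  + split; [pose proof PI_RGT_0; lra|].
    destruct H1 as [H1|H1]; [lra|exfalso].
    rewrite H1, sin_PI, Rmult_0_r in Hs. symmetry in Hs.
    apply Rabs_eq_0 in Hs. lra.
  + rewrite Hc, Hs, Rabs_pos_eq by lra. now destruct w.
- split; [pose proof PI_RGT_0; lra|].
  rewrite cos_neg, sin_neg, Ropp_mult_distr_r_reverse, Hc, Hs.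
  rewrite Rabs_left1, Ropp_involutive by lra. now destruct w.
Qed.

Record SL2Z := mkSL2Z {
  ga : Z; gb : Z; gc : Z; gd : Z;
  g_det : (ga * gd - gb * gc)%Z = 1%Z }.

Definition mobius (g : SL2Z) (z : C) : C :=
  (IZR (ga g) * z + IZR (gb g)) / (IZR (gc g) * z + IZR (gd g)).

Definition autj (g : SL2Z) (z : C) : C := IZR (gc g) * z + IZR (gd g).

Definition sigma_m1 (n : nat) : R :=
  sum_n_m (fun d => if Nat.eqb (n mod d) 0 then (/ INR d)%R else 0%R) 1 n.

(** Only applied to absolutely convergent series. *)
Definition Cseries (a : nat -> C) : C :=
  (Series (fun n => Re (a n)), Series (fun n => Im (a n))).

Definition log_eta (z : C) : C :=
  PI * Ci * z / 12
  - Cseries (fun n => sigma_m1 (S n) * Cpow (Cexp (2 * PI * Ci * z)) (S n)).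

Definition eta_pow (r z : C) : C := Cexp (2 * r * log_eta z).

Definition eta_bar_pow (r z : C) : C := Cexp (- (2 * r) * Cconj (log_eta z)).

(** [iota P] is the unique complex number satisfying [P]. It exists here because
    [log_eta (mobius g z) - log_eta z] and half the logarithm of [autj g z]
    differ by a constant on [upper]. *)
Definition mult_sys (r : C) (g : SL2Z) : C :=
  @iota C_CompleteNormedModule (fun v : C => forall z, upper z ->
    eta_pow r (mobius g z) = v * cpow (autj g z) r * eta_pow r z).

Definition congr_mod2 (p r : C) : Prop := exists m : Z, p - r = 2 * IZR m.

Definition slash (r p : C) (F : C -> C) (g : SL2Z) (z : C) : C :=
  / mult_sys r g * cpow (autj g z) (- p) * F (mobius g z).

Definition slash_anti (r k : C) (F : C -> C) (g : SL2Z) (z : C) : C :=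
  / mult_sys r g * cpow_low (autj g (Cconj z)) (- k) * F (mobius g z).

Definition invariant (r p : C) (F : C -> C) : Prop :=
  forall (g : SL2Z) z, upper z -> slash r p F g z = F z.

Definition invariant_anti (r k : C) (F : C -> C) : Prop :=
  forall (g : SL2Z) z, upper z -> slash_anti r k F g z = F z.

Definition exp_growth (F : C -> C) : Prop :=
  exists a : R, (0 < a)%R /\
    forall K : R -> Prop, compact K ->
      exists B Y : R, (0 < Y)%R /\
        forall x y : R, K x -> (Y <= y)%R ->
          (Cmod (F (x, y)) <= B * exp (a * y))%R.

Definition holomorphic_on (U : C -> Prop) (f : C -> C) : Prop :=
  forall z, U z -> @ex_derive C_AbsRing C_NormedModule f z.

Definition antiholomorphic_on (U : C -> Prop) (f : C -> C) : Prop :=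
  holomorphic_on U (fun z => Cconj (f z)).

Definition partial_x (F : C -> C) (z : C) : C :=
  (Derive (fun t => Re (F (t, Im z))) (Re z),
   Derive (fun t => Im (F (t, Im z))) (Re z)).
Definition partial_y (F : C -> C) (z : C) : C :=
  (Derive (fun t => Re (F (Re z, t))) (Im z),
   Derive (fun t => Im (F (Re z, t))) (Im z)).

Definition ex_partials (F : C -> C) (z : C) : Prop :=
  ex_derive (fun t => Re (F (t, Im z))) (Re z) /\
  ex_derive (fun t => Im (F (t, Im z))) (Re z) /\
  ex_derive (fun t => Re (F (Re z, t))) (Im z) /\
  ex_derive (fun t => Im (F (Re z, t))) (Im z).

(** Class C^n in the real sense. *)
Fixpoint class_C (n : nat) (F : C -> C) : Prop :=
  (forall z, upper z -> continuous F z) /\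
  match n with
  | O => True
  | S m => (forall z, upper z -> ex_partials F z) /\
           class_C m (partial_x F) /\ class_C m (partial_y F)
  end.

Definition d_z (F : C -> C) (z : C) : C :=
  / 2 * (partial_x F z - Ci * partial_y F z).
Definition d_zbar (F : C -> C) (z : C) : C :=
  / 2 * (partial_x F z + Ci * partial_y F z).

Definition Laplace (p : C) (F : C -> C) (z : C) : C :=
  - (4) * Im z * Im z * d_z (d_zbar F) z + 2 * Ci * p * Im z * d_zbar F z.

Definition xi (p : C) (F : C -> C) (z : C) : C :=
  2 * Ci * cpow (Im z) p * d_zbar F z.

(** [Mbar k r] and [Hharm p r] have weight [k], [p] and multiplier system v_r.
    The congruences express that the actions are only defined for weights in
    the class modulo 2 fixed by the multiplier system. *)
Definition Mbar (k r : C) (F : C -> C) : Prop :=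
  congr_mod2 k (- r) /\ antiholomorphic_on upper F /\
  invariant_anti r k F /\ exp_growth F.

Definition Hharm (p r : C) (F : C -> C) : Prop :=
  congr_mod2 p r /\ class_C 2 F /\ (forall z, upper z -> Laplace p F z = 0) /\
  invariant r p F /\ exp_growth F.

(** Absolute convergence makes the sum independent of the order, and makes the
    terms in [is_fourier_expansion] uniquely determined by [F]. *)
Definition is_sum_Z (a : Z -> C) (s : C) : Prop :=
  ex_series (fun n => Cmod (a (Z.of_nat n))) /\
  ex_series (fun n => Cmod (a (- Z.of_nat (S n))%Z)) /\
  exists s1 s2 : C,
    is_series (fun n => a (Z.of_nat n)) s1 /\
    is_series (fun n => a (- Z.of_nat (S n))%Z) s2 /\
    s = s1 + s2.

Definition is_fourier_expansion (r : C) (F : C -> C) (T : Z -> C -> C) : Prop :=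
  (forall (nu : Z) z (x' : R), upper z ->
     T nu (z + x') = Cexp (2 * PI * Ci * (IZR nu + r / 12) * x') * T nu z) /\
  (forall z, upper z -> is_sum_Z (fun nu => T nu z) (F z)).

Definition holomorphic_family (U : C -> Prop) (H : C -> C -> C) : Prop :=
  (forall z, upper z -> holomorphic_on U (fun r => H r z)) /\
  exists T : C -> Z -> C -> C,
    (forall r, U r -> is_fourier_expansion r (H r) (T r)) /\
    (forall (nu : Z) z, upper z -> holomorphic_on U (fun r => T r nu z)).

Definition slit_plane (M : Z) (r : C) : Prop :=
  ~ (Im r = 0%R /\ (12 * IZR M <= Re r)%R).

(* Main.v *)
Require Import Defs.
From Stdlib Require Import Lra Lia Psatz List ClassicalEpsilon FunctionalExtensionality Permutation FinFun.
Open Scope R_scope.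
Open Scope C_scope.

(** A harmonic lift is sought in the form H_r = eta^(2r) h_r.  Since eta^(2r) is holomorphic and carries the multiplier
    system, h_r must be a (nonholomorphic) modular form of integral weight l whose antiholomorphic derivative is
    G_r = F y^(-l-r) |eta|^(-4r) / (2i); the Laplace equation then only says that y^(l+r) times the antiholomorphic
    derivative of H_r is antiholomorphic.  Everything must be holomorphic in r.

    At the cusp.  Expand F exp(2r conj S) = sum of a_n conj(q)^n, where log eta = pi i z/12 - S and a_n = 0 for n << 0.
    Termwise integration gives the solution u_r = exp(2rS) sum of a_n q^(-n) f_n(r,y), where f_n is a primitive in y of
    -y^(-l-r) exp(-4 pi b y) with b = n - r/12.  For large n only the primitive that vanishes at infinity gives a
    convergent series.  It is an incomplete gamma function, singular exactly where b meets the negative real axis, that is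
    for r in [12n, oo); so it may be used for all n >= M when r avoids [12M, oo).  The finitely many other
    terms use the primitive that vanishes at y = 1, which is entire in r ([ff], [Gam], [V_wd]).

    Globally.  Let psi be periodic, supported in y >= 1/2, with sum 1 over the translates by the lower rows (c,d) ([pu],
    [pu_sum]).  On the cylinder, solve dbar s = - u Delta^k dbar psi by Fourier series: the right hand side lives in a
    strip, and the solution is bounded up to the real axis ([s1_bound]).  Then t = psi u Delta^k + s is bounded on
    y <= Y, so its Poincare series of weight l + 12k >= 4 converges as an Eisenstein series does.  The antiholomorphic
    derivative of t is psi G Delta^k; the translates of psi sum to 1, so the Poincare series divided by Delta^k is the
    required h_r ([hh_inv], [hh_wd]).  All sums converge locally uniformly in r, hence the family is holomorphic; by
    Goursat's theorem h_r - u_r is holomorphic in z, which gives the differentiability of h_r.  The terms of the Fourier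
    expansion are integrals over x, and inherit holomorphy in r ([TT_ana]).

    The transformation law of log eta is needed, up to a constant, for all of SL(2,Z) ([lg_mobius]).  Its derivative
    is a weight two Eisenstein series, for which z -> -1/z is an exchange of summations; this is legitimate after
    subtracting 1/((cz+d)^2 - 1), whose rows telescope to 0 while its columns are cotangent series ([serre]).  The
    sums over one index are instances of Fourier inversion at a single point ([fourier_inv]). *)

(** * Continuity and differentiability *)

Tactic Notation "have" ident(H) ":" lconstr(T) := assert (H : T).
Tactic Notation "have" ident(H) ":" lconstr(T) "by" tactic3(t) := assert (H : T) by t.
Tactic Notation "have" ident(H) ":=" lconstr(t) := assert (H := t).
Lemma lt_rmin x a b : x < Rmin a b -> x < a /\ x < b.
Proof. intros. have H1 := Rmin_l a b. have H2 := Rmin_r a b. lra. Qed.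
Tactic Notation "take" constr(d) := exists d; split; [assumption|].
Tactic Notation "take_min" constr(a) constr(b) := exists (Rmin a b); split; [now apply Rmin_glb_lt|].
Tactic Notation "take_min" constr(a) constr(b) "as" ident(y) ident(H) :=
  exists (Rmin a b); split; [now apply Rmin_glb_lt|]; intros y H; apply lt_rmin in H.
Tactic Notation "vanish" constr(c) := replace c with (RtoC 0) by ring.
Tactic Notation "le_by" uconstr(H) := eapply Rle_trans; [apply H|].
Ltac pairs := cbn [fst snd].
Ltac minmax := rewrite Rmin_left, Rmax_right by lra.
Ltac tri := eapply Rle_trans; [apply Cmod_triangle|].
Notation RV := R_CompleteNormedModule.
Notation classical := excluded_middle_informative.

Definition dC (z w : C) : R := Cmod (w - z).
Definition dR (x y : R) : R := Rabs (y - x).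
Definition dP {X Y : Type} (d1 : X -> X -> R) (d2 : Y -> Y -> R) (p q : X * Y) : R :=
  (d1 (fst p) (fst q) + d2 (snd p) (snd q))%R.

(** Distances are plain functions, so that families indexed by products, reals and complex numbers are treated alike. *)
Definition ct {X Y : Type} (dX : X -> X -> R) (dY : Y -> Y -> R) (f : X -> Y) (x : X) :=
  forall eps : R, 0 < eps -> exists del : R, 0 < del /\
    forall y, dX x y < del -> dY (f x) (f y) < eps.

(** First order expansion with Wirtinger coefficients [A] and [B] in the coordinate [io]. For [io] the identity of C
    these are the two Wirtinger derivatives; for the inclusion of the real line only [A + B] is determined. *)
Definition wd {X : Type} (io : X -> C) (f : X -> C) (x : X) (A B : C) :=
  forall eps : R, 0 < eps -> exists del : R, 0 < del /\
    forall y, Cmod (io y - io x) < del ->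
      Cmod (f y - f x - ((io y - io x) * A + Cconj (io y - io x) * B))
        <= eps * Cmod (io y - io x).

Definition idC (z : C) : C := z.
Notation cder f z l := (wd idC f z l 0).
Notation rder f t l := (wd RtoC f t l 0).

Lemma Cmod_symm a b : Cmod (a - b) = Cmod (b - a).
Proof. rewrite <- Cmod_opp. f_equal. ring. Qed.
Lemma Cmod_tri3 a b c : Cmod (a - c) <= Cmod (a - b) + Cmod (b - c).
Proof. replace (a - c) with ((a - b) + (b - c)) by ring. apply Cmod_triangle. Qed.
Lemma Cmod_tri_inv a b : Cmod a - Cmod b <= Cmod (a - b).
Proof. have H := Cmod_triangle (a - b) b. replace (a - b + b) with a in H by ring. lra. Qed.
Lemma Cmod_pos_nz z : 0 < Cmod z -> z <> 0.
Proof. intros H E. rewrite E, Cmod_0 in H. lra. Qed.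
Lemma im_le_Cmod z : Rabs (Im z) <= Cmod z.
Proof. have H := Rmax_Cmod z. have H1 := Rmax_r (Rabs (fst z)) (Rabs (snd z)). unfold Im. lra. Qed.
Lemma Cmod_RtoC_sub x y : Cmod (RtoC y - RtoC x) = Rabs (y - x).
Proof. rewrite <- RtoC_minus, Cmod_R. reflexivity. Qed.
Lemma Cmod_eq_small a : (forall eps, 0 < eps -> Cmod a <= eps) -> a = 0.
Proof. intros H. apply Cmod_eq_0. have H0 := Cmod_ge_0 a. specialize (H (Cmod a / 2)%R). lra. Qed.
Lemma C_eq (z w : C) : Re z = Re w -> Im z = Im w -> z = w.
Proof. destruct z, w. simpl. now intros -> ->. Qed.
Lemma RtoC_nz (x : R) : x <> 0 -> RtoC x <> 0.
Proof. intros H E. now apply RtoC_inj in E. Qed.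
Lemma Ci_nz : Ci <> 0.
Proof. apply Cmod_pos_nz. rewrite Cmod_Ci. lra. Qed.
Lemma PIC_nz : RtoC PI <> 0.
Proof. apply RtoC_nz, PI_neq0. Qed.

Ltac pos_more := fail.
Ltac pos := repeat first [assumption | apply Cmod_ge_0 | apply Rle_0_sqr | apply Rabs_pos | apply pow2_ge_0 | apply pos_INR
  | apply exp_pos | apply PI_RGT_0 | apply Rmin_glb_lt | apply Rmult_lt_0_compat | apply Rmult_le_pos | apply Rinv_0_lt_compat
  | apply Rdiv_lt_0_compat | pos_more | lra | apply pow_le | apply Rabs_pos_lt; lra | apply Rlt_le; solve [pos] ].
Ltac nz_more := fail.
Ltac nz := repeat first [assumption | nz_more | apply Cmult_neq_0 | apply Ci_nz | apply PIC_nz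
  | apply RtoC_nz; first [assumption | apply not_0_IZR; first [assumption | lia] | lra | apply Rgt_not_eq; solve [pos]]].
Ltac more := fail.
(** The hook [more] is extended when closure lemmas for continuity, holomorphy and derivatives become available. *)
Ltac go := intros; first [assumption | reflexivity | lra | lia | solve [pos] | solve [nz] | ring | solve [cbv beta; ring] | solve [field; repeat split; nz]
  | easy | more | solve [apply C_eq; unfold Re, Im; simpl; ring] | solve [auto 6] | nra].

Lemma Cmod_le_ReIm z : Cmod z <= Rabs (Re z) + Rabs (Im z).
Proof. destruct z as [a b]. simpl. replace (a, b) with (RtoC a + Ci * RtoC b) by go. tri. rewrite Cmod_mult, !Cmod_R, Cmod_Ci. lra. Qed.
Lemma rmin_pos a b : 0 < a -> 0 < b -> 0 < Rmin a b.
Proof. go. Qed.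
Lemma le_all_eps (a b : R) : (forall eps, 0 < eps -> a <= b + eps) -> a <= b.
Proof. intros H. specialize (H ((a - b) / 2)%R). lra. Qed.

Section Continuity.
Context {X Y Z : Type} (dX : X -> X -> R) (dY : Y -> Y -> R) (dZ : Z -> Z -> R).

Lemma ct_comp (f : Y -> Z) (g : X -> Y) x :
  ct dX dY g x -> ct dY dZ f (g x) -> ct dX dZ (fun t => f (g t)) x.
Proof. intros Hg Hf eps He. destruct (Hf eps He) as [d1 [H1 H2]]. destruct (Hg d1 H1) as [d2 [H3 H4]]. exists d2. go. Qed.

Lemma ct_pair (f : X -> Y) (g : X -> Z) x :
  ct dX dY f x -> ct dX dZ g x -> ct dX (dP dY dZ) (fun t => (f t, g t)) x.
Proof.
intros Hf Hg eps He. destruct (Hf (eps / 2)%R ltac:(lra)) as [d1 [H1 H2]]. destruct (Hg (eps / 2)%R ltac:(lra)) as [d2 [H3 H4]].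
take_min d1 d2. intros y Hy. apply lt_rmin in Hy. unfold dP. simpl. specialize (H2 y (proj1 Hy)). specialize (H4 y (proj2 Hy)). lra.
Qed.

Lemma ct_ext_loc (f g : X -> Y) x :
  (exists del, 0 < del /\ forall y, dX x y < del -> f y = g y) -> f x = g x ->
  ct dX dY f x -> ct dX dY g x.
Proof.
intros [d [Hd He]] Hx Hf eps Hp. destruct (Hf eps Hp) as [d1 [H1 H2]]. take_min d d1. intros y Hy. apply lt_rmin in Hy.
rewrite <- Hx, <- He by tauto. now apply H2.
Qed.
End Continuity.

Lemma ct_ext {X Y} dX dY (f g : X -> Y) x :
  (forall y, f y = g y) -> ct dX dY f x -> ct dX dY g x.
Proof. intros H Hf eps He. destruct (Hf eps He) as [d [H1 H2]]. take d. intros y Hy. rewrite <- !H. go. Qed.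
Lemma ct_const {X} (dX : X -> X -> R) (c : C) x : ct dX dC (fun _ => c) x.
Proof. intros eps He. exists 1%R. split; [lra|]. intros. unfold dC. vanish (c - c). now rewrite Cmod_0. Qed.
Lemma ct_constR {X} (dX : X -> X -> R) (c : R) x : ct dX dR (fun _ => c) x.
Proof. intros eps He. exists 1%R. split; [lra|]. intros. unfold dR. now rewrite Rminus_diag, Rabs_R0. Qed.
Lemma ct_id {X} (dX : X -> X -> R) x : ct dX dX (fun t => t) x.
Proof. intros eps He. exists eps. auto. Qed.

Lemma dC_ge0 z w : 0 <= dC z w. Proof. go. Qed.
Lemma dR_ge0 z w : 0 <= dR z w. Proof. go. Qed.
Lemma dP_ge0 {X Y} (d1 : X -> X -> R) (d2 : Y -> Y -> R) :
  (forall a b, 0 <= d1 a b) -> (forall a b, 0 <= d2 a b) ->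
  forall p q, 0 <= dP d1 d2 p q.
Proof. intros H1 H2 p q. unfold dP. specialize (H1 (fst p) (fst q)). specialize (H2 (snd p) (snd q)). lra. Qed.
Lemma ct_fst {X Y} (d1 : X -> X -> R) (d2 : Y -> Y -> R) p :
  (forall a b, 0 <= d2 a b) -> ct (dP d1 d2) d1 (fun t => fst t) p.
Proof. intros H eps He. take eps. intros q Hq. unfold dP in Hq. specialize (H (snd p) (snd q)). lra. Qed.
Lemma ct_snd {X Y} (d1 : X -> X -> R) (d2 : Y -> Y -> R) p :
  (forall a b, 0 <= d1 a b) -> ct (dP d1 d2) d2 (fun t => snd t) p.
Proof. intros H eps He. take eps. intros q Hq. unfold dP in Hq. specialize (H (fst p) (fst q)). lra. Qed.

Section CtC.
Context {X : Type} (dX : X -> X -> R).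

Lemma ct_plus (f g : X -> C) x :
  ct dX dC f x -> ct dX dC g x -> ct dX dC (fun t => f t + g t) x.
Proof.
intros Hf Hg eps He. destruct (Hf (eps / 2)%R ltac:(lra)) as [d1 [H1 H2]]. destruct (Hg (eps / 2)%R ltac:(lra)) as [d2 [H3 H4]].
take_min d1 d2. intros y Hy. apply lt_rmin in Hy. unfold dC in *.
replace (f y + g y - (f x + g x)) with ((f y - f x) + (g y - g x)) by ring. eapply Rle_lt_trans; [apply Cmod_triangle|].
specialize (H2 y (proj1 Hy)). specialize (H4 y (proj2 Hy)). lra.
Qed.

Lemma ct_opp (f : X -> C) x : ct dX dC f x -> ct dX dC (fun t => - f t) x.
Proof.
intros Hf eps He. destruct (Hf eps He) as [d1 [H1 H2]]. take d1. intros y Hy. unfold dC in *.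
replace (- f y - - f x) with (- (f y - f x)) by ring. rewrite Cmod_opp. go.
Qed.

Lemma ct_minus (f g : X -> C) x :
  ct dX dC f x -> ct dX dC g x -> ct dX dC (fun t => f t - g t) x.
Proof. intros. apply ct_plus; [go|now apply ct_opp]. Qed.

Lemma ct_mult (f g : X -> C) x :
  ct dX dC f x -> ct dX dC g x -> ct dX dC (fun t => f t * g t) x.
Proof.
intros Hf Hg eps He. set (a := (Cmod (f x) + 1)%R). set (b := (Cmod (g x) + 1)%R).
have Ha : 0 < a by (unfold a; have H := Cmod_ge_0 (f x); lra). have Hb : 0 < b by (unfold b; have H := Cmod_ge_0 (g x); lra).
destruct (Hf (Rmin 1 (eps / (2 * b)))) as [d1 [H1 H2]]. { go. } destruct (Hg (eps / (2 * a))%R) as [d2 [H3 H4]]. { go. } take_min d1 d2.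
intros y Hy. apply lt_rmin in Hy as [Hy1 Hy2]. specialize (H2 y Hy1). specialize (H4 y Hy2). apply lt_rmin in H2. unfold dC in *.
replace (f y * g y - f x * g x) with (f y * (g y - g x) + (f y - f x) * g x) by ring. eapply Rle_lt_trans; [apply Cmod_triangle|].
rewrite !Cmod_mult. have Hfy : Cmod (f y) < a. { unfold a. have H := Cmod_tri_inv (f y) (f x). lra. }
have E1 : Cmod (f y) * Cmod (g y - g x) <= a * (eps / (2 * a)). { apply Rmult_le_compat; try apply Cmod_ge_0; lra. }
have E2 : Cmod (f y - f x) * Cmod (g x) < eps / (2 * b) * b.
{ apply Rle_lt_trans with (eps / (2 * b) * Cmod (g x))%R.
 - apply Rmult_le_compat_r; [go|lra].
 - apply Rmult_lt_compat_l; [go|unfold b; lra]. } replace (a * (eps / (2 * a)))%R with (eps / 2)%R in E1 by (field; lra).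
replace (eps / (2 * b) * b)%R with (eps / 2)%R in E2 by (field; lra). lra.
Qed.

Lemma ct_conj (f : X -> C) x : ct dX dC f x -> ct dX dC (fun t => Cconj (f t)) x.
Proof.
intros Hf eps He. destruct (Hf eps He) as [d1 [H1 H2]]. take d1. intros y Hy. unfold dC in *. rewrite <- Cminus_conj, Cmod_conj. go.
Qed.

Lemma ct_inv (f : X -> C) x : f x <> 0 -> ct dX dC f x -> ct dX dC (fun t => / f t) x.
Proof.
intros Hn Hf eps He. have Hp := proj1 (Cmod_gt_0 _) Hn. set (a := Cmod (f x)) in *.
destruct (Hf (Rmin (a / 2) (eps * (a * a) / 2))) as [d [H1 H2]]. { go. } take d. intros y Hy. specialize (H2 y Hy). apply lt_rmin in H2.
unfold dC in *. have Hy2 : a / 2 < Cmod (f y). { have H := Cmod_tri_inv (f x) (f y). rewrite Cmod_symm in H. fold a in H. lra. }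
have Hny : f y <> 0 by (apply Cmod_pos_nz; lra). replace (/ f y - / f x) with ((f x - f y) / (f y * f x)) by go. rewrite Cmod_div by go.
rewrite Cmod_mult, Cmod_symm. fold a. apply Rmult_lt_reg_r with (Cmod (f y) * a)%R; [nra|].
replace (Cmod (f y - f x) / (Cmod (f y) * a) * (Cmod (f y) * a))%R with (Cmod (f y - f x)) by (field; nra).
assert (eps * (Cmod (f y) * a) > eps * (a / 2 * a)); [|nra]. apply Rmult_gt_compat_l; [go|]. go.
Qed.

Lemma ct_RtoC (f : X -> R) x : ct dX dR f x -> ct dX dC (fun t => RtoC (f t)) x.
Proof. intros Hf eps He. destruct (Hf eps He) as [d [H1 H2]]. take d. intros y Hy. unfold dC. rewrite Cmod_RtoC_sub. now apply H2. Qed.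

Lemma ct_Re (f : X -> C) x : ct dX dC f x -> ct dX dR (fun t => Re (f t)) x.
Proof.
intros Hf eps He. destruct (Hf eps He) as [d [H1 H2]]. take d. intros y Hy. specialize (H2 y Hy). unfold dR. unfold dC in H2.
have H := re_le_Cmod (f y - f x). replace (Re (f y) - Re (f x))%R with (Re (f y - f x)) by go. lra.
Qed.

Lemma ct_Im (f : X -> C) x : ct dX dC f x -> ct dX dR (fun t => Im (f t)) x.
Proof.
intros Hf eps He. destruct (Hf eps He) as [d [H1 H2]]. take d. intros y Hy. specialize (H2 y Hy). unfold dR. unfold dC in H2.
have H := im_le_Cmod (f y - f x). replace (Im (f y) - Im (f x))%R with (Im (f y - f x)) by go. lra.
Qed.

Lemma ct_Rstd (g : R -> R) (f : X -> R) x :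
  ct dX dR f x -> continuity_pt g (f x) -> ct dX dR (fun t => g (f t)) x.
Proof.
intros Hf Hg eps He. destruct (Hg eps He) as [a [Ha Hb]]. destruct (Hf a Ha) as [d [H1 H2]]. take d. intros y Hy. specialize (H2 y Hy).
unfold dR in *. destruct (Req_dec (f x) (f y)) as [E|E].
- rewrite E, Rminus_diag, Rabs_R0. go. - apply (Hb (f y)). go.
Qed.

Lemma ct_approx (f : X -> C) x :
  (forall eps, 0 < eps -> exists g, ct dX dC g x /\ exists del, 0 < del /\
    Cmod (f x - g x) <= eps /\
    forall y, dX x y < del -> Cmod (f y - g y) <= eps) -> ct dX dC f x.
Proof.
intros H eps He. destruct (H (eps / 4)%R ltac:(lra)) as [g [Hg [d [Hd [Hx Hy]]]]]. destruct (Hg (eps / 4)%R ltac:(lra)) as [d1 [H1 H2]].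
take_min d d1 as y Hyy. destruct Hyy as [Hy1 Hy2]. specialize (Hy y Hy1). specialize (H2 y Hy2). unfold dC in *.
have T1 := Cmod_tri3 (f y) (g y) (f x). have T2 := Cmod_tri3 (g y) (g x) (f x). rewrite (Cmod_symm (g x)) in T2. lra.
Qed.

Lemma ct_ReIm (f : X -> C) x :
  ct dX dR (fun t => Re (f t)) x -> ct dX dR (fun t => Im (f t)) x -> ct dX dC f x.
Proof.
intros H1 H2. apply ct_ext with (f := fun t => RtoC (Re (f t)) + Ci * RtoC (Im (f t))).
- go. - apply ct_plus; [now apply ct_RtoC|]. apply ct_mult; [apply ct_const|now apply ct_RtoC].
Qed.
End CtC.

Lemma ct_pow {X} (dX : X -> X -> R) (f : X -> C) n x :
  ct dX dC f x -> ct dX dC (fun t => f t ^ n) x.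
Proof. intros H. induction n; simpl; [apply ct_const|now apply ct_mult]. Qed.
Lemma ct_div {X} (dX : X -> X -> R) (f g : X -> C) x :
  g x <> 0 -> ct dX dC f x -> ct dX dC g x -> ct dX dC (fun t => f t / g t) x.
Proof. intros. apply ct_mult; [go|now apply ct_inv]. Qed.

Section Wd.
Context {X : Type} (io : X -> C).
Let dI (x y : X) := Cmod (io y - io x).

Lemma wd_lip (f : X -> C) x A B : wd io f x A B -> exists K del, 0 < K /\ 0 < del /\
  forall y, Cmod (io y - io x) < del -> Cmod (f y - f x) <= K * Cmod (io y - io x).
Proof.
intros H. destruct (H 1%R ltac:(lra)) as [d [H1 H2]]. exists (1 + Cmod A + Cmod B)%R, d. have HA := Cmod_ge_0 A. have HB := Cmod_ge_0 B.
split; [lra|]. split; [assumption|]. intros y Hy. specialize (H2 y Hy). set (h := io y - io x) in *.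
replace (f y - f x) with ((f y - f x - (h * A + Cconj h * B)) + (h * A + Cconj h * B)) by ring. tri.
have H3 := Cmod_triangle (h * A) (Cconj h * B). rewrite !Cmod_mult, Cmod_conj in H3. lra.
Qed.

Lemma wd_ct (f : X -> C) x A B : wd io f x A B -> ct dI dC f x.
Proof.
intros H. apply wd_lip in H as [K [d [HK [Hd H]]]]. intros eps He. exists (Rmin d (eps / K)). split. { go. } intros y Hy.
apply lt_rmin in Hy. eapply Rle_lt_trans; [now apply H|]. fold (dI x y). apply Rlt_le_trans with (K * (eps / K))%R; [go|]. right. field.
lra.
Qed.

Lemma wd_eq (f : X -> C) x A B A' B' : A = A' -> B = B' -> wd io f x A B -> wd io f x A' B'.
Proof. now intros -> ->. Qed.
Lemma wd_ext (f g : X -> C) x A B : (forall y, f y = g y) -> wd io f x A B -> wd io g x A B.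
Proof. intros H Hf eps He. destruct (Hf eps He) as [d [H1 H2]]. exists d. split; [assumption|]. intros y Hy. rewrite <- !H. go. Qed.

Lemma wd_ext_loc (f g : X -> C) x A B :
  (exists del, 0 < del /\ forall y, Cmod (io y - io x) < del -> f y = g y) ->
  wd io f x A B -> wd io g x A B.
Proof.
intros [e [He H]] Hf eps Hp. destruct (Hf eps Hp) as [d [H1 H2]]. take_min e d as y Hy. rewrite <- !H; [now apply H2| |tauto].
vanish (io x - io x). now rewrite Cmod_0.
Qed.

Lemma wd_const c x : wd io (fun _ => c) x 0 0.
Proof. intros eps He. exists 1%R. split; [lra|]. intros y _. replace (_ - _ - _) with (RtoC 0) by ring. rewrite Cmod_0. go. Qed.
Lemma wd_io x : wd io io x 1 0.
Proof. intros eps He. exists 1%R. split; [lra|]. intros y _. replace (_ - _ - _) with (RtoC 0) by ring. rewrite Cmod_0. go. Qed.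

Lemma wd_plus f g x A B A' B' : wd io f x A B -> wd io g x A' B' ->
  wd io (fun t => f t + g t) x (A + A') (B + B').
Proof.
intros Hf Hg eps He. destruct (Hf (eps / 2)%R ltac:(lra)) as [d1 [H1 H2]]. destruct (Hg (eps / 2)%R ltac:(lra)) as [d2 [H3 H4]].
take_min d1 d2 as y Hy. specialize (H2 y (proj1 Hy)). specialize (H4 y (proj2 Hy)). set (h := io y - io x) in *.
replace (f y + g y - (f x + g x) - (h * (A + A') + Cconj h * (B + B'))) with ((f y - f x - (h * A + Cconj h * B)) + (g y - g x - (h * A' +
 Cconj h * B'))) by ring. tri. lra.
Qed.

Lemma wd_conj f x A B : wd io f x A B -> wd io (fun t => Cconj (f t)) x (Cconj B) (Cconj A).
Proof.
intros Hf eps He. destruct (Hf eps He) as [d [H1 H2]]. take d. intros y Hy. specialize (H2 y Hy). set (h := io y - io x) in *.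
rewrite <- Cmod_conj in H2. rewrite !Cminus_conj, Cplus_conj, !Cmult_conj, Cconj_conj in H2.
replace (_ - _ - _) with (Cconj (f y) - Cconj (f x) - (Cconj h * Cconj A + h * Cconj B)) by ring. go.
Qed.
End Wd.
Tactic Notation "wd_by" tactic0(t) := eapply wd_eq; [| |t].

(** The chain rule; [io2] is the coordinate of the intermediate space. *)
Lemma wd_chain {X Y} (io : X -> C) (io2 : Y -> C) (f : Y -> C) (g : X -> Y) x A B a b :
  wd io2 f (g x) A B -> wd io (fun t => io2 (g t)) x a b ->
  wd io (fun t => f (g t)) x (A * a + B * Cconj b) (A * b + B * Cconj a).
Proof.
intros Hf Hg. destruct (wd_lip _ _ _ _ _ Hg) as [K [d0 [HK [Hd0 Hl]]]]. intros eps He. set (c := (1 + Cmod A + Cmod B)%R).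
have HA := Cmod_ge_0 A. have HB := Cmod_ge_0 B. have Hc : 0 < c by (unfold c; lra). destruct (Hf (eps / (2 * K))%R) as [d1 [H1 H2]]; [go|].
destruct (Hg (eps / (2 * c))%R) as [d2 [H3 H4]]; [go|]. exists (Rmin d0 (Rmin d2 (d1 / K))). split. { go. } intros y Hy.
apply lt_rmin in Hy as [Hy0 Hy]. apply lt_rmin in Hy as [Hy2 Hy1]. specialize (Hl y Hy0). specialize (H4 y Hy2).
set (h := io y - io x) in *. set (k := io2 (g y) - io2 (g x)) in *. have Hk : Cmod k < d1.
{ apply Rlt_le_trans with (K * (d1 / K))%R.
 - go. - right. field. lra. } specialize (H2 (g y) Hk). fold k in H2. set (e := k - (h * a + Cconj h * b)) in *.
replace (f (g y) - f (g x) - (h * (A * a + B * Cconj b) + Cconj h * (A * b + B * Cconj a))) with ((f (g y) - f (g x) - (k * A + Cconj k *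
 B)) + (e * A + Cconj e * B)). 2:{ go. } tri. have E1 := Cmod_triangle (e * A) (Cconj e * B). rewrite !Cmod_mult, Cmod_conj in E1.
have E2 : eps / (2 * K) * Cmod k <= eps / 2 * Cmod h.
{ apply Rle_trans with (eps / (2 * K) * (K * Cmod h))%R.
 - apply Rmult_le_compat_l; [go|go]. - right. field. lra. } have E3 : Cmod e * c <= eps / 2 * Cmod h.
{ apply Rle_trans with (eps / (2 * c) * Cmod h * c)%R.
 - go. - right. field. lra. } have E4 : Cmod e * Cmod A + Cmod e * Cmod B <= Cmod e * c. { unfold c. have H := Cmod_ge_0 e. lra. } lra.
Qed.

Lemma wd_comp_hol {X} (io : X -> C) (f : C -> C) (g : X -> C) x l a b :
  cder f (g x) l -> wd io g x a b -> wd io (fun t => f (g t)) x (l * a) (l * b).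
Proof. intros Hf Hg. wd_by (apply (wd_chain io idC f g x l 0 a b Hf Hg)); ring. Qed.

Section Wd2.
Context {X : Type} (io : X -> C).

Lemma wd_mult f g x A B A' B' : wd io f x A B -> wd io g x A' B' ->
  wd io (fun t => f t * g t) x (A * g x + f x * A') (B * g x + f x * B').
Proof.
intros Hf Hg eps He. destruct (wd_lip _ _ _ _ _ Hf) as [K [d0 [HK [Hd0 Hl]]]]. set (a := (Cmod (f x) + 1)%R). set (b := (Cmod (g x) + 1)%R).
have Ha : 0 < a by (unfold a; have H := Cmod_ge_0 (f x); lra). have Hb : 0 < b by (unfold b; have H := Cmod_ge_0 (g x); lra).
destruct (Hf (eps / (3 * b))%R) as [d1 [H1 H2]]; [go|]. destruct (Hg (eps / (3 * a))%R) as [d2 [H3 H4]]; [go|].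
destruct (wd_ct _ _ _ _ _ Hg (eps / (3 * K))%R) as [d3 [H5 H6]]; [go|]. exists (Rmin (Rmin d0 d1) (Rmin d2 d3)). split; [go|]. intros y Hy.
apply lt_rmin in Hy as [Hy Hy']. apply lt_rmin in Hy. apply lt_rmin in Hy'. specialize (Hl y (proj1 Hy)). specialize (H2 y (proj2 Hy)).
specialize (H4 y (proj1 Hy')). specialize (H6 y (proj2 Hy')). unfold dC in H6. set (h := io y - io x) in *.
replace (f y * g y - f x * g x - (h * (A * g x + f x * A') + Cconj h * (B * g x + f x * B'))) with ((f y - f x - (h * A + Cconj h * B)) * g
 x + f x * (g y - g x - (h * A' + Cconj h * B')) + (f y - f x) * (g y - g x)) by ring. tri.
eapply Rle_trans; [apply Rplus_le_compat_r, Cmod_triangle|]. rewrite !Cmod_mult.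
have E1 : Cmod (f y - f x - (h * A + Cconj h * B)) * Cmod (g x) <= eps / 3 * Cmod h.
{ apply Rle_trans with (eps / (3 * b) * Cmod h * b)%R.
 - apply Rmult_le_compat; try apply Cmod_ge_0; [go|unfold b; lra].
 - right; field; lra. } have E2 : Cmod (f x) * Cmod (g y - g x - (h * A' + Cconj h * B')) <= eps / 3 * Cmod h.
{ apply Rle_trans with (a * (eps / (3 * a) * Cmod h))%R.
 - apply Rmult_le_compat; try apply Cmod_ge_0; [unfold a; lra|go].
 - right; field; lra. } have E3 : Cmod (f y - f x) * Cmod (g y - g x) <= eps / 3 * Cmod h.
{ apply Rle_trans with ((K * Cmod h) * (eps / (3 * K)))%R.
 - apply Rmult_le_compat; try apply Cmod_ge_0; [go|lra]. - right; field; lra. } lra.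
Qed.

Lemma wd_scal c f x A B : wd io f x A B -> wd io (fun t => c * f t) x (c * A) (c * B).
Proof. intros H. wd_by (apply (wd_mult _ _ _ _ _ _ _ (wd_const io c x) H)); ring. Qed.
Lemma wd_opp f x A B : wd io f x A B -> wd io (fun t => - f t) x (- A) (- B).
Proof. intros H. apply wd_ext with (f := fun t => - (1) * f t); [go|]. wd_by (apply (wd_scal _ _ _ _ _ H)); ring. Qed.
Lemma wd_minus f g x A B A' B' : wd io f x A B -> wd io g x A' B' ->
  wd io (fun t => f t - g t) x (A - A') (B - B').
Proof. intros Hf Hg. apply (wd_plus io f (fun t => - g t)); [go|]. now apply wd_opp. Qed.

Lemma wd_pow n f x A B : wd io f x A B ->
  wd io (fun t => f t ^ n) x (INR n * f x ^ pred n * A) (INR n * f x ^ pred n * B).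
Proof.
intros H. induction n as [|n IH].
- simpl. wd_by (apply wd_const); simpl; ring.
- wd_by (apply (wd_mult _ _ _ _ _ _ _ H IH)); (destruct n; [go|]; cbn [pred]; rewrite (S_INR (S n)), RtoC_plus; simpl; ring).
Qed.
End Wd2.

Lemma cder_inv (z : C) : z <> 0 -> cder (fun w => / w) z (- / (z * z)).
Proof.
intros Hz eps He. have Hp := proj1 (Cmod_gt_0 _) Hz. set (a := Cmod z) in *. exists (Rmin (a / 2) (eps * (a * a * a) / 2)). split. { go. }
intros y Hy. unfold idC in *. apply lt_rmin in Hy. have Hy3 : a / 2 < Cmod y.
{ have H := Cmod_tri_inv z y. rewrite Cmod_symm in H. fold a in H. lra. } have Hny : y <> 0 by (apply Cmod_pos_nz; lra).
replace (/ y - / z - ((y - z) * - / (z * z) + Cconj (y - z) * 0)) with ((y - z) * (y - z) / (y * (z * z))) by go. rewrite Cmod_div by go.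
rewrite !Cmod_mult. fold a. set (t := Cmod (y - z)) in *. have Ht := Cmod_ge_0 (y - z). fold t in Ht.
apply Rmult_le_reg_r with (Cmod y * (a * a))%R; [go|].
replace (t * t / (Cmod y * (a * a)) * (Cmod y * (a * a)))%R with (t * t)%R by (field; split; lra).
apply Rle_trans with (eps * (a * a * a) / 2 * t)%R; [go|]. assert (eps * t * (a * a) * (a / 2) <= eps * t * (a * a) * Cmod y); [|lra].
apply Rmult_le_compat_l; [|lra]. go.
Qed.

Lemma wd_inv {X} (io : X -> C) (f : X -> C) x A B : f x <> 0 -> wd io f x A B ->
  wd io (fun t => / f t) x (- / (f x * f x) * A) (- / (f x * f x) * B).
Proof. intros Hn H. apply (wd_comp_hol io (fun w => / w) f); [apply cder_inv; exact Hn|go]. Qed.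

Lemma wd_unique_cder (f : C -> C) (z l l' : C) : cder f z l -> cder f z l' -> l = l'.
Proof.
intros H1 H2. have H3 := wd_minus idC _ _ _ _ _ _ _ H1 H2. have E : l - l' = 0.
{ apply Cmod_eq_small. intros eps He. destruct (H3 eps He) as [d [Hd H]]. specialize (H (z + RtoC (d / 2))). unfold idC in H.
 replace (z + RtoC (d / 2) - z) with (RtoC (d / 2)) in H by ring. replace (_ - _ - _) with (- (RtoC (d / 2) * (l - l'))) in H by ring.
 rewrite Cmod_opp, Cmod_mult, Cmod_R, Rabs_pos_eq in H by lra. go. } replace l with (l - l' + l') by ring. rewrite E. ring.
Qed.

(** * Real and complex exponentials *)

Lemma rder_real (g : R -> R) (t l : R) : derivable_pt_lim g t l ->
  rder (fun s => RtoC (g s)) t (RtoC l).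
Proof.
intros H eps He. destruct (H eps He) as [d Hd]. exists d. split; [apply cond_pos|]. intros y Hy. rewrite Cmod_RtoC_sub in Hy.
replace (_ - _ - _) with (RtoC (g y - g t - (y - t) * l)). 2:{ go. } rewrite Cmod_RtoC_sub, Cmod_R. destruct (Req_dec (y - t) 0) as [E|E].
- have E2 : y = t by lra. subst. rewrite !Rminus_diag, Rmult_0_l, Rminus_diag, Rabs_R0. lra.
- specialize (Hd (y - t)%R E Hy). replace (t + (y - t))%R with y in Hd by ring.
 replace (g y - g t - (y - t) * l)%R with (((g y - g t) / (y - t) - l) * (y - t))%R by go. rewrite Rabs_mult.
 apply Rmult_le_compat_r; [go|]. go.
Qed.

Lemma wd_real {X} (io : X -> C) (g : R -> R) (f : X -> R) x (l : R) a b :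
  derivable_pt_lim g (f x) l -> wd io (fun t => RtoC (f t)) x a b ->
  wd io (fun t => RtoC (g (f t))) x (l * a) (l * b).
Proof. intros Hg Hf. eapply wd_eq; [| |apply (wd_chain io RtoC (fun s => RtoC (g s)) f x l 0 a b (rder_real _ _ _ Hg) Hf)]; ring. Qed.

Lemma rder_Re f t l : rder f t l -> derivable_pt_lim (fun s => Re (f s)) t (Re l).
Proof.
intros H eps He. destruct (H (eps / 2)%R ltac:(lra)) as [d [Hd H1]]. exists (mkposreal d Hd). intros h Hh Hd2. simpl in Hd2.
specialize (H1 (t + h)%R). rewrite !Cmod_RtoC_sub in H1. replace (t + h - t)%R with h in H1 by ring. have Hp := Rabs_pos_lt _ Hh.
have H2 := re_le_Cmod (f (t + h)%R - f t - ((RtoC (t + h) - t) * l + Cconj (RtoC (t + h) - t) * 0)).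
replace (Re (f (t + h)%R - f t - ((RtoC (t + h) - t) * l + Cconj (RtoC (t + h) - t) * 0))) with (((Re (f (t + h)%R) - Re (f t)) / h - Re l)
 * h)%R in H2. 2:{ destruct (f (t+h)%R), (f t), l. simpl. go. } rewrite Rabs_mult in H2. go.
Qed.

Lemma rder_scal f t (c l : C) : rder f t l -> rder (fun s => c * f s) t (c * l).
Proof. intros H. wd_by (apply (wd_scal _ _ _ _ _ _ H)); ring. Qed.

Lemma rder_Im f t l : rder f t l -> derivable_pt_lim (fun s => Im (f s)) t (Im l).
Proof.
intros H. apply (rder_scal _ _ (- Ci)) in H. apply rder_Re in H. replace (Im l) with (Re (- Ci * l)) by (unfold Re, Im; simpl; ring).
intros eps He. destruct (H eps He) as [d Hd]. exists d. intros h H1 H2.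
replace (Im (f (t + h)%R)) with (Re (- Ci * f (t + h)%R)) by (unfold Re, Im; simpl; ring).
replace (Im (f t)) with (Re (- Ci * f t)) by (unfold Re, Im; simpl; ring). go.
Qed.

Lemma wd_Re z : wd idC (fun w => RtoC (Re w)) z (/ 2) (/ 2).
Proof.
intros eps He. exists 1%R. split; [lra|]. intros y _. unfold idC. replace (_ - _ - _) with (RtoC 0). { rewrite Cmod_0. go. }
rewrite !re_alt, Cminus_conj. field.
Qed.

Lemma wd_Im z : wd idC (fun w => RtoC (Im w)) z (- Ci / 2) (Ci / 2).
Proof.
intros eps He. exists 1%R. split; [lra|]. intros y _. unfold idC. replace (_ - _ - _) with (RtoC 0). { rewrite Cmod_0. go. }
apply C_eq; unfold Re, Im; simpl; field.
Qed.

Lemma Cexp_eq z : Cexp z = RtoC (exp (Re z)) * (RtoC (cos (Im z)) + Ci * RtoC (sin (Im z))).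
Proof. apply C_eq; unfold Cexp, Re, Im; simpl; ring. Qed.

Lemma cder_Cexp z : cder Cexp z (Cexp z).
Proof.
apply wd_ext with (f := fun z => RtoC (exp (Re z)) * (RtoC (cos (Im z)) + Ci * RtoC (sin (Im z)))). { intros. now rewrite Cexp_eq. }
have H1 := wd_real idC exp Re z (exp (Re z)) _ _ (derivable_pt_lim_exp _) (wd_Re z).
have H2 := wd_real idC cos Im z (- sin (Im z)) _ _ (derivable_pt_lim_cos _) (wd_Im z).
have H3 := wd_real idC sin Im z (cos (Im z)) _ _ (derivable_pt_lim_sin _) (wd_Im z).
wd_by (apply (wd_mult _ _ _ _ _ _ _ _ H1 (wd_plus _ _ _ _ _ _ _ _ H2 (wd_scal _ Ci _ _ _ _ H3)))).
- rewrite Cexp_eq. apply C_eq; unfold Re, Im; simpl; field. - go.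
Qed.

Lemma Cexp_plus a b : Cexp (a + b) = Cexp a * Cexp b.
Proof. apply C_eq; unfold Cexp, Re, Im; simpl; rewrite exp_plus, ?cos_plus, ?sin_plus; ring. Qed.
Lemma Cexp_0 : Cexp 0 = 1.
Proof. apply C_eq; unfold Cexp, Re, Im; simpl; rewrite exp_0, ?cos_0, ?sin_0; ring. Qed.

Lemma Cmod_Cexp z : Cmod (Cexp z) = exp (Re z).
Proof.
unfold Cmod, Cexp. simpl. replace (_ + _)%R with ((exp (Re z))²)%R.
- apply sqrt_Rsqr. go. - have H := sin2_cos2 (Im z). unfold Rsqr in *. nra.
Qed.

Lemma Cexp_nz z : Cexp z <> 0.
Proof. apply Cmod_pos_nz. rewrite Cmod_Cexp. go. Qed.

Lemma Cexp_opp z : Cexp (- z) = / Cexp z.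
Proof.
have H : Cexp (- z) * Cexp z = 1. { rewrite <- Cexp_plus. vanish (- z + z). apply Cexp_0. } have Hn := Cexp_nz z.
replace (Cexp (- z)) with (Cexp (- z) * Cexp z / Cexp z) by go. rewrite H. go.
Qed.

Lemma Cexp_minus a b : Cexp (a - b) = Cexp a / Cexp b.
Proof. unfold Cminus. now rewrite Cexp_plus, Cexp_opp. Qed.
Lemma Cexp_conj z : Cexp (Cconj z) = Cconj (Cexp z).
Proof. apply C_eq; unfold Cexp, Re, Im; simpl; rewrite ?cos_neg, ?sin_neg; ring. Qed.
Lemma Cexp_R (x : R) : Cexp (RtoC x) = RtoC (exp x).
Proof. apply C_eq; unfold Cexp, Re, Im; simpl; rewrite ?cos_0, ?sin_0; ring. Qed.

Lemma Cexp_pow z n : Cexp z ^ n = Cexp (INR n * z).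
Proof.
induction n as [|n IH].
- simpl. vanish (0 * z). now rewrite Cexp_0. - cbn [Cpow]. rewrite IH, <- Cexp_plus, S_INR, RtoC_plus. f_equal. ring.
Qed.

Lemma wd_Cexp {X} (io : X -> C) (f : X -> C) x A B : wd io f x A B ->
  wd io (fun t => Cexp (f t)) x (Cexp (f x) * A) (Cexp (f x) * B).
Proof. intros H. apply (wd_comp_hol io Cexp f); [apply cder_Cexp|go]. Qed.
Lemma ct_Cexp {X} (dX : X -> X -> R) (f : X -> C) x :
  ct dX dC f x -> ct dX dC (fun t => Cexp (f t)) x.
Proof. intros H. apply (ct_comp dX dC dC Cexp f); [go|]. apply (wd_ct idC Cexp _ _ _ (cder_Cexp (f x))). Qed.

Definition ee (z : C) : C := Cexp (2 * PI * Ci * z).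

Lemma ee_plus a b : ee (a + b) = ee a * ee b.
Proof. unfold ee. rewrite <- Cexp_plus. f_equal. ring. Qed.
Lemma ee_0 : ee 0 = 1.
Proof. unfold ee. vanish (2 * PI * Ci * 0). apply Cexp_0. Qed.
Lemma ee_opp z : ee (- z) = / ee z.
Proof. unfold ee. rewrite <- Cexp_opp. f_equal. ring. Qed.
Lemma ee_nz z : ee z <> 0.
Proof. apply Cexp_nz. Qed.
Ltac nz_more ::= first [apply ee_nz | apply Cpow_nz].
Lemma Cmod_ee z : Cmod (ee z) = exp (- (2 * PI * Im z)).
Proof. unfold ee. rewrite Cmod_Cexp. f_equal. destruct z. simpl. ring. Qed.
Lemma Cmod_ee_R (x : R) : Cmod (ee x) = 1.
Proof. rewrite Cmod_ee. replace (- (2 * PI * Im x))%R with 0%R by (unfold Im; simpl; ring). apply exp_0. Qed.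

Lemma ee_1 : ee 1 = 1.
Proof.
unfold ee. replace (2 * PI * Ci * 1) with ((0, 2 * PI)%R : C) by go.
apply C_eq; unfold Cexp, Re, Im; simpl; rewrite exp_0, ?cos_2PI, ?sin_2PI; ring.
Qed.

Lemma ee_nat n : ee (INR n) = 1.
Proof. induction n as [|n IH]; [apply ee_0|]. rewrite S_INR, RtoC_plus, ee_plus, IH, ee_1. ring. Qed.

Lemma ee_Z (n : Z) : ee (IZR n) = 1.
Proof.
destruct (Z_le_gt_dec 0 n) as [H|H].
- rewrite <- (Z2Nat.id n H), <- INR_IZR_INZ. apply ee_nat.
- replace (RtoC (IZR n)) with (- RtoC (INR (Z.to_nat (- n)))).
 + rewrite ee_opp, ee_nat. field. + rewrite INR_IZR_INZ, Z2Nat.id by lia. rewrite opp_IZR, RtoC_opp. ring.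
Qed.

Lemma wd_ee {X} (io : X -> C) (f : X -> C) x A B : wd io f x A B ->
  wd io (fun t => ee (f t)) x (2 * PI * Ci * ee (f x) * A) (2 * PI * Ci * ee (f x) * B).
Proof. intros H. unfold ee. wd_by (apply wd_Cexp, wd_scal, H); simpl; ring. Qed.
Lemma ct_ee {X} (dX : X -> X -> R) (f : X -> C) x :
  ct dX dC f x -> ct dX dC (fun t => ee (f t)) x.
Proof. intros H. apply ct_Cexp, ct_mult; [apply ct_const|go]. Qed.

(** * Integrals over the unit interval *)

Definition CI (f : R -> C) : C :=
  (RInt (fun t => Re (f t)) 0 1, RInt (fun t => Im (f t)) 0 1).
Definition I01 (t : R) := (0 <= t <= 1).
Definition ic (f : R -> C) := forall t, I01 t -> ct dR dC f t.

Lemma ct_continuous (f : R -> R) t : ct dR dR f t -> continuous f t.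
Proof.
intros H. apply filterlim_locally. intros eps. destruct (H eps (cond_pos eps)) as [d [H1 H2]]. exists (mkposreal d H1). intros y Hy.
apply H2. go.
Qed.

Lemma ex_I (f : R -> R) : (forall t, I01 t -> ct dR dR f t) -> ex_RInt f 0 1.
Proof. intros H. apply (ex_RInt_continuous (V := RV)). intros z. minmax. intros Hz. apply ct_continuous. go. Qed.
Lemma ex_IRe f : ic f -> ex_RInt (fun t => Re (f t)) 0 1.
Proof. intros H. apply ex_I. intros. now apply ct_Re, H. Qed.
Lemma ex_IIm f : ic f -> ex_RInt (fun t => Im (f t)) 0 1.
Proof. intros H. apply ex_I. intros. now apply ct_Im, H. Qed.
Lemma ic_plus f g : ic f -> ic g -> ic (fun t => f t + g t).
Proof. intros H1 H2 t Ht. apply ct_plus; auto. Qed.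
Lemma ic_mult f g : ic f -> ic g -> ic (fun t => f t * g t).
Proof. intros H1 H2 t Ht. apply ct_mult; auto. Qed.
Lemma ic_const c : ic (fun _ => c).
Proof. intros t Ht. apply ct_const. Qed.
Lemma CI_ext f g : (forall t, I01 t -> f t = g t) -> CI f = CI g.
Proof. intros H. unfold CI. f_equal; apply RInt_ext; intros t; minmax; intros Ht; rewrite H; trivial; unfold I01; lra. Qed.

Lemma CI_plus f g : ic f -> ic g -> CI (fun t => f t + g t) = CI f + CI g.
Proof.
intros Hf Hg. apply C_eq; unfold CI, Re, Im; simpl.
- apply (RInt_plus (V := RV)); now apply ex_IRe. - apply (RInt_plus (V := RV)); now apply ex_IIm.
Qed.

Lemma RInt_lin (f g : R -> R) a b : ex_RInt f 0 1 -> ex_RInt g 0 1 ->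
  RInt (fun t => a * f t + b * g t)%R 0 1 = (a * RInt f 0 1 + b * RInt g 0 1)%R.
Proof.
intros Hf Hg. apply is_RInt_unique. apply (is_RInt_plus (V := R_NormedModule) (fun t => a * f t)%R (fun t => b * g t)%R).
- apply (is_RInt_scal (V := R_NormedModule) f 0 1 a). now apply (RInt_correct (V := RV)).
- apply (is_RInt_scal (V := R_NormedModule) g 0 1 b). now apply (RInt_correct (V := RV)).
Qed.

Lemma CI_scal c f : ic f -> CI (fun t => c * f t) = c * CI f.
Proof.
intros Hf. apply C_eq; unfold CI; simpl.
- rewrite <- (RInt_ext (V := RV) (fun t => Re c * Re (f t) + (- Im c) * Im (f t))%R).
 + rewrite RInt_lin; [unfold Re, Im; simpl; ring|now apply ex_IRe|now apply ex_IIm]. + intros. unfold Re, Im; simpl; ring.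
- rewrite <- (RInt_ext (V := RV) (fun t => Re c * Im (f t) + Im c * Re (f t))%R).
 + rewrite RInt_lin; [go|now apply ex_IIm|now apply ex_IRe]. + go.
Qed.

Lemma CI_opp f : ic f -> CI (fun t => - f t) = - CI f.
Proof. intros H. rewrite (CI_ext _ (fun t => - (1) * f t)) by go. rewrite CI_scal by go. ring. Qed.
Lemma CI_minus f g : ic f -> ic g -> CI (fun t => f t - g t) = CI f - CI g.
Proof. intros Hf Hg. unfold Cminus. rewrite CI_plus, CI_opp; trivial. intros t Ht. now apply ct_opp, Hg. Qed.

Lemma CI_const c : CI (fun _ => c) = c.
Proof.
unfold CI. rewrite !(RInt_const (V := RV)).
apply C_eq; unfold Re, Im; simpl; rewrite ?Rminus_0_r; unfold scal; simpl; unfold mult; simpl; ring.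
Qed.

Lemma CI_bound f M : ic f -> (forall t, I01 t -> Cmod (f t) <= M) -> Cmod (CI f) <= M.
Proof.
intros Hf HM. set (c := CI f). destruct (Req_dec (Cmod c) 0) as [E|E].
{ rewrite E. apply Rle_trans with (Cmod (f 0%R)); [go|apply HM; unfold I01; lra]. } have Hc := Cmod_ge_0 c.
have H : (Cmod c * Cmod c)%R = Re (CI (fun t => Cconj c * f t)).
{ rewrite CI_scal by go. fold c. have H := Cmod2_conj c. rewrite Cmult_comm, <- H. unfold Re; simpl. ring. }
have Hic : ic (fun t => Cconj c * f t) by (apply ic_mult; [apply ic_const|go]). have H2 : Re (CI (fun t => Cconj c * f t)%C) <= Cmod c * M.
{ replace (Cmod c * M)%R with (RInt (fun _ => Cmod c * M)%R 0 1).
 2:{ rewrite (RInt_const (V := RV)). unfold scal; simpl; unfold mult; simpl; ring. }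
 apply RInt_le; [lra|exact (ex_IRe _ Hic)|apply (ex_RInt_const (V := RV))|]. intros t Ht. have H1 := re_le_Cmod (Cconj c * f t).
 have H3 := Rle_abs (Re (Cconj c * f t)%C). rewrite Cmod_mult, Cmod_conj in H1. have H4 : Cmod (f t) <= M by (apply HM; unfold I01; lra).
 go. } go.
Qed.

Lemma CI_FTC F f : (forall t, I01 t -> rder F t (f t)) -> ic f -> CI f = F 1%R - F 0%R.
Proof.
intros HF Hf. apply C_eq; unfold CI.
- apply (is_RInt_unique (V := RV)). apply (is_RInt_derive (V := RV) (fun t => Re (F t))); minmax; intros t Ht.
 + apply is_derive_Reals, rder_Re, HF, Ht. + apply ct_continuous. apply ct_Re, Hf, Ht.
- apply (is_RInt_unique (V := RV)). apply (is_RInt_derive (V := RV) (fun t => Im (F t))); minmax; intros t Ht.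
 + apply is_derive_Reals, rder_Im, HF, Ht. + apply ct_continuous. apply ct_Im, Hf, Ht.
Qed.

(** The mean value inequality. *)
Lemma mvi (g g' : R -> C) a b M : a <= b ->
  (forall t, a <= t <= b -> rder g t (g' t)) ->
  (forall t, a <= t <= b -> Cmod (g' t) <= M) ->
  Cmod (g b - g a) <= M * (b - a).
Proof.
intros Hab Hd HM. set (c := g b - g a). destruct (Req_dec (Cmod c) 0) as [E|E].
{ have H := Cmod_ge_0 (g' a). have H1 := HM a ltac:(lra). go. } have Hc := Cmod_ge_0 c.
destruct (MVT_gen (fun t => Re (Cconj c * g t)) a b (fun t => Re (Cconj c * g' t))) as [x [Hx Ex]].
- intros t. minmax. intros Ht. apply is_derive_Reals, rder_Re, rder_scal, Hd. lra.
- intros t. minmax. intros Ht. apply derivable_continuous_pt. exists (Re (Cconj c * g' t)). apply rder_Re, rder_scal, Hd. lra.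
- rewrite Rmin_left, Rmax_right in Hx by lra. have H : (Cmod c * Cmod c)%R = (Re (Cconj c * g b)%C - Re (Cconj c * g a)%C)%R.
 { replace (Re (Cconj c * g b)%C - Re (Cconj c * g a)%C)%R with (Re (c * Cconj c)%C).
  - rewrite <- Cmod2_conj. unfold Re; simpl. ring.
  - unfold Re; simpl. ring. } have H1 := re_le_Cmod (Cconj c * g' x). have H3 := Rle_abs (Re (Cconj c * g' x)%C).
 rewrite Cmod_mult, Cmod_conj in H1. have H4 := HM x Hx. have H5 : Cmod c * Cmod (g' x) <= Cmod c * M by go. go.
Qed.

(** By compactness of [0,1], this condition at all t is uniform in t; hence integrals depend continuously on x. *)
Definition jc {X} (dX : X -> X -> R) (f : X -> R -> C) (x : X) (t : R) :=
  forall eps, 0 < eps -> exists del, 0 < del /\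
   forall y s, dX x y < del -> Rabs (s - t) < del -> Cmod (f y s - f x t) < eps.

Lemma I01_compact (P : R -> R -> Prop) :
  (forall t, I01 t -> exists del, 0 < del /\ P t del) ->
  (forall t d d', 0 < d' <= d -> P t d -> P t d') ->
  exists d, 0 < d /\ forall s, I01 s -> exists t, I01 t /\ Rabs (s - t) < d /\ P t d \/
     exists t d', I01 t /\ d <= d' /\ Rabs (s - t) < d' /\ P t d'.
Proof.
intros H Hm.
set (del := fun t => match classical (I01 t) with | left h => proj1_sig (constructive_indefinite_description _ (H t h)) | right _ => 1%R
 end). have Hdel : forall t, 0 < del t /\ (I01 t -> P t (del t)).
{ intros t. unfold del. destruct (classical (I01 t)) as [h|h].
 - destruct (constructive_indefinite_description _ _) as [d Hd]. go.
 - split; [lra|tauto]. } destruct (compactness_value_1d 0 1 (fun t => mkposreal (del t) (proj1 (Hdel t)))) as [d Hd]. exists d.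
split; [apply cond_pos|]. intros s Hs. specialize (Hd s Hs). apply NNPP in Hd as [t [Ht [H1 H2]]]. exists t. right. exists t, (del t).
repeat split; try apply Ht; try assumption. now apply Hdel.
Qed.

Lemma tube {X} (dX : X -> X -> R) (f : X -> R -> C) x :
  dX x x = 0%R ->
  (forall t, I01 t -> jc dX f x t) -> forall eps, 0 < eps -> exists del, 0 < del /\
    forall y, dX x y < del -> forall t, I01 t -> Cmod (f y t - f x t) <= eps.
Proof.
intros Hx H eps He.
destruct (I01_compact (fun t d => forall y s, dX x y < d -> Rabs (s - t) < d -> Cmod (f y s - f x t) < eps / 2)) as [d [Hd H1]].
- intros t Ht. apply (H t Ht (eps / 2)%R). lra. - intros t d d' Hdd Hp y s H1 H2. apply Hp; lra.
- take d. intros y Hy s Hs.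
 have Hq : exists t d', d <= d' /\ Rabs (s - t) < d' /\ (forall y s, dX x y < d' -> Rabs (s - t) < d' -> Cmod (f y s - f x t) < eps / 2).
 { destruct (H1 s Hs) as [t [[Ht [Ha Hb]]|[t' [d' [Ht [Ha [Hb Hc]]]]]]].
  - exists t, d. go.
  - exists t', d'. tauto. } destruct Hq as [t [d' [Ha [Hb Hc]]]]. have E1 := Hc y s ltac:(lra) Hb. have E2 := Hc x s ltac:(lra) Hb.
 have T := Cmod_tri3 (f y s) (f x t) (f x s). rewrite (Cmod_symm (f x t)) in T. lra.
Qed.

Lemma jc_ct {X} (dX : X -> X -> R) f x t : dX x x = 0%R -> jc dX f x t -> ct dR dC (f x) t.
Proof. intros Hx H eps He. destruct (H eps He) as [d [H1 H2]]. take d. intros s Hs. apply H2; [lra|go]. Qed.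

Lemma ct_jc {X} (dX : X -> X -> R) (f : X -> R -> C) x t :
  ct (dP dX dR) dC (fun p => f (fst p) (snd p)) (x, t) -> jc dX f x t.
Proof.
intros H eps He. destruct (H eps He) as [d [H1 H2]]. exists (d / 2)%R. split; [lra|]. intros y s Hy Hs. apply (H2 (y, s)). unfold dP; simpl.
unfold dR. lra.
Qed.

Lemma ct_CI {X} (dX : X -> X -> R) (f : X -> R -> C) x : dX x x = 0%R ->
  (exists del, 0 < del /\ forall y, dX x y < del -> ic (f y)) ->
  (forall t, I01 t -> jc dX f x t) -> ct dX dC (fun y => CI (f y)) x.
Proof.
intros Hx [d0 [Hd0 Hic]] H eps He. destruct (tube dX f x Hx H (eps / 2)%R ltac:(lra)) as [d [Hd H1]]. take_min d0 d as y Hy. unfold dC.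
rewrite <- CI_minus; [|apply Hic; tauto|apply Hic; lra]. apply Rle_lt_trans with (eps / 2)%R; [|lra]. apply CI_bound.
- intros t Ht. apply ct_minus; [apply Hic; tauto|apply Hic; [lra|go]]. - intros t Ht. apply H1; tauto.
Qed.

Lemma wd_CI {X} (io : X -> C) (f : X -> R -> C) (f' : R -> C) x :
  (exists del, 0 < del /\ forall y, Cmod (io y - io x) < del -> ic (f y)) -> ic f' ->
  (forall eps, 0 < eps -> exists del, 0 < del /\ forall y, Cmod (io y - io x) < del ->
    forall t, I01 t -> Cmod (f y t - f x t - (io y - io x) * f' t) <= eps * Cmod (io y - io x)) ->
  wd io (fun y => CI (f y)) x (CI f') 0.
Proof.
intros [d0 [Hd0 Hic]] Hf' H eps He. destruct (H eps He) as [d [Hd H1]]. take_min d0 d as y Hy. have Hx : ic (f x).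
{ apply Hic. vanish (io x - io x). now rewrite Cmod_0. } have Hy' : ic (f y) by (apply Hic; tauto). rewrite <- CI_minus by go.
replace (_ - _) with (CI (fun t => f y t - f x t - (io y - io x) * f' t)).
- apply CI_bound.
 + intros t Ht. apply ct_minus; [apply ct_minus; auto|]. apply ct_mult; [apply ct_const|auto]. + intros t Ht. apply H1; tauto.
- rewrite (CI_minus (fun t => f y t - f x t)), CI_scal; trivial; [ring| |].
 + intros t Ht. apply ct_minus; auto. + intros t Ht. apply ct_mult; [apply ct_const|auto].
Qed.

(** * Cauchy's theory *)

Lemma ct_fst' {X Y Z} (dX : X -> X -> R) (dY : Y -> Y -> R) (dZ : Z -> Z -> R) (g : X -> Y * Z) x :
  ct dX (dP dY dZ) g x -> (forall a b, 0 <= dZ a b) -> ct dX dY (fun t => fst (g t)) x.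
Proof. intros H Hn. apply (ct_comp dX (dP dY dZ) dY (fun p => fst p) g x H). now apply ct_fst. Qed.
Lemma ct_snd' {X Y Z} (dX : X -> X -> R) (dY : Y -> Y -> R) (dZ : Z -> Z -> R) (g : X -> Y * Z) x :
  ct dX (dP dY dZ) g x -> (forall a b, 0 <= dY a b) -> ct dX dZ (fun t => snd (g t)) x.
Proof. intros H Hn. apply (ct_comp dX (dP dY dZ) dZ (fun p => snd p) g x H). now apply ct_snd. Qed.

Ltac cring := cbv beta; ring.
Ltac nng := repeat first [apply dC_ge0 | apply dR_ge0 | apply dP_ge0 | intros; apply Cmod_ge_0 | intro | assumption].
Ltac ctt := repeat first
  [ assumption | apply ct_const | apply ct_constR | apply ct_id | apply ct_plus | apply ct_minus | apply ct_opp
  | apply ct_mult | apply ct_conj | apply ct_ee | apply ct_Cexp | apply ct_RtoC | apply ct_pow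
  | apply ct_pair
  | eapply ct_fst'; [ | solve [nng]] | eapply ct_snd'; [ | solve [nng]] ].
Ltac wd_more := fail.
Ltac wdt := repeat first [assumption | apply wd_const | apply wd_io | lazymatch goal with
  | |- wd _ (fun t => ee _) _ _ _ => apply wd_ee
  | |- wd _ (fun t => Cexp _) _ _ _ => apply wd_Cexp
  | |- wd _ (fun t => Cconj _) _ _ _ => apply wd_conj
  | |- wd _ (fun t => _ + _) _ _ _ => apply wd_plus
  | |- wd _ (fun t => _ - _) _ _ _ => apply wd_minus
  | |- wd _ (fun t => - _) _ _ _ => apply wd_opp
  | |- wd _ (fun t => _ * _) _ _ _ => first [apply wd_scal | apply wd_mult]
  | |- wd _ (fun t => / _) _ _ _ => apply wd_inv; [solve [nz]|]
  | |- wd _ (fun t => _ / _) _ _ _ => apply wd_mult end | wd_more].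
Ltac der := eapply wd_eq; [| |solve [wdt]].
Ltac derive := der; cbv beta; first [ring | field; repeat split; nz].
Ltac more ::= first [solve [ctt] | solve [intros ? ?; ctt] | solve [derive]].

Lemma dC_refl z : dC z z = 0%R.
Proof. unfold dC. vanish (z - z). apply Cmod_0. Qed.
Lemma dR_refl z : dR z z = 0%R.
Proof. unfold dR. now rewrite Rminus_diag, Rabs_R0. Qed.

Lemma mvi_wd {X} (io : X -> C) (f f' : X -> C) (x y : X) (l : C) eps (ln : R -> X) :
  (forall s, io (ln s) = io x + s * (io y - io x)) -> ln 0%R = x -> ln 1%R = y ->
  (forall s, I01 s -> wd io f (ln s) (f' (ln s)) 0 /\ Cmod (f' (ln s) - l) <= eps) ->
  Cmod (f y - f x - (io y - io x) * l) <= eps * Cmod (io y - io x).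
Proof.
intros Hl H0 H1 H. set (h := io y - io x) in *. set (g := fun s : R => f (ln s) - s * h * l).
have Hg := mvi g (fun s => (f' (ln s) - l) * h) 0 1 (eps * Cmod h)%R ltac:(lra). have E : f y - f x - h * l = g 1%R - g 0%R.
{ unfold g. rewrite H0, H1. ring. } rewrite E. eapply Rle_trans; [apply Hg|lra].
- intros s Hs. destruct (H s Hs) as [Hd _]. have Hl2 : wd RtoC (fun s => io (ln s)) s h 0.
 { apply wd_ext with (f := fun s : R => io x + s * h); [go|]. go. }
 wd_by (apply wd_minus; [apply (wd_chain RtoC io f ln s _ _ _ _ Hd Hl2)| apply wd_mult; [apply wd_mult; [apply wd_io|apply wd_const]|apply
  wd_const]]).
 + cring. + cring.
- intros s Hs. rewrite Cmod_mult. apply Rmult_le_compat_r; [go|]. now apply H.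
Qed.

Lemma wd_CI_par {X} (io : X -> C) (f f' : X -> R -> C) (x : X) (ln : X -> R -> X) :
  (forall y s, io (ln y s) = io x + s * (io y - io x)) -> (forall y, ln y 0%R = x) ->
  (forall y, ln y 1%R = y) ->
  (exists del, 0 < del /\ forall y, Cmod (io y - io x) < del ->
     ic (f y) /\ forall t, I01 t -> wd io (fun y => f y t) y (f' y t) 0) ->
  (forall t, I01 t -> jc (fun x y => Cmod (io y - io x)) f' x t) ->
  wd io (fun y => CI (f y)) x (CI (f' x)) 0.
Proof.
intros Hln H0 H1 [d0 [Hd0 Hf]] Hj. have Hxx : Cmod (io x - io x) = 0%R. { vanish (io x - io x). apply Cmod_0. } apply wd_CI.
- take d0. intros y Hy. now apply Hf. - intros t Ht. apply (jc_ct (fun x y => Cmod (io y - io x))); [go|go].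
- intros eps He. destruct (tube (fun x y => Cmod (io y - io x)) f' x Hxx Hj eps He) as [d [Hd Ht]]. take_min d0 d. intros y Hy t Hti.
 apply lt_rmin in Hy. apply (mvi_wd io (fun y => f y t) (fun y => f' y t) x y (f' x t) eps (ln y)); auto. intros s Hs.
 have Hc : Cmod (io (ln y s) - io x) <= Cmod (io y - io x).
 { rewrite Hln. replace (io x + s * (io y - io x) - io x) with (s * (io y - io x)) by ring.
  rewrite Cmod_mult, Cmod_R, Rabs_pos_eq by apply Hs. rewrite <- (Rmult_1_l (Cmod (io y - io x))) at 2.
  apply Rmult_le_compat_r; [go|apply Hs]. } split; [apply Hf; [lra|go]|]. apply Ht; [lra|go].
Qed.

Lemma cder_CI (f f' : C -> R -> C) z :
  (exists del, 0 < del /\ forall y, Cmod (y - z) < del ->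
     ic (f y) /\ forall t, I01 t -> cder (fun y => f y t) y (f' y t)) ->
  (forall t, I01 t -> jc dC f' z t) -> cder (fun y => CI (f y)) z (CI (f' z)).
Proof. intros H1 H2. apply (wd_CI_par idC f f' z (fun y s => z + s * (y - z))); trivial. - go. - go. Qed.

Lemma rder_CI (f f' : R -> R -> C) s :
  (exists del, 0 < del /\ forall y, Rabs (y - s) < del ->
     ic (f y) /\ forall t, I01 t -> rder (fun y => f y t) y (f' y t)) ->
  (forall t, I01 t -> jc dR f' s t) -> rder (fun y => CI (f y)) s (CI (f' s)).
Proof.
intros [d [Hd H1]] H2. apply (wd_CI_par RtoC f f' s (fun y u => s + u * (y - s))%R).
- go. - go. - go. - take d. intros y. rewrite Cmod_RtoC_sub. go.
- intros t Ht eps He. destruct (H2 t Ht eps He) as [e [He1 He2]]. exists e. split; [assumption|]. intros y u. rewrite Cmod_RtoC_sub. go.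
Qed.

Lemma const_of_rder0 (g : R -> C) : (forall s, I01 s -> rder g s 0) -> g 1%R = g 0%R.
Proof.
intros H. have H1 := mvi g (fun _ => 0) 0 1 0 ltac:(lra) H. have E : g 1%R - g 0%R = 0.
{ apply Cmod_eq_0. apply Rle_antisym; [|go]. eapply Rle_trans; [apply H1|lra]. intros. rewrite Cmod_0. lra. }
replace (g 1%R) with (g 1%R - g 0%R + g 0%R) by ring. rewrite E. ring.
Qed.

Section Circle.
Variables (z0 : C) (rho : R).
Hypothesis Hrho : 0 < rho.
Definition circ (t : R) : C := z0 + rho * ee t.

Lemma Cmod_circ t : Cmod (circ t - z0) = rho.
Proof. unfold circ. replace (z0 + rho * ee t - z0) with (rho * ee t) by ring. rewrite Cmod_mult, Cmod_ee_R, Cmod_R, Rabs_pos_eq; lra. Qed.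
Lemma circ_far z t : Cmod (z - z0) < rho -> rho - Cmod (z - z0) <= Cmod (circ t - z).
Proof. intros H. have T := Cmod_tri3 (circ t) z z0. rewrite Cmod_circ in T. lra. Qed.
Lemma circ_nz z t : Cmod (z - z0) < rho -> circ t - z <> 0.
Proof. intros H. apply Cmod_pos_nz. have H1 := circ_far z t H. lra. Qed.
Lemma rder_circ t : rder circ t (2 * PI * Ci * (rho * ee t)).
Proof. wd_by (apply wd_plus; [apply wd_const|apply wd_scal, wd_ee, wd_io]); cring. Qed.

(** Integrals against powers of the Cauchy kernel can be differentiated under the sign. *)
Definition CK (phi : R -> C) (m : nat) (z : C) : C := CI (fun t => phi t * (/ (circ t - z)) ^ m).

Lemma CK_jc phi m z t : ic phi -> Cmod (z - z0) < rho -> I01 t ->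
  jc dC (fun z t => phi t * (/ (circ t - z)) ^ m) z t.
Proof.
intros Hp Hz Ht. apply ct_jc. apply ct_mult.
- apply (ct_comp (dP dC dR) dR dC phi (fun p => snd p)); [ctt|]. go. - apply ct_pow. apply ct_inv; [now apply circ_nz|]. go.
Qed.

Lemma near_disc z R : Cmod (z - z0) < R -> exists del, 0 < del /\
  forall y, Cmod (y - z) < del -> Cmod (y - z0) < R.
Proof. intros H. exists (R - Cmod (z - z0))%R. split; [lra|]. intros y Hy. have T := Cmod_tri3 y z z0. lra. Qed.

Lemma cder_CK phi m z : ic phi -> Cmod (z - z0) < rho ->
  cder (CK phi m) z (INR m * CK phi (S m) z).
Proof.
intros Hp Hz. have Hic : forall m y, Cmod (y - z0) < rho -> ic (fun t => phi t * (/ (circ t - y)) ^ m).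
{ intros m' y Hy t Ht. apply (jc_ct dC (fun z t => phi t * (/ (circ t - z)) ^ m')); [apply dC_refl|]. now apply CK_jc. } unfold CK at 2.
rewrite <- CI_scal by go. apply (cder_CI (fun z t => phi t * (/ (circ t - z)) ^ m) (fun z t => INR m * (phi t * (/ (circ t - z)) ^ S m))).
- destruct (near_disc z rho Hz) as [d [Hd H]]. take d. intros y Hy. split; [go|]. intros t Ht. have Hnz := circ_nz y t (H y Hy).
 wd_by (apply wd_scal, wd_pow, wd_inv; [go|apply wd_minus; [apply wd_const|apply (wd_io idC)]]).
 + destruct m as [|m]; cbv beta; simpl; [ring|]. go. + go.
- intros t Ht. apply ct_jc. apply ct_mult; [go|]. have H := CK_jc phi (S m) z t Hp Hz Ht. intros eps He. destruct (H eps He) as [d [Hd H1]].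
 take d. intros [y s] Hy. unfold dP in Hy. cbn [fst snd] in Hy. apply H1.
 + have T := dR_ge0 t s. cbn [fst]. lra. + have T := dC_ge0 z y. cbn [snd]. fold (dR t s). lra.
Qed.

(** The Cauchy transform of 1 is locally constant, because 1/(w-y)^2 has a primitive on the circle. *)
Lemma winding z : Cmod (z - z0) < rho -> CI (fun t => (rho * ee t) / (circ t - z)) = 1.
Proof.
intros Hz. set (phi := fun t : R => rho * ee t). have Hp : ic phi by (intros t Ht; unfold phi; ctt).
have H2 : forall y, Cmod (y - z0) < rho -> CK phi 2 y = 0.
{ intros y Hy. have Hn := fun t => circ_nz y t Hy. have Hi : ic (fun t => phi t * (/ (circ t - y)) ^ 2).
 { intros t Ht. apply (jc_ct dC (fun z t => phi t * (/ (circ t - z)) ^ 2)); [apply dC_refl|]. now apply CK_jc. } unfold CK.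
 rewrite (CI_FTC (fun t => - / (2 * PI * Ci) * / (circ t - y))); trivial.
 - unfold circ. replace (ee 1%R) with (ee 0%R) by (rewrite ee_0; symmetry; exact ee_1). ring.
 - intros t _. specialize (Hn t). wd_by (apply wd_scal, wd_inv; [exact Hn|apply wd_minus; [apply rder_circ|apply wd_const]]).
  + cbv beta. unfold phi. go.
  + cring. } transitivity (CK phi 1 z); [apply CI_ext; intros; unfold phi; simpl; unfold Cdiv; ring|]. transitivity (CK phi 1 z0).
- have E := const_of_rder0 (fun s => CK phi 1 (z0 + s * (z - z0))). cbv beta in E. replace (z0 + 1 * (z - z0)) with z in E by ring.
 replace (z0 + 0 * (z - z0)) with z0 in E by ring. apply E. intros s Hs. have Hd : Cmod (z0 + s * (z - z0) - z0) < rho.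
 { replace (z0 + s * (z - z0) - z0) with (s * (z - z0)) by ring. unfold I01 in Hs. rewrite Cmod_mult, Cmod_R, Rabs_pos_eq by lra.
  have P := Cmod_ge_0 (z - z0). nra. }
 wd_by (apply (wd_comp_hol RtoC (CK phi 1) (fun s => z0 + s * (z - z0))); [now apply cder_CK| apply wd_plus; [apply wd_const|apply wd_mult;
  [apply wd_io|apply wd_const]]]); rewrite H2 by exact Hd; ring.
- rewrite <- (CI_const 1). apply CI_ext. intros t _. unfold phi, circ. have H := ee_nz t. have H1 : RtoC rho <> 0 by (apply RtoC_nz; lra).
 simpl. replace (z0 + rho * ee t - z0) with (rho * ee t) by ring. go.
Qed.
End Circle.


Definition disc (z0 : C) (R : R) (z : C) : Prop := (Cmod (z - z0) < R).

Lemma disc_open z0 R z : disc z0 R z -> exists del, 0 < del /\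
  forall y, disc z del y -> disc z0 R y.
Proof. apply near_disc. Qed.
Lemma disc_center z0 R : 0 < R -> disc z0 R z0.
Proof. intros H. unfold disc. vanish (z0 - z0). now rewrite Cmod_0. Qed.

(** Cauchy's formula: the integral of f(z+s(w-z))/(w-z) over the circle does not depend on s. *)
Lemma cauchy (f f' : C -> C) z0 R rho z : 0 < rho < R ->
  (forall w, disc z0 R w -> cder f w (f' w) /\ ct dC dC f' w) -> disc z0 rho z ->
  f z = CK z0 rho (fun t => f (circ z0 rho t) * (rho * ee t)) 1 z.
Proof.
intros [Hr HrR] Hf Hz. unfold disc in Hz. set (c := circ z0 rho). have Hnz : forall t, c t - z <> 0 by (intros t; now apply circ_nz).
set (pt := fun s t => z + RtoC s * (c t - z)). set (eta := ((R - rho) / (2 * rho))%R). have Heta : 0 < eta by (apply Rdiv_lt_0_compat; lra).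
have Hpt : forall s y t, I01 s -> Rabs (y - s) < eta -> disc z0 R (pt y t).
{ intros s y t Hs Hy. unfold disc, pt, I01 in *. have Hct : Cmod (c t - z0) = rho by now apply Cmod_circ. have Hb := Cmod_tri3 (c t) z0 z.
 rewrite (Cmod_symm z0) in Hb. have P := Cmod_ge_0 (c t - z).
 replace (z + y * (c t - z) - z0) with (RtoC (1 - s) * (z - z0) + s * (c t - z0) + RtoC (y - s) * (c t - z)) by go.
 eapply Rle_lt_trans; [apply Cmod_triangle|]. eapply Rle_lt_trans; [apply Rplus_le_compat_r, Cmod_triangle|].
 rewrite !Cmod_mult, !Cmod_R, Hct, (Rabs_pos_eq (1 - s)), (Rabs_pos_eq s) by lra.
 have He : (eta * (2 * rho) = R - rho)%R by (unfold eta; field; lra).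
 assert (Rabs (y - s) * Cmod (c t - z) <= Rabs (y - s) * (2 * rho)) by (apply Rmult_le_compat_l; [apply Rabs_pos|lra]). nra. }
have Hp0 : forall s t, I01 s -> disc z0 R (pt s t). { intros s t Hs. apply (Hpt s); [assumption|]. now rewrite Rminus_diag, Rabs_R0. }
have Hptc : forall p, ct (dP dR dR) dC (fun p => pt (fst p) (snd p)) p by (intros p; unfold pt, c, circ; ctt).
set (k := fun s t => f (pt s t) * ((rho * ee t) / (c t - z))). set (k' := fun s t => f' (pt s t) * (rho * ee t)).
have E1 : CI (k 1%R) = CK z0 rho (fun t => f (circ z0 rho t) * (rho * ee t)) 1 z.
{ apply CI_ext. intros t _. unfold k, pt. replace (z + 1 * (c t - z)) with (c t) by ring. fold c. go. } have E0 : CI (k 0%R) = f z.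
{ transitivity (CI (fun t => f z * ((rho * ee t) / (c t - z)))).
 - apply CI_ext. intros t _. unfold k, pt. do 2 f_equal. ring.
 - rewrite CI_scal; [unfold c; rewrite winding by assumption; ring|]. intros t Ht. apply ct_div; [apply Hnz|ctt|]. go. } rewrite <- E0.
transitivity (CI (k 1%R)); [|go]. symmetry. apply (const_of_rder0 (fun s => CI (k s))). intros s Hs.
apply (wd_eq RtoC _ _ (CI (k' s)) 0); [|go|].
2: { apply (rder_CI k k').
 - take eta. intros y Hy. split; intros t Ht.
  + apply (jc_ct dR k); [apply dR_refl|]. apply ct_jc. unfold k. apply ct_mult.
   * apply (ct_comp (dP dR dR) dC dC f (fun p => pt (fst p) (snd p))); [go|]. exact (wd_ct idC f _ _ _ (proj1 (Hf _ (Hpt s y t Hs Hy)))).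
   * apply ct_div; [go|ctt|]. go.
  + unfold k, k'. have Hn := Hnz t.
   wd_by (apply wd_mult; [apply (wd_comp_hol RtoC f (fun s => pt s t)); [apply Hf, (Hpt s); assumption|unfold pt; apply wd_plus; [apply
    wd_const|apply wd_mult; [apply wd_io|apply wd_const]]]|apply wd_const]).
   * cbv beta. go. * cring.
 - intros t Ht. apply ct_jc. unfold k'. apply ct_mult; [|ctt]. apply (ct_comp (dP dR dR) dC dC f' (fun p => pt (fst p) (snd p))); [go|].
  now apply Hf, Hp0. } destruct (Req_dec s 0) as [Es|Es].
- subst s. transitivity (CI (fun t => (f' z * rho) * ee t)).
 { apply CI_ext. intros t _. unfold k', pt. replace (z + 0 * (c t - z)) with z by ring. ring. } rewrite CI_scal by go.
 rewrite (CI_ext _ (fun t => / (2 * PI * Ci) * (2 * PI * Ci * ee t))) by go. rewrite CI_scal, (CI_FTC (fun t => ee t)) by go.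
 replace (ee 1%R) with (ee 0%R) by (rewrite ee_0; symmetry; exact ee_1). ring.
- have Hs0 : RtoC s <> 0 by go. transitivity (/ (2 * PI * Ci * s) * CI (fun t => f' (pt s t) * (s * (2 * PI * Ci * (rho * ee t))))).
 + rewrite <- CI_scal.
  * apply CI_ext. intros t _. unfold k'. go.
  * intros t Ht. apply ct_mult; [|ctt]. apply (ct_comp dR dC dC f' (fun t => pt s t)); [unfold pt, c, circ; ctt|]. now apply Hf, Hp0.
 + rewrite (CI_FTC (fun t => f (pt s t))).
  * unfold pt, c, circ. replace (ee 1%R) with (ee 0%R) by (rewrite ee_0; symmetry; exact ee_1). ring.
  * intros t Ht.
   wd_by (apply (wd_comp_hol RtoC f (fun t => pt s t)); [apply Hf; now apply Hp0| unfold pt; apply wd_plus; [apply wd_const|apply wd_scal,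
    wd_minus; [apply rder_circ|apply wd_const]]]); cbv beta; ring.
  * intros t Ht. apply ct_mult; [|ctt]. apply (ct_comp dR dC dC f' (fun t => pt s t)); [go|]. now apply Hf, Hp0.
Qed.

(** The continuity of the derivative is required here so that Cauchy's formula follows by differentiation under the
    integral; [goursat] removes this requirement. *)
Definition ana (f : C -> C) (z0 : C) : Prop := exists (R : R) (f' : C -> C), 0 < R /\
  forall z, disc z0 R z -> cder f z (f' z) /\ ct dC dC f' z.

Definition dd (f : C -> C) (z : C) : C := epsilon (inhabits (RtoC 0)) (fun l => cder f z l).

Lemma cder_dd f z l : cder f z l -> dd f z = l.
Proof. intros H. apply (wd_unique_cder f z); [|go]. apply (epsilon_spec (inhabits (RtoC 0)) (fun l => cder f z l)). now exists l. Qed.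
Lemma ana_near f z0 : ana f z0 -> exists R, 0 < R /\ forall z, disc z0 R z -> ana f z.
Proof. intros [R [f' [HR H]]]. take R. intros z Hz. destruct (disc_open z0 R z Hz) as [d [Hd Hd2]]. exists d, f'. go. Qed.

Lemma ana_dd f z : ana f z -> cder f z (dd f z) /\ ct dC dC (dd f) z.
Proof.
intros [R [f' [HR H]]]. have E : forall y, disc z R y -> dd f y = f' y by (intros y Hy; now apply cder_dd, H).
have Hz := disc_center z R HR. split.
- rewrite E by go. now apply H. - apply ct_ext_loc with (f := f'); [|symmetry; now apply E|now apply H]. take R. intros y Hy. symmetry. go.
Qed.

Lemma ana_ct f z : ana f z -> ct dC dC f z.
Proof. intros H. apply ana_dd in H. exact (wd_ct idC f z _ _ (proj1 H)). Qed.
Lemma ana_intro f f' z0 R : 0 < R ->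
  (forall z, disc z0 R z -> cder f z (f' z) /\ ct dC dC f' z) -> ana f z0.
Proof. intros. exists R, f'. tauto. Qed.

Lemma ana_ext_loc f g z0 : (exists R, 0 < R /\ forall z, disc z0 R z -> f z = g z) ->
  ana f z0 -> ana g z0.
Proof.
intros [R [HR E]] [R' [f' [HR' H]]]. exists (Rmin R R'), f'. split; [now apply rmin_pos|]. intros z Hz. apply lt_rmin in Hz as [Hz1 Hz2].
split; [|now apply H]. apply wd_ext_loc with (f := f); [|now apply H]. destruct (disc_open z0 R z Hz1) as [d [Hd Hd2]]. exists d. go.
Qed.

Lemma ana_CK z0 rho phi m z : 0 < rho -> ic phi -> disc z0 rho z -> ana (CK z0 rho phi m) z.
Proof.
intros Hr Hp Hz. destruct (disc_open z0 rho z Hz) as [d [Hd Hd2]]. apply (ana_intro _ (fun z => INR m * CK z0 rho phi (S m) z) z d Hd).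
intros y Hy. apply Hd2 in Hy. split; [now apply cder_CK|]. apply ct_mult; [go|].
apply (wd_ct idC _ y _ _ (cder_CK z0 rho Hr phi (S m) y Hp Hy)).
Qed.

Lemma ic_circ f z0 rho R : 0 < rho < R -> (forall z, disc z0 R z -> ct dC dC f z) ->
  ic (fun t => f (circ z0 rho t) * (rho * ee t)).
Proof.
intros Hr Hf t Ht. apply ct_mult; [|ctt]. apply (ct_comp dR dC dC f (circ z0 rho)); [go|]. apply Hf. unfold disc. rewrite Cmod_circ; lra.
Qed.

Lemma cauchy_ana f z0 R rho z : 0 < rho < R -> (forall w, disc z0 R w -> ana f w) ->
  disc z0 rho z -> f z = CK z0 rho (fun t => f (circ z0 rho t) * (rho * ee t)) 1 z.
Proof. intros Hr Hf. apply (cauchy f (dd f) z0 R rho z Hr). intros w Hw. now apply ana_dd, Hf. Qed.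

(** Cauchy's integral can be differentiated twice. *)
Lemma ana_deriv f z0 : ana f z0 -> ana (dd f) z0.
Proof.
intros H. destruct (ana_near f z0 H) as [R [HR Ha]]. set (phi := fun t => f (circ z0 (R / 2) t) * (RtoC (R / 2) * ee t)).
have Hr : 0 < R / 2 < R by lra. have Hic : ic phi by (apply (ic_circ f z0 (R / 2) R Hr); intros; now apply ana_ct, Ha).
have E : forall z, disc z0 (R / 2) z -> f z = CK z0 (R / 2) phi 1 z. { intros z Hz. now apply (cauchy_ana f z0 R (R / 2)). }
apply ana_ext_loc with (f := fun z => INR 1 * CK z0 (R / 2) phi 2 z).
- exists (R / 2)%R. split; [lra|]. intros z Hz. symmetry. apply cder_dd. apply wd_ext_loc with (f := CK z0 (R / 2) phi 1).
 + destruct (disc_open _ _ _ Hz) as [d [Hd Hd2]]. take d. intros y Hy. symmetry. go. + apply cder_CK; [lra|go|go].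
- apply ana_ext_loc with (f := CK z0 (R / 2) phi 2).
 + exists 1%R. split; [lra|]. intros z _. simpl. ring. + apply ana_CK; [lra|go|apply disc_center; lra].
Qed.

Lemma CK_bound z0 rho phi m z M : 0 < rho -> ic phi -> (forall t, I01 t -> Cmod (phi t) <= M) ->
  disc z0 (rho / 2) z -> Cmod (CK z0 rho phi m z) <= M * (2 / rho) ^ m.
Proof.
intros Hr Hp HM Hz. unfold disc in Hz. apply CI_bound.
- intros t Ht. apply (jc_ct dC (fun z t => phi t * (/ (circ z0 rho t - z)) ^ m)); [apply dC_refl|]. apply CK_jc; trivial. lra.
- intros t Ht. rewrite Cmod_mult, Cmod_pow. have Hf := circ_far z0 rho Hr z t ltac:(lra). apply Rmult_le_compat; [go|go|go|].
 apply pow_incr. split; [go|]. rewrite Cmod_inv by (apply circ_nz; lra). replace (2 / rho)%R with (/ (rho / 2))%R by (field; lra).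
 apply Rinv_le_contravar; lra.
Qed.

(** Weierstrass: Cauchy's formula passes to the limit. *)
Lemma hol_approx f z0 R : 0 < R ->
  (forall eps, 0 < eps -> exists g, (forall z, disc z0 R z -> ana g z) /\
     forall z, disc z0 R z -> Cmod (f z - g z) <= eps) -> ana f z0.
Proof.
intros HR H. have Hc : forall z, disc z0 R z -> ct dC dC f z.
{ intros z Hz. apply ct_approx. intros eps He. destruct (H eps He) as [g [Hg E]]. exists g. split; [now apply ana_ct, Hg|].
 destruct (disc_open _ _ _ Hz) as [d [Hd Hd2]]. exists d. go. }
set (phi := fun h : C -> C => fun t => h (circ z0 (R / 2) t) * (RtoC (R / 2) * ee t)). have Hr : 0 < R / 2 < R by lra.
assert (Hic : forall h, (forall z, disc z0 R z -> ct dC dC h z) -> ic (phi h)) by (intros h Hh; now apply (ic_circ h z0 (R / 2) R Hr)).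
apply ana_ext_loc with (f := CK z0 (R / 2) (phi f) 1). 2: { apply ana_CK; [lra|go|apply disc_center; lra]. } exists (R / 4)%R.
split; [lra|]. intros z Hz. have Hz2 : disc z0 (R / 2) z by (unfold disc in *; lra). have HzR : disc z0 R z by (unfold disc in *; lra).
have E : CK z0 (R / 2) (phi f) 1 z - f z = 0.
{ apply Cmod_eq_small. intros eps He. destruct (H (eps / 3)%R ltac:(lra)) as [g [Hg E]]. have Eg := cauchy_ana g z0 R (R / 2) z Hr Hg Hz2.
 fold (phi g) in Eg. have Hgc : forall z, disc z0 R z -> ct dC dC g z by (intros; now apply ana_ct, Hg).
 have B1 : Cmod (CK z0 (R / 2) (phi f) 1 z - CK z0 (R / 2) (phi g) 1 z) <= 2 * (eps / 3).
 { unfold CK. rewrite <- CI_minus.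
  - rewrite (CI_ext _ (fun t => (phi f t - phi g t) * (/ (circ z0 (R / 2) t - z)) ^ 1)) by go.
   replace (2 * (eps / 3))%R with (eps / 3 * (R / 2) * (2 / (R / 2)) ^ 1)%R by (simpl; field; lra).
   refine (CK_bound z0 (R / 2) (fun t => phi f t - phi g t) 1 z (eps / 3 * (R / 2)) _ _ _ _); [lra| | |].
   + intros t Ht. apply ct_minus; apply Hic; assumption.
   + intros t Ht. unfold phi. replace (_ - _) with ((f (circ z0 (R / 2) t) - g (circ z0 (R / 2) t)) * (RtoC (R / 2) * ee t)) by ring.
    rewrite !Cmod_mult, Cmod_ee_R, Cmod_R, Rabs_pos_eq, Rmult_1_r by lra. apply Rmult_le_compat_r; [lra|]. apply E. unfold disc.
    rewrite Cmod_circ; lra.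
   + unfold disc in *. lra.
  - intros t Ht. apply (jc_ct dC (fun z t => phi f t * (/ (circ z0 (R / 2) t - z)) ^ 1)); [apply dC_refl|]. apply CK_jc; trivial; [lra|go].
  - intros t Ht. apply (jc_ct dC (fun z t => phi g t * (/ (circ z0 (R / 2) t - z)) ^ 1)); [apply dC_refl|]. apply CK_jc; trivial; [lra|go]. }
 specialize (E z HzR). rewrite <- Eg in B1. have T := Cmod_tri3 (CK z0 (R / 2) (phi f) 1 z) (g z) (f z). rewrite (Cmod_symm (g z)) in T.
 lra. } replace (CK z0 (R / 2) (phi f) 1 z) with (CK z0 (R / 2) (phi f) 1 z - f z + f z) by ring. rewrite E. ring.
Qed.

Lemma cauchy_est f z0 R M : 0 < R -> (forall z, disc z0 R z -> ana f z) ->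
  (forall z, disc z0 R z -> Cmod (f z) <= M) -> Cmod (dd f z0) <= M * (8 / R).
Proof.
intros HR Ha HM. set (phi := fun t => f (circ z0 (R / 2) t) * (RtoC (R / 2) * ee t)). have Hr : 0 < R / 2 < R by lra.
have Hic : ic phi by (apply (ic_circ f z0 (R / 2) R Hr); intros; now apply ana_ct, Ha). have E : dd f z0 = INR 1 * CK z0 (R / 2) phi 2 z0.
{ apply cder_dd. apply wd_ext_loc with (f := CK z0 (R / 2) phi 1).
 - exists (R / 2)%R. split; [lra|]. intros y Hy. symmetry. now apply (cauchy_ana f z0 R (R / 2)).
 - apply cder_CK; [lra|go|apply disc_center; lra]. } rewrite E, Cmult_1_l.
replace (M * (8 / R))%R with (M * (R / 2) * (2 / (R / 2)) ^ 2)%R by (simpl; field; lra). apply CK_bound; [lra|go| |apply disc_center; lra].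
intros t Ht. unfold phi. rewrite !Cmod_mult, Cmod_ee_R, Cmod_R, Rabs_pos_eq, Rmult_1_r by lra. apply Rmult_le_compat_r; [lra|]. apply HM.
unfold disc. rewrite Cmod_circ; lra.
Qed.


Ltac cfield := field; repeat split; try (apply RtoC_nz; lra).

Lemma ana_const c z : ana (fun _ => c) z.
Proof. apply (ana_intro _ (fun _ => RtoC 0) z 1); [lra|]. intros y _. split; [go|go]. Qed.
Lemma ana_id z : ana (fun w => w) z.
Proof. apply (ana_intro _ (fun _ => RtoC 1) z 1); [lra|]. intros y _. split; [go|go]. Qed.

Lemma ana_two f g z0 : ana f z0 -> ana g z0 -> exists r, 0 < r /\
  forall z, disc z0 r z -> ana f z /\ ana g z.
Proof.
intros Hf Hg. destruct (ana_near _ _ Hf) as [r1 [H1 H2]]. destruct (ana_near _ _ Hg) as [r2 [H3 H4]]. take_min r1 r2 as z Hz.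
split; [apply H2|apply H4]; apply Hz.
Qed.

Lemma ana_plus f g z : ana f z -> ana g z -> ana (fun w => f w + g w) z.
Proof.
intros Hf Hg. destruct (ana_two f g z Hf Hg) as [r [Hr H]]. apply (ana_intro _ (fun w => dd f w + dd g w) z r Hr). intros y Hy.
destruct (H y Hy) as [H1 H2]. apply ana_dd in H1. apply ana_dd in H2. split.
- wd_by (apply wd_plus; [apply H1|apply H2]); cring. - apply ct_plus; tauto.
Qed.

Lemma ana_mult f g z : ana f z -> ana g z -> ana (fun w => f w * g w) z.
Proof.
intros Hf Hg. destruct (ana_two f g z Hf Hg) as [r [Hr H]]. apply (ana_intro _ (fun w => dd f w * g w + f w * dd g w) z r Hr). intros y Hy.
destruct (H y Hy) as [H1 H2]. have Hf' := ana_ct _ _ H1. have Hg' := ana_ct _ _ H2. apply ana_dd in H1. apply ana_dd in H2. split.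
- wd_by (apply wd_mult; [apply H1|apply H2]); cring. - apply ct_plus; apply ct_mult; tauto.
Qed.

Lemma ana_opp f z : ana f z -> ana (fun w => - f w) z.
Proof.
intros H. apply ana_ext_loc with (f := fun w => - (1) * f w).
- exists 1%R. split; [lra|]. go. - apply ana_mult; [apply ana_const|go].
Qed.

Lemma ana_minus f g z : ana f z -> ana g z -> ana (fun w => f w - g w) z.
Proof. intros. apply ana_plus; [go|now apply ana_opp]. Qed.

Lemma ana_comp f g z : ana g z -> ana f (g z) -> ana (fun w => f (g w)) z.
Proof.
intros Hg Hf. destruct (ana_near _ _ Hg) as [r1 [H1 H2]]. destruct (ana_near _ _ Hf) as [r2 [H3 H4]].
destruct (ana_ct g z Hg r2 H3) as [d [Hd Hd2]]. apply (ana_intro _ (fun w => dd f (g w) * dd g w) z (Rmin r1 d)); [go|]. intros y Hy.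
apply lt_rmin in Hy as [Hy1 Hy2]. have A1 := ana_dd _ _ (H2 y Hy1). have A2 := ana_dd _ _ (H4 _ (Hd2 y Hy2)). split.
- wd_by (apply (wd_comp_hol idC f g); [apply A2|apply A1]); cring.
- apply ct_mult; [|go]. apply (ct_comp dC dC dC (dd f) g); [|go]. apply ana_ct. go.
Qed.

Lemma ana_inv (f : C -> C) z : f z <> 0 -> ana f z -> ana (fun w => / f w) z.
Proof.
intros Hn H. apply (ana_comp (fun w => / w) f); [go|].
apply (ana_intro _ (fun w => - / (w * w)) (f z) (Cmod (f z))); [now apply Cmod_gt_0|]. intros y Hy. have Hy0 : y <> 0.
{ intros E. unfold disc in Hy. rewrite E in Hy. replace (0 - f z) with (- f z) in Hy by ring. rewrite Cmod_opp in Hy. lra. } split; [go|].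
apply ct_opp, ct_inv; [go|]. ctt.
Qed.

Lemma ana_div (f g : C -> C) z : g z <> 0 -> ana f z -> ana g z -> ana (fun w => f w / g w) z.
Proof. intros. apply ana_mult; [go|now apply ana_inv]. Qed.
Lemma ana_Cexp f z : ana f z -> ana (fun w => Cexp (f w)) z.
Proof. intros H. apply (ana_comp Cexp f); [go|]. apply (ana_intro _ Cexp (f z) 1); [lra|]. intros y _. split; [apply cder_Cexp|ctt]. Qed.
Lemma ana_ee f z : ana f z -> ana (fun w => ee (f w)) z.
Proof. intros H. apply ana_Cexp, ana_mult; [apply ana_const|go]. Qed.
Lemma ana_pow f n z : ana f z -> ana (fun w => f w ^ n) z.
Proof. intros H. induction n; simpl; [apply ana_const|now apply ana_mult]. Qed.

Ltac anat := repeat first [assumption | apply ana_const | apply ana_id | apply ana_plus | apply ana_minus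
  | apply ana_opp | apply ana_mult | apply ana_Cexp | apply ana_ee | apply ana_pow ].
Ltac more ::= first [solve [ctt] | solve [intros ? ?; ctt] | solve [anat] | solve [derive]].

Definition clamp (t : R) : R := Rmax 0 (Rmin 1 t).

Lemma clamp_01 t : I01 (clamp t).
Proof. unfold clamp, I01, Rmax, Rmin. repeat destruct (Rle_dec _ _); lra. Qed.
Lemma clamp_id t : I01 t -> clamp t = t.
Proof. unfold clamp, I01, Rmax, Rmin. intros. repeat destruct (Rle_dec _ _); lra. Qed.
Lemma clamp_lip s t : Rabs (clamp s - clamp t) <= Rabs (s - t).
Proof. unfold clamp, Rmax, Rmin. repeat destruct (Rle_dec _ _); split_Rabs; lra. Qed.

Lemma jc_ct2 {X} (dX : X -> X -> R) (f : X -> R -> C) x t : (forall a b, 0 <= dX a b) ->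
  jc dX f x t -> ct (dP dX dR) dC (fun p => f (fst p) (snd p)) (x, t).
Proof.
intros Hn H eps He. destruct (H eps He) as [d [Hd H1]]. take d. intros [y s] Hy. unfold dP in Hy. cbn [fst snd] in *. have T1 := Hn x y.
have T2 := dR_ge0 t s. apply H1; [lra|]. fold (dR t s). lra.
Qed.

Lemma ana_CI (f : C -> R -> C) z0 r : 0 < r ->
  (forall z t, disc z0 r z -> I01 t -> jc dC f z t) ->
  (forall z t, disc z0 r z -> I01 t -> ana (fun w => f w t) z) -> ana (fun z => CI (f z)) z0.
Proof.
intros Hr Hj Ha. set (g := fun z t => f z (clamp t)). have Hg : forall z t, disc z0 r z -> jc dC g z t.
{ intros z t Hz eps He. destruct (Hj z (clamp t) Hz (clamp_01 t) eps He) as [d [Hd H]]. take d. intros y s Hy Hs. apply H; [go|].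
 have T := clamp_lip s t. lra. } apply ana_ext_loc with (f := fun z => CI (g z)).
{ take r. intros z _. apply CI_ext. intros t Ht. unfold g. now rewrite clamp_id. }
assert (Hga : forall z t, disc z0 r z -> ana (fun w => g w t) z) by (intros z t Hz; apply Ha; [go|apply clamp_01]). set (rho := (r / 2)%R).
have Hrho : 0 < rho < r by (unfold rho; lra).
set (F := fun (p : C * RbaseSymbolsImpl.R) th => (g (circ z0 rho th) (snd p) * (rho * ee th)) * (/ (circ z0 rho th - fst p)) ^ 2).
set (g' := fun z t => CI (F (z, t))). have HF : forall z t th, disc z0 rho z -> jc (dP dC dR) F (z, t) th.
{ intros z t th Hz. apply ct_jc. apply ct_mult; [apply ct_mult|].
 - apply (ct_comp (dP (dP dC dR) dR) (dP dC dR) dC (fun p => g (fst p) (snd p)) (fun p => (circ z0 rho (snd p), snd (fst p)))).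
  + go. + apply jc_ct2; [go|]. apply Hg. unfold disc. rewrite Cmod_circ; lra.
 - ctt. - apply ct_pow, ct_inv; [pairs; apply circ_nz; [lra|go]|]. go. } have Hxx : forall p, dP dC dR p p = 0%R.
{ intros p. unfold dP. rewrite dC_refl, dR_refl. lra. } have HicF : forall z t, disc z0 rho z -> ic (F (z, t)).
{ intros z t Hz th Hth. apply (jc_ct (dP dC dR)); [go|go]. } have Hg' : forall z t, disc z0 rho z -> jc dC g' z t.
{ intros z t Hz. apply ct_jc. apply ct_ext with (f := fun p => CI (F p)); [go|]. apply ct_CI; [go| |go].
 destruct (disc_open _ _ _ Hz) as [d [Hd Hd2]]. take d. intros [y s] Hy. apply HicF, Hd2. unfold dP in Hy. cbn [fst snd] in Hy.
 have T := dR_ge0 t s. unfold disc. fold (dC z y). lra. } have Hder : forall z t, disc z0 rho z -> cder (fun w => g w t) z (g' z t).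
{ intros z t Hz. set (phi := fun th => g (circ z0 rho th) t * (rho * ee th)).
 have Hic : ic phi by (apply (ic_circ (fun w => g w t) z0 rho r Hrho); intros; now apply ana_ct, Hga).
 apply wd_ext_loc with (f := CK z0 rho phi 1).
 - destruct (disc_open _ _ _ Hz) as [d [Hd Hd2]]. take d. intros y Hy. symmetry.
  apply (cauchy_ana (fun w => g w t) z0 r rho y Hrho); [go|go].
 - eapply wd_eq; [|go|apply cder_CK; [lra|go|go]]. go. } have HinR : forall z, disc z0 rho z -> disc z0 r z by (unfold disc; intros; lra).
apply (ana_intro _ (fun z => CI (g' z)) z0 rho); [lra|]. intros z Hz. destruct (disc_open _ _ _ Hz) as [d [Hd Hd2]]. split.
- apply cder_CI; [|go]. take d. intros y Hy. split.
 + intros t Ht. apply (jc_ct dC g); [apply dC_refl|]. go. + go.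
- apply ct_CI; [apply dC_refl| |go]. take d. intros y Hy t Ht. apply (jc_ct dC g'); [apply dC_refl|]. go.
Qed.

(** ** Goursat's theorem *)

Definition II (g : R -> C) (a b : R) : C := (RInt (fun t => Re (g t)) a b, RInt (fun t => Im (g t)) a b).
Definition cab (g : R -> C) a b := forall t, Rmin a b <= t <= Rmax a b -> ct dR dC g t.

Lemma ex_ab (f : R -> R) a b : (forall t, Rmin a b <= t <= Rmax a b -> ct dR dR f t) -> ex_RInt f a b.
Proof. intros H. apply (ex_RInt_continuous (V := RV)). intros z Hz. apply ct_continuous. go. Qed.

Lemma RInt_lin_comp (f : R -> R) a b : ex_RInt f a b ->
  RInt (fun s => (b - a) * f (a + s * (b - a)))%R 0 1 = RInt f a b.
Proof.
intros H. rewrite (RInt_ext (V := RV) _ (fun y => scal (b - a)%R (f ((b - a) * y + a)%R))).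
- rewrite (RInt_comp_lin (V := RV)).
 + f_equal; ring. + replace ((b - a) * 0 + a)%R with a by ring. now replace ((b - a) * 1 + a)%R with b by ring.
- intros. unfold scal; simpl; unfold mult; simpl. do 2 f_equal. ring.
Qed.

Lemma ic_cab g a b : cab g a b -> ic (fun s => g (a + s * (b - a))%R).
Proof.
intros H t Ht. apply (ct_comp dR dR dC g (fun s => (a + s * (b - a))%R)).
- apply (ct_Rstd dR (fun s => (a + s * (b - a))%R) (fun s => s)); [go|]. apply derivable_continuous_pt.
 apply derivable_pt_plus; [apply derivable_pt_const| apply derivable_pt_mult; [apply derivable_pt_id|apply derivable_pt_const]].
- apply H. unfold I01 in Ht. unfold Rmin, Rmax. destruct (Rle_dec a b); nra.
Qed.

Lemma II_CI g a b : cab g a b -> II g a b = RtoC (b - a) * CI (fun s => g (a + s * (b - a))%R).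
Proof.
intros H. rewrite <- CI_scal by now apply ic_cab. apply C_eq; unfold II, CI.
- rewrite <- RInt_lin_comp.
 + apply RInt_ext. intros. unfold Re, RtoC; simpl. ring. + apply ex_ab. intros. now apply ct_Re, H.
- change (RInt (fun t => Im (g t)) a b = RInt (fun t => Im (RtoC (b - a) * g (a + t * (b - a))%R)%C) 0 1). rewrite <- RInt_lin_comp.
 + apply RInt_ext. intros. unfold Im, RtoC; simpl. ring. + apply ex_ab. intros. now apply ct_Im, H.
Qed.

Lemma II_Chasles g a b c : cab g a b -> cab g b c -> II g a b + II g b c = II g a c.
Proof.
intros H1 H2. apply C_eq; unfold II; simpl.
- apply (RInt_Chasles (V := RV) (fun t => Re (g t)) a b c); apply ex_ab; intros; apply ct_Re; auto.
- apply (RInt_Chasles (V := RV) (fun t => Im (g t)) a b c); apply ex_ab; intros; apply ct_Im; auto.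
Qed.

Lemma II_01 g : II g 0 1 = CI g.
Proof. go. Qed.

Definition seg (f : C -> C) (a b : C) : C := (b - a) * CI (fun s => f (a + s * (b - a))).

Section Goursat.
Variables (z0 : C) (r : R) (f : C -> C).
Hypothesis Hr : 0 < r.
Hypothesis Hf : forall z, disc z0 r z -> exists l, cder f z l.

Lemma g_ct z : disc z0 r z -> ct dC dC f z.
Proof. intros Hz. destruct (Hf z Hz) as [l Hl]. exact (wd_ct idC f z _ _ Hl). Qed.

Lemma disc_convex a b s R' : disc z0 R' a -> disc z0 R' b -> I01 s -> disc z0 R' (a + s * (b - a)).
Proof.
unfold disc, I01. intros Ha Hb Hs. replace (a + s * (b - a) - z0) with (RtoC (1 - s) * (a - z0) + s * (b - z0)) by go.
eapply Rle_lt_trans; [apply Cmod_triangle|]. rewrite !Cmod_mult, !Cmod_R, !Rabs_pos_eq by lra. destruct (Req_dec s 0); [go|]. go.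
Qed.

Lemma seg_ic a b : disc z0 r a -> disc z0 r b -> ic (fun s => f (a + s * (b - a))).
Proof. intros Ha Hb t Ht. apply (ct_comp dR dC dC f); [go|]. now apply g_ct, disc_convex. Qed.
Lemma seg_cab a b : disc z0 r a -> disc z0 r b -> cab (fun s => f (a + s * (b - a))) 0 1.
Proof. intros Ha Hb t. minmax. intros. now apply seg_ic. Qed.

Lemma seg_rev a b : disc z0 r a -> disc z0 r b -> seg f b a = - seg f a b.
Proof.
intros Ha Hb. unfold seg. have E : CI (fun s => f (b + s * (a - b))) = CI (fun s => f (a + s * (b - a))).
{ set (g := fun s : R => f (a + s * (b - a))). have H1 : cab g 0 1 by now apply seg_cab. have H2 : cab g 1 0.
 { intros t. rewrite Rmin_comm, Rmax_comm. go. } have H := II_Chasles g 0 1 0 H1 H2. rewrite II_01, (II_CI g 1 0 H2) in H.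
 replace (II g 0 0) with (RtoC 0) in H. 2:{ apply C_eq; unfold II; simpl; now rewrite (RInt_point (V := RV)). }
 rewrite (CI_ext (fun s => f (b + s * (a - b))) (fun s => g (1 + s * (0 - 1))%R)). 2:{ intros s _. unfold g. f_equal. go. }
 replace (RtoC (0 - 1)) with (- RtoC 1) in H by go.
 replace (CI g) with (CI g + - (1) * CI (fun s => g (1 + s * (0 - 1))%R) + CI (fun s => g (1 + s * (0 - 1))%R)) by ring. rewrite H. ring. }
rewrite E. ring.
Qed.

Definition mid (a b : C) : C := (a + b) / 2.

Lemma disc_mid a b : disc z0 r a -> disc z0 r b -> disc z0 r (mid a b).
Proof.
intros Ha Hb. replace (mid a b) with (a + RtoC (/ 2) * (b - a)).
- apply disc_convex; trivial. unfold I01. lra. - unfold mid. rewrite RtoC_inv by lra. cfield.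
Qed.

Lemma seg_half a b : disc z0 r a -> disc z0 r b -> seg f a b = seg f a (mid a b) + seg f (mid a b) b.
Proof.
intros Ha Hb. unfold seg. set (g := fun s : R => f (a + s * (b - a))). have H1 : forall u v, 0 <= u <= 1 -> 0 <= v <= 1 -> cab g u v.
{ intros u v Hu Hv t Ht. apply (seg_ic a b Ha Hb). unfold I01. unfold Rmin, Rmax in Ht. destruct (Rle_dec u v); lra. }
rewrite <- (II_01 g), <- (II_Chasles g 0 (/ 2) 1) by (apply H1; lra). rewrite !II_CI by (apply H1; lra).
rewrite (CI_ext (fun s => f (a + s * (mid a b - a))) (fun s => g (0 + s * (/ 2 - 0))%R)).
2:{ intros s _. unfold g, mid. f_equal. rewrite RtoC_plus, RtoC_mult, RtoC_minus, RtoC_inv by lra. cfield. }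
rewrite (CI_ext (fun s => f (mid a b + s * (b - mid a b))) (fun s => g (/ 2 + s * (1 - / 2))%R)).
2:{ intros s _. unfold g, mid. f_equal. rewrite RtoC_plus, RtoC_mult, RtoC_minus, RtoC_inv by lra. cfield. } unfold mid.
rewrite !RtoC_minus, RtoC_inv by lra. cfield.
Qed.

Definition tri (a b c : C) : C := seg f a b + seg f b c + seg f c a.

Lemma tri_split a b c : disc z0 r a -> disc z0 r b -> disc z0 r c ->
  tri a b c = tri a (mid a b) (mid c a) + tri (mid a b) b (mid b c) + tri (mid c a) (mid b c) c
    + tri (mid a b) (mid b c) (mid c a).
Proof.
intros Ha Hb Hc. unfold tri. have M1 := disc_mid a b Ha Hb. have M2 := disc_mid b c Hb Hc. have M3 := disc_mid c a Hc Ha.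
rewrite (seg_half a b Ha Hb), (seg_half b c Hb Hc), (seg_half c a Hc Ha), (seg_rev (mid b c) (mid a b) M2 M1), (seg_rev (mid c a) (mid b c)
 M3 M2), (seg_rev (mid a b) (mid c a) M1 M3). ring.
Qed.
End Goursat.


Lemma half_pow_pos n : 0 < (/ 2) ^ n.
Proof. apply pow_lt. lra. Qed.

Lemma cauchy_seq_bound (u : nat -> C) K : (forall n, Cmod (u (S n) - u n) <= K * (/ 2) ^ n) ->
  forall n m, Cmod (u (n + m)%nat - u n) <= 2 * K * (/ 2) ^ n * (1 - (/ 2) ^ m).
Proof.
intros H n m. induction m as [|m IH].
- rewrite Nat.add_0_r. vanish (u n - u n). rewrite Cmod_0. go.
- rewrite Nat.add_succ_r. have T := Cmod_tri3 (u (S (n + m))) (u (n + m)%nat) (u n). specialize (H (n + m)%nat). rewrite pow_add in H.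
 simpl ((/ 2) ^ S m)%R. lra.
Qed.

Lemma real_limit (u : nat -> R) (e : nat -> R) : (forall n m, Rabs (u (n + m)%nat - u n) <= e n) ->
  (forall eps, 0 < eps -> exists n, e n < eps) -> exists l, forall n, Rabs (u n - l) <= e n.
Proof.
intros H He. destruct (Rcomplete.R_complete u) as [l Hl].
- intros eps Hp. destruct (He (eps / 2)%R ltac:(lra)) as [n Hn]. exists n. intros a b Ha Hb. have H1 := H n (a - n)%nat.
 have H2 := H n (b - n)%nat. replace (n + (a - n))%nat with a in H1 by lia. replace (n + (b - n))%nat with b in H2 by lia. unfold Rdist.
 split_Rabs; lra.
- exists l. intros n. apply le_all_eps. intros eps Hp. destruct (Hl eps Hp) as [N HN]. specialize (HN (n + N)%nat ltac:(lia)).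
 unfold Rdist in HN. specialize (H n N). split_Rabs; lra.
Qed.

Lemma complex_limit (u : nat -> C) (e : nat -> R) : (forall n m, Cmod (u (n + m)%nat - u n) <= e n) ->
  (forall eps, 0 < eps -> exists n, e n < eps) -> exists l, forall n, Cmod (u n - l) <= 2 * e n.
Proof.
intros H He. destruct (real_limit (fun n => Re (u n)) e) as [a Ha]; [|go|].
{ intros n m. eapply Rle_trans; [|apply (H n m)]. replace (Re (u (n + m)%nat) - Re (u n))%R with (Re (u (n + m)%nat - u n)) by go.
 apply re_le_Cmod. } destruct (real_limit (fun n => Im (u n)) e) as [b Hb]; [|go|].
{ intros n m. eapply Rle_trans; [|apply (H n m)]. replace (Im (u (n + m)%nat) - Im (u n))%R with (Im (u (n + m)%nat - u n)) by go.
 apply im_le_Cmod. } exists (a, b). intros n. le_by Cmod_le_ReIm. replace (Re (u n - (a, b))) with (Re (u n) - a)%R by go.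
replace (Im (u n - (a, b))) with (Im (u n) - b)%R by go. specialize (Ha n). specialize (Hb n). lra.
Qed.

Lemma geom_small K eps : 0 < eps -> exists n, K * (/ 2) ^ n < eps.
Proof.
intros He. destruct (pow_lt_1_zero (/ 2) ltac:(rewrite Rabs_pos_eq; lra) (eps / (Rabs K + 1))%R) as [n Hn].
{ apply Rdiv_lt_0_compat; [go|]. have H := Rabs_pos K. lra. } exists n. specialize (Hn n (Nat.le_refl n)). have Hp := half_pow_pos n.
rewrite Rabs_pos_eq in Hn by lra. have HK := Rabs_pos K. have HK2 := Rle_abs K.
have E : (eps / (Rabs K + 1) * (Rabs K + 1) = eps)%R by (field; lra). go.
Qed.

Lemma seg_affine al be a b : seg (fun z => al + be * z) a b =
  (al * b + be * b * b / 2) - (al * a + be * a * a / 2).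
Proof.
unfold seg. rewrite <- CI_scal. 2: { go. }
rewrite (CI_FTC (fun t => al * (a + t * (b - a)) + be * (a + t * (b - a)) * (a + t * (b - a)) / 2)).
- go. - go. - go.
Qed.

Section Goursat2.
Variables (z0 : C) (r : R) (f : C -> C).
Hypothesis Hr : 0 < r.
Hypothesis Hf : forall z, disc z0 r z -> exists l, cder f z l.

Let T : Type := (C * C * C)%type.
Definition tperi (t : C * C * C) : R := let '(a, b, c) := t in (Cmod (a - b) + Cmod (b - c) + Cmod (c - a))%R.
Definition tin (t : C * C * C) : Prop := let '(a, b, c) := t in disc z0 (r / 2) a /\ disc z0 (r / 2) b /\ disc z0 (r / 2) c.
Definition ttri (t : C * C * C) : C := let '(a, b, c) := t in tri f a b c.
Definition tfst (t : C * C * C) : C := fst (fst t).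
Definition tnext (t t' : C * C * C) : Prop := tin t' /\ tperi t' = (tperi t / 2)%R /\
  Cmod (ttri t) <= 4 * Cmod (ttri t') /\ Cmod (tfst t' - tfst t) <= tperi t.

Lemma Cmod_half z : Cmod (z / 2) = (Cmod z / 2)%R.
Proof. rewrite Cmod_div by go. rewrite Cmod_R, Rabs_pos_eq by lra. go. Qed.
Lemma disc_half z : disc z0 (r / 2) z -> disc z0 r z.
Proof. unfold disc. go. Qed.

Lemma tnext_ex t : tin t -> exists t', tnext t t'.
Proof.
destruct t as [[a b] c]. intros [Ha [Hb Hc]]. have Ha' := disc_half a Ha. have Hb' := disc_half b Hb. have Hc' := disc_half c Hc.
have S := tri_split z0 r f Hf a b c Ha' Hb' Hc'. have M : forall a b, disc z0 (r / 2) a -> disc z0 (r / 2) b -> disc z0 (r / 2) (mid a b).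
{ intros u v. apply (disc_mid z0 (r / 2)). } have Pa := Cmod_ge_0 (a - b). have Pb := Cmod_ge_0 (b - c). have Pc := Cmod_ge_0 (c - a).
have H4 : exists t', In t' ((a, mid a b, mid c a) :: (mid a b, b, mid b c) :: (mid c a, mid b c, c) :: (mid a b, mid b c, mid c a) :: nil)
 /\ Cmod (tri f a b c) <= 4 * Cmod (ttri t').
{ apply NNPP. intros Hn.
 have Hn' : forall t', In t' ((a, mid a b, mid c a) :: (mid a b, b, mid b c) :: (mid c a, mid b c, c) :: (mid a b, mid b c, mid c a) ::
  nil) -> 4 * Cmod (ttri t') < Cmod (tri f a b c). { intros t' Ht'. apply Rnot_le_lt. intros Hle. apply Hn. now exists t'. }
 have N1 := Hn' _ (or_introl eq_refl). have N2 := Hn' _ (or_intror (or_introl eq_refl)).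
 have N3 := Hn' _ (or_intror (or_intror (or_introl eq_refl))). have N4 := Hn' _ (or_intror (or_intror (or_intror (or_introl eq_refl)))).
 unfold ttri in *. rewrite S in N1, N2, N3, N4. set (A1 := tri f a (mid a b) (mid c a)) in *. set (A2 := tri f (mid a b) b (mid b c)) in *.
 set (A3 := tri f (mid c a) (mid b c) c) in *. set (A4 := tri f (mid a b) (mid b c) (mid c a)) in *.
 have T1 := Cmod_triangle (A1 + A2 + A3) A4. have T2 := Cmod_triangle (A1 + A2) A3. have T3 := Cmod_triangle A1 A2. lra. }
destruct H4 as [t' [Hin Hle]]. exists t'. have Q : tin t' /\ tperi t' = (tperi (a, b, c) / 2)%R /\ Cmod (tfst t' - a) <= tperi (a, b, c).
{ have Q1 : Cmod (a - mid a b) = (Cmod (a - b) / 2)%R. { rewrite <- Cmod_half. f_equal. unfold mid. field. }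
 have Q2 : Cmod (mid a b - b) = (Cmod (a - b) / 2)%R. { rewrite <- Cmod_half. f_equal. unfold mid. field. }
 have Q3 : Cmod (b - mid b c) = (Cmod (b - c) / 2)%R. { rewrite <- Cmod_half. f_equal. unfold mid. field. }
 have Q4 : Cmod (mid b c - c) = (Cmod (b - c) / 2)%R. { rewrite <- Cmod_half. f_equal. unfold mid. field. }
 have Q5 : Cmod (c - mid c a) = (Cmod (c - a) / 2)%R. { rewrite <- Cmod_half. f_equal. unfold mid. field. }
 have Q6 : Cmod (mid c a - a) = (Cmod (c - a) / 2)%R. { rewrite <- Cmod_half. f_equal. unfold mid. field. }
 have Q7 : Cmod (mid a b - mid c a) = (Cmod (b - c) / 2)%R. { rewrite <- Cmod_half. f_equal. go. }
 have Q8 : Cmod (mid b c - mid a b) = (Cmod (c - a) / 2)%R. { rewrite <- Cmod_half. f_equal. go. }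
 have Q9 : Cmod (mid c a - mid b c) = (Cmod (a - b) / 2)%R. { rewrite (Cmod_symm a b), <- Cmod_half, <- Cmod_opp. f_equal. go. }
 have Q2' := Cmod_symm (mid a b) a.
 destruct Hin as [E|[E|[E|[E|[]]]]]; subst t'; unfold tin, tperi, tfst; pairs; (split; [go|]); split.
 - go. - vanish (a - a). rewrite Cmod_0. lra. - go. - go. - go. - go.
 - rewrite (Cmod_symm (mid a b)), Q8, (Cmod_symm (mid b c)), Q9, (Cmod_symm (mid c a)), Q7. lra. - go. } go.
Qed.

Fixpoint tseq (t : C * C * C) (n : nat) : C * C * C :=
  match n with O => t | S m => epsilon (inhabits t) (tnext (tseq t m)) end.

Lemma tseq_next t n : tin t -> tin (tseq t n) /\ tnext (tseq t n) (tseq t (S n)).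
Proof.
intros Ht. have H : forall n, tin (tseq t n) -> tnext (tseq t n) (tseq t (S n)).
{ intros m Hm. apply (epsilon_spec (inhabits t) (tnext (tseq t m))). now apply tnext_ex. } have H2 : tin (tseq t n).
{ induction n as [|n IH]; [go|]. apply (H n IH). } go.
Qed.

Lemma seg_close g a b eps : disc z0 r a -> disc z0 r b -> (forall z, ct dC dC g z) ->
  (forall s, I01 s -> Cmod (f (a + s * (b - a))%C - g (a + s * (b - a))%C)%C <= eps) ->
  Cmod (seg f a b - seg g a b) <= Cmod (a - b) * eps.
Proof.
intros Ha Hb Hg H. unfold seg. have Hi : ic (fun s => g (a + s * (b - a))). { intros t Ht. apply (ct_comp dR dC dC g); [go|go]. }
have Hfi := seg_ic z0 r f Hf a b Ha Hb. replace (_ - _) with ((b - a) * CI (fun s => f (a + s * (b - a)) - g (a + s * (b - a)))).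
2:{ rewrite CI_minus by go. ring. } rewrite Cmod_mult, Cmod_symm. apply Rmult_le_compat_l; [go|]. apply CI_bound; [|go]. intros t Ht.
apply ct_minus; auto.
Qed.

Lemma tri_zero a b c : tin (a, b, c) -> tri f a b c = 0.
Proof.
intros Ht. set (t := (a, b, c)) in *. set (K := tperi t). have HK : 0 <= K.
{ unfold K, tperi, t. have H1 := Cmod_ge_0 (a - b). have H2 := Cmod_ge_0 (b - c). have H3 := Cmod_ge_0 (c - a). lra. }
have Hper : forall n, tperi (tseq t n) = (K * (/ 2) ^ n)%R.
{ induction n as [|n IH]; [unfold K; simpl; lra|]. destruct (tseq_next t n Ht) as [_ [_ [H _]]]. rewrite H, IH. simpl. lra. }
have Htri : forall n, Cmod (ttri t) <= 4 ^ n * Cmod (ttri (tseq t n)).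
{ induction n as [|n IH]; [simpl; lra|]. destruct (tseq_next t n Ht) as [_ [_ [_ [H _]]]]. have Hp : 0 < 4 ^ n by (apply pow_lt; lra).
 simpl (4 ^ S n)%R. go. } set (u := fun n => tfst (tseq t n)). have Hu : forall n m, Cmod (u (n + m)%nat - u n) <= 2 * K * (/ 2) ^ n.
{ intros n m. have H := cauchy_seq_bound u K. le_by H.
 - intros k. destruct (tseq_next t k Ht) as [_ [_ [_ [_ H2]]]]. rewrite Hper in H2. go.
 - have P2 := half_pow_pos m. assert (0 <= 2 * K * (/ 2) ^ n) by go. nra. } destruct (complex_limit u _ Hu) as [zs Hzs].
{ intros eps He. now apply geom_small. } have Hzd : disc z0 r zs.
{ unfold disc. have H0 : Cmod (zs - z0) <= r / 2; [|lra]. apply le_all_eps. intros eps He.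
 destruct (geom_small (2 * (2 * K)) eps He) as [n Hn]. specialize (Hzs n). destruct (tseq_next t n Ht) as [H _].
 have Hd : disc z0 (r / 2) (u n) by (unfold u; destruct (tseq t n) as [[x y] w]; apply H). unfold disc in Hd.
 have Tz := Cmod_tri3 zs (u n) z0. rewrite (Cmod_symm zs (u n)) in Tz. lra. } destruct (Hf zs Hzd) as [l Hl]. apply Cmod_eq_small.
intros eps He. destruct (Hl (eps / (5 * K * K + 1))%R) as [d [Hd H]]. { apply Rdiv_lt_0_compat; [go|]. nra. }
set (e := (eps / (5 * K * K + 1))%R) in *. have He0 : 0 < e by (unfold e; apply Rdiv_lt_0_compat; [go|nra]).
destruct (geom_small (5 * K) d Hd) as [n Hn]. specialize (Hzs n). specialize (Htri n). specialize (Hper n).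
destruct (tseq_next t n Ht) as [Hin _]. unfold u in Hzs. destruct (tseq t n) as [[x y] w]. unfold tfst in Hzs. cbn [fst snd] in *.
unfold tperi in Hper. destruct Hin as [Hx [Hy Hw]]. set (s := (K * (/ 2) ^ n)%R) in *. have Px := Cmod_ge_0 (x - y).
have Py := Cmod_ge_0 (y - w). have Pw := Cmod_ge_0 (w - x). have Bx : Cmod (x - zs) <= 5 * s by (unfold s in *; lra).
have By : Cmod (y - zs) <= 5 * s. { have T1 := Cmod_tri3 y x zs. rewrite (Cmod_symm y x) in T1. unfold s in *. lra. }
have Bw : Cmod (w - zs) <= 5 * s. { have T1 := Cmod_tri3 w x zs. unfold s in *. lra. } set (g := fun z => (f zs - l * zs) + l * z).
have Hg : forall p q, Cmod (p - zs) <= 5 * s -> Cmod (q - zs) <= 5 * s -> disc z0 r p -> disc z0 r q -> Cmod (seg f p q - seg g p q) <=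
 Cmod (p - q) * (e * (5 * s)).
{ intros p q Hp Hq Dp Dq. apply seg_close; trivial.
 - go.
 - intros s' Hs'. set (z := p + s' * (q - p)). have Bz : Cmod (z - zs) <= 5 * s.
  { unfold z. replace (p + s' * (q - p) - zs) with (RtoC (1 - s') * (p - zs) + s' * (q - zs)) by go. tri. unfold I01 in Hs'.
   rewrite !Cmod_mult, !Cmod_R, !Rabs_pos_eq by lra. nra. } specialize (H z). unfold idC in H.
  have Hz : Cmod (z - zs) < d by (unfold s in Bz; lra). replace (f z - g z) with (f z - f zs - ((z - zs) * l + Cconj (z - zs) * 0)) by go.
  go. } have E : tri f x y w = (seg f x y - seg g x y) + (seg f y w - seg g y w) + (seg f w x - seg g w x).
{ unfold tri, g. rewrite !seg_affine. field. } have B1 := Hg x y Bx By (disc_half x Hx) (disc_half y Hy).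
have B2 := Hg y w By Bw (disc_half y Hy) (disc_half w Hw). have B3 := Hg w x Bw Bx (disc_half w Hw) (disc_half x Hx).
have T1 := Cmod_triangle ((seg f x y - seg g x y) + (seg f y w - seg g y w)) (seg f w x - seg g w x).
have T2 := Cmod_triangle (seg f x y - seg g x y) (seg f y w - seg g y w). rewrite <- E in T1.
have B : Cmod (tri f x y w) <= s * (e * (5 * s)) by go. le_by Htri. apply Rle_trans with (4 ^ n * (s * (e * (5 * s))))%R.
{ apply Rmult_le_compat_l; [go|go]. } have E4 : (4 ^ n * ((/ 2) ^ n * (/ 2) ^ n) = 1)%R.
{ rewrite <- !Rpow_mult_distr. replace (4 * (/ 2 * / 2))%R with 1%R by lra. apply pow1. }
replace (4 ^ n * (s * (e * (5 * s))))%R with ((4 ^ n * ((/ 2) ^ n * (/ 2) ^ n)) * (e * (5 * K * K)))%R by (unfold s; ring).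
assert (e * (5 * K * K + 1) = eps)%R by (unfold e; field; nra). nra.
Qed.

Lemma goursat : ana f z0.
Proof.
have Hr2 : 0 < r / 2 by lra. have HP : forall z, disc z0 (r / 2) z -> cder (fun z => seg f z0 z) z (f z).
{ intros z Hz. intros eps He. destruct (g_ct z0 r f Hf z (disc_half z Hz) eps He) as [d1 [Hd1 H1]].
 destruct (disc_open _ _ _ Hz) as [d2 [Hd2 H2]]. take_min d1 d2. intros y Hy. unfold idC in *. apply lt_rmin in Hy.
 have Hyd : disc z0 (r / 2) y by (apply H2; apply Hy). have H0 := disc_center z0 (r / 2) Hr2.
 have T0 := tri_zero z0 z y (conj H0 (conj Hz Hyd)). unfold tri in T0.
 rewrite (seg_rev z0 r f Hf z0 y (disc_half _ H0) (disc_half _ Hyd)) in T0. have E : seg f z0 y - seg f z0 z = seg f z y.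
 { replace (seg f z y) with ((seg f z0 z + seg f z y + - seg f z0 y) + (seg f z0 y - seg f z0 z)) by ring. rewrite T0. ring. } rewrite E.
 replace (_ - _) with (seg f z y - seg (fun _ => f z) z y). 2:{ unfold seg. rewrite CI_const. ring. }
 le_by ((seg_close (fun _ => f z) z y eps (disc_half _ Hz) (disc_half _ Hyd))).
 - go.
 - intros s Hs. left. apply H1. unfold dC. replace (z + s * (y - z) - z) with (s * (y - z)) by ring. rewrite Cmod_mult, Cmod_R.
  unfold I01 in Hs. rewrite Rabs_pos_eq by lra. have P := Cmod_ge_0 (y - z). nra.
 - rewrite Cmod_symm. lra. } have HA : ana (fun z => seg f z0 z) z0.
{ apply (ana_intro _ f z0 (r / 2) Hr2). intros z Hz. split; [go|]. apply (g_ct z0 r f Hf). now apply disc_half. } apply ana_deriv in HA.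
apply ana_ext_loc with (2 := HA). exists (r / 2)%R. split; [assumption|]. intros z Hz. apply cder_dd. go.
Qed.
End Goursat2.

(** * The principal logarithm *)

Definition clog (w : C) : C := (ln (Cmod w), arg w).
Definition slit (w : C) : Prop := ~ (Im w = 0%R /\ Re w <= 0).

Lemma slit_nz w : slit w -> w <> 0.
Proof. intros H E. apply H. rewrite E. go. Qed.

Lemma Cexp_clog (w : C) : w <> 0 -> Cexp (clog w) = w.
Proof.
intros H. destruct (arg_spec w H) as [_ E]. unfold Cexp, clog. unfold Re, Im. pairs. rewrite exp_ln by now apply Cmod_gt_0. go.
Qed.

Lemma slit_pos w : slit w -> 0 < Cmod w + Re w.
Proof.
intros H. have H1 := re_le_Cmod w. destruct (Rle_lt_dec 0 (Re w)) as [H2|H2].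
- have H3 := proj1 (Cmod_gt_0 w) (slit_nz w H). lra.
- rewrite Rabs_left in H1 by lra. destruct (Req_dec (Cmod w + Re w) 0) as [E|E]; [|lra]. exfalso. apply H. have H4 := Cmod2_alt w. go.
Qed.

Lemma arg_atan w : slit w -> arg w = (2 * atan (Im w / (Cmod w + Re w)))%R.
Proof.
intros H. have Hn := slit_nz w H. have Hm := proj1 (Cmod_gt_0 w) Hn. destruct (arg_spec w Hn) as [Ha E]. set (t := arg w) in *.
have ER : Re w = (Cmod w * cos t)%R by (rewrite E at 1; reflexivity). have EI : Im w = (Cmod w * sin t)%R by (rewrite E at 1; reflexivity).
have Ht : t <> PI. { intros Et. apply H. rewrite ER, EI, Et, sin_PI, cos_PI. lra. } have Hc : 0 < cos (t / 2) by (apply cos_gt_0; lra).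
have E2 : (Im w / (Cmod w + Re w))%R = tan (t / 2).
{ rewrite ER, EI. replace t with (2 * (t / 2))%R at 1 2 by field. rewrite sin_2a, cos_2a. unfold tan. have S := sin2_cos2 (t / 2).
 unfold Rsqr in S.
 replace (Cmod w + Cmod w * (cos (t / 2) * cos (t / 2) - sin (t / 2) * sin (t / 2)))%R with (Cmod w * (2 * (cos (t / 2) * cos (t / 2))))%R
  by nra. field. lra. } rewrite E2, atan_tan by lra. field.
Qed.

Lemma slit_open w : slit w -> exists d, 0 < d /\ forall y, disc w d y -> slit y.
Proof.
intros H. have Hp := slit_pos w H. exists ((Cmod w + Re w) / 2)%R. split; [lra|]. intros y Hy [H1 H2]. unfold disc in Hy.
have H3 : Cmod y = (- Re y)%R. { have H4 := Cmod2_alt y. have H5 := Cmod_ge_0 y. go. } have H4 := Cmod_tri_inv w y.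
rewrite Cmod_symm in H4. have H5 := re_le_Cmod (y - w). replace (Re (y - w)) with (Re y - Re w)%R in H5 by go. split_Rabs; lra.
Qed.

Lemma ct_clog w : slit w -> ct dC dC clog w.
Proof.
intros H. have Hp := slit_pos w H. have Hm := proj1 (Cmod_gt_0 w) (slit_nz w H). have Hcm : ct dC dR Cmod w.
{ intros eps He. take eps. intros y Hy. have T1 := Cmod_tri_inv y w. have T2 := Cmod_tri_inv w y. rewrite Cmod_symm in T2.
 apply Rle_lt_trans with (Cmod (y - w)); [|go]. apply Rabs_le. lra. } apply ct_ReIm.
- apply (ct_Rstd dC ln Cmod); [go|]. apply derivable_continuous_pt. exists (/ Cmod w)%R. now apply derivable_pt_lim_ln.
- destruct (slit_open w H) as [d [Hd Hd2]]. apply ct_ext_loc with (f := fun y => (2 * atan (Im y / (Cmod y + Re y)))%R).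
 + take d. intros y Hy. symmetry. apply arg_atan. go. + symmetry. now apply arg_atan.
 + apply (ct_Rstd dC (fun t => 2 * atan t)%R (fun y => (Im y / (Cmod y + Re y))%R)).
  * intros eps He. have Hc : ct dC dC (fun y => RtoC (Im y) / (RtoC (Cmod y) + RtoC (Re y))) w.
   { apply ct_div.
    - rewrite <- RtoC_plus. go. - apply ct_RtoC, ct_Im. go. - apply ct_plus; [now apply ct_RtoC|]. apply ct_RtoC, ct_Re. go. }
   destruct (Hc (Rmin eps 1) ltac:(apply rmin_pos; lra)) as [e [He1 He2]]. take_min e d as y Hy. specialize (He2 y (proj1 Hy)).
   apply lt_rmin in He2. unfold dC in He2. have Hpy := slit_pos y (Hd2 y (proj2 Hy)).
   rewrite <- !RtoC_plus, <- !RtoC_div, Cmod_RtoC_sub in He2 by lra. go.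
  * apply continuity_pt_mult; [apply continuity_pt_const; intros ? ?; reflexivity|]. apply derivable_continuous_pt, derivable_pt_atan.
Qed.

Lemma cder_clog w : slit w -> cder clog w (/ w).
Proof.
intros H. have Hn := slit_nz w H. have Hw := proj1 (Cmod_gt_0 w) Hn. set (a := Cmod w) in *. intros eps He.
set (e := Rmin (a / 2) (eps * a * a / 2)). have He0 : 0 < e by go. destruct (cder_Cexp (clog w) e He0) as [d1 [Hd1 H1]].
destruct (ct_clog w H d1 Hd1) as [d2 [Hd2 H2]]. destruct (slit_open w H) as [d3 [Hd3 H3]]. take_min d2 d3. intros y Hy. unfold idC in *.
apply lt_rmin in Hy. specialize (H2 y (proj1 Hy)). specialize (H1 _ H2). have Hyn := slit_nz y (H3 y (proj2 Hy)).
rewrite !Cexp_clog in H1 by go. set (k := clog y - clog w) in *. set (h := y - w) in *.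
replace (h - (k * w + Cconj k * 0)) with (h - k * w) in H1 by ring. have Hk : Cmod k * a <= Cmod h + e * Cmod k.
{ unfold a. rewrite <- Cmod_mult. replace (k * w) with (h - (h - k * w)) by ring. tri. rewrite Cmod_opp. lra. }
have e1 := Rmin_l (a / 2) (eps * a * a / 2). have e2 := Rmin_r (a / 2) (eps * a * a / 2). fold e in e1, e2. have Ph := Cmod_ge_0 h.
have Hk2 : Cmod k * (a / 2) <= Cmod h by nra. replace (k - (h * / w + Cconj h * 0)) with (- (h - k * w) / w) by go.
rewrite Cmod_div, Cmod_opp by go. apply Rmult_le_reg_r with a; [go|]. unfold Rdiv. rewrite Rmult_assoc, Rinv_l, Rmult_1_r by lra. go.
Qed.

Lemma ana_clog f z : slit (f z) -> ana f z -> ana (fun w => clog (f w)) z.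
Proof.
intros Hs H. apply (ana_comp clog f); [go|]. destruct (slit_open _ Hs) as [d [Hd Hd2]]. apply (ana_intro _ (fun w => / w) (f z) d Hd).
intros y Hy. have Hsy := Hd2 y Hy. split.
- now apply cder_clog. - apply ct_inv; [now apply slit_nz|]. go.
Qed.

Lemma cpow_clog w s : cpow w s = Cexp (s * clog w).
Proof. go. Qed.

Lemma clog_scale (t : R) (w : C) : 0 < t -> w <> 0 -> clog (t * w) = ln t + clog w.
Proof.
intros Ht Hw. have Hm := proj1 (Cmod_gt_0 w) Hw.
have E1 : Cmod (t * w) = (t * Cmod w)%R by (rewrite Cmod_mult, Cmod_R, Rabs_pos_eq by lra; reflexivity). have E2 : arg (t * w) = arg w.
{ unfold arg. rewrite E1. replace (Re (t * w)) with (t * Re w)%R by (unfold Re, RtoC; simpl; ring).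
 replace (Im (t * w)) with (t * Im w)%R by (unfold Im, RtoC; simpl; ring).
 replace (t * Re w / (t * Cmod w))%R with (Re w / Cmod w)%R by (field; lra).
 destruct (Rle_dec 0 (t * Im w)) as [H|H], (Rle_dec 0 (Im w)) as [H'|H']; trivial; exfalso; nra. } unfold clog.
rewrite E1, E2, ln_mult by go. go.
Qed.

Lemma clog_R (t : R) : 0 < t -> clog t = RtoC (ln t).
Proof.
intros Ht. unfold clog, arg. rewrite Cmod_R, Rabs_pos_eq by lra. unfold Im, Re. cbn [fst snd RtoC]. destruct (Rle_dec 0 0) as [H|H]; [|lra].
replace (t / t)%R with 1%R by (field; lra). now rewrite acos_1.
Qed.

(** * Unconditional sums *)

Definition eqd {A : Type} (x y : A) : {x = y} + {x <> y} := classical (x = y).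

Fixpoint lsum {A} (f : A -> C) (L : list A) : C :=
  match L with nil => 0 | a :: K => f a + lsum f K end.
Fixpoint rsum {A} (f : A -> R) (L : list A) : R :=
  match L with nil => 0%R | a :: K => (f a + rsum f K)%R end.

(** Convergence along the net of finite sets. It is invariant under reindexing by construction, and one notion serves
    for sums over N, Z and pairs. *)
Definition is_sum {A} (f : A -> C) (s : C) : Prop := forall eps, 0 < eps ->
  exists L0, forall L, NoDup L -> incl L0 L -> Cmod (lsum f L - s) <= eps.

(** Summability of a majorant: all estimates of series go through one [M] with bounded finite sums. *)
Definition bnd {A} (M : A -> R) : Prop :=
  (forall a, 0 <= M a) /\ exists B, forall L, NoDup L -> rsum M L <= B.

Definition tailset {A} (M : A -> R) (L0 : list A) (eps : R) : Prop :=
  NoDup L0 /\ forall L, NoDup L -> (forall a, In a L -> ~ In a L0) -> rsum M L <= eps.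

Definition SUM {A} (f : A -> C) : C := epsilon (inhabits (RtoC 0)) (is_sum f).

Lemma lsum_app {A} (f : A -> C) L K : lsum f (L ++ K) = lsum f L + lsum f K.
Proof. induction L as [|a L IH]; simpl; [ring|]. rewrite IH. ring. Qed.
Lemma rsum_app {A} (f : A -> R) L K : rsum f (L ++ K) = (rsum f L + rsum f K)%R.
Proof. induction L as [|a L IH]; simpl; [ring|]. go. Qed.
Lemma lsum_perm {A} (f : A -> C) L K : Permutation L K -> lsum f L = lsum f K.
Proof. induction 1; simpl; try ring; try (rewrite IHPermutation; ring). congruence. Qed.
Lemma rsum_perm {A} (f : A -> R) L K : Permutation L K -> rsum f L = rsum f K.
Proof. induction 1; simpl; try ring; try (rewrite IHPermutation; ring). go. Qed.
Lemma lsum_ext {A} (f g : A -> C) L : (forall a, In a L -> f a = g a) -> lsum f L = lsum g L.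
Proof. induction L as [|a L IH]; simpl; [go|]. intros H. rewrite H, IH by auto. go. Qed.
Lemma lsum_plus {A} (f g : A -> C) L : lsum (fun a => f a + g a) L = lsum f L + lsum g L.
Proof. induction L as [|a L IH]; simpl; [ring|]. rewrite IH. ring. Qed.
Lemma lsum_scal {A} c (f : A -> C) L : lsum (fun a => c * f a) L = c * lsum f L.
Proof. induction L as [|a L IH]; simpl; [ring|]. rewrite IH. ring. Qed.
Lemma lsum_minus {A} (f g : A -> C) L : lsum (fun a => f a - g a) L = lsum f L - lsum g L.
Proof. induction L as [|a L IH]; simpl; [ring|]. rewrite IH. ring. Qed.
Lemma lsum_map {A B} (f : B -> C) (h : A -> B) L : lsum f (map h L) = lsum (fun a => f (h a)) L.
Proof. induction L as [|a L IH]; simpl; [go|]. now rewrite IH. Qed.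
Lemma rsum_map {A B} (f : B -> R) (h : A -> B) L : rsum f (map h L) = rsum (fun a => f (h a)) L.
Proof. induction L as [|a L IH]; simpl; [reflexivity|]. go. Qed.
Lemma lsum_zero {A} (f : A -> C) L : (forall a, In a L -> f a = 0) -> lsum f L = 0.
Proof. induction L as [|a L IH]; simpl; intros H; [go|]. rewrite H, IH by auto. ring. Qed.
Lemma lsum_bound {A} (f : A -> C) (M : A -> R) L : (forall a, In a L -> Cmod (f a) <= M a) ->
  Cmod (lsum f L) <= rsum M L.
Proof. induction L as [|a L IH]; simpl; intros H; [rewrite Cmod_0; lra|]. tri. apply Rplus_le_compat; auto. Qed.
Lemma rsum_le {A} (f g : A -> R) L : (forall a, In a L -> f a <= g a) -> rsum f L <= rsum g L.
Proof. induction L as [|a L IH]; simpl; intros H; [lra|]. apply Rplus_le_compat; auto. Qed.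
Lemma rsum_pos {A} (f : A -> R) L : (forall a, 0 <= f a) -> 0 <= rsum f L.
Proof. intros H. induction L as [|a L IH]; simpl; [lra|]. specialize (H a). lra. Qed.
Lemma rsum_scal {A} c (f : A -> R) L : rsum (fun a => c * f a)%R L = (c * rsum f L)%R.
Proof. induction L as [|a L IH]; simpl; [ring|]. go. Qed.

Definition diffl {A} (L L0 : list A) : list A :=
  filter (fun a => if in_dec eqd a L0 then false else true) L.

Lemma in_diffl {A} (L L0 : list A) a : In a (diffl L L0) <-> In a L /\ ~ In a L0.
Proof. unfold diffl. rewrite filter_In. destruct (in_dec eqd a L0); intuition discriminate. Qed.
Lemma NoDup_app_disj {A} (L K : list A) : NoDup L -> NoDup K -> (forall a, In a K -> ~ In a L) -> NoDup (L ++ K).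
Proof. intros H1 H2 H3. apply NoDup_app; trivial. intros a Ha Hb. now apply (H3 a). Qed.

Lemma perm_split {A} (L L0 : list A) : NoDup L -> NoDup L0 -> incl L0 L ->
  Permutation L (L0 ++ diffl L L0) /\ NoDup (diffl L L0).
Proof.
intros H1 H2 H3. have H4 : NoDup (diffl L L0) by now apply NoDup_filter. split; [|go]. apply NoDup_Permutation; [go| |].
- apply NoDup_app_disj; trivial. intros a Ha. now apply in_diffl in Ha.
- intros a. rewrite in_app_iff, in_diffl. destruct (in_dec eqd a L0) as [i|i]; split; intuition.
Qed.

Lemma rsum_incl {A} (M : A -> R) (L K : list A) : (forall a, 0 <= M a) -> NoDup L -> NoDup K -> incl L K ->
  rsum M L <= rsum M K.
Proof.
intros HM HL HK Hi. destruct (perm_split K L HK HL Hi) as [P _]. rewrite (rsum_perm M _ _ P), rsum_app. have H := rsum_pos M (diffl K L) HM.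
lra.
Qed.

Lemma nodup_union {A} (L K : list A) : exists U, NoDup U /\ incl L U /\ incl K U.
Proof. exists (nodup eqd (L ++ K)). split; [apply NoDup_nodup|]. split; intros a Ha; apply nodup_In, in_app_iff; tauto. Qed.

Lemma tail_ex {A} (M : A -> R) : bnd M -> forall eps, 0 < eps -> exists L0, tailset M L0 eps.
Proof.
intros [H0 [B HB]] eps He. set (E := fun x => exists L, NoDup L /\ x = rsum M L). destruct (completeness E) as [S [HS1 HS2]].
{ exists B. intros x [L [HL Ex]]. subst. go. } { exists 0%R, nil. split; [constructor|go]. }
have Hex : exists L0, NoDup L0 /\ S - eps < rsum M L0.
{ apply NNPP. intros Hn. have HS3 : S <= S - eps; [|lra]. apply HS2. intros x [L [HL Ex]]. apply Rnot_lt_le. intros Hlt. apply Hn. exists L.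
 split; [go|lra]. } destruct Hex as [L0 [HL0 Hs]]. take L0. intros L HL Hd. have H1 := HS1 (rsum M (L0 ++ L)). rewrite rsum_app in H1.
have H2 : E (rsum M L0 + rsum M L)%R. { exists (L0 ++ L). split; [now apply NoDup_app_disj|now rewrite rsum_app]. } specialize (H1 H2). lra.
Qed.

Lemma tail_diff {A} (f : A -> C) M L0 eps L : (forall a, Cmod (f a) <= M a) -> tailset M L0 eps ->
  NoDup L -> incl L0 L -> Cmod (lsum f L - lsum f L0) <= eps.
Proof.
intros Hf [HL0 Ht] HL Hi. destruct (perm_split L L0 HL HL0 Hi) as [P Nd]. rewrite (lsum_perm f _ _ P), lsum_app.
replace (_ - _) with (lsum f (diffl L L0)) by ring. eapply Rle_trans; [apply (lsum_bound f M); auto|]. apply Ht; trivial. intros a Ha.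
now apply in_diffl in Ha.
Qed.

Lemma is_sum_unique {A} (f : A -> C) s s' : is_sum f s -> is_sum f s' -> s = s'.
Proof.
intros H H'. have E : s - s' = 0.
{ apply Cmod_eq_small. intros eps He. destruct (H (eps / 2)%R ltac:(lra)) as [L1 H1]. destruct (H' (eps / 2)%R ltac:(lra)) as [L2 H2].
 destruct (nodup_union L1 L2) as [U [HU [I1 I2]]]. specialize (H1 U HU I1). specialize (H2 U HU I2). have T2 := Cmod_tri3 s (lsum f U) s'.
 rewrite (Cmod_symm s (lsum f U)) in T2. lra. } replace s with (s - s' + s') by ring. rewrite E. ring.
Qed.

Lemma is_sum_ex {A} (f : A -> C) M : bnd M -> (forall a, Cmod (f a) <= M a) -> exists s, is_sum f s.
Proof.
intros HM Hf. have Hch : forall n : nat, { L | tailset M L ((/ 2) ^ n)%R }.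
{ intros n. apply constructive_indefinite_description. apply tail_ex; [go|apply half_pow_pos]. } set (Ls := fun n => proj1_sig (Hch n)).
have HLs : forall n, tailset M (Ls n) ((/ 2) ^ n)%R by (intros n; exact (proj2_sig (Hch n))).
have Hdec : forall n m, (/ 2) ^ (n + m) <= (/ 2) ^ n.
{ intros n m. rewrite pow_add. have P := half_pow_pos n. have H : (/ 2) ^ m <= 1. { rewrite <- (pow1 m). apply pow_incr. lra. } nra. }
destruct (complex_limit (fun n => lsum f (Ls n)) (fun n => 2 * (/ 2) ^ n)%R) as [s Hs].
- intros n m. destruct (nodup_union (Ls n) (Ls (n + m)%nat)) as [U [HU [I1 I2]]]. have D1 := tail_diff f M _ _ U Hf (HLs n) HU I1.
 have D2 := tail_diff f M _ _ U Hf (HLs (n + m)%nat) HU I2. have T := Cmod_tri3 (lsum f (Ls (n + m)%nat)) (lsum f U) (lsum f (Ls n)).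
 rewrite (Cmod_symm (lsum f (Ls (n + m)%nat)) (lsum f U)) in T. specialize (Hdec n m). lra.
- intros eps He. now apply geom_small.
- exists s. intros eps He. destruct (geom_small 5 eps He) as [n Hn]. exists (Ls n). intros L HL Hi.
 have D := tail_diff f M _ _ L Hf (HLs n) HL Hi. specialize (Hs n). have T := Cmod_tri3 (lsum f L) (lsum f (Ls n)) s. lra.
Qed.

Lemma is_sum_tail {A} (f : A -> C) M s L0 eps : (forall a, Cmod (f a) <= M a) -> is_sum f s ->
  tailset M L0 eps -> forall L, NoDup L -> incl L0 L -> Cmod (lsum f L - s) <= eps.
Proof.
intros Hf Hs Ht L HL Hi. apply le_all_eps. intros e He. destruct (Hs e He) as [L1 H1]. destruct (nodup_union L L1) as [U [HU [I1 I2]]].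
specialize (H1 U HU I2). destruct (perm_split U L HU HL I1) as [P Nd]. have D : Cmod (lsum f U - lsum f L) <= eps.
{ rewrite (lsum_perm f _ _ P), lsum_app. replace (_ - _) with (lsum f (diffl U L)) by ring.
 eapply Rle_trans; [apply (lsum_bound f M); auto|]. apply Ht; trivial. intros a Ha Hb. apply in_diffl in Ha. apply Ha. go. }
have T := Cmod_tri3 (lsum f L) (lsum f U) s. rewrite (Cmod_symm (lsum f L) (lsum f U)) in T. lra.
Qed.

Lemma SUM_spec {A} (f : A -> C) M : bnd M -> (forall a, Cmod (f a) <= M a) -> is_sum f (SUM f).
Proof. intros HM Hf. apply (epsilon_spec (inhabits (RtoC 0)) (is_sum f)). now apply (is_sum_ex f M). Qed.
Lemma SUM_eq {A} (f : A -> C) s : is_sum f s -> SUM f = s.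
Proof. intros H. apply (is_sum_unique f); [|go]. apply (epsilon_spec (inhabits (RtoC 0)) (is_sum f)). now exists s. Qed.
Lemma is_sum_ext {A} (f g : A -> C) s : (forall a, f a = g a) -> is_sum f s -> is_sum g s.
Proof. intros E H eps He. destruct (H eps He) as [L0 H0]. exists L0. intros L HL Hi. rewrite <- (lsum_ext f g) by auto. go. Qed.

Lemma is_sum_plus {A} (f g : A -> C) s s' : is_sum f s -> is_sum g s' -> is_sum (fun a => f a + g a) (s + s').
Proof.
intros H H' eps He. destruct (H (eps / 2)%R ltac:(lra)) as [L1 H1]. destruct (H' (eps / 2)%R ltac:(lra)) as [L2 H2]. exists (L1 ++ L2).
intros L HL Hi. destruct (incl_app_inv _ _ Hi) as [I1 I2]. specialize (H1 L HL I1). specialize (H2 L HL I2). rewrite lsum_plus.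
replace (_ - _) with ((lsum f L - s) + (lsum g L - s')) by ring. tri. lra.
Qed.

Lemma is_sum_scal {A} c (f : A -> C) s : is_sum f s -> is_sum (fun a => c * f a) (c * s).
Proof.
intros H eps He. have Hc := Cmod_ge_0 c. destruct (H (eps / (Cmod c + 1))%R) as [L0 H0]; [go|]. exists L0. intros L HL Hi.
specialize (H0 L HL Hi). rewrite lsum_scal. replace (c * lsum f L - c * s) with (c * (lsum f L - s)) by ring. rewrite Cmod_mult.
apply Rle_trans with ((Cmod c + 1) * (eps / (Cmod c + 1)))%R; [|right; field; lra]. apply Rmult_le_compat; try lra; apply Cmod_ge_0.
Qed.

Lemma is_sum_minus {A} (f g : A -> C) s s' : is_sum f s -> is_sum g s' -> is_sum (fun a => f a - g a) (s - s').
Proof.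
intros H H'. apply is_sum_ext with (f := fun a => f a + - (1) * g a); [go|]. replace (s - s') with (s + - (1) * s') by ring.
apply is_sum_plus; [go|now apply is_sum_scal].
Qed.

Lemma is_sum_0 {A} (f : A -> C) : (forall a, f a = 0) -> is_sum f 0.
Proof. intros H eps He. exists nil. intros L _ _. rewrite lsum_zero by auto. vanish (0 - 0). rewrite Cmod_0. lra. Qed.

Lemma is_sum_finite {A} (f : A -> C) L0 : NoDup L0 -> (forall a, ~ In a L0 -> f a = 0) -> is_sum f (lsum f L0).
Proof.
intros HL0 H eps He. exists L0. intros L HL Hi. destruct (perm_split L L0 HL HL0 Hi) as [P Nd].
rewrite (lsum_perm f _ _ P), lsum_app, (lsum_zero f (diffl L L0)).
- vanish (lsum f L0 + 0 - lsum f L0). rewrite Cmod_0. lra. - intros a Ha. apply H. now apply in_diffl in Ha.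
Qed.

Lemma is_sum_reindex {A B} (f : B -> C) (h : A -> B) (k : B -> A) s :
  (forall a, k (h a) = a) -> (forall b, h (k b) = b) -> is_sum f s -> is_sum (fun a => f (h a)) s.
Proof.
intros H1 H2 Hs eps He. destruct (Hs eps He) as [L0 H0]. exists (map k L0). intros L HL Hi. rewrite <- lsum_map. apply H0.
- apply FinFun.Injective_map_NoDup; [|go]. intros a b E. rewrite <- (H1 a), <- (H1 b). now rewrite E.
- intros b Hb. rewrite <- (H2 b). apply in_map, Hi. now apply in_map.
Qed.

Lemma is_sum_inj {A B} (f : A -> C) (h : B -> A) (k : A -> B) s :
  (forall b, k (h b) = b) -> (forall a, h (k a) = a \/ f a = 0) ->
  is_sum (fun b => f (h b)) s -> is_sum f s.
Proof.
intros H1 H2 Hs eps He. destruct (Hs eps He) as [L0 H0]. exists (map h L0). intros L HL Hi.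
set (L1 := filter (fun a => if eqd (h (k a)) a then true else false) L). have Hin : forall a, In a L1 <-> In a L /\ h (k a) = a.
{ intros a. unfold L1. rewrite filter_In. destruct (eqd (h (k a)) a); intuition discriminate. }
have N1 : NoDup L1 by now apply NoDup_filter. have E : lsum f L = lsum f L1.
{ have I : incl L1 L by (intros a Ha; now apply Hin in Ha). destruct (perm_split L L1 HL N1 I) as [P Nd].
 rewrite (lsum_perm f _ _ P), lsum_app. rewrite (lsum_zero f (diffl L L1)); [ring|]. intros a Ha. apply in_diffl in Ha.
 destruct (H2 a) as [Hx|Hx]; [|go]. exfalso. apply (proj2 Ha). apply Hin. tauto. } have E2 : map h (map k L1) = L1.
{ rewrite map_map. rewrite <- (map_id L1) at 2. apply map_ext_in. intros a Ha. now apply Hin in Ha. } rewrite E, <- E2, lsum_map. apply H0.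
- apply (NoDup_map_inv h). now rewrite E2.
- intros b Hb. rewrite <- (H1 b). apply in_map. apply Hin. split; [apply Hi; now apply in_map|now rewrite H1].
Qed.

Lemma tail_zero_bound {A} (h : A -> C) M L0 eps s : (forall a, Cmod (h a) <= M a) -> tailset M L0 eps ->
  (forall a, In a L0 -> h a = 0) -> is_sum h s -> Cmod s <= eps.
Proof.
intros Hh Ht H0 Hs. have D := is_sum_tail h M s L0 eps Hh Hs Ht L0 (proj1 Ht) (incl_refl _). rewrite lsum_zero in D by go.
replace (0 - s) with (- s) in D by ring. now rewrite Cmod_opp in D.
Qed.

(** Summation by packets: the fibres of [p] are summed first. *)
Lemma is_sum_fiber {A B} (p : A -> B) (f : A -> C) M (g : B -> C) s :
  bnd M -> (forall a, Cmod (f a) <= M a) -> is_sum f s ->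
  (forall b, is_sum (fun a => if eqd (p a) b then f a else 0) (g b)) -> is_sum g s.
Proof.
intros HM Hf Hs Hg eps He. destruct (tail_ex M HM eps He) as [L0 Ht]. exists (map p L0). intros K HK Hi.
set (F := fun a => if in_dec eqd (p a) K then f a else 0). have HF : is_sum F (lsum g K).
{ unfold F. clear Hi. induction K as [|b K IH].
 - apply is_sum_0. go.
 - inversion HK as [|? ? Hnb HK']; subst. specialize (IH HK'). apply is_sum_ext with (2 := is_sum_plus _ _ _ _ (Hg b) IH). intros a.
  destruct (eqd (p a) b) as [e|e].
  + destruct (in_dec eqd (p a) K) as [i|i]; [exfalso; apply Hnb; now rewrite <- e|]. destruct (in_dec eqd (p a) (b :: K)) as [j|j]; [ring|].
   exfalso. apply j. left. go.
  + destruct (in_dec eqd (p a) K) as [i|i]; destruct (in_dec eqd (p a) (b :: K)) as [j|j]; try ring.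
   * exfalso. apply j. now right. * exfalso. destruct j as [j|j]; [go|go]. } apply (tail_zero_bound (fun a => F a - f a) M L0 eps); trivial.
- intros a. unfold F. destruct (in_dec eqd (p a) K).
 + vanish (f a - f a). rewrite Cmod_0. apply HM. + replace (0 - f a) with (- f a) by ring. now rewrite Cmod_opp.
- intros a Ha. unfold F. destruct (in_dec eqd (p a) K) as [i|i]; [ring|]. exfalso. apply i, Hi. now apply in_map. - now apply is_sum_minus.
Qed.

Lemma is_sum_fubini {A B} (f : A * B -> C) M (g : A -> C) s :
  bnd M -> (forall a, Cmod (f a) <= M a) -> is_sum f s ->
  (forall a, is_sum (fun b => f (a, b)) (g a)) -> is_sum g s.
Proof.
intros HM Hf Hs Hg. apply (is_sum_fiber fst f M g s HM Hf Hs). intros a. apply (is_sum_inj _ (fun b => (a, b)) snd).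
- go. - intros [a' b]. simpl. destruct (eqd a' a) as [e|e]; [left; now subst|go].
- apply is_sum_ext with (2 := Hg a). intros b. simpl. destruct (eqd a a) as [e|e]; [go|go].
Qed.

(** ** Majorants *)

Lemma bnd_le {A} (M M' : A -> R) c : bnd M -> (forall a, 0 <= M' a <= c * M a) -> bnd M'.
Proof.
intros [H0 [B HB]] H. split; [apply H|]. exists (Rabs c * B)%R. intros L HL. apply Rle_trans with (rsum (fun a => Rabs c * M a)%R L).
- apply rsum_le. intros a _. destruct (H a) as [_ H1]. specialize (H0 a). have H2 := Rle_abs c. go.
- rewrite rsum_scal. apply Rmult_le_compat_l; [go|auto].
Qed.

Lemma bnd_plus {A} (M M' : A -> R) : bnd M -> bnd M' -> bnd (fun a => M a + M' a)%R.
Proof.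
intros [H0 [B HB]] [H0' [B' HB']]. split.
- intros a. specialize (H0 a). specialize (H0' a). lra.
- exists (B + B')%R. intros L HL. specialize (HB L HL). specialize (HB' L HL).
 have E : rsum (fun a => M a + M' a)%R L = (rsum M L + rsum M' L)%R. { clear. induction L as [|a L IH]; simpl; [ring|]. go. } lra.
Qed.

Lemma bnd_scal {A} (M : A -> R) c : 0 <= c -> bnd M -> bnd (fun a => c * M a)%R.
Proof. intros Hc HM. apply (bnd_le M _ c HM). intros a. destruct HM as [H0 _]. specialize (H0 a). go. Qed.
Lemma bnd_inj {A B} (M : A -> R) (h : B -> A) : (forall x y, h x = h y -> x = y) -> bnd M -> bnd (fun b => M (h b)).
Proof. intros Hi [H0 [K HK]]. split; [go|]. exists K. intros L HL. rewrite <- rsum_map. apply HK. now apply FinFun.Injective_map_NoDup. Qed.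

Lemma bnd_nat (M : nat -> R) B : (forall n, 0 <= M n) -> (forall n, rsum M (seq 0 n) <= B) -> bnd M.
Proof.
intros H0 HB. split; [assumption|]. exists B. intros L HL. apply Rle_trans with (rsum M (seq 0 (S (list_max L)))); [|go].
apply rsum_incl; trivial; [apply seq_NoDup|]. intros a Ha. apply in_seq. have H := proj1 (list_max_le L (list_max L)) (Nat.le_refl _).
rewrite Forall_forall in H. specialize (H a Ha). lia.
Qed.

Lemma rsum_seq_S (M : nat -> R) n : rsum M (seq 0 (S n)) = (rsum M (seq 0 n) + M n)%R.
Proof. rewrite seq_S, rsum_app. simpl. ring. Qed.

Lemma bnd_geom x : 0 <= x < 1 -> bnd (fun n => x ^ n)%R.
Proof.
intros Hx. apply (bnd_nat _ (/ (1 - x))).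
- go.
- intros n. have H : rsum (fun n => x ^ n)%R (seq 0 n) <= / (1 - x) * (1 - x ^ n).
 { induction n as [|n IH]; [simpl; lra|]. rewrite rsum_seq_S.
  have E : (/ (1 - x) * (1 - x ^ n) + x ^ n = / (1 - x) * (1 - x ^ S n))%R by (simpl; field; lra). lra. } have P := pow_le x n (proj1 Hx).
 assert (0 < / (1 - x)) by go. nra.
Qed.

Lemma bnd_geom_poly x : 0 <= x < 1 -> bnd (fun n => INR (S n) ^ 3 * x ^ n)%R.
Proof.
intros Hx.
(* with s = (1+x)/2 the factor (n+1)^3 (x/s)^n is bounded *)
destruct (Req_dec x 0) as [E|E].
- apply (bnd_nat _ 1).
 + go.
 + intros n. have H : rsum (fun n => INR (S n) ^ 3 * x ^ n)%R (seq 0 n) <= if Nat.eqb n 0 then 0 else 1.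
  { induction n as [|n IH]; [simpl; lra|]. rewrite rsum_seq_S. subst x. destruct n.
   - simpl. lra. - replace (0 ^ S n)%R with 0%R by (simpl; ring). simpl Nat.eqb in *. go. } destruct (Nat.eqb n 0); lra.
- set (d := ((1 - x) / 4)%R). have Hd : 0 < d by go. set (s := (1 + d)%R). have Hs : forall n, INR n * d <= s ^ n.
 { intros n. have H := poly n d Hd. unfold s. lra. } have Hs1 : 1 <= s by (unfold s; lra). have Hsx : s ^ 3 * x < 1.
 { unfold s, d. set (t := (1 - x)%R). replace x with (1 - t)%R by (unfold t; ring). assert (0 < t < 1) by (unfold t; lra). go. }
 apply (bnd_le (fun n => (s ^ 3 * x) ^ n)%R _ (s ^ 3 / d ^ 3)%R).
 + apply bnd_geom. split; [|go]. go.
 + intros n. split.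
  * go.
  * have P := pos_INR (S n). have H2 : (INR (S n) * d) ^ 3 <= (s ^ S n) ^ 3 by (apply pow_incr; split; [nra|go]).
   replace (s ^ 3 / d ^ 3 * (s ^ 3 * x) ^ n)%R with ((s ^ S n) ^ 3 / d ^ 3 * x ^ n)%R.
   2:{ rewrite Rpow_mult_distr, <- !pow_mult. replace (S n * 3)%nat with (3 + 3 * n)%nat by lia. rewrite pow_add. go. }
   apply Rmult_le_compat_r; [go|]. apply Rmult_le_reg_r with (d ^ 3)%R; [go|].
   replace ((s ^ S n) ^ 3 / d ^ 3 * d ^ 3)%R with ((s ^ S n) ^ 3)%R by (field; lra). lra.
Qed.

Lemma bnd_quad : bnd (fun n => / (1 + INR n * INR n))%R.
Proof.
apply (bnd_nat _ 4).
- intros n. left. apply Rinv_0_lt_compat. go.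
- intros n. have H : rsum (fun n => / (1 + INR n * INR n))%R (seq 0 n) <= 4 * (1 - / (INR n + 1)).
 { induction n as [|n IH].
  - simpl. lra.
  - rewrite rsum_seq_S, S_INR. have P := pos_INR n. have E : / (1 + INR n * INR n) <= 4 * (/ (INR n + 1) - / (INR n + 1 + 1)).
   { replace (4 * (/ (INR n + 1) - / (INR n + 1 + 1)))%R with (/ ((INR n + 1) * (INR n + 2) / 4))%R by (field; lra).
    apply Rinv_le_contravar; nra. } lra. } have P := pos_INR n. assert (0 < / (INR n + 1)) by go. lra.
Qed.

Lemma bnd_Z (M : nat -> R) : bnd M -> bnd (fun n : Z => M (Z.abs_nat n)).
Proof.
intros [H0 [B HB]]. split; [go|]. exists (B + B)%R. intros L HL. set (P := filter (Z.leb 0) L).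
set (Q := filter (fun n => negb (Z.leb 0 n)) L). have E : Permutation L (P ++ Q).
{ apply NoDup_Permutation; [go| |].
 - apply NoDup_app_disj; try now apply NoDup_filter. intros a Ha Hb. apply filter_In in Ha. apply filter_In in Hb. go.
 - intros a. rewrite in_app_iff. unfold P, Q. rewrite !filter_In. destruct (Z.leb 0 a); simpl; intuition discriminate. }
rewrite (rsum_perm _ _ _ E), rsum_app.
have Hm : forall K, NoDup K -> (forall a b, In a K -> In b K -> Z.abs_nat a = Z.abs_nat b -> a = b) -> rsum (fun n : Z => M (Z.abs_nat n))
 K <= B.
{ intros K HK Hinj. rewrite <- (rsum_map M Z.abs_nat). apply HB. induction K as [|a K IH]; simpl; [constructor|]. inversion HK; subst.
 constructor.
 - intros Hi. apply in_map_iff in Hi as [b [Eb Hb]]. assert (b = a) by (apply Hinj; [now right|now left|go]). congruence.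
 - apply IH; [go|]. intros x y Hx Hy. apply Hinj; now right. } apply Rplus_le_compat; apply Hm; try now apply NoDup_filter.
- intros a b Ha Hb. apply filter_In in Ha. apply filter_In in Hb. go. - intros a b Ha Hb. apply filter_In in Ha. apply filter_In in Hb. go.
Qed.

Definition qz (n : Z) : R := (/ (1 + IZR n * IZR n))%R.

Lemma qz_pos n : 0 < qz n.
Proof. apply Rinv_0_lt_compat. go. Qed.
Ltac pos_more ::= first [apply qz_pos | apply half_pow_pos].

Lemma bnd_qz : bnd qz.
Proof.
apply (bnd_le _ qz 1 (bnd_Z _ bnd_quad)). intros n. split; [left; apply qz_pos|]. unfold qz. rewrite Rmult_1_l. right. do 2 f_equal.
rewrite INR_IZR_INZ, Zabs2Nat.id_abs, <- !mult_IZR. f_equal. lia.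
Qed.

Lemma bnd_prod {A B} (M : A -> R) (M' : B -> R) : bnd M -> bnd M' -> bnd (fun p => M (fst p) * M' (snd p))%R.
Proof.
intros [H0 [K HK]] [H0' [K' HK']]. split. { intros p. apply Rmult_le_pos; auto. } exists (K * K')%R. intros L HL.
set (L1 := nodup eqd (map fst L)). set (L2 := nodup eqd (map snd L)). have N1 : NoDup L1 by apply NoDup_nodup.
have N2 : NoDup L2 by apply NoDup_nodup.
have Hprod : forall U V, rsum (fun p => M (fst p) * M' (snd p))%R (list_prod U V) = (rsum M U * rsum M' V)%R.
{ intros U V. induction U as [|u U IH]; simpl; [ring|]. rewrite rsum_app, IH, rsum_map. simpl. rewrite rsum_scal. ring. }
have Hnd : forall (U : list A) (V : list B), NoDup U -> NoDup V -> NoDup (list_prod U V).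
{ intros U V HU HV. induction U as [|u U IH]; simpl; [constructor|]. inversion HU; subst. apply NoDup_app_disj.
 - apply FinFun.Injective_map_NoDup; [|go]. intros x y E. congruence. - go.
 - intros [a b] Ha Hb. apply in_prod_iff in Ha. apply in_map_iff in Hb as [y [Ey _]]. inversion Ey; subst. tauto. }
apply Rle_trans with (rsum (fun p => M (fst p) * M' (snd p))%R (list_prod L1 L2)).
- apply rsum_incl; trivial.
 + intros p. apply Rmult_le_pos; auto. + go.
 + intros [a b] Hp. apply in_prod_iff. split; apply nodup_In; [now apply (in_map fst L (a, b))|now apply (in_map snd L (a, b))].
- rewrite Hprod. apply Rmult_le_compat; auto; now apply rsum_pos.
Qed.

(** ** Sums of functions *)

Lemma ct_SUM {A X} (dX : X -> X -> R) (f : A -> X -> C) (F : X -> C) M x : dX x x = 0%R -> bnd M ->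
  (exists del, 0 < del /\ forall y, dX x y < del -> is_sum (fun a => f a y) (F y) /\
     forall a, Cmod (f a y) <= M a) ->
  (forall a, ct dX dC (f a) x) -> ct dX dC F x.
Proof.
intros Hx HM [d [Hd H]] Hc. apply ct_approx. intros eps He. destruct (tail_ex M HM eps He) as [L0 Ht].
exists (fun y => lsum (fun a => f a y) L0). split.
- clear Ht. induction L0 as [|a L IH]; simpl; [go|]. now apply ct_plus.
- have Hy : forall y, dX x y < d -> Cmod (F y - lsum (fun a => f a y) L0) <= eps.
 { intros y Hy. rewrite Cmod_symm. destruct (H y Hy) as [H1 H2].
  apply (is_sum_tail (fun a => f a y) M (F y) L0 eps H2 H1 Ht L0 (proj1 Ht) (incl_refl _)). } take d. split; [apply Hy; lra|go].
Qed.

Lemma ana_lsum {A} (f : A -> C -> C) L z : (forall a, In a L -> ana (f a) z) -> ana (fun w => lsum (fun a => f a w) L) z.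
Proof. induction L as [|a L IH]; simpl; intros H; [go|]. apply ana_plus; auto. Qed.

Lemma ana_SUM {A} (f : A -> C -> C) (F : C -> C) M z0 r : 0 < r -> bnd M ->
  (forall a z, disc z0 r z -> ana (f a) z /\ Cmod (f a z) <= M a) ->
  (forall z, disc z0 r z -> is_sum (fun a => f a z) (F z)) -> ana F z0.
Proof.
intros Hr HM Hf HF. apply (hol_approx F z0 r Hr). intros eps He. destruct (tail_ex M HM eps He) as [L0 Ht].
exists (fun y => lsum (fun a => f a y) L0). split.
- intros z Hz. apply ana_lsum. intros a _. now apply Hf.
- intros z Hz. rewrite Cmod_symm. apply (is_sum_tail (fun a => f a z) M (F z) L0 eps); auto; [intros a; now apply Hf|apply Ht|go].
Qed.

Lemma dd_minus f g z : ana f z -> ana g z -> dd (fun w => f w - g w) z = dd f z - dd g z.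
Proof. intros Hf Hg. apply cder_dd. wd_by (apply wd_minus; [apply ana_dd, Hf|apply ana_dd, Hg]); ring. Qed.

Lemma dd_lsum {A} (f : A -> C -> C) L z : (forall a, In a L -> ana (f a) z) ->
  dd (fun w => lsum (fun a => f a w) L) z = lsum (fun a => dd (f a) z) L.
Proof.
intros H. apply cder_dd. induction L as [|a L IH]; simpl; [go|].
wd_by (apply wd_plus; [apply ana_dd, H; now left|apply IH; intros; apply H; now right]); ring.
Qed.

Lemma dd_SUM {A} (f : A -> C -> C) (F : C -> C) M z0 r : 0 < r -> bnd M ->
  (forall a z, disc z0 r z -> ana (f a) z /\ Cmod (f a z) <= M a) ->
  (forall z, disc z0 r z -> is_sum (fun a => f a z) (F z)) -> is_sum (fun a => dd (f a) z0) (dd F z0).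
Proof.
intros Hr HM Hf HF eps He. destruct (tail_ex M HM (eps * (r / 8))%R) as [L0 Ht]; [go|]. exists L0. intros L HL Hi.
rewrite <- dd_lsum by (intros a _; apply Hf; now apply disc_center). have HFa : forall z, disc z0 r z -> ana F z.
{ intros z Hz. destruct (disc_open _ _ _ Hz) as [d [Hd Hd2]]. apply (ana_SUM f F M z d Hd HM); intros; [go|go]; now apply Hd2. }
have HLa : forall z, disc z0 r z -> ana (fun w => lsum (fun a => f a w) L) z. { intros z Hz. apply ana_lsum. intros a _. now apply Hf. }
rewrite <- dd_minus by (try apply HFa; try apply HLa; now apply disc_center). replace eps with (eps * (r / 8) * (8 / r))%R by (field; lra).
apply cauchy_est; trivial.
- intros z Hz. apply ana_minus; auto. - intros z Hz. apply (is_sum_tail (fun a => f a z) M (F z) L0); auto. intros a. now apply Hf.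
Qed.

Lemma wd_lsum {A X} (io : X -> C) (f : A -> X -> C) (a b : A -> C) L x :
  (forall i, In i L -> wd io (f i) x (a i) (b i)) ->
  wd io (fun y => lsum (fun i => f i y) L) x (lsum a L) (lsum b L).
Proof. induction L as [|i L IH]; simpl; intros H; [go|]. apply wd_plus; auto. Qed.

(** The Lipschitz bound makes the difference quotients of a tail uniformly small. *)
Lemma wd_SUM {A X} (io : X -> C) (f : A -> X -> C) (a b : A -> C) (F : X -> C) M x sa sb : bnd M ->
  (exists del, 0 < del /\ forall y, Cmod (io y - io x) < del -> is_sum (fun i => f i y) (F y) /\
     forall i, Cmod (f i y - f i x) <= M i * Cmod (io y - io x)) ->
  (forall i, wd io (f i) x (a i) (b i)) -> is_sum a sa -> is_sum b sb -> wd io F x sa sb.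
Proof.
intros HM [d [Hd H]] Hw Ha Hb eps He. destruct (tail_ex M HM (eps / 4)%R ltac:(lra)) as [L0 Ht].
destruct (Ha (eps / 4)%R ltac:(lra)) as [L1 H1]. destruct (Hb (eps / 4)%R ltac:(lra)) as [L2 H2].
destruct (nodup_union L1 L2) as [U [HU [I1 I2]]]. destruct (nodup_union U L0) as [L [HL [I3 I4]]]. specialize (H1 L HL (incl_tran I1 I3)).
specialize (H2 L HL (incl_tran I2 I3)). destruct (wd_lsum io f a b L x (fun i _ => Hw i) (eps / 4)%R ltac:(lra)) as [d1 [Hd1 Hw1]].
take_min d d1 as y Hy. specialize (Hw1 y (proj2 Hy)). destruct (H y (proj1 Hy)) as [Hs Hl].
have Hxx : Cmod (io x - io x) < d by (replace (io x - io x) with (RtoC 0) by ring; now rewrite Cmod_0). destruct (H x Hxx) as [Hsx _].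
set (h := io y - io x) in *. have Hd0 : is_sum (fun i => f i y - f i x) (F y - F x) by now apply is_sum_minus.
have T1 : Cmod (lsum (fun i => f i y - f i x)%C L - (F y - F x)) <= eps / 4 * Cmod h.
{ apply (is_sum_tail _ (fun i => M i * Cmod h)%R _ L0); auto. split; [apply Ht|]. intros K HK HK2.
 have E : rsum (fun i => M i * Cmod h)%R K = (Cmod h * rsum M K)%R. { clear. induction K as [|k K IH]; simpl; [go|]. go. }
 rewrite E, Rmult_comm. apply Rmult_le_compat_r; [go|]. now apply Ht. } rewrite lsum_minus in T1.
replace (F y - F x - (h * sa + Cconj h * sb)) with (- (lsum (fun i => f i y) L - lsum (fun i => f i x) L - (F y - F x)) + (lsum (fun i => f
 i y) L - lsum (fun i => f i x) L - (h * lsum a L + Cconj h * lsum b L)) + (h * (lsum a L - sa) + Cconj h * (lsum b L - sb))) by ring. tri.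
eapply Rle_trans; [apply Rplus_le_compat_r, Cmod_triangle|]. rewrite Cmod_opp.
have T2 := Cmod_triangle (h * (lsum a L - sa)) (Cconj h * (lsum b L - sb)). rewrite !Cmod_mult, Cmod_conj in T2. have Ph := Cmod_ge_0 h. go.
Qed.

(** * Fourier series *)

Definition ez (n : Z) (t : C) : C := ee (IZR n * t).
Definition fc (f : R -> C) (n : Z) : C := CI (fun t => f t * ez (- n) t).

Lemma ez_plus n m t : ez (n + m) t = ez n t * ez m t.
Proof. unfold ez. rewrite <- ee_plus, plus_IZR, RtoC_plus. f_equal. ring. Qed.
Lemma ez_add n s t : ez n (s + t) = ez n s * ez n t.
Proof. unfold ez. rewrite <- ee_plus. f_equal. ring. Qed.
Lemma ez_0 t : ez 0 t = 1.
Proof. unfold ez. vanish (0 * t). apply ee_0. Qed.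
Lemma ez_opp n t : ez (- n) t = / ez n t.
Proof. unfold ez. rewrite <- ee_opp, opp_IZR, RtoC_opp. f_equal. ring. Qed.
Lemma Cmod_ez_R n (t : R) : Cmod (ez n t) = 1.
Proof. unfold ez. rewrite <- RtoC_mult. apply Cmod_ee_R. Qed.
Lemma Cmod_ez n z : Cmod (ez n z) = exp (- (2 * PI * IZR n * Im z)).
Proof. unfold ez. rewrite Cmod_ee. f_equal. unfold Im, RtoC. simpl. ring. Qed.
Lemma ez_int n (k : Z) : ez n (IZR k) = 1.
Proof. unfold ez. rewrite <- RtoC_mult, <- mult_IZR. apply ee_Z. Qed.
Lemma ez_conj n (t : R) : Cconj (ez n t) = ez (- n) t.
Proof. unfold ez, ee. rewrite <- Cexp_conj, opp_IZR, RtoC_opp. f_equal. go. Qed.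
Lemma wd_ez {X} (io : X -> C) n (f : X -> C) x a b : wd io f x a b ->
  wd io (fun t => ez n (f t)) x (2 * PI * Ci * IZR n * ez n (f x) * a) (2 * PI * Ci * IZR n * ez n (f x) * b).
Proof. intros H. unfold ez. wd_by (apply wd_ee, wd_scal, H); cring. Qed.
Lemma ct_ez {X} (dX : X -> X -> R) n (f : X -> C) x : ct dX dC f x -> ct dX dC (fun t => ez n (f t)) x.
Proof. go. Qed.
Ltac ictt := repeat first [progress ctt | apply ct_ez | apply ct_div | match goal with
  | |- ic _ => let t := fresh "t" in let H := fresh "H" in intros t H
  | H : ic ?f |- ct _ _ ?f _ => apply H | H : ic ?f |- ct _ _ (fun t => ?f t) _ => apply H end].
Ltac wd_more ::= lazymatch goal with |- wd _ (fun t => ez _ _) _ _ _ => apply wd_ez end.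
Ltac more ::= first [solve [ictt] | solve [anat] | solve [derive] | solve [repeat first [assumption | apply bnd_qz | apply bnd_prod | apply bnd_plus
  | apply bnd_scal; [solve [pos]|]]]].

Lemma CI_ez (n : Z) : CI (fun t => ez n t) = if Z.eqb n 0 then 1 else 0.
Proof.
destruct (Z.eqb_spec n 0) as [E|E].
- subst. rewrite (CI_ext _ (fun _ => RtoC 1)) by (intros; apply ez_0). apply CI_const.
- rewrite (CI_ext _ (fun t => / (2 * PI * Ci * IZR n) * (2 * PI * Ci * IZR n * ez n t))).
 + rewrite CI_scal, (CI_FTC (fun t => ez n t)).
  * rewrite (ez_int n 1), (ez_int n 0). ring. * go. * go. * go.
 + go.
Qed.

Lemma ic_ez f n : ic f -> ic (fun t => f t * ez n t).
Proof. go. Qed.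
Lemma CI_conj f : ic f -> CI (fun t => Cconj (f t)) = Cconj (CI f).
Proof. intros H. apply C_eq. - go. - apply (RInt_opp (V := RV)). now apply ex_IIm. Qed.
Lemma fc_bound f n M : ic f -> (forall t, I01 t -> Cmod (f t) <= M) -> Cmod (fc f n) <= M.
Proof. intros Hf HM. apply CI_bound; [go|]. intros t Ht. rewrite Cmod_mult, Cmod_ez_R, Rmult_1_r. go. Qed.

Section Bessel.
Variable g : R -> C.
Hypothesis Hg : ic g.
Definition fpart (L : list Z) (t : R) : C := lsum (fun n => fc g n * ez n t) L.

Lemma fpart_ic L : ic (fpart L).
Proof. intros t Ht. induction L as [|n L IH]; simpl; [go|]. go. Qed.

Lemma fc_fpart L n : ~ In n L -> fc (fpart L) n = 0.
Proof.
intros Hn. unfold fc. induction L as [|m L IH].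
- rewrite (CI_ext _ (fun _ => RtoC 0)); [apply CI_const|]. go.
- rewrite (CI_ext _ (fun t => fc g m * ez (m - n) t + fpart L t * ez (- n) t)).
 + rewrite CI_plus, CI_scal, CI_ez, IH.
  * destruct (Z.eqb_spec (m - n) 0) as [E|E]; [|ring]. exfalso. apply Hn. left. lia. * intros Hi. apply Hn. now right. * go. * go.
  * apply ic_ez, fpart_ic.
 + intros t _. unfold fpart. simpl. replace (m - n)%Z with (m + - n)%Z by lia. rewrite ez_plus. ring.
Qed.

Lemma bessel_eq L : NoDup L -> CI (fun t => (g t - fpart L t) * Cconj (g t - fpart L t)) =
  CI (fun t => g t * Cconj (g t)) - lsum (fun n => fc g n * Cconj (fc g n)) L.
Proof.
induction L as [|n L IH]; intros HL.
- simpl. rewrite (CI_ext _ (fun t => g t * Cconj (g t))); [ring|]. go.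
- inversion HL as [|? ? Hn HL']; subst. specialize (IH HL'). set (h := fun t => g t - fpart L t).
 change (CI (fun t => h t * Cconj (h t)) = CI (fun t => g t * Cconj (g t)) - lsum (fun n => fc g n * Cconj (fc g n)) L) in IH.
 have Hh : ic h by (intros t Ht; apply ct_minus; [go|now apply fpart_ic]). have E1 : CI (fun t => h t * ez (- n) t) = fc g n.
 { rewrite (CI_ext _ (fun t => g t * ez (- n) t - fpart L t * ez (- n) t)) by go.
  rewrite CI_minus by (apply ic_ez; trivial; apply fpart_ic). change (fc g n - fc (fpart L) n = fc g n). rewrite fc_fpart by go. ring. }
 have Hhe : ic (fun t => h t * ez (- n) t) by now apply ic_ez. have E2 : CI (fun t => Cconj (h t * ez (- n) t)) = Cconj (fc g n).
 { rewrite CI_conj by go. now rewrite E1. }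
 have Hhec : ic (fun t => Cconj (h t * ez (- n) t)) by (intros t Ht; apply ct_conj; now apply Hhe).
 rewrite (CI_ext _ (fun t => h t * Cconj (h t) + (fc g n * Cconj (fc g n) + (- Cconj (fc g n) * (h t * ez (- n) t) + - fc g n * Cconj (h t
  * ez (- n) t))))).
 + have Hhh : ic (fun t => h t * Cconj (h t)) by (intros t Ht; apply ct_mult; [|apply ct_conj]; now apply Hh).
  rewrite !CI_plus, CI_const, !CI_scal, E1, E2, IH; trivial.
  * go. * apply ic_mult; [go|go]. * apply ic_mult; [go|go]. * go. * apply ic_plus; (apply ic_mult; [go|go]).
  * apply ic_plus; [go|]. apply ic_plus; (apply ic_mult; [go|go]).
 + intros t _. unfold h, fpart. simpl. have Ec : ez n t * ez (- n) t = 1.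
  { rewrite <- ez_plus. replace (n + - n)%Z with 0%Z by lia. apply ez_0. }
  rewrite !Cminus_conj, !Cmult_conj, !Cplus_conj, !Cminus_conj, !Cmult_conj, !ez_conj. replace (- - n)%Z with n by lia.
  set (x := ez n t) in *. set (y := ez (- n) t) in *.
  replace (fc g n * Cconj (fc g n)) with (fc g n * Cconj (fc g n) * (x * y)) by (rewrite Ec; ring). ring.
Qed.

(** The integral of |g - partial sum|^2 is nonnegative. *)
Lemma bessel L : NoDup L -> rsum (fun n => Cmod (fc g n) ^ 2)%R L <= Re (CI (fun t => (g t * Cconj (g t))%C)).
Proof.
intros HL. have E := bessel_eq L HL. apply (f_equal Re) in E.
replace (Re (CI (fun t => g t * Cconj (g t)) - lsum (fun n => fc g n * Cconj (fc g n)) L)) with (Re (CI (fun t => g t * Cconj (g t))%C) -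
 rsum (fun n => Cmod (fc g n) ^ 2)%R L)%R in E.
2:{ have E2 : lsum (fun n => fc g n * Cconj (fc g n)) L = RtoC (rsum (fun n => Cmod (fc g n) ^ 2)%R L).
 { clear. induction L as [|n L IH]; [go|]. cbn [lsum rsum]. rewrite IH, RtoC_plus, Cmod2_conj. go. } rewrite E2. go. }
have P : 0 <= Re (CI (fun t => ((g t - fpart L t) * Cconj (g t - fpart L t))%C)).
{ have Hh : ic (fun t => g t - fpart L t) by (intros t Ht; apply ct_minus; [go|now apply fpart_ic]). apply RInt_ge_0; [lra| |].
 - apply (ex_IRe (fun t => (g t - fpart L t) * Cconj (g t - fpart L t))). intros t Ht. apply ct_mult; [|apply ct_conj]; now apply Hh.
 - intros t _. rewrite <- Cmod2_conj. go. } lra.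
Qed.
End Bessel.

Lemma ee_one (x : R) : Rabs x < 1 -> ee x = 1 -> x = 0%R.
Proof.
intros Hx E. have E1 : cos (2 * (PI * x)) = 1%R.
{ apply (f_equal Re) in E. simpl in E.
 replace (((2 * PI - 0 * 0) * 0 - (2 * 0 + 0 * PI) * 1) * x - ((2 * PI - 0 * 0) * 1 + (2 * 0 + 0 * PI) * 0) * 0)%R with 0%R in E by ring.
 rewrite exp_0, Rmult_1_l in E. rewrite <- E. f_equal. go. } rewrite cos_2a_sin in E1. have HP := PI_RGT_0.
destruct (Rtotal_order x 0) as [H|[H|H]]; [|go|].
- have S := sin_gt_0 (PI * - x). rewrite Ropp_mult_distr_r_reverse, sin_neg in S. rewrite Rabs_left in Hx by go. go.
- have S := sin_gt_0 (PI * x). rewrite Rabs_right in Hx by lra. go.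
Qed.

Fixpoint zlist (N : nat) : list Z :=
  match N with O => 0%Z :: nil | S K => Z.of_nat (S K) :: (- Z.of_nat (S K))%Z :: zlist K end.

Lemma in_zlist N n : In n (zlist N) <-> (Z.abs n <= Z.of_nat N)%Z.
Proof. induction N as [|N IH]; [simpl; lia|]. cbn [zlist In]. rewrite IH. lia. Qed.

Lemma NoDup_zlist N : NoDup (zlist N).
Proof.
induction N as [|N IH]; [repeat constructor; auto|]. constructor.
- cbn [In]. rewrite in_zlist. lia. - constructor; [|go]. rewrite in_zlist. lia.
Qed.

Lemma zlist_covers (L : list Z) : exists N0, forall N, (N0 <= N)%nat -> incl L (zlist N).
Proof.
induction L as [|a L [N0 H]].
- exists O. go.
- exists (Nat.max N0 (Z.abs_nat a)). intros N HN x [E|Hx].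
 + apply in_zlist. lia. + apply (H N); [lia|go].
Qed.

Lemma is_sum_seq_limit {A} (f : A -> C) s v (Ls : nat -> list A) : is_sum f s ->
  (forall N, NoDup (Ls N)) -> (forall L : list A, exists N0, forall N, (N0 <= N)%nat -> incl L (Ls N)) ->
  (forall eps, 0 < eps -> exists N0, forall N, (N0 <= N)%nat -> Cmod (lsum f (Ls N) - v) <= eps) -> s = v.
Proof.
intros Hs Hnd Hc Hv. have E : s - v = 0.
{ apply Cmod_eq_small. intros eps He. destruct (Hs (eps / 2)%R ltac:(lra)) as [L0 H0]. destruct (Hc L0) as [N0 HN0].
 destruct (Hv (eps / 2)%R ltac:(lra)) as [N1 HN1]. set (N := Nat.max N0 N1). specialize (H0 (Ls N) (Hnd N) (HN0 N ltac:(unfold N; lia))).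
 specialize (HN1 N ltac:(unfold N; lia)). have T := Cmod_tri3 s (lsum f (Ls N)) v. rewrite (Cmod_symm s (lsum f (Ls N))) in T. lra. }
replace s with (s - v + v) by ring. rewrite E. ring.
Qed.

(** The difference quotient of Caratheodory. *)
Definition dq (f : R -> C) (t0 : R) (l : C) (t : R) : C := if Req_EM_T t t0 then l else (f t - f t0) / (t - t0).

Lemma dq_ct f t0 l t : rder f t0 l -> ct dR dC f t -> ct dR dC (dq f t0 l) t.
Proof.
intros H Hc. destruct (Req_EM_T t t0) as [E|E].
- subst t. intros eps He. destruct (H (eps / 2)%R ltac:(lra)) as [d [Hd H1]]. take d. intros y Hy. unfold dR, dC in *. specialize (H1 y).
 rewrite Cmod_RtoC_sub in H1. unfold dq. destruct (Req_EM_T t0 t0) as [_|]; [|go]. destruct (Req_EM_T y t0) as [Ey|Ey].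
 { vanish (l - l). now rewrite Cmod_0. } have N : RtoC y - RtoC t0 <> 0 by (rewrite <- RtoC_minus; apply RtoC_nz; lra).
 replace (_ - l) with ((f y - f t0 - ((y - t0) * l + Cconj (y - t0) * 0)) / (y - t0)) by go. rewrite Cmod_div, Cmod_RtoC_sub by go.
 have P : 0 < Rabs (y - t0) by go. apply Rle_lt_trans with (eps / 2)%R; [|lra]. apply Rmult_le_reg_r with (Rabs (y - t0)); [go|].
 unfold Rdiv at 1. rewrite Rmult_assoc, Rinv_l, Rmult_1_r; lra.
- apply ct_ext_loc with (f := fun t => (f t - f t0) / (t - t0)).
 + exists (Rabs (t - t0)). split; [go|]. intros y Hy. unfold dq, dR in *. destruct (Req_EM_T y t0); [|go]. subst.
  rewrite Rabs_minus_sym in Hy. lra.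
 + unfold dq. destruct (Req_EM_T t t0); [go|go]. + apply ct_div; [rewrite <- RtoC_minus; apply RtoC_nz; lra|go|go].
Qed.

(** By Bessel's inequality, the squares of the coefficients are summable. *)
Lemma riemann_lebesgue g : ic g -> forall eps, 0 < eps ->
  exists N, forall n, (Z.of_nat N < Z.abs n)%Z -> Cmod (fc g n) <= eps.
Proof.
intros Hg eps He. destruct (tail_ex (fun n => Cmod (fc g n) ^ 2)%R) with (eps := (eps ^ 2)%R) as [L0 H]; [|nra|].
{ split; [intros; apply pow2_ge_0|]. eexists. intros L HL. now apply bessel. } destruct (zlist_covers L0) as [N HN]. exists N. intros n Hn.
destruct H as [_ H]. specialize (H (n :: nil)). simpl rsum in H. have H1 : Cmod (fc g n) ^ 2 + 0 <= eps ^ 2.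
{ apply H; [repeat constructor; auto|]. intros x [<-|[]] Hx. apply (HN N (Nat.le_refl N)), in_zlist in Hx. lia. } apply Rnot_lt_le. go.
Qed.

(** Fourier inversion at a point of differentiability.  With g(t) = (f(t)-f(t0))/(e(t-t0)-1), the partial sums telescope
    to f(t0) plus a difference of two Fourier coefficients of g. *)
Lemma fourier_inv (f : R -> C) (t0 : R) (l : C) M : ic f -> 0 < t0 < 1 -> rder f t0 l -> bnd M ->
  (forall n, Cmod (fc f n) <= M n) -> is_sum (fun n => fc f n * ez n t0) (f t0).
Proof.
intros Hf Ht0 Hl HM Hfc. have Hb : forall n, Cmod (fc f n * ez n t0) <= M n by (intros n; now rewrite Cmod_mult, Cmod_ez_R, Rmult_1_r).
destruct (is_sum_ex _ M HM Hb) as [s Hs]. set (w0 := 2 * PI * Ci). have Hw : w0 <> 0 by (unfold w0; nz).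
set (D := fun t : R => ee (t - t0) - 1). have D0 : D t0 = 0 by (unfold D; replace (t0 - t0) with (RtoC 0) by ring; rewrite ee_0; ring).
have HDd : rder D t0 w0.
{ unfold D. wd_by (apply wd_minus; [apply wd_ee, wd_minus; [apply wd_io|apply wd_const]|apply wd_const]); [|cring]. cbv beta.
 vanish (t0 - t0). rewrite ee_0. unfold w0. ring. } have HD : forall t, I01 t -> t <> t0 -> D t <> 0.
{ intros t Ht Hn E. apply Hn. have E1 : ee (t - t0)%R = 1.
 { rewrite RtoC_minus. unfold D in E. replace (ee (t - t0)) with (ee (t - t0) - 1 + 1) by ring. rewrite E. ring. }
 apply ee_one in E1; [lra|]. unfold I01 in Ht. apply Rabs_def1; lra. }
have Hsub : forall t, t <> t0 -> RtoC t - RtoC t0 <> 0 by (intros; rewrite <- RtoC_minus; apply RtoC_nz; lra).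
set (g := fun t => dq f t0 l t / dq D t0 w0 t). have Hg : ic g.
{ intros t Ht. apply ct_div; [|apply dq_ct; auto|apply dq_ct; [assumption|unfold D; ctt]]. unfold dq.
 destruct (Req_EM_T t t0) as [E|E]; [assumption|]. rewrite D0. intros E0. apply (HD t Ht E).
 replace (D t) with ((D t - 0) / (t - t0) * (t - t0)) by (field; auto). rewrite E0. ring. }
have Hfg : forall t, I01 t -> f t - f t0 = D t * g t.
{ intros t Ht. unfold g, dq. destruct (Req_EM_T t t0) as [E|E]; [subst; rewrite D0; ring|]. rewrite D0. have N := HD t Ht E.
 have N2 := Hsub t E. field. auto. } clearbody g. have Hz : forall m, ic (fun t => ez m t) by (intros m t _; apply ct_ez; ctt).
have Hgz : forall m, ic (fun t => g t * ez m t) by (intros m; now apply ic_ez). set (ga := fun n => ez n t0 * fc g n).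
have Hrel : forall n, fc f n * ez n t0 = (if Z.eqb n 0 then f t0 else 0) + (ga (n - 1)%Z - ga n).
{ intros n. have E : fc f n = (if Z.eqb n 0 then f t0 else 0) + (ez (- 1) t0 * fc g (n - 1) - fc g n).
 { unfold fc at 1. rewrite (CI_ext _ (fun t => f t0 * ez (- n) t + (ez (- 1) t0 * (g t * ez (- (n - 1)) t) - g t * ez (- n) t))).
  - rewrite CI_plus, CI_minus, !CI_scal, CI_ez by (intros t Ht; ictt). unfold fc.
   replace (Z.eqb (- n) 0) with (Z.eqb n 0) by (destruct (Z.eqb_spec n 0), (Z.eqb_spec (- n) 0); trivial; lia). destruct (Z.eqb n 0); ring.
  - intros t Ht. replace (f t) with (f t0 + (f t - f t0)) by ring. rewrite (Hfg t Ht). unfold D.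
   replace (- (n - 1))%Z with (- n + 1)%Z by lia. rewrite ez_plus. replace (ee (t - t0)) with (ez 1 t * ez (- 1) t0); [ring|]. unfold ez.
   rewrite <- ee_plus. f_equal. go. } unfold ga. rewrite E. replace (n - 1)%Z with (n + - 1)%Z at 2 by lia. rewrite ez_plus.
 destruct (Z.eqb_spec n 0) as [En|En]; [subst; rewrite ez_0|]; ring. }
have Htel : forall N, lsum (fun n => fc f n * ez n t0) (zlist N) = f t0 + (ga (- Z.of_nat (S N))%Z - ga (Z.of_nat N)).
{ induction N as [|N IH]; [simpl lsum; rewrite Hrel; simpl; ring|]. cbn [zlist lsum]. rewrite IH, !Hrel.
 destruct (Z.eqb_spec (Z.of_nat (S N)) 0) as [E1|E1]; [lia|]. destruct (Z.eqb_spec (- Z.of_nat (S N)) 0) as [E2|E2]; [lia|].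
 replace (Z.of_nat (S N) - 1)%Z with (Z.of_nat N) by lia. replace (- Z.of_nat (S N) - 1)%Z with (- Z.of_nat (S (S N)))%Z by lia. ring. }
replace (f t0) with s; [assumption|]. apply (is_sum_seq_limit _ s _ zlist Hs); [apply NoDup_zlist|apply zlist_covers|]. intros eps He.
destruct (riemann_lebesgue g Hg (eps / 2)%R ltac:(lra)) as [N0 HN]. exists (S N0). intros N HN0. rewrite Htel.
have G : forall n, (Z.of_nat N0 < Z.abs n)%Z -> Cmod (ga n) <= eps / 2.
{ intros n Hn. unfold ga. rewrite Cmod_mult, Cmod_ez_R, Rmult_1_l. now apply HN. }
have T := Cmod_triangle (ga (- Z.of_nat (S N))%Z) (- ga (Z.of_nat N)). rewrite Cmod_opp in T. have G1 := G (- Z.of_nat (S N))%Z ltac:(lia).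
have G2 := G (Z.of_nat N) ltac:(lia). replace (_ - f t0) with (ga (- Z.of_nat (S N))%Z + - ga (Z.of_nat N)) by ring. lra.
Qed.

Lemma fourier_inv0 (f f' : R -> C) M : ic f -> (forall t, 0 < t < 1 -> rder f t (f' t)) -> bnd M ->
  (forall n, Cmod (fc f n) <= M n) -> is_sum (fun n => fc f n) (f 0%R).
Proof.
intros Hf Hd HM Hfc. have Hb : forall (t : R) n, Cmod (fc f n * ez n t) <= M n. { intros t n. now rewrite Cmod_mult, Cmod_ez_R, Rmult_1_r. }
set (s := fun t : R => SUM (fun n => fc f n * ez n t)).
have Hs : forall t : R, is_sum (fun n => fc f n * ez n t) (s t) by (intros t; now apply (SUM_spec _ M)).
have Hst : forall t, 0 < t < 1 -> s t = f t. { intros t Ht. apply SUM_eq. apply (fourier_inv f t (f' t) M); auto. }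
have Hsc : ct dR dC s 0%R.
{ apply (ct_SUM dR (fun n (t : R) => fc f n * ez n t) s M); [apply dR_refl|go| |].
 - exists 1%R. split; [lra|]. go. - go. } apply is_sum_ext with (f := fun n => fc f n * ez n 0%R). { intros n. rewrite (ez_int n 0). ring. }
replace (f 0%R) with (s 0%R); [go|]. have E : s 0%R - f 0%R = 0.
{ apply Cmod_eq_small. intros eps He. destruct (Hsc (eps / 2)%R ltac:(lra)) as [d1 [Hd1 H1]].
 destruct (Hf 0%R ltac:(unfold I01; lra) (eps / 2)%R ltac:(lra)) as [d2 [Hd2 H2]]. set (t := Rmin (1 / 2) (Rmin d1 d2 / 2)).
 have Hm := rmin_pos d1 d2 Hd1 Hd2. have Ht : 0 < t < 1. { unfold t. split; [go|]. have H := Rmin_l (1 / 2) (Rmin d1 d2 / 2). lra. }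
 have Ht2 : t < Rmin d1 d2 by (unfold t; have H := Rmin_r (1 / 2) (Rmin d1 d2 / 2); lra). apply lt_rmin in Ht2. specialize (H1 t).
 specialize (H2 t). unfold dR, dC in *. rewrite Rminus_0_r, Rabs_pos_eq in H1, H2 by lra. rewrite (Hst t Ht) in H1.
 have T := Cmod_tri3 (s 0%R) (f t) (f 0%R). rewrite (Cmod_symm (s 0%R)  (f t)) in T. lra. }
replace (s 0%R) with (s 0%R - f 0%R + f 0%R) by ring. rewrite E. ring.
Qed.

Lemma periodic_Z (f : R -> C) : (forall t, f (t + 1)%R = f t) -> forall (k : Z) t, f (t + IZR k)%R = f t.
Proof.
intros H. have Hn : forall n t, f (t + INR n)%R = f t.
{ induction n as [|n IH]; intros t; [simpl; f_equal; ring|]. rewrite S_INR. replace (t + (INR n + 1))%R with ((t + INR n) + 1)%R by ring.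
 now rewrite H. } intros k t. destruct (Z_le_gt_dec 0 k) as [Hk|Hk].
- rewrite <- (Z2Nat.id k Hk), <- INR_IZR_INZ. go.
- rewrite <- (Hn (Z.to_nat (- k)) (t + IZR k)%R). f_equal. rewrite INR_IZR_INZ, Z2Nat.id, opp_IZR by lia. ring.
Qed.

Lemma fourier_per (f f' : R -> C) M : (forall t, f (t + 1)%R = f t) -> (forall t, rder f t (f' t)) -> bnd M ->
  (forall n, Cmod (fc f n) <= M n) -> forall t : R, is_sum (fun n => fc f n * ez n t) (f t).
Proof.
intros Hp Hd HM Hfc t. have Hic : ic f.
{ intros s _ eps He. destruct (wd_ct RtoC f s _ _ (Hd s) eps He) as [d [Hd1 H1]]. take d. intros y Hy. apply H1. rewrite Cmod_RtoC_sub. go. }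
set (k := Int_part t). set (t1 := frac_part t). have Et : t = (t1 + IZR k)%R by (unfold t1, k, frac_part; ring).
have Ht1 : 0 <= t1 < 1 by (have B := base_fp t; unfold t1; lra). rewrite Et, (periodic_Z f Hp).
apply is_sum_ext with (f := fun n => fc f n * ez n t1). { intros n. rewrite RtoC_plus, ez_add, ez_int. ring. }
destruct (Req_dec t1 0) as [E|E].
- rewrite E. apply is_sum_ext with (f := fun n => fc f n); [intros n; rewrite (ez_int n 0); ring|]. apply (fourier_inv0 f f' M); auto.
- apply (fourier_inv f t1 (f' t1) M); auto. lra.
Qed.

Lemma fc_deriv (f f' : R -> C) n : (forall t, I01 t -> rder f t (f' t)) -> ic f' -> f 0%R = f 1%R ->
  fc f' n = 2 * PI * Ci * IZR n * fc f n.
Proof.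
intros Hd Hf' H01. have Hic : ic f.
{ intros s Hs eps He. destruct (wd_ct RtoC f s _ _ (Hd s Hs) eps He) as [d [Hd1 H1]]. take d. intros y Hy. apply H1. rewrite Cmod_RtoC_sub.
 go. } have E : CI (fun t => f' t * ez (- n) t + - (2 * PI * Ci * IZR n) * (f t * ez (- n) t)) = 0.
{ rewrite (CI_FTC (fun t => f t * ez (- n) t)).
 - rewrite (ez_int (- n) 1), (ez_int (- n) 0), H01. ring.
 - intros t Ht. wd_by (apply wd_mult; [go|apply wd_ez, wd_io]).
  + rewrite opp_IZR, RtoC_opp. go. + cring.
 - go. } rewrite CI_plus, CI_scal in E.
- unfold fc.
 replace (CI (fun t => f' t * ez (- n) t)) with ((CI (fun t => f' t * ez (- n) t) + - (2 * PI * Ci * IZR n) * CI (fun t => f t * ez (- n)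
  t)) + 2 * PI * Ci * IZR n * CI (fun t => f t * ez (- n) t)) by ring. rewrite E. ring.
- go. - go. - go.
Qed.

(** Two integrations by parts. *)
Lemma fc_decay (f f1 f2 : R -> C) B n : (forall t, I01 t -> rder f t (f1 t)) ->
  (forall t, I01 t -> rder f1 t (f2 t)) -> ic f2 -> f 0%R = f 1%R -> f1 0%R = f1 1%R ->
  (forall t, I01 t -> Cmod (f t) <= B) -> (forall t, I01 t -> Cmod (f2 t) <= B) ->
  Cmod (fc f n) <= 2 * B * qz n.
Proof.
intros H1 H2 Hf2 E0 E1 HB HB2. have Hw : forall h h', (forall t, I01 t -> rder h t (h' t)) -> ic h.
{ intros h h' Hd s Hs eps He. destruct (wd_ct RtoC h s _ _ (Hd s Hs) eps He) as [d [Hd1 Hd2]]. take d. intros y Hy. apply Hd2.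
 rewrite Cmod_RtoC_sub. go. } have Hf := Hw _ _ H1. have Hf1 := Hw _ _ H2. have B0 := fc_bound f n B Hf HB.
have B2 := fc_bound f2 n B Hf2 HB2. rewrite (fc_deriv f1 f2 n H2 Hf2 E1), (fc_deriv f f1 n H1 Hf1 E0) in B2.
rewrite !Cmod_mult, Cmod_Ci, !Cmod_R in B2. have HP := PI2_3_2. rewrite (Rabs_pos_eq 2), (Rabs_pos_eq PI) in B2 by lra.
set (x := Cmod (fc f n)) in *. have Hx : 0 <= x by go.
have E : (Rabs (IZR n) * Rabs (IZR n) = IZR n * IZR n)%R by (rewrite <- Rabs_mult; apply Rabs_pos_eq; apply Rle_0_sqr).
have HQ : 0 <= IZR n * IZR n by go. have B3 : IZR n * IZR n * x <= B.
{ replace (2 * PI * 1 * Rabs (IZR n) * (2 * PI * 1 * Rabs (IZR n) * x))%R with (4 * (PI * PI) * ((Rabs (IZR n) * Rabs (IZR n)) * x))%R in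
  B2 by ring. rewrite E in B2. have Hpp : 1 <= 4 * (PI * PI) by nra. go. } unfold qz.
apply Rmult_le_reg_r with (1 + IZR n * IZR n)%R; [lra|].
replace (2 * B * / (1 + IZR n * IZR n) * (1 + IZR n * IZR n))%R with (2 * B)%R by (field; lra). lra.
Qed.

(** * Partial fractions *)

Definition kap (X m : R) : R := (m * m / (2 * (m * m) + 2 * (X * X) + 1))%R.

Lemma kap_pos X m : 0 < m -> 0 < kap X m.
Proof. intros H. have H1 := Rle_0_sqr X. unfold Rsqr in H1. assert (0 < m * m) by nra. go. Qed.

Lemma lattice_low z X m (c d : R) : 0 < m -> m <= Im z -> Rabs (Re z) <= X ->
  kap X m * (c * c + d * d) <= Cmod (c * z + d) * Cmod (c * z + d).
Proof.
intros Hm Hy Hx. set (x := Re z) in *. set (y := Im z) in *.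
have E : (Cmod (c * z + d) * Cmod (c * z + d) = (c * x + d) * (c * x + d) + c * c * (y * y))%R.
{ replace (Cmod (c * z + d) * Cmod (c * z + d))%R with (Cmod (c * z + d) ^ 2)%R by ring. rewrite Cmod2_alt. unfold x, y, Re, Im, RtoC.
 simpl. ring. } rewrite E. unfold kap. have Hx2 : x * x <= X * X. { split_Rabs; nra. } have Hy2 : m * m <= y * y by nra.
set (K := (2 * (m * m) + 2 * (X * X) + 1)%R). have HK : 0 < K by (unfold K; nra). apply Rmult_le_reg_r with K; [go|].
replace (m * m / K * (c * c + d * d) * K)%R with (m * m * (c * c + d * d))%R by (field; lra). set (u := (c * x + d)%R).
have Hd : d * d <= 2 * (u * u) + 2 * (c * c) * (X * X).
{ have Q := Rle_0_sqr (u + c * x). unfold Rsqr in Q. have Ed : d = (u - c * x)%R by (unfold u; ring). go. }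
assert (H1 : m * m * (c * c + d * d) <= m * m * (2 * (u * u) + (2 * (X * X) + 1) * (c * c))) by go.
have H2 : c * c * (m * m) <= c * c * (y * y) by go. have H3 : c * c * (m * m) * K <= c * c * (y * y) * K by go.
have H4 : 2 * (m * m) * (u * u) <= u * u * K. { unfold K. nra. } have H5 : m * m * ((2 * (X * X) + 1) * (c * c)) <= c * c * (m * m) * K.
{ unfold K. nra. } lra.
Qed.

Definition lowc (z : C) : R := kap (Rabs (Re z)) (Im z).
Lemma lowc_pos z : upper z -> 0 < lowc z.
Proof. intros H. now apply kap_pos. Qed.
Lemma lowc_spec z (c d : R) : upper z ->
  lowc z * (c * c + d * d) <= Cmod (c * z + d) * Cmod (c * z + d).
Proof. intros H. apply lattice_low; [go|lra|lra]. Qed.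

Lemma czd_nz z (c d : R) : upper z -> (c <> 0 \/ d <> 0)%R -> c * z + d <> 0.
Proof.
intros Hz Hcd E. have H := lowc_spec z c d Hz. rewrite E, Cmod_0 in H. have P := lowc_pos z Hz. assert (0 < c * c + d * d) by go. nra.
Qed.

Lemma zn_low z n : upper z -> lowc z * (1 + IZR n * IZR n) <= Cmod (z - IZR n) * Cmod (z - IZR n).
Proof. intros Hz. have H := lowc_spec z 1 (- IZR n) Hz. replace (1 * z + (- IZR n)%R) with (z - IZR n) in H by go. lra. Qed.
Lemma zn_nz z n : upper z -> z - IZR n <> 0.
Proof. intros Hz. replace (z - IZR n) with (1%R * z + (- IZR n)%R) by go. apply czd_nz; [go|lra]. Qed.
Lemma upper_ee_lt z : upper z -> Cmod (ee z) < 1.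
Proof. intros H. rewrite Cmod_ee, <- exp_0. apply exp_increasing. have P := PI_RGT_0. unfold upper in H. nra. Qed.

Lemma upper_ee_1 z : upper z -> 1 - ee z <> 0.
Proof.
intros H E. have L := upper_ee_lt z H. replace (ee z) with (1 - (1 - ee z)) in L by ring. rewrite E in L.
replace (1 - 0) with (RtoC 1) in L by ring. rewrite Cmod_1 in L. lra.
Qed.

Lemma inv_qz_bound x k n : 0 < k -> k * (1 + IZR n * IZR n) <= x -> / x <= / k * qz n.
Proof. intros Hk Hx. unfold qz. rewrite <- Rinv_mult. apply Rinv_le_contravar; [|go]. go. Qed.

Definition lam (z : C) : C := ee z / ((1 - ee z) * (1 - ee z)).

Lemma rder_lin a b t : rder (fun t : R => a + t * b) t b.
Proof. go. Qed.

Lemma fourier_eval (f f' : R -> C) (P : Z -> R -> C) (c : Z -> C) K : 0 <= K -> (forall t, rder f t (f' t)) ->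
  (forall n t, rder (P n) t (f t * ez (- n) t)) -> (forall n, P n 1%R - P n 0%R = c n) ->
  (forall n, Cmod (c n) <= K * qz n) -> is_sum c (f 0%R).
Proof.
intros HK Hf HP Hc Hb. have Hi : ic f.
{ intros t _ eps He. destruct (wd_ct RtoC f t _ _ (Hf t) eps He) as [d [Hd H]]. take d. intros y Hy. apply H. now rewrite Cmod_RtoC_sub. }
have E : forall n, fc f n = c n by (intros n; unfold fc; rewrite (CI_FTC (P n)); auto; now apply ic_ez).
apply is_sum_ext with (f := fc f); [go|]. apply (fourier_inv0 f f' (fun n => K * qz n)%R); auto.
- go. - intros n. now rewrite E.
Qed.

(** The sum of 1/(z-n)^2: Fourier inversion at 0 for (q+(1-q)t)e(zt) on the unit interval. *)
Lemma lipschitz z : upper z -> is_sum (fun n : Z => / ((z - IZR n) * (z - IZR n))) ((2 * PI * Ci) * (2 * PI * Ci) * lam z).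
Proof.
intros Hz. set (q := ee z). set (w0 := 2 * PI * Ci). have Hw0 : w0 <> 0 by (unfold w0; nz). have Hq : 1 - q <> 0 by now apply upper_ee_1.
have Hn := fun n => zn_nz z n Hz. have Pl := lowc_pos z Hz.
have H : is_sum (fun n : Z => (1 - q) * (1 - q) * / (w0 * w0) * / ((z - IZR n) * (z - IZR n))) ((q + 0%R * (1 - q)) * ee (z * 0%R)).
{ apply (fourier_eval (fun t : R => (q + t * (1 - q)) * ee (z * t)) (fun t => (1 - q) * ee (z * t) + (q + t * (1 - q)) * (w0 * ee (z * t) *
  z)) (fun n t => ((q + t * (1 - q)) / (w0 * (z - IZR n)) - (1 - q) / (w0 * (z - IZR n) * (w0 * (z - IZR n)))) * (ee (z * t) * ez (- n) t))
  _ (Cmod ((1 - q) * (1 - q) * / (w0 * w0)) * / lowc z)); [pos| | | |].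
 - intros t. der; unfold w0; cring.
 - intros n t. specialize (Hn n). der; [|cring]. cbv beta. rewrite opp_IZR, RtoC_opp. fold w0. field. split; assumption.
 - intros n. specialize (Hn n). replace (z * 1%R) with z by ring. vanish (z * 0%R). rewrite (ez_int _ 1), (ez_int _ 0), ee_0. fold q. field.
  split; assumption.
 - intros n. rewrite Cmod_mult, Rmult_assoc. apply Rmult_le_compat_l; [apply Cmod_ge_0|].
  rewrite Cmod_inv, Cmod_mult by (now apply Cmult_neq_0). apply inv_qz_bound; [assumption|now apply zn_low]. }
have H2 := is_sum_scal (w0 * w0 / ((1 - q) * (1 - q))) _ _ H. rewrite Cmult_0_r, ee_0 in H2.
replace (w0 * w0 * lam z) with (w0 * w0 / ((1 - q) * (1 - q)) * ((q + 0%R * (1 - q)) * 1)).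
- apply is_sum_ext with (2 := H2). intros n. specialize (Hn n). field. repeat split; assumption. - unfold lam. fold q. go.
Qed.

Lemma is_sum_single (v : C) : is_sum (fun n : Z => if Z.eqb n 0 then v else 0) v.
Proof.
have H := is_sum_finite (fun n : Z => if Z.eqb n 0 then v else 0) (0%Z :: nil). simpl in H. rewrite Cplus_0_r in H.
apply H; [repeat constructor; auto|]. intros a Ha. destruct (Z.eqb_spec a 0); [|reflexivity]. exfalso. apply Ha. go.
Qed.

(** Fourier inversion at the end point 0, for t^2 - t. *)
Lemma zeta2 : is_sum (fun n : Z => if Z.eqb n 0 then 0 else / (IZR n * IZR n)) (PI * PI / 3).
Proof.
set (w0 := 2 * PI * Ci). have HP := PIC_nz. have Hw0 : w0 <> 0 by (unfold w0; nz).
have Hw2 : w0 * w0 = - (4 * (PI * PI)) by (unfold w0; apply C_eq; simpl; ring).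
have Hn : forall n, n <> 0%Z -> RtoC (IZR n) <> 0 by (intros; nz). have HPr := PI2_3_2.
have H : is_sum (fun n : Z => if Z.eqb n 0 then - / 6 else / (2 * (PI * PI)) * / (IZR n * IZR n)) (0%R * 0%R - 0%R).
{ apply (fourier_eval (fun t : R => t * t - t) (fun t => 2 * t - 1) (fun n t => if Z.eqb n 0 then t * t * t / 3 - t * t / 2 else (- (t * t
  - t) / (w0 * IZR n) - (2 * t - 1) / (w0 * IZR n * (w0 * IZR n)) - 2 / (w0 * IZR n * (w0 * IZR n) * (w0 * IZR n))) * ez (- n) t) _ 2);
  [lra| | | |].
 - intros t. der; cring.
 - intros n t. destruct (Z.eqb_spec n 0) as [E|E]; (der; [|cring]); cbv beta.
  + subst. rewrite ez_0. field. + specialize (Hn n E). rewrite opp_IZR, RtoC_opp. fold w0. field. split; assumption.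
 - intros n. destruct (Z.eqb_spec n 0) as [E|E]; [field|]. specialize (Hn n E). rewrite (ez_int _ 1), (ez_int _ 0).
  transitivity (- (2) / (w0 * w0 * (IZR n * IZR n))); [field; split; assumption|]. rewrite Hw2. field. split; assumption.
 - intros n. unfold qz. destruct (Z.eqb_spec n 0) as [E|E].
  + subst. rewrite Cmod_opp, Cmod_inv, Cmod_R, Rabs_pos_eq by (try lra; nz). lra.
  + specialize (Hn n E). rewrite Cmod_mult, !Cmod_inv, !Cmod_mult, !Cmod_R by nz.
   rewrite (Rabs_pos_eq 2), (Rabs_pos_eq PI), <- Rabs_mult by lra.
   have Hn1 : 1 <= IZR n * IZR n by (rewrite <- mult_IZR; apply IZR_le; nia).
   have H1 : / (2 * (PI * PI)) <= 1 by (rewrite <- Rinv_1; apply Rinv_le_contravar; nra).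
   have H2 : / (IZR n * IZR n) <= 2 * / (1 + IZR n * IZR n).
   { replace (2 * / (1 + IZR n * IZR n))%R with (/ ((1 + IZR n * IZR n) / 2))%R by (field; lra). apply Rinv_le_contravar; lra. }
   assert (0 < / (2 * (PI * PI))) by (apply Rinv_0_lt_compat; nra). assert (0 < / (IZR n * IZR n)) by (apply Rinv_0_lt_compat; lra).
   rewrite (Rabs_pos_eq (IZR n * IZR n)) by lra. nra. }
have H3 := is_sum_scal (2 * (PI * PI)) _ _ (is_sum_minus _ _ _ _ H (is_sum_single (- / 6))).
replace (PI * PI / 3) with (2 * (PI * PI) * (0%R * 0%R - 0%R - - / 6)) by field. apply is_sum_ext with (2 := H3). intros n.
destruct (Z.eqb_spec n 0) as [E|E]; [ring|]. specialize (Hn n E). go.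
Qed.

(** The cotangent series: Fourier inversion at 0 for e(a(t-1/2)) + e(-a(t-1/2)). *)
Lemma cot_sum a : upper a -> is_sum (fun n : Z => / (a * a - IZR n * IZR n)) (PI * Ci / a * ((ee a + 1) / (ee a - 1))).
Proof.
intros Ha. set (w0 := 2 * PI * Ci). have HP := PIC_nz. have HCi := Ci_nz. have Hw0 : w0 <> 0 by (unfold w0; nz).
have Han : a <> 0 by (replace a with (a - IZR 0) by ring; now apply zn_nz). set (u := ee (a / 2)). have Hu : u <> 0 by apply ee_nz.
have Euu : u * u = ee a by (unfold u; rewrite <- ee_plus; f_equal; field). have HD : u * u - 1 <> 0.
{ rewrite Euu. intros E. apply (upper_ee_1 a Ha). replace (1 - ee a) with (- (ee a - 1)) by ring. rewrite E. ring. }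
have Hm := fun n => zn_nz a n Ha. have Pl := lowc_pos a Ha. have Hp : forall n : Z, a + IZR n <> 0.
{ intros n. replace (a + IZR n) with (a - IZR (- n)) by (rewrite opp_IZR, RtoC_opp; ring). apply Hm. }
have Ef : forall n : Z, a * a - IZR n * IZR n = (a - IZR n) * (a + IZR n) by (intros; ring).
have Hk : (u * u - 1) * a <> 0 by now apply Cmult_neq_0. set (K := (u - / u) / w0 * (2 * a)).
have H : is_sum (fun n : Z => K * / (a * a - IZR n * IZR n)) (/ u * ee (a * 0%R) + u * ee (- a * 0%R)).
{ apply (fourier_eval (fun t : R => / u * ee (a * t) + u * ee (- a * t)) (fun t => / u * (w0 * ee (a * t) * a) + u * (w0 * ee (- a * t) * -
  a)) (fun n t => (/ u / (w0 * (a - IZR n)) * ee (a * t) - u / (w0 * (a + IZR n)) * ee (- a * t)) * ez (- n) t) _ (Cmod K * / lowc a));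
  [pos| | | |].
 - intros t. der; unfold w0; cring.
 - intros n t. specialize (Hm n). specialize (Hp n). der; [|cring]. cbv beta. rewrite opp_IZR, RtoC_opp. fold w0. field. auto.
 - intros n. specialize (Hm n). specialize (Hp n). replace (a * 1%R) with a by ring. replace (- a * 1%R) with (- a) by ring.
  vanish (a * 0%R). vanish (- a * 0%R). rewrite (ez_int _ 1), (ez_int _ 0), ee_0, ee_opp, <- Euu, Ef. unfold K. field. auto.
 - intros n. rewrite Cmod_mult, Rmult_assoc. apply Rmult_le_compat_l; [apply Cmod_ge_0|]. rewrite Ef, Cmod_inv by now apply Cmult_neq_0.
  apply inv_qz_bound; [assumption|]. rewrite Cmod_mult. have L1 := zn_low a n Ha. have L2 := zn_low a (- n) Ha.
  rewrite opp_IZR, RtoC_opp in L2. replace (a - - IZR n) with (a + IZR n) in L2 by ring. have Q := Rle_0_sqr (IZR n). unfold Rsqr in Q.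
  set (x := Cmod (a - IZR n)) in *. set (y := Cmod (a + IZR n)) in *. set (L := (lowc a * (1 + IZR n * IZR n))%R) in *.
  assert (0 <= x) by apply Cmod_ge_0. assert (0 <= y) by apply Cmod_ge_0. have HL : 0 <= L by (unfold L; apply Rmult_le_pos; lra).
  replace (- IZR n * - IZR n)%R with (IZR n * IZR n)%R in L2 by ring. fold L in L2. apply Rnot_lt_le. intros Hlt.
  assert (L * L <= (x * x) * (y * y)) by (apply Rmult_le_compat; lra).
  assert ((x * y) * (x * y) < L * L) by (apply Rmult_le_0_lt_compat; try assumption; now apply Rmult_le_pos). nra. }
have H2 := is_sum_scal (/ K) _ _ H. have HK : K <> 0.
{ intros E. apply Hk. replace ((u * u - 1) * a) with (K * (u * w0 / 2)) by (unfold K; field; auto). rewrite E. ring. }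
rewrite !Cmult_0_r, ee_0 in H2. replace (PI * Ci / a * ((ee a + 1) / (ee a - 1))) with (/ K * (/ u * 1 + u * 1)).
- apply is_sum_ext with (2 := H2). intros n. specialize (Hm n). specialize (Hp n). rewrite Ef. field. auto.
- rewrite <- Euu. unfold K, w0. go.
Qed.

(** * The weight two Eisenstein series under z -> -1/z *)

Lemma opp_upper z : upper z -> upper (- / z).
Proof.
intros Hz. unfold upper in *. destruct z as [x y]. simpl in *. assert (0 < x * (x * 1) + y * (y * 1)) by nra.
replace (- (- y / (x * (x * 1) + y * (y * 1))))%R with (y / (x * (x * 1) + y * (y * 1)))%R by go. go.
Qed.

Lemma upper_nz z : upper z -> z <> 0.
Proof. intros Hz E. unfold upper in Hz. rewrite E in Hz. unfold Im in Hz; simpl in Hz. lra. Qed.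
Lemma upper_scal (c : R) z : 0 < c -> upper z -> upper (c * z).
Proof. unfold upper. intros Hc Hz. replace (Im (c * z)) with (c * Im z)%R by (unfold Im; simpl; ring). nra. Qed.

Definition pi2 : C := 2 * PI * Ci.

Section Serre.
Variable z : C.
Hypothesis Hz : upper z.
Let w (c d : Z) : C := IZR c * z + IZR d.

Lemma w_nz c d : c <> 0%Z -> w c d <> 0.
Proof. intros H. apply czd_nz; [go|]. left. now apply not_0_IZR. Qed.

(** The subtracted term makes the double series absolutely convergent, of order |cz+d|^(-4), and does not change the row
    sums, by [tele_row]. *)
Definition sa (p : Z * Z) : C := let (c, d) := p in
  if Z.eqb c 0 then 0 else / (w c d * w c d) - / (w c d * w c d - 1).

Lemma w_sq_low c d : c <> 0%Z -> lowc z / 3 * (IZR c * IZR c + IZR d * IZR d) <= Cmod (w c d * w c d - 1).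
Proof.
intros Hc. replace (w c d * w c d - 1) with ((w c (d - 1)) * (w c (d + 1))).
2:{ unfold w. rewrite minus_IZR, plus_IZR, RtoC_minus, RtoC_plus. ring. } rewrite Cmod_mult.
set (A := (lowc z / 3 * (IZR c * IZR c + IZR d * IZR d))%R). have Hl := lowc_pos z Hz.
have Hc1 : 1 <= IZR c * IZR c by (rewrite <- mult_IZR; apply IZR_le; nia).
have B : forall e : Z, (e = d - 1 \/ e = d + 1)%Z -> A <= Cmod (w c e) * Cmod (w c e).
{ intros e He. eapply Rle_trans; [|apply (lowc_spec z (IZR c) (IZR e) Hz)]. unfold A.
 replace (lowc z / 3 * (IZR c * IZR c + IZR d * IZR d))%R with (lowc z * ((IZR c * IZR c + IZR d * IZR d) / 3))%R by field.
 apply Rmult_le_compat_l; [lra|]. have Q1 := Rle_0_sqr (2 * IZR d - 3). have Q2 := Rle_0_sqr (2 * IZR d + 3). unfold Rsqr in Q1, Q2.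
 destruct He as [He|He]; subst e; rewrite ?minus_IZR, ?plus_IZR; lra. } have B1 := B (d - 1)%Z (or_introl eq_refl).
have B2 := B (d + 1)%Z (or_intror eq_refl). set (x := Cmod (w c (d - 1))) in *. set (y := Cmod (w c (d + 1))) in *. assert (0 <= x) by go.
assert (0 <= y) by go. have HA : 0 <= A. { unfold A. go. } destruct (Rle_lt_dec A (x * y)) as [|Hlt]; [go|].
assert ((x * y) * (x * y) < A * A) by (apply Rmult_le_0_lt_compat; try assumption; now apply Rmult_le_pos). nra.
Qed.

Lemma w_sq_nz c d : c <> 0%Z -> w c d * w c d - 1 <> 0.
Proof.
intros Hc. apply Cmod_pos_nz. eapply Rlt_le_trans; [|now apply w_sq_low]. have Hl := lowc_pos z Hz.
have Hc1 : 1 <= IZR c * IZR c by (rewrite <- mult_IZR; apply IZR_le; nia). go.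
Qed.

Definition saM : R := (9 / (lowc z * lowc z))%R.

Lemma saM_pos : 0 < saM.
Proof. have Hl := lowc_pos z Hz. go. Qed.

Lemma sa_bound p : Cmod (sa p) <= saM * (qz (fst p) * qz (snd p)).
Proof.
destruct p as [c d]. unfold sa. pairs. have Hl := lowc_pos z Hz. destruct (Z.eqb_spec c 0) as [E|Hc].
{ rewrite Cmod_0. apply Rmult_le_pos; [go|]. apply Rmult_le_pos; left; apply qz_pos. } have N1 := w_nz c d Hc. have N2 := w_sq_nz c d Hc.
have L2 := w_sq_low c d Hc. have L1 := lowc_spec z (IZR c) (IZR d) Hz.
replace (/ (w c d * w c d) - / (w c d * w c d - 1)) with (- / ((w c d * w c d) * (w c d * w c d - 1))) by go.
rewrite Cmod_opp, Cmod_inv by go. rewrite (Cmod_mult (w c d * w c d)), Cmod_mult.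
have Hc1 : 1 <= IZR c * IZR c by (rewrite <- mult_IZR; apply IZR_le; nia). have Q := Rle_0_sqr (IZR d). unfold Rsqr in Q.
set (C2 := (IZR c * IZR c)%R) in *. set (D2 := (IZR d * IZR d)%R) in *. set (s := (C2 + D2)%R) in *. unfold saM, qz. fold C2 D2.
replace (9 / (lowc z * lowc z) * (/ (1 + C2) * / (1 + D2)))%R with (/ (lowc z * lowc z / 9 * ((1 + C2) * (1 + D2))))%R by (field; lra).
apply Rinv_le_contravar.
- go.
- have H1 : (1 + C2) * (1 + D2) <= 3 * (s * s) by (unfold s; nra). apply Rle_trans with (lowc z * lowc z / 9 * (3 * (s * s)))%R; [go|].
 replace (lowc z * lowc z / 9 * (3 * (s * s)))%R with ((lowc z * s) * (lowc z / 3 * s))%R by field. assert (0 <= s) by (unfold s; lra).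
 apply Rmult_le_compat; try assumption; apply Rmult_le_pos; lra.
Qed.

Lemma bnd_sa : bnd (fun p : Z * Z => saM * (qz (fst p) * qz (snd p)))%R.
Proof. have Hl := lowc_pos z Hz. go. Qed.

(** A row is a Lipschitz sum, up to the sign of c. *)
Lemma row_sum c : c <> 0%Z -> is_sum (fun d : Z => / (w c d * w c d)) (pi2 * pi2 * lam (Rabs (IZR c) * z)).
Proof.
intros Hc. have Hu : upper (Rabs (IZR c) * z) by (apply upper_scal; [apply Rabs_pos_lt; now apply not_0_IZR|go]). have H := lipschitz _ Hu.
destruct (Rle_lt_dec 0 (IZR c)) as [H0|H0].
- rewrite Rabs_pos_eq in * by go. apply (is_sum_ext (fun d => (fun n : Z => / ((IZR c * z - IZR n) * (IZR c * z - IZR n))) (- d)%Z)).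
 + intros d. unfold w. rewrite opp_IZR, RtoC_opp. do 2 f_equal; ring.
 + apply (is_sum_reindex (fun n : Z => / ((IZR c * z - IZR n) * (IZR c * z - IZR n))) Z.opp Z.opp); trivial; intros; lia.
- rewrite Rabs_left in * by go. apply is_sum_ext with (2 := H). intros d. f_equal. go.
Qed.

Lemma tele_part c N : c <> 0%Z -> lsum (fun d : Z => / (w c d * w c d - 1)) (zlist N) =
     / 2 * (/ w c (- Z.of_nat N - 1)%Z + / w c (- Z.of_nat N)%Z - / w c (Z.of_nat N) - / w c (Z.of_nat N + 1)%Z).
Proof.
intros Hc. set (T := fun d : Z => / w c d).
change (lsum (fun d : Z => / (w c d * w c d - 1)) (zlist N) = / 2 * (T (- Z.of_nat N - 1)%Z + T (- Z.of_nat N)%Z - T (Z.of_nat N) - T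
 (Z.of_nat N + 1)%Z)). have Ht : forall d, / (w c d * w c d - 1) = / 2 * (T (d - 1)%Z - T (d + 1)%Z).
{ intros d. unfold T. have N1 := w_nz c (d - 1) Hc. have N2 := w_nz c (d + 1) Hc.
 replace (w c d * w c d - 1) with ((w c (d - 1)) * (w c (d + 1))). 2:{ unfold w. rewrite minus_IZR, plus_IZR, RtoC_minus, RtoC_plus. ring. }
 replace (/ (w c (d - 1) * w c (d + 1))) with (/ 2 * ((w c (d + 1) - w c (d - 1)) / (w c (d - 1) * w c (d + 1)))).
 - go.
 - replace (w c (d + 1) - w c (d - 1)) with (RtoC 2).
  + go. + unfold w. rewrite minus_IZR, plus_IZR, RtoC_minus, RtoC_plus. go. } induction N as [|N IH].
- cbn [zlist lsum]. rewrite Ht. go.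
- cbn [zlist lsum]. rewrite IH, !Ht. replace (- Z.of_nat (S N) + 1)%Z with (- Z.of_nat N)%Z by lia.
 replace (Z.of_nat (S N) - 1)%Z with (Z.of_nat N) by lia. replace (- Z.of_nat N - 1)%Z with (- Z.of_nat (S N))%Z by lia.
 replace (Z.of_nat N + 1)%Z with (Z.of_nat (S N))%Z by lia. ring.
Qed.

Lemma tele_row c : c <> 0%Z -> is_sum (fun d : Z => / (w c d * w c d - 1)) 0.
Proof.
intros Hc. have Hl := lowc_pos z Hz. have Hc1 : 1 <= IZR c * IZR c by (rewrite <- mult_IZR; apply IZR_le; nia).
have Hb : forall d, Cmod (/ (w c d * w c d - 1)) <= / (lowc z / 3) * qz d.
{ intros d. rewrite Cmod_inv by now apply w_sq_nz. apply inv_qz_bound; [lra|]. eapply Rle_trans; [|now apply w_sq_low]. go. }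
destruct (is_sum_ex _ _ (bnd_scal qz (/ (lowc z / 3)) ltac:(left; apply Rinv_0_lt_compat; lra) bnd_qz) Hb) as [s Hs].
replace (RtoC 0) with s; [go|]. apply (is_sum_seq_limit _ s 0 zlist Hs); [apply NoDup_zlist|apply zlist_covers|].
set (T := fun d : Z => / w c d).
assert (Htel : forall N, lsum (fun d : Z => / (w c d * w c d - 1)) (zlist N) = / 2 * (T (- Z.of_nat N - 1)%Z + T (- Z.of_nat N)%Z - T
 (Z.of_nat N) - T (Z.of_nat N + 1)%Z)) by (intros N; now apply tele_part).
have HT : forall eps, 0 < eps -> exists N0 : nat, forall d : Z, INR N0 <= Rabs (IZR d) -> Cmod (T d) <= eps.
{ intros eps He. destruct (INR_unbounded (/ (eps * eps * lowc z) + 1)) as [N0 HN0]. exists N0. intros d Hd. have N1 := w_nz c d Hc.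
 unfold T. rewrite Cmod_inv by go. have P := proj1 (Cmod_gt_0 _) N1. have L := lowc_spec z (IZR c) (IZR d) Hz. fold (w c d) in L.
 set (x := Cmod (w c d)) in *. have Hep : 0 < eps * eps * lowc z by go. have Hi : 0 < / (eps * eps * lowc z) by go.
 have Hd2 : INR N0 * INR N0 <= IZR d * IZR d.
 { replace (IZR d * IZR d)%R with (Rabs (IZR d) * Rabs (IZR d))%R by (rewrite <- Rabs_mult; apply Rabs_pos_eq; apply Rle_0_sqr). go. }
 have H1 : / (eps * eps * lowc z) < IZR d * IZR d by nra. have H2 : 1 < eps * eps * lowc z * (IZR d * IZR d).
 { replace 1%R with (eps * eps * lowc z * / (eps * eps * lowc z))%R by (field; lra). go. } have H4 : 1 < eps * x.
 { assert (0 < eps * x) by go. nra. } apply Rmult_le_reg_r with x; [go|]. rewrite Rinv_l by lra. lra. } intros eps He.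
destruct (HT (eps / 2)%R ltac:(lra)) as [N0 HN0]. exists N0. intros N HN. rewrite Htel. unfold Cminus at 1. vanish (- RtoC 0).
rewrite Cplus_0_r. have HZ : IZR (Z.of_nat N) = INR N by (symmetry; apply INR_IZR_INZ).
have HN1 : 0 <= INR N0 <= INR N by (split; [go|now apply le_INR]). have B1 : Cmod (T (- Z.of_nat N - 1)%Z) <= eps / 2.
{ apply HN0. rewrite minus_IZR, opp_IZR, HZ, Rabs_left1; lra. } have B2 : Cmod (T (- Z.of_nat N)%Z) <= eps / 2.
{ apply HN0. rewrite opp_IZR, HZ, Rabs_left1; lra. } have B3 : Cmod (T (Z.of_nat N)%Z) <= eps / 2.
{ apply HN0. rewrite HZ, Rabs_pos_eq; lra. } have B4 : Cmod (T (Z.of_nat N + 1)%Z) <= eps / 2.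
{ apply HN0. rewrite plus_IZR, HZ, Rabs_pos_eq; lra. } rewrite Cmod_mult, Cmod_inv, Cmod_R, Rabs_pos_eq by go.
set (t1 := T (- Z.of_nat N - 1)%Z) in *. set (t2 := T (- Z.of_nat N)%Z) in *. set (t3 := T (Z.of_nat N)) in *.
set (t4 := T (Z.of_nat N + 1)%Z) in *. have S1 := Cmod_triangle (t1 + t2 - t3) (- t4). have S2 := Cmod_triangle (t1 + t2) (- t3).
have S3 := Cmod_triangle t1 t2. rewrite Cmod_opp in S1, S2. change (t1 + t2 + - t3) with (t1 + t2 - t3) in S2.
change (t1 + t2 - t3 + - t4) with (t1 + t2 - t3 - t4) in S1. lra.
Qed.

Definition s' : C := - / z.
Definition inv2 (d : Z) : C := if Z.eqb d 0 then 0 else / (IZR d * IZR d).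

(** Since cz + d = z(c - d s') with s' = -1/z, columns are rows for -1/z. *)
Lemma col_sum d : is_sum (fun c : Z => if Z.eqb c 0 then 0 else / (w c d * w c d))
  (if Z.eqb d 0 then PI * PI / 3 / (z * z) else pi2 * pi2 * lam (Rabs (IZR d) * s') / (z * z) - inv2 d).
Proof.
have Hn := upper_nz z Hz. have Hs := opp_upper z Hz. destruct (Z.eqb_spec d 0) as [E|E].
- subst. have H := is_sum_scal (/ (z * z)) _ _ zeta2. replace (PI * PI / 3 / (z * z)) with (/ (z * z) * (PI * PI / 3)) by go.
 apply is_sum_ext with (2 := H). intros c. destruct (Z.eqb_spec c 0) as [Ec|Ec]; [ring|]. unfold w. go.
- have Hu : upper (Rabs (IZR d) * s') by (apply upper_scal; [apply Rabs_pos_lt; now apply not_0_IZR|go]). have H := lipschitz _ Hu.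
 have H1 : is_sum (fun c : Z => / ((IZR d * s' - IZR c) * (IZR d * s' - IZR c))) (pi2 * pi2 * lam (Rabs (IZR d) * s')).
 { destruct (Rle_lt_dec 0 (IZR d)) as [H0|H0].
  - rewrite Rabs_pos_eq in * by go. exact H.
  - rewrite Rabs_left in * by go.
   apply (is_sum_ext (fun c => (fun n : Z => / (((- IZR d)%R * s' - IZR n) * ((- IZR d)%R * s' - IZR n))) (- c)%Z)).
   + intros c. rewrite opp_IZR, !RtoC_opp. f_equal. ring.
   + apply (is_sum_reindex (fun n : Z => / (((- IZR d)%R * s' - IZR n) * ((- IZR d)%R * s' - IZR n))) Z.opp Z.opp); trivial; intros; lia. }
 have H2 := is_sum_scal (/ (z * z)) _ _ H1. have H3 := is_sum_single (inv2 d). replace (pi2 * pi2 * lam (Rabs (IZR d) * s') / (z * z)) with (/ (z * z) * (pi2 * pi2 * lam (Rabs (IZR d) * s'))) by go.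
 apply is_sum_ext with (2 := is_sum_minus _ _ _ _ H2 H3). intros c.
 have Ew : (IZR d * s' - IZR c) * (IZR d * s' - IZR c) = w c d * w c d / (z * z). { unfold w, s'. go. } rewrite Ew. unfold inv2.
 destruct (Z.eqb_spec d 0) as [Ed|Ed]; [go|]. destruct (Z.eqb_spec c 0) as [Ec|Ec].
 + subst. unfold w. go. + have N1 := w_nz c d Ec. go.
Qed.

Definition row (x : C) (c : Z) : C := if Z.eqb c 0 then 0 else pi2 * pi2 * lam (Rabs (IZR c) * x).

Lemma is_sum_rows s : is_sum sa s -> is_sum (row z) s.
Proof.
intros Hs. apply (is_sum_fubini sa _ (row z) s bnd_sa sa_bound Hs). intros c. unfold row, sa.
destruct (Z.eqb_spec c 0) as [E|E]; [now apply is_sum_0|].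
replace (pi2 * pi2 * lam (Rabs (IZR c) * z)) with (pi2 * pi2 * lam (Rabs (IZR c) * z) - 0) by ring.
apply is_sum_minus; [now apply row_sum|now apply tele_row].
Qed.

Definition VV (m : R) : C := PI * Ci / z * ((ee (m * s') + 1) / (ee (m * s') - 1)) + / m.

Lemma cot_row (m : R) : 0 < m ->
  is_sum (fun c : Z => if Z.eqb c 0 then 0 else m / (IZR c * z * (IZR c * z) - m * m)) (VV m).
Proof.
intros Hm. have Hn := upper_nz z Hz. have Hs := opp_upper z Hz. have Hu : upper (m * s') by now apply upper_scal.
have Hq : ee (m * s') - 1 <> 0.
{ intros E. apply (upper_ee_1 _ Hu). replace (1 - ee (m * s')) with (- (ee (m * s') - 1)) by ring. rewrite E. ring. }
have H := is_sum_scal (- m / (z * z)) _ _ (cot_sum _ Hu). have H3 := is_sum_single (- / m).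
replace (VV m) with (- m / (z * z) * (PI * Ci / (m * s') * ((ee (m * s') + 1) / (ee (m * s') - 1))) - - / m).
2:{ unfold VV. unfold s' at 1. go. } apply is_sum_ext with (2 := is_sum_minus _ _ _ _ H H3). intros c. destruct (Z.eqb_spec c 0) as [Ec|Ec].
- subst. unfold s'. go.
- have Hnz : IZR c * z * (IZR c * z) - m * m <> 0.
 { replace (IZR c * z * (IZR c * z) - m * m) with ((IZR c * z + m) * (IZR c * z + (- m)%R)) by go.
  apply Cmult_neq_0; apply czd_nz; trivial; left; now apply not_0_IZR. }
 replace (m * s' * (m * s') - IZR c * IZR c) with (- (IZR c * z * (IZR c * z) - m * m) / (z * z)).
 + go. + unfold s'. go.
Qed.

Lemma VV_limit eps : 0 < eps -> exists N0 : nat, forall N, (N0 <= N)%nat -> Cmod (VV (INR N) + PI * Ci / z) <= eps.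
Proof.
intros He. have Hn := upper_nz z Hz. have Hs := opp_upper z Hz. set (x := Cmod (ee s')). have Hx : x < 1 by now apply upper_ee_lt.
have Hx0 : 0 <= x by go. set (K := Cmod (PI * Ci / z)). have HK : 0 <= K by go. set (e1 := Rmin (/ 2) (eps / (8 * (K + 1)))).
have He1 : 0 < e1 by go. destruct (pow_lt_1_zero x ltac:(rewrite Rabs_pos_eq; lra) e1 He1) as [N1 HN1].
destruct (INR_unbounded (2 / eps)) as [N2 HN2]. exists (S (Nat.max N1 N2)). intros N HN. have HNp : 0 < INR N by (apply lt_0_INR; lia).
have Hu : upper (INR N * s') by now apply upper_scal. have Hq : ee (INR N * s') - 1 <> 0.
{ intros E. apply (upper_ee_1 _ Hu). replace (1 - ee (INR N * s')) with (- (ee (INR N * s') - 1)) by ring. rewrite E. ring. }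
set (u := ee (INR N * s')) in *. have Eu : Cmod u = (x ^ N)%R.
{ unfold u, x. rewrite <- Cmod_pow. f_equal. unfold ee. rewrite Cexp_pow. f_equal. ring. } specialize (HN1 N ltac:(lia)).
rewrite Rabs_pos_eq in HN1 by go. apply lt_rmin in HN1. unfold VV. fold u.
replace (PI * Ci / z * ((u + 1) / (u - 1)) + / INR N + PI * Ci / z) with (PI * Ci / z * (2 * u / (u - 1)) + / INR N) by go. tri.
rewrite (Cmod_mult (PI * Ci / z)). fold K. rewrite Cmod_inv, Cmod_R, Rabs_pos_eq by go. have B1 : Cmod (2 * u / (u - 1)) <= 4 * Cmod u.
{ rewrite Cmod_div, Cmod_mult, Cmod_R, Rabs_pos_eq by go. have T := Cmod_tri_inv 1 u. rewrite Cmod_1, (Cmod_symm 1 u) in T.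
 apply Rmult_le_reg_r with (Cmod (u - 1)); [lra|]. unfold Rdiv. rewrite Rmult_assoc, Rinv_l, Rmult_1_r by lra. have P := Cmod_ge_0 u. nra. }
have B2 : K * Cmod (2 * u / (u - 1)) <= eps / 2.
{ apply Rle_trans with (K * (4 * (eps / (8 * (K + 1)))))%R; [go|]. apply Rmult_le_reg_r with (8 * (K + 1))%R; [lra|].
 replace (K * (4 * (eps / (8 * (K + 1)))) * (8 * (K + 1)))%R with (K * 4 * eps)%R by (field; lra). nra. } have B3 : / INR N <= eps / 2.
{ replace (eps / 2)%R with (/ (2 / eps))%R by (field; lra). apply Rinv_le_contravar; [go|]. assert (INR N2 <= INR N) by (apply le_INR; lia).
 lra. } lra.
Qed.

(** Summation by columns. The subtracted series, which sums to 0 by rows, has partial sums [VV N + VV (N+1)] by columns,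
    in cotangent values; their limit is the anomalous term in 1/z. *)
Lemma serre s r' : is_sum sa s -> is_sum (row s') r' ->
  s = r' / (z * z) - PI * PI / 3 + PI * PI / 3 / (z * z) + pi2 / z.
Proof.
intros Hs Hr. have Hn := upper_nz z Hz.
set (col := fun d : Z => if Z.eqb d 0 then PI * PI / 3 / (z * z) else pi2 * pi2 * lam (Rabs (IZR d) * s') / (z * z) - inv2 d).
have Hcol : is_sum col (r' / (z * z) - PI * PI / 3 + PI * PI / 3 / (z * z)).
{ have H3 := is_sum_single (PI * PI / 3 / (z * z)). replace (r' / (z * z)) with (/ (z * z) * r') by go.
 apply is_sum_ext with (2 := is_sum_plus _ _ _ _ (is_sum_minus _ _ _ _ (is_sum_scal (/ (z * z)) _ _ Hr) zeta2) H3). intros d.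
 unfold col, row, inv2. destruct (Z.eqb_spec d 0) as [E|E]; unfold Cdiv; ring. }
have Hg : forall d, exists g, is_sum (fun c : Z => sa (c, d)) g.
{ intros d. apply (is_sum_ex _ (fun c => saM * qz d * qz c)%R).
 - apply bnd_scal; [|go]. apply Rmult_le_pos; [left; apply saM_pos|go].
 - intros c. have H := sa_bound (c, d). cbn [fst snd] in H. lra. } set (g := fun d => SUM (fun c : Z => sa (c, d))).
have Hgs : forall d, is_sum (fun c : Z => sa (c, d)) (g d).
{ intros d. apply (epsilon_spec (inhabits (RtoC 0)) (is_sum (fun c : Z => sa (c, d)))). go. } have Hgt : is_sum g s.
{ have Hsw : is_sum (fun p : Z * Z => sa (snd p, fst p)) s.
 { apply (is_sum_reindex sa (fun p : Z * Z => (snd p, fst p)) (fun p => (snd p, fst p))); trivial; intros [a b]; reflexivity. }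
 apply (is_sum_fubini (fun p : Z * Z => sa (snd p, fst p)) (fun p => saM * (qz (fst p) * qz (snd p)))%R g s); trivial.
 - apply bnd_sa. - intros [a b]. have H := sa_bound (b, a). cbn [fst snd] in *. lra. } set (B := fun d => col d - g d).
have HB : is_sum B (r' / (z * z) - PI * PI / 3 + PI * PI / 3 / (z * z) - s) by now apply is_sum_minus.
have HBd : forall d, is_sum (fun c : Z => if Z.eqb c 0 then 0 else / (w c d * w c d - 1)) (B d).
{ intros d. apply is_sum_ext with (2 := is_sum_minus _ _ _ _ (col_sum d) (Hgs d)). intros c. unfold sa. destruct (Z.eqb_spec c 0); ring. }
have Hpart : forall N, (1 <= N)%nat -> lsum B (zlist N) = VV (INR N) + VV (INR (S N)).
{ intros N HN. apply (is_sum_unique (fun c : Z => lsum (fun d => if Z.eqb c 0 then 0 else / (w c d * w c d - 1)) (zlist N))).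
 - generalize (zlist N). intros L. induction L as [|d L IH]; cbn [lsum]; [now apply is_sum_0|]. now apply is_sum_plus.
 - have P1 : 0 < INR N by (apply lt_0_INR; lia). have P2 : 0 < INR (S N) by (apply lt_0_INR; lia).
  apply is_sum_ext with (2 := is_sum_plus _ _ _ _ (cot_row _ P1) (cot_row _ P2)). intros c.
  destruct (Z.eqb_spec c 0) as [E|E]; [rewrite lsum_zero by reflexivity; ring|]. rewrite tele_part by go.
  have E1 : forall k : Z, IZR c * z * (IZR c * z) - IZR k * IZR k = w c k * w c (- k).
  { intros k. unfold w. rewrite opp_IZR, RtoC_opp. ring. } replace (- Z.of_nat N - 1)%Z with (- Z.of_nat (S N))%Z by lia.
  replace (Z.of_nat N + 1)%Z with (Z.of_nat (S N)) by lia. rewrite !INR_IZR_INZ, !E1.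
  have E2 : forall k : Z, IZR k / (w c k * w c (- k)) = / 2 * (/ w c (- k) - / w c k).
  { intros k. have N1 := w_nz c k E. have N2 := w_nz c (- k) E.
   replace (RtoC (IZR k)) with ((w c k - w c (- k)) / 2) by (unfold w; rewrite opp_IZR, RtoC_opp; field). go. } rewrite !E2. ring. }
have HE : r' / (z * z) - PI * PI / 3 + PI * PI / 3 / (z * z) - s = - pi2 / z.
{ apply (is_sum_seq_limit B _ _ zlist HB); [apply NoDup_zlist|apply zlist_covers|]. intros eps He.
 destruct (VV_limit (eps / 2)%R ltac:(lra)) as [N0 HN0]. exists (S N0). intros N HN. rewrite Hpart by lia. have V1 := HN0 N ltac:(lia).
 have V2 := HN0 (S N) ltac:(lia).
 replace (_ - _) with ((VV (INR N) + PI * Ci / z) + (VV (INR (S N)) + PI * Ci / z)) by (unfold pi2; field; assumption). tri. lra. }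
replace s with (r' / (z * z) - PI * PI / 3 + PI * PI / 3 / (z * z) - (r' / (z * z) - PI * PI / 3 + PI * PI / 3 / (z * z) - s)) by ring.
rewrite HE at 1. go.
Qed.
End Serre.

Lemma row_summable z : upper z -> exists s, is_sum (row z) s /\ is_sum (sa z) s.
Proof. intros Hz. destruct (is_sum_ex (sa z) _ (bnd_sa z Hz) (sa_bound z Hz)) as [s Hs]. exists s. split; [now apply is_sum_rows|go]. Qed.
Lemma row_trans z s r : upper z -> is_sum (row z) s -> is_sum (row (- / z)) r ->
  s = r / (z * z) - PI * PI / 3 + PI * PI / 3 / (z * z) + pi2 / z.
Proof. intros Hz Hs Hr. destruct (row_summable z Hz) as [s1 [H1 H2]]. rewrite (is_sum_unique _ _ _ Hs H1). now apply (serre z Hz). Qed.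

(** * The logarithm of the eta function *)

Lemma nat_sum_lim (a : nat -> C) s : is_sum a s -> forall eps, 0 < eps ->
  exists N, forall n, (N <= n)%nat -> Cmod (lsum a (seq 0 (S n)) - s) <= eps.
Proof.
intros H eps He. destruct (H eps He) as [L0 H0]. exists (list_max L0). intros n Hn. apply H0; [apply seq_NoDup|]. intros k Hk. apply in_seq.
have Hm := proj1 (list_max_le L0 (list_max L0)) (Nat.le_refl _). rewrite Forall_forall in Hm. specialize (Hm k Hk). lia.
Qed.

Lemma lsum_seq_S (a : nat -> C) n : lsum a (seq 0 (S n)) = lsum a (seq 0 n) + a n.
Proof. rewrite seq_S, lsum_app. go. Qed.
Lemma sum_f_lsum (g : C -> R) (a : nat -> C) n : (forall u v, g (u + v) = (g u + g v)%R) ->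
  sum_f_R0 (fun k => g (a k)) n = g (lsum a (seq 0 (S n))).
Proof. intros Hg. induction n as [|n IH]; [simpl; f_equal; ring|]. simpl sum_f_R0. rewrite IH, (lsum_seq_S a (S n)), Hg. go. Qed.

Lemma Cseries_sum (a : nat -> C) s : is_sum a s -> Cseries a = s.
Proof.
intros H. unfold Cseries.
have G : forall g : C -> R, (forall u v, g (u + v) = (g u + g v)%R) -> (forall u, Rabs (g u) <= Cmod u) -> (forall u : C, g (Copp u) = (- g
 u)%R) -> Series (fun n => g (a n)) = g s.
{ intros g Hg Hb Ho. apply is_series_unique, is_series_Reals. intros eps He. destruct (nat_sum_lim a s H (eps / 2)%R ltac:(lra)) as [N HN].
 exists N. intros n Hn. rewrite sum_f_lsum by go. unfold R_dist. specialize (HN n Hn).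
 replace (g (lsum a (seq 0 (S n))) - g s)%R with (g (lsum a (seq 0 (S n)) - s)).
 - eapply Rle_lt_trans; [apply Hb|]. lra.
 - unfold Cminus. rewrite Hg, Ho. ring. } rewrite (G Re), (G Im); try reflexivity; try (intros; apply im_le_Cmod).
- go. - intros u. have X := Rmax_Cmod u. have Y := Rmax_l (Rabs (fst u)) (Rabs (snd u)). unfold Re. lra.
Qed.

Lemma nat_split (f : nat -> C) s : is_sum (fun n => f (S n)) s -> is_sum f (f 0%nat + s).
Proof.
intros H. apply is_sum_ext with (f := fun n => (if Nat.eqb n 0 then f 0%nat else 0) + (if Nat.eqb n 0 then 0 else f n)).
{ intros n. destruct (Nat.eqb_spec n 0); [subst|]; ring. } apply is_sum_plus.
- have E : lsum (fun n => if Nat.eqb n 0 then f 0%nat else 0) (0%nat :: nil) = f 0%nat by go.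
 have H1 : is_sum (fun n => if Nat.eqb n 0 then f 0%nat else 0) (lsum (fun n => if Nat.eqb n 0 then f 0%nat else 0) (0%nat :: nil)).
 2:{ now rewrite E in H1. } apply is_sum_finite; [repeat constructor; intros []|]. intros n Hn.
 destruct (Nat.eqb_spec n 0); [subst; exfalso; apply Hn; now left|go].
- apply (is_sum_inj _ S pred).
 + go. + intros [|n]; [go|go]. + exact H.
Qed.

Lemma exp_INR (a : R) n : (exp (a * INR n) = exp a ^ n)%R.
Proof.
induction n as [|n IH]; [simpl; now rewrite Rmult_0_r, exp_0|]. rewrite S_INR, Rmult_plus_distr_l, Rmult_1_r, exp_plus, IH. simpl. ring.
Qed.

Lemma ee_pow n z : ee (INR n * z) = Cpow (ee z) n.
Proof.
induction n as [|n IH].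
- rewrite Cmult_0_l. apply ee_0. - rewrite S_INR, RtoC_plus, Cmult_plus_distr_r, ee_plus, IH, Cmult_1_l. go.
Qed.

Lemma exp_mono x y : x <= y -> exp x <= exp y.
Proof. intros [H|H]; [left; now apply exp_increasing|subst; lra]. Qed.

Lemma ee_geom m z n : m <= Im z -> Cmod (ee (INR n * z)) <= exp (- (2 * PI * m)) ^ n.
Proof.
intros Hm. rewrite ee_pow. have Hp : Cmod (Cpow (ee z) n) = (Cmod (ee z) ^ n)%R.
{ induction n as [|n IH]; simpl; [apply Cmod_1|]. now rewrite Cmod_mult, IH. } rewrite Hp. apply pow_incr. split; [go|]. rewrite Cmod_ee.
apply exp_mono. have P := PI_RGT_0. nra.
Qed.

Lemma q_range m : 0 < m -> 0 <= exp (- (2 * PI * m)) < 1.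
Proof. intros Hm. split; [go|]. rewrite <- exp_0. apply exp_increasing. have P := PI_RGT_0. go. Qed.

Lemma geom_deriv_sum y : Cmod y < 1 -> is_sum (fun c : nat => INR (S c) * Cpow y (S c)) (y / ((1 - y) * (1 - y))).
Proof.
intros Hy. have P := Cmod_ge_0 y. have Hp : forall n, Cmod (Cpow y n) = (Cmod y ^ n)%R.
{ induction n as [|n IH]; simpl; [apply Cmod_1|]. now rewrite Cmod_mult, IH. } have Hn : 1 - y <> 0.
{ intros E. replace y with (1 - (1 - y)) in Hy by ring. rewrite E in Hy. replace (1 - 0) with (RtoC 1) in Hy by ring. rewrite Cmod_1 in Hy.
 lra. } destruct (is_sum_ex (fun c : nat => Cpow y (S c)) (fun n => Cmod y ^ n)%R) as [G HG]. { now apply bnd_geom. }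
{ intros n. rewrite Hp. simpl. have Q := pow_le (Cmod y) n P. nra. }
destruct (is_sum_ex (fun c : nat => INR (S c) * Cpow y (S c)) (fun n => INR (S n) ^ 3 * Cmod y ^ n)%R) as [S0 HS].
{ now apply bnd_geom_poly. }
{ intros n. rewrite Cmod_mult, Hp, Cmod_R, Rabs_pos_eq by go. rewrite S_INR. simpl. have Q := pow_le (Cmod y) n P. have R := pos_INR n.
 set (t := INR n) in *. set (u := (Cmod y ^ n)%R) in *. assert ((t + 1) * (Cmod y * u) <= (t + 1) * u) by (apply Rmult_le_compat_l; nra).
 go. } have EG : G = y * (1 + G). { apply (is_sum_unique _ _ _ HG). apply is_sum_scal. apply (nat_split (fun c => Cpow y c)). go. }
have ES : S0 - y * S0 = G.
{ apply (is_sum_unique (fun c : nat => INR (S c) * Cpow y (S c) - y * (INR c * Cpow y c))).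
 - apply is_sum_minus; [go|]. apply is_sum_scal. replace S0 with (INR 0 * Cpow y 0 + S0) by go.
  now apply (nat_split (fun c => INR c * Cpow y c)).
 - apply is_sum_ext with (2 := HG). intros c. rewrite S_INR, RtoC_plus. go. } replace (y / ((1 - y) * (1 - y))) with S0; [go|].
have EG2 : G = y / (1 - y). { replace G with ((G - y * G) / (1 - y)) by go. rewrite EG at 1. go. }
replace S0 with ((S0 - y * S0) / (1 - y)) by go. rewrite ES, EG2. go.
Qed.

(** The double series of sigma_{-1}(n) q^n. *)
Definition qt (p : nat * nat) (z : C) : C := / INR (S (fst p)) * ee (INR (S (fst p) * S (snd p)) * z).
Definition sg (z : C) : C := SUM (fun p => qt p z).
Definition qm (m : R) (p : nat * nat) : R := (exp (- (2 * PI * m)) ^ fst p * exp (- (2 * PI * m)) ^ snd p)%R.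

Lemma bnd_qm m : 0 < m -> bnd (qm m).
Proof. intros Hm. apply bnd_prod; apply bnd_geom; now apply q_range. Qed.

Lemma ee_qm m z p : 0 < m -> m <= Im z -> Cmod (ee (INR (S (fst p) * S (snd p)) * z)) <= qm m p.
Proof.
intros Hm Hz. destruct p as [d c]. unfold qm. simpl fst. simpl snd. eapply Rle_trans; [apply (ee_geom m); assumption|]. rewrite <- pow_add.
replace (S d * S c)%nat with ((d + c) + (1 + d * c))%nat by lia. rewrite pow_add. have Q := q_range m Hm. set (x := exp _) in *.
have P1 := pow_le x (d + c) (proj1 Q). have P2 : x ^ (1 + d * c) <= 1. { rewrite <- (pow1 (1 + d * c)). apply pow_incr. lra. } nra.
Qed.

Lemma INR_S_ge n : 1 <= INR (S n).
Proof. rewrite S_INR. have H := pos_INR n. lra. Qed.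
Lemma INR_S_nz n : RtoC (INR (S n)) <> 0.
Proof. apply RtoC_nz. have H := INR_S_ge n. lra. Qed.

Lemma qt_bound m z p : 0 < m -> m <= Im z -> Cmod (qt p z) <= qm m p.
Proof.
intros Hm Hz. unfold qt. rewrite Cmod_mult, Cmod_inv by apply INR_S_nz. have H1 := INR_S_ge (fst p). rewrite Cmod_R, Rabs_pos_eq by lra.
have H2 := ee_qm m z p Hm Hz. have H3 : / INR (S (fst p)) <= 1 by (rewrite <- Rinv_1; apply Rinv_le_contravar; lra).
have H5 := Cmod_ge_0 (ee (INR (S (fst p) * S (snd p)) * z)). nra.
Qed.

Lemma sg_spec z : upper z -> is_sum (fun p => qt p z) (sg z).
Proof. intros Hz. apply (SUM_spec _ (qm (Im z))); [now apply bnd_qm|]. intros p. apply qt_bound; [go|lra]. Qed.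

Lemma disc_im z0 r z : disc z0 r z -> Im z0 - r < Im z.
Proof.
intros H. unfold disc in H. have X := im_le_Cmod (z - z0). replace (Im (z - z0)) with (Im z - Im z0)%R in X by go.
have Y := Rle_abs (- (Im z - Im z0)). rewrite Rabs_Ropp in Y. lra.
Qed.

Lemma disc_upper z0 z : upper z0 -> disc z0 (Im z0 / 2) z -> Im z0 / 2 <= Im z /\ upper z.
Proof. intros H0 H. apply disc_im in H. unfold upper in *. lra. Qed.
Lemma ana_qt p z : ana (qt p) z.
Proof. go. Qed.

Lemma dd_qt p z : dd (qt p) z = pi2 * (INR (S (snd p)) * ee (INR (S (fst p) * S (snd p)) * z)).
Proof.
apply cder_dd. wd_by (apply wd_mult; [apply wd_const|apply wd_ee, wd_mult; [apply wd_const|apply (wd_io idC)]]).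
- rewrite mult_INR, RtoC_mult. unfold pi2. field. apply INR_S_nz. - cring.
Qed.

Lemma ana_sg z : upper z -> ana sg z.
Proof.
intros Hz. have H2 : 0 < Im z / 2 by go. apply (ana_SUM qt sg _ z (Im z / 2)%R H2 (bnd_qm _ H2)).
- intros p y Hy. split; [apply ana_qt|]. apply qt_bound; [go|]. now apply disc_upper.
- intros y Hy. apply sg_spec. now apply (disc_upper z y Hz).
Qed.

(** Minus the logarithmic derivative of the product is half a weight two Eisenstein series. *)
Lemma dd_sg z s : upper z -> is_sum (row z) s -> s = 2 * pi2 * dd sg z.
Proof.
intros Hz Hs. have Hy : 0 < Im z by go. have H2 : 0 < Im z / 2 by lra. have HD : is_sum (fun p => dd (qt p) z) (dd sg z).
{ apply (dd_SUM qt sg _ z (Im z / 2)%R H2 (bnd_qm _ H2)).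
 - intros p y Hy1. split; [apply ana_qt|]. apply qt_bound; [go|]. now apply disc_upper.
 - intros y Hy1. apply sg_spec. now apply (disc_upper z y Hz). } set (x := exp (- (2 * PI * Im z))). have Hx := q_range (Im z) Hy.
have HL : is_sum (fun d : nat => pi2 * lam (INR (S d) * z)) (dd sg z).
{ apply (is_sum_fubini _ (fun p => Cmod pi2 * (x ^ fst p * (INR (S (snd p)) ^ 3 * x ^ snd p)))%R) with (3 := HD).
 - apply bnd_scal; [go|]. apply (bnd_prod (fun n => x ^ n)%R (fun n => INR (S n) ^ 3 * x ^ n)%R).
  + now apply bnd_geom. + now apply bnd_geom_poly.
 - intros p. rewrite dd_qt, !Cmod_mult. apply Rmult_le_compat_l; [go|]. have H := ee_qm (Im z) z p Hy (Rle_refl _). unfold qm in H.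
  fold x in H. have G := INR_S_ge (snd p). rewrite Cmod_R, Rabs_pos_eq by lra. have P1 := pow_le x (fst p) (proj1 Hx).
  have P2 := pow_le x (snd p) (proj1 Hx). have P3 : 0 <= x ^ fst p * x ^ snd p by nra. set (t := INR (S (snd p))) in *.
  assert (t <= t ^ 3) by go. go.
 - intros d. apply is_sum_ext with (f := fun c : nat => pi2 * (INR (S c) * Cpow (ee (INR (S d) * z)) (S c))).
  { intros c. rewrite dd_qt. simpl fst. simpl snd. rewrite <- ee_pow. do 3 f_equal. rewrite mult_INR, RtoC_mult. ring. } apply is_sum_scal.
  apply geom_deriv_sum. apply upper_ee_lt. apply upper_scal; [|go]. have G := INR_S_ge d. lra. } apply (is_sum_scal pi2) in HL.
apply (is_sum_unique _ _ _ Hs). set (f1 := fun c : Z => if Z.ltb 0 c then row z c else 0).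
set (f2 := fun c : Z => if Z.ltb c 0 then row z c else 0). apply is_sum_ext with (f := fun c => f1 c + f2 c).
{ intros c. unfold f1, f2, row. destruct (Z.ltb_spec 0 c), (Z.ltb_spec c 0), (Z.eqb_spec c 0); try lia; ring. }
replace (2 * pi2 * dd sg z) with (pi2 * dd sg z + pi2 * dd sg z) by ring. apply is_sum_plus.
- apply (is_sum_inj _ (fun d : nat => Z.of_nat (S d)) (fun c => Z.to_nat (c - 1))).
 + go. + intros c. unfold f1. destruct (Z.ltb_spec 0 c); [go|go].
 + apply is_sum_ext with (2 := HL). intros d. unfold f1, row. destruct (Z.ltb_spec 0 (Z.of_nat (S d))); [|lia].
  destruct (Z.eqb_spec (Z.of_nat (S d)) 0); [lia|]. rewrite <- INR_IZR_INZ, Rabs_pos_eq by go. ring.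
- apply (is_sum_inj _ (fun d : nat => - Z.of_nat (S d))%Z (fun c => Z.to_nat (- c - 1))).
 + go. + intros c. unfold f2. destruct (Z.ltb_spec c 0); [go|go].
 + apply is_sum_ext with (2 := HL). intros d. unfold f2, row. destruct (Z.ltb_spec (- Z.of_nat (S d)) 0); [|lia].
  destruct (Z.eqb_spec (- Z.of_nat (S d)) 0); [lia|]. rewrite opp_IZR, Rabs_Ropp, <- INR_IZR_INZ, Rabs_pos_eq by go. ring.
Qed.

Lemma sum_n_m_lsum (f : nat -> R) (v : C) n : lsum (fun d => f (S d) * v) (seq 0 n) = sum_n_m f 1 n * v.
Proof.
induction n as [|n IH].
- rewrite sum_n_m_zero by lia. simpl. change (@zero R_AbelianMonoid) with 0%R. ring.
- rewrite lsum_seq_S, IH. destruct n as [|n].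
 + rewrite sum_n_m_zero by lia. rewrite sum_n_n. change (@zero R_AbelianMonoid) with 0%R. ring.
 + rewrite (sum_n_Sm f 1 (S n)) by lia. cbv [plus]. go.
Qed.

Lemma log_eta_eq z : upper z -> log_eta z = PI * Ci * z / 12 - sg z.
Proof.
intros Hz. unfold log_eta. f_equal. apply Cseries_sum.
apply (is_sum_fiber (fun p => pred (S (fst p) * S (snd p))) (fun p => qt p z) (qm (Im z))).
- now apply bnd_qm. - intros p. apply qt_bound; [go|lra]. - now apply sg_spec.
- intros n. apply (is_sum_inj _ (fun d => (d, pred (S n / S d)%nat)) fst).
 + go.
 + intros [d c]. simpl fst. simpl snd. destruct (eqd (pred (S d * S c)) n) as [E|E]; [left|go]. have E2 : S n = (S c * S d)%nat by lia.
  rewrite E2, Nat.div_mul by lia. go.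
 + unfold sigma_m1.
  rewrite <- sum_n_m_lsum, (lsum_ext _ (fun d => (if eqd (pred (S (fst (d, pred (S n / S d))) * S (snd (d, pred (S n / S d))))) n then qt
   (d, pred (S n / S d)) z else 0))).
  * apply is_sum_finite; [apply seq_NoDup|]. intros d Hd. pairs.
   destruct (eqd (pred (S d * S (pred (S n / S d)))) n) as [E|E]; [|go]. exfalso. apply Hd. apply in_seq. go.
  * intros d Hd. apply in_seq in Hd. pairs. have Hq : (S n / S d <> 0)%nat by (intros E; apply Nat.div_small_iff in E; lia).
   have Hdm := Nat.div_mod_eq (S n) (S d). replace (S (pred (S n / S d))) with (S n / S d)%nat by lia.
   destruct (Nat.eqb_spec (S n mod S d) 0) as [E|E].
   -- destruct (eqd (pred (S d * (S n / S d))) n) as [E2|E2]; [|lia]. unfold qt. pairs.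
    replace (S (pred (S n / S d))) with (S n / S d)%nat by lia. replace (S d * (S n / S d))%nat with (S n) by lia.
    rewrite ee_pow, RtoC_inv; [go|]. have G := INR_S_ge d. lra.
   -- destruct (eqd (pred (S d * (S n / S d))) n) as [E2|E2]; [lia|]. ring.
Qed.

(** * The transformation law of eta *)

Definition lg (z : C) : C := PI * Ci * z / 12 - sg z.

Lemma ana_lg z : upper z -> ana lg z.
Proof. intros Hz. apply ana_minus; [|now apply ana_sg]. go. Qed.
Lemma upper_disc z : upper z -> exists d, 0 < d /\ forall y, disc z d y -> upper y.
Proof. intros Hz. exists (Im z / 2)%R. split; [go|]. intros y Hy. now apply (disc_upper z y Hz). Qed.

Lemma const_upper (f : C -> C) z w : (forall y, upper y -> cder f y 0) -> upper z -> upper w -> f z = f w.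
Proof.
intros H Hz Hw. have E := const_of_rder0 (fun s : R => f (z + s * (w - z))). cbv beta in E. replace (z + 1%R * (w - z)) with w in E by ring.
replace (z + 0%R * (w - z)) with z in E by ring. symmetry. apply E. intros s [Hs0 Hs1]. have Hy : upper (z + s * (w - z)).
{ unfold upper in *. replace (Im (z + s * (w - z))) with ((1 - s) * Im z + s * Im w)%R by (unfold Im; simpl; ring). go. }
wd_by (apply (wd_comp_hol RtoC f (fun s : R => z + s * (w - z)) s 0); [go|apply rder_lin]); ring.
Qed.

Lemma slit_upper z : upper z -> slit z.
Proof. intros H [E _]. unfold upper in H. lra. Qed.
Lemma cder_lg z : upper z -> cder lg z (dd lg z).
Proof. intros H. apply ana_dd. now apply ana_lg. Qed.

Lemma dd_lg z s : upper z -> is_sum (row z) s -> dd lg z = PI * Ci / 12 - s / (2 * pi2).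
Proof.
intros Hz Hs. rewrite (dd_sg z s Hz Hs). apply cder_dd.
wd_by (apply wd_minus; [apply wd_mult; [apply wd_mult; [apply wd_const|apply (wd_io idC)]|apply wd_const]|apply ana_dd, ana_sg, Hz]).
- unfold pi2. go. - cring.
Qed.

Lemma cder_opp_inv (z : C) : z <> 0 -> cder (fun w => - / w) z (/ (z * z)).
Proof. intros H. wd_by (apply wd_opp, cder_inv, H); ring. Qed.
Lemma upper_Ci : upper Ci.
Proof. unfold upper, Im; simpl; lra. Qed.
Lemma INR12 : INR 12 = 12%R.
Proof. simpl. ring. Qed.

Lemma lg_S : exists K, Cexp (24 * K) = 1 /\ forall z, upper z -> lg (- / z) = lg z + / 2 * clog z + K.
Proof.
have H : forall y, upper y -> cder (fun z => lg (- / z) - lg z - / 2 * clog z) y 0.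
{ intros z Hz. have Hn := upper_nz z Hz. have Hz' := opp_upper z Hz. destruct (row_summable z Hz) as [s [Hs _]].
 destruct (row_summable _ Hz') as [r [Hr _]]. have T := row_trans z s r Hz Hs Hr.
 wd_by (apply wd_minus; [apply wd_minus; [apply (wd_comp_hol idC lg (fun z => - / z)); [apply cder_lg, Hz'|apply cder_opp_inv, Hn]|apply
  cder_lg, Hz]| apply wd_mult; [apply wd_const|apply cder_clog, slit_upper, Hz]]); [|ring].
 rewrite (dd_lg z s Hz Hs), (dd_lg _ r Hz' Hr), T. unfold pi2. have Hi : Ci * Ci = - (1) by (apply C_eq; simpl; ring).
 match goal with |- ?X = _ => replace X with (PI * (Ci * Ci + 1) * (1 - z * z) / (12 * Ci * (z * z))) end.
 - rewrite Hi. vanish (- (1) + 1). unfold Cdiv. ring.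
 - field. repeat split; trivial; try apply Ci_nz; apply PIC_nz. } set (K := lg (- / Ci) - lg Ci - / 2 * clog Ci).
have HK : forall z, upper z -> lg (- / z) = lg z + / 2 * clog z + K.
{ intros z Hz. have E := const_upper _ z Ci H Hz upper_Ci. cbv beta in E. fold K in E. rewrite <- E. ring. } exists K. split; [|exact HK].
have EI : - / Ci = Ci by (apply C_eq; simpl; field). have E := HK Ci upper_Ci. rewrite EI in E. have E2 : K = - (/ 2 * clog Ci).
{ replace K with (lg Ci + / 2 * clog Ci + K - lg Ci - / 2 * clog Ci) by ring. rewrite <- E. ring. } rewrite E2.
replace (24 * - (/ 2 * clog Ci)) with (- (INR 12 * clog Ci)) by (rewrite INR12; field).
rewrite Cexp_opp, <- Cexp_pow, Cexp_clog by apply Ci_nz. replace (Ci ^ 12) with ((Ci * Ci) ^ 6) by ring.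
replace (Ci * Ci) with (- (1)) by (apply C_eq; simpl; ring). field.
Qed.

Lemma sg_shift z (n : Z) : upper z -> sg (z + IZR n) = sg z.
Proof.
intros Hz. unfold sg. f_equal. apply functional_extensionality. intros p. unfold qt. f_equal.
rewrite Cmult_plus_distr_l, ee_plus, INR_IZR_INZ, <- RtoC_mult, <- mult_IZR, ee_Z. ring.
Qed.

Definition Dl (z : C) : C := Cexp (24 * lg z).

Lemma Dl_shift z (n : Z) : upper z -> Dl (z + IZR n) = Dl z.
Proof.
intros Hz. unfold Dl, lg. rewrite sg_shift by go.
replace (24 * (PI * Ci * (z + IZR n) / 12 - sg z)) with (24 * (PI * Ci * z / 12 - sg z) + 2 * PI * Ci * IZR n) by field. rewrite Cexp_plus.
change (Cexp (2 * PI * Ci * IZR n)) with (ee (IZR n)). rewrite ee_Z. ring.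
Qed.

Lemma Dl_S z : upper z -> Dl (- / z) = z ^ 12 * Dl z.
Proof.
intros Hz. destruct lg_S as [K [HK H]]. unfold Dl. rewrite H by go.
replace (24 * (lg z + / 2 * clog z + K)) with (INR 12 * clog z + 24 * lg z + 24 * K) by (rewrite INR12; field).
rewrite !Cexp_plus, HK, <- Cexp_pow, Cexp_clog by now apply upper_nz. ring.
Qed.

Lemma autj_nz (g : SL2Z) z : upper z -> autj g z <> 0.
Proof.
intros Hz. apply czd_nz; [assumption|]. have H := g_det g. destruct (Z.eq_dec (gc g) 0) as [E|E].
- right. intros E2. apply (eq_IZR _ 0) in E2. go. - left. intros E2. apply (eq_IZR _ 0) in E2. go.
Qed.

Lemma g_detR (g : SL2Z) : (IZR (ga g) * IZR (gd g) - IZR (gb g) * IZR (gc g) = 1)%R.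
Proof. rewrite <- !mult_IZR, <- minus_IZR. now rewrite g_det. Qed.

Lemma Im_mobius g z : upper z -> Im (mobius g z) = (Im z / (Cmod (autj g z) * Cmod (autj g z)))%R.
Proof.
intros Hz. have Hn := autj_nz g z Hz. have Hp := proj1 (Cmod_gt_0 _) Hn. have D := g_detR g. set (w := autj g z) in *.
have E : (Cmod w * Cmod w = Re w * Re w + Im w * Im w)%R. { unfold Cmod. rewrite sqrt_sqrt; [unfold Re, Im; ring|]. go. } rewrite E.
unfold Cdiv, Cinv, Im, Re in *. simpl in *.
apply Rmult_eq_reg_r with ((fst z * IZR (gc g) + IZR (gd g))^2 + (snd z * IZR (gc g))^2)%R; [|nra].
transitivity ((IZR (ga g) * IZR (gd g) - IZR (gb g) * IZR (gc g)) * snd z)%R; [|rewrite D]; field; nra.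
Qed.

Lemma mobius_upper g z : upper z -> upper (mobius g z).
Proof. intros Hz. unfold upper. rewrite Im_mobius by go. have Hp := proj1 (Cmod_gt_0 _) (autj_nz g z Hz). go. Qed.
Lemma unit_pair (a d : Z) : (a * d = 1)%Z -> (d = 1 /\ a = 1 \/ d = -1 /\ a = -1)%Z.
Proof. intros H. destruct (Z.eq_mul_1 _ _ H); subst; lia. Qed.

(** Euclid's algorithm on the lower left entry. *)
Lemma Dl_mobius_aux (n : nat) : forall g, (Z.abs_nat (gc g) <= n)%nat -> forall z, upper z ->
  Dl (mobius g z) = autj g z ^ 12 * Dl z.
Proof.
induction n as [|n IH]; intros [a b c d D] Hn z Hz; simpl in Hn.
- have Hc : c = 0%Z by lia. subst c. unfold mobius, autj. cbn [ga gb gc gd]. have Hd := unit_pair a d ltac:(lia).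
 destruct Hd as [[-> ->]|[-> ->]].
 + replace ((1 * z + IZR b) / (0 * z + 1)) with (z + IZR b) by (field; replace (0 * z + 1) with (RtoC 1) by ring; apply RtoC_nz; lra).
  rewrite Dl_shift by assumption. simpl. ring.
 + replace ((IZR (-1) * z + IZR b) / (0 * z + IZR (-1))) with (z + IZR (- b)).
  * rewrite Dl_shift by assumption. simpl. ring.
  * rewrite opp_IZR, RtoC_opp. replace (0 * z + IZR (-1)) with (RtoC (-1)) by ring. field; apply RtoC_nz; lra.
- destruct (Z.eq_dec c 0) as [Ec|Ec]. { apply (IH (mkSL2Z a b c d D)); [simpl; lia|assumption]. } set (q := (a / c)%Z).
 set (a' := (a - q * c)%Z). set (b' := (b - q * d)%Z). have Ha' : (Z.abs_nat a' <= n)%nat.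
 { have M := Z.mod_bound_or a c Ec. rewrite Z.mod_eq in M by assumption. assert (a' = a - c * (a / c))%Z by (unfold a', q; ring). lia. }
 have D1 : (a' * d - b' * c = 1)%Z by (unfold a', b'; rewrite <- D; ring). have D2 : (- c * b' - - d * a' = 1)%Z by go.
 set (g1 := mkSL2Z a' b' c d D1). set (g2 := mkSL2Z (- c) (- d) a' b' D2). have U2 := mobius_upper g2 z Hz. have N2 := autj_nz g2 z Hz.
 have N1 := autj_nz g1 z Hz. have I2 := IH g2 Ha' z Hz. have E2 : mobius g2 z = - autj g1 z / autj g2 z.
 { unfold mobius, autj. simpl. rewrite !opp_IZR, !RtoC_opp. go. } have E1 : mobius (mkSL2Z a b c d D) z = - / mobius g2 z + IZR q.
 { rewrite E2. unfold mobius, autj in *. simpl in *. have Ea : a = (a' + q * c)%Z by go. have Eb : b = (b' + q * d)%Z by go.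
  rewrite Ea, Eb, !plus_IZR, !mult_IZR, !RtoC_plus, !RtoC_mult. go. } rewrite E1, Dl_shift by now apply opp_upper.
 rewrite Dl_S, I2, E2 by go. change (autj (mkSL2Z a b c d D) z) with (autj g1 z). go.
Qed.

Lemma Dl_mobius g z : upper z -> Dl (mobius g z) = autj g z ^ 12 * Dl z.
Proof. apply (Dl_mobius_aux _ g (Nat.le_refl _)). Qed.

Lemma cder_mobius g z : upper z -> cder (mobius g) z (/ (autj g z * autj g z)).
Proof.
intros Hz. have Hn := autj_nz g z Hz. have D := f_equal RtoC (g_detR g). rewrite RtoC_minus, !RtoC_mult in D.
have Hlin : forall u v : R, cder (fun w => u * w + v) z u.
{ intros u v. wd_by (apply wd_plus; [apply wd_mult; [apply wd_const|apply (wd_io idC)]|apply wd_const]); cring. } unfold autj in *.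
wd_by (apply wd_mult; [go|apply wd_inv; [go|go]]); [|cring]. set (a := RtoC (IZR (ga g))) in *. set (b := RtoC (IZR (gb g))) in *.
set (c := RtoC (IZR (gc g))) in *. set (d := RtoC (IZR (gd g))) in *.
transitivity ((a * d - b * c) / ((c * z + d) * (c * z + d))); [|rewrite D]; field; assumption.
Qed.

Lemma ana_mobius g z : upper z -> ana (mobius g) z.
Proof. intros Hz. apply ana_div; [exact (autj_nz g z Hz)| |]; (apply ana_plus; [go|go]). Qed.

Lemma lg_mobius g : exists K, Cexp (24 * K) = 1 /\
  forall z, upper z -> lg (mobius g z) = lg z + / 2 * clog (autj g z) + K.
Proof.
set (k := fun z => lg (mobius g z) - lg z - / 2 * clog (autj g z)). have H1 : forall z, upper z -> Cexp (24 * k z) = 1.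
{ intros z Hz. have E := Dl_mobius g z Hz. unfold Dl in E. unfold k.
 replace (24 * (lg (mobius g z) - lg z - / 2 * clog (autj g z))) with (24 * lg (mobius g z) - 24 * lg z - INR 12 * clog (autj g z)) by
  (rewrite INR12; field). have N := autj_nz g z Hz. rewrite !Cexp_minus, <- Cexp_pow, Cexp_clog, E by go. have N2 := Cexp_nz (24 * lg z).
 go. } have Hc : forall z, upper z -> k z = k Ci.
{ intros z Hz. destruct (Z.eq_dec (gc g) 0) as [Ec|Ec].
 - have Hg := g_det g. have Hd := unit_pair (ga g) (gd g) ltac:(lia). have Hm : exists n : Z, forall z, mobius g z = z + IZR n.
  { unfold mobius. rewrite Ec. destruct Hd as [[-> ->]|[-> ->]].
   - exists (gb g). go.
   - exists (- gb g)%Z. intros y. rewrite opp_IZR, RtoC_opp. go. } destruct Hm as [n Hm]. unfold k, autj. rewrite Ec, !Hm. unfold lg.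
  rewrite !sg_shift by (trivial; apply upper_Ci). replace (0 * z) with (0 * Ci) by ring. field.
 - apply const_upper; trivial; [|apply upper_Ci]. intros y Hy. have Hd : cder k y (dd k y).
  { apply ana_dd. apply ana_minus; [apply ana_minus|].
   - apply (ana_comp lg (mobius g)); [now apply ana_mobius|]. apply ana_lg. now apply mobius_upper. - now apply ana_lg.
   - apply ana_mult; [apply ana_const|]. apply ana_clog.
    + intros [E _]. unfold autj in E.
     replace (Im (IZR (gc g) * y + IZR (gd g))) with (IZR (gc g) * Im y)%R in E by (unfold Im; simpl; ring). unfold upper in Hy.
     apply Rmult_integral in E as [E|E]; [|lra]. apply (eq_IZR _ 0) in E. go.
    + go. } have H2 : cder (fun z => Cexp (24 * k z)) y (Cexp (24 * k y) * (24 * dd k y)).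
  { wd_by (apply wd_Cexp, wd_mult; [apply wd_const|exact Hd]); cring. } have H3 : cder (fun z => Cexp (24 * k z)) y 0.
  { destruct (upper_disc y Hy) as [d [Hd0 Hd1]]. apply (wd_ext_loc idC (fun _ => 1)); [|apply wd_const]. take d. intros x Hx. symmetry. go. }
  have H4 := wd_unique_cder _ _ _ _ H2 H3. rewrite H1 in H4 by go. eapply wd_eq; [|go|exact Hd].
  replace (dd k y) with (1 * (24 * dd k y) / 24) by field. rewrite H4. go. } exists (k Ci). split; [apply H1, upper_Ci|]. intros z Hz.
rewrite <- (Hc z Hz). go.
Qed.

Lemma eta_pow_lg r z : upper z -> eta_pow r z = Cexp (2 * r * lg z).
Proof. intros Hz. unfold eta_pow. rewrite log_eta_eq by go. go. Qed.

Lemma mult_sys_spec r g : mult_sys r g <> 0 /\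
  forall z, upper z -> eta_pow r (mobius g z) = mult_sys r g * cpow (autj g z) r * eta_pow r z.
Proof.
destruct (lg_mobius g) as [K [_ HK]].
have H : forall z, upper z -> eta_pow r (mobius g z) = Cexp (2 * r * K) * cpow (autj g z) r * eta_pow r z.
{ intros z Hz. rewrite !eta_pow_lg by (trivial; now apply mobius_upper). rewrite HK by go. rewrite cpow_clog, <- !Cexp_plus. f_equal. field. }
have Hu : forall v : C, (forall z, upper z -> eta_pow r (mobius g z) = v * cpow (autj g z) r * eta_pow r z) -> v = Cexp (2 * r * K).
{ intros v Hv. have E1 := H Ci upper_Ci. rewrite (Hv Ci upper_Ci) in E1. have N1 : cpow (autj g Ci) r <> 0 by apply Cexp_nz.
 have N2 : eta_pow r Ci <> 0 by apply Cexp_nz.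
 replace v with (v * cpow (autj g Ci) r * eta_pow r Ci / (cpow (autj g Ci) r * eta_pow r Ci)) by go. rewrite E1. go. }
have E : mult_sys r g = Cexp (2 * r * K). { apply (@iota_unique C_AbsRing C_CompleteNormedModule); [go|go]. } rewrite E.
split; [apply Cexp_nz|go].
Qed.

Lemma mult_sys_0 g : mult_sys 0 g = 1.
Proof.
destruct (mult_sys_spec 0 g) as [_ H]. specialize (H Ci upper_Ci). unfold eta_pow, cpow in H.
have E : forall x, Cexp (2 * 0 * x) = 1 by (intros; replace (2 * 0 * x) with (RtoC 0) by ring; apply Cexp_0). rewrite !E in H.
replace (0 * (ln (Cmod (autj g Ci)), arg (autj g Ci))) with (RtoC 0) in H by ring. rewrite Cexp_0 in H. rewrite H. ring.
Qed.

Lemma Re_lg_mobius g z : upper z -> (Re (lg (mobius g z)) = Re (lg z) + / 2 * ln (Cmod (autj g z)))%R.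
Proof.
intros Hz. destruct (lg_mobius g) as [K [HK H]]. rewrite H by go. have E : Re K = 0%R.
{ have E1 : Cmod (Cexp (24 * K)) = 1%R by (rewrite HK; apply Cmod_1). rewrite Cmod_Cexp in E1. rewrite <- exp_0 in E1. apply exp_inv in E1.
 unfold Re in *. simpl in E1. lra. } unfold Re in *. simpl. go.
Qed.

(** * The incomplete gamma function *)

Lemma is_sum_le {A} (f : A -> C) M s B : is_sum f s -> (forall a, Cmod (f a) <= M a) ->
  (forall L, NoDup L -> rsum M L <= B) -> Cmod s <= B.
Proof.
intros Hs Hf HB. apply le_all_eps. intros eps He. destruct (Hs eps He) as [L0 H0]. destruct (nodup_union L0 nil) as [U [HU [I1 _]]].
specialize (H0 U HU I1). have H1 := lsum_bound f M U (fun a _ => Hf a). specialize (HB U HU). have T := Cmod_tri_inv s (lsum f U).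
rewrite (Cmod_symm s (lsum f U)) in T. go.
Qed.

Lemma PI_gt_3 : 3 < PI.
Proof. have H := PI2_3_2. go. Qed.
Lemma ln_le_sub x : 0 < x -> ln x <= x - 1.
Proof. intros H. have E := exp_ineq1_le (ln x). rewrite exp_ln in E by go. lra. Qed.
Lemma ln_ge_inv x : 0 < x -> - / x <= ln x.
Proof. intros H. have P := Rinv_0_lt_compat x H. have E := ln_le_sub (/ x) P. rewrite ln_Rinv in E by go. lra. Qed.

(** Powers are absorbed by an exponential of arbitrarily small rate. *)
Definition klc (K eps del : R) : R := (K * (Rabs (ln ((K + 1) / eps)) + / del))%R.

Lemma klog K eps del x : 0 <= K -> 0 < eps -> 0 < del <= x ->
  K * Rabs (ln x) <= eps * x + klc K eps del.
Proof.
intros HK He [Hd Hx]. have H0 : 0 < x by lra. unfold klc. have H1 : K * ln x <= eps * x + K * Rabs (ln ((K + 1) / eps)).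
{ have Hk : 0 < (K + 1) / eps by go. have E : ln x = (ln (x / ((K + 1) / eps)) + ln ((K + 1) / eps))%R.
 { rewrite <- ln_mult; [|go|go]. f_equal. field. lra. } have L1 := ln_le_sub (x / ((K + 1) / eps)) ltac:(now apply Rdiv_lt_0_compat).
 have L2 := Rle_abs (ln ((K + 1) / eps)). have L3 : K * ln x <= K * (x / ((K + 1) / eps)) + K * Rabs (ln ((K + 1) / eps)) by go.
 have L4 : K * (x / ((K + 1) / eps)) <= eps * x.
 { replace (K * (x / ((K + 1) / eps)))%R with (eps * x * (K / (K + 1)))%R by (field; lra).
  assert (K / (K + 1) <= 1) by (apply Rmult_le_reg_r with (K + 1)%R; [lra|]; replace (K / (K + 1) * (K + 1))%R with K by (field; lra); lra).
  assert (0 < eps * x) by nra. nra. } lra. } have Hi : 0 < / del by go. have H2 : - ln x <= / del.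
{ have L := ln_ge_inv x H0. assert (/ x <= / del) by (apply Rinv_le_contravar; lra). lra. } have P1 := Rabs_pos (ln ((K + 1) / eps)).
unfold Rabs at 1. destruct (Rcase_abs (ln x)); nra.
Qed.

Lemma arg_bound (w : C) : w <> 0 -> Rabs (arg w) <= PI.
Proof. intros H. destruct (arg_spec w H) as [[H1 H2] _]. apply Rabs_le. lra. Qed.

Lemma Re_mult_bound (p q : C) : Re (p * q) <= Cmod p * (Rabs (Re q) + Rabs (Im q)).
Proof.
have H := re_le_Cmod (p * q). rewrite Cmod_mult in H. have H2 := Rle_abs (Re (p * q)). have H3 := Cmod_le_ReIm q. have H4 := Cmod_ge_0 p.
nra.
Qed.

Definition phi (p t : C) : C := Cexp (- p * clog t - 4 * PI * t).

Lemma phi_bound K del p x : Cmod p <= K -> 0 < del <= Cmod x ->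
  Cmod (phi p x) <= exp (klc K 1 del + K * PI + Cmod x - 4 * PI * Re x).
Proof.
intros Hp Hx. unfold phi. rewrite Cmod_Cexp. apply exp_mono. have H0 : x <> 0 by (apply Cmod_gt_0; lra). have HK := Cmod_ge_0 p.
have H1 := klog K 1 del (Cmod x) ltac:(lra) ltac:(lra) Hx. have H2 := Re_mult_bound (- p) (clog x). rewrite Cmod_opp in H2.
unfold clog at 2 3 in H2. unfold Re at 2, Im in H2. cbn [fst snd] in H2. have H3 := arg_bound x H0. have H4 := Rabs_pos (ln (Cmod x)).
have H5 := Rabs_pos (arg x).
replace (Re (- p * clog x - 4 * PI * x)) with (Re (- p * clog x) - 4 * PI * Re x)%R by (unfold Re; simpl; ring). go.
Qed.

Lemma slit_ray w : slit w -> exists d del, 0 < d /\ 0 < del /\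
  forall w' t, disc w d w' -> 0 <= t -> slit (w' + t) /\ del <= Cmod (w' + t).
Proof.
intros H. destruct (Req_dec (Im w) 0) as [E|E].
- have Hr : 0 < Re w by (apply Rnot_le_lt; intros Hr; now apply H). exists (Re w / 2)%R, (Re w / 2)%R.
 repeat split; try lra; unfold disc in *.
 + have X := re_le_Cmod (w' - w). replace (Re (w' - w)) with (Re w' - Re w)%R in X by go. have Y := Rle_abs (- (Re w' - Re w)).
  rewrite Rabs_Ropp in Y. intros [_ Q]. replace (Re (w' + t)) with (Re w' + t)%R in Q by go. lra.
 + have X := re_le_Cmod (w' - w). replace (Re (w' - w)) with (Re w' - Re w)%R in X by go. have Y := Rle_abs (- (Re w' - Re w)).
  rewrite Rabs_Ropp in Y. have Z := re_le_Cmod (w' + t). replace (Re (w' + t)) with (Re w' + t)%R in Z by go. have V := Rle_abs (Re w' + t).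
  lra.
- have Hr : 0 < Rabs (Im w) by go. exists (Rabs (Im w) / 2)%R, (Rabs (Im w) / 2)%R. repeat split; try lra; unfold disc in *.
 + have X := im_le_Cmod (w' - w). replace (Im (w' - w)) with (Im w' - Im w)%R in X by go. intros [Q _].
  replace (Im (w' + t)) with (Im w') in Q by (unfold Im; simpl; ring). rewrite Q in X. replace (0 - Im w)%R with (- Im w)%R in X by ring.
  rewrite Rabs_Ropp in X. lra.
 + have X := im_le_Cmod (w' - w). replace (Im (w' - w)) with (Im w' - Im w)%R in X by go. have Z := im_le_Cmod (w' + t).
  replace (Im (w' + t)) with (Im w') in Z by (unfold Im; simpl; ring). have T := Rabs_triang_inv (Im w) (Im w').
  rewrite (Rabs_minus_sym (Im w)) in T. lra.
Qed.

Definition good (w : C) (del : R) : Prop := (0 < del) /\ forall t, 0 <= t -> slit (w + t) /\ del <= Cmod (w + t).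

Definition gterm (p w : C) (j : nat) : C := CI (fun s => phi p (w + (INR j + s)%R)).
(** This is the integral of t^(-p) exp(-4 pi t) along the horizontal ray from w, which stays in the slit plane: it
    continues the incomplete gamma function there. Cutting the ray into unit intervals makes it a series of proper
    integrals. *)
Definition Gam (p w : C) : C := SUM (gterm p w).
Definition gK (K del : R) (w : C) : R := exp (klc K 1 del + K * PI + Cmod w - 4 * PI * Re w).

Lemma ct_phi {X} (dX : X -> X -> R) (p t : X -> C) x : slit (t x) -> ct dX dC p x -> ct dX dC t x ->
  ct dX dC (fun x => phi (p x) (t x)) x.
Proof. intros Hs Hp Ht. have H := ct_comp dX dC dC clog t x Ht (ct_clog _ Hs). ctt. Qed.

Lemma ic_phi p w del j : good w del -> ic (fun s => phi p (w + (INR j + s)%R)).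
Proof.
intros [_ H] s [Hs _]. have P := pos_INR j. apply ct_phi; [apply H; lra|ctt|]. apply ct_ext with (f := fun s : R => w + (INR j + s)); [go|].
ctt.
Qed.

Lemma gterm_bound K del p w j : good w del -> Cmod p <= K ->
  Cmod (gterm p w j) <= gK K del w * exp (- (1)) ^ j.
Proof.
intros Hg Hp. apply CI_bound; [now apply (ic_phi p w del)|]. intros s [Hs0 Hs1]. destruct Hg as [Hd Hg]. have P := pos_INR j.
destruct (Hg (INR j + s)%R ltac:(lra)) as [_ H2]. eapply Rle_trans; [apply (phi_bound K del); [go|go]|]. unfold gK.
rewrite <- exp_INR, <- exp_plus. apply exp_mono. have T := Cmod_triangle w (INR j + s)%R.
rewrite Cmod_R, (Rabs_pos_eq (INR j + s)) in T by lra. replace (Re (w + (INR j + s)%R)) with (Re w + (INR j + s))%R by go.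
have G := PI_gt_3. nra.
Qed.

Lemma e1_range : 0 <= exp (- (1)) < 1.
Proof. split; [left; apply exp_pos|]. have H := exp_increasing (- (1)) 0 ltac:(lra). now rewrite exp_0 in H. Qed.

Lemma Gam_spec del p w : good w del -> is_sum (gterm p w) (Gam p w).
Proof.
intros Hg. apply (SUM_spec _ (fun j => gK (Cmod p) del w * exp (- (1)) ^ j)%R).
- apply bnd_scal; [go|]. apply bnd_geom, e1_range. - intros j. apply gterm_bound; [go|lra].
Qed.

Lemma Gam_bound : exists B, 0 <= B /\ forall K del p w, good w del -> Cmod p <= K -> Cmod (Gam p w) <= B * gK K del w.
Proof.
destruct (bnd_geom (exp (- (1))) e1_range) as [H0 [B HB]]. exists B. split; [apply (HB nil); constructor|]. intros K del p w Hg Hp.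
apply (is_sum_le (gterm p w) (fun j => gK K del w * exp (- (1)) ^ j)%R).
- now apply (Gam_spec del). - intros j. now apply gterm_bound.
- intros L HL. rewrite rsum_scal, Rmult_comm. apply Rmult_le_compat_r; [go|go].
Qed.

Lemma near_disc_bound w d w' : disc w d w' -> Cmod w' <= Cmod w + d.
Proof. unfold disc. intros H. have T := Cmod_triangle (w' - w) w. replace (w' - w + w) with w' in T by ring. lra. Qed.

Lemma gK_loc K del w d w' : disc w d w' -> 0 < d -> gK K del w' <= exp (klc K 1 del + K * PI + 20 * (Cmod w + d)).
Proof.
intros H Hd. have B := near_disc_bound _ _ _ H. apply exp_mono. have R1 := re_le_Cmod w'. have R2 := Rle_abs (- Re w').
rewrite Rabs_Ropp in R2. have P4 := PI_4. have P0 := PI_RGT_0. have P1 := Cmod_ge_0 w'. go.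
Qed.

Lemma ct_of_fst {X} (dX : X -> X -> R) (r : X -> C) x (t : R) : ct dX dC r x -> ct (dP dX dR) dC (fun q => r (fst q)) (x, t).
Proof. intros H. apply (ct_comp (dP dX dR) dX dC r (fun q => fst q)); [|exact H]. apply ct_fst. intros; apply dR_ge0. Qed.
Lemma ct_of_snd {X} (dX : X -> X -> R) x (t : R) : (forall a b, 0 <= dX a b) -> ct (dP dX dR) dC (fun q => RtoC (snd q)) (x, t).
Proof. intros H. apply ct_RtoC. now apply ct_snd. Qed.

Lemma ct_ray {X} (dX : X -> X -> R) (w : X -> C) x j (t : R) : (forall a b, 0 <= dX a b) -> ct dX dC w x ->
  ct (dP dX dR) dC (fun q => w (fst q) + (INR j + snd q)%R) (x, t).
Proof.
intros Hn H. apply (ct_ext _ _ (fun q : X * R => w (fst q) + (INR j + snd q))); [intros; now rewrite RtoC_plus|].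
apply ct_plus; [now apply ct_of_fst|]. apply ct_plus; [apply ct_const|now apply ct_of_snd].
Qed.

(** Near a point of the slit plane one geometric majorant serves for all the terms. *)
Lemma Gam_near {X} (dX : X -> X -> R) (p w : X -> C) x : slit (w x) -> ct dX dC p x -> ct dX dC w x ->
  exists e del B, 0 < e /\ 0 <= B /\ forall y, dX x y < e -> good (w y) del /\ forall j, Cmod (gterm (p y) (w y) j) <= B * exp (- (1)) ^ j.
Proof.
intros Hs Hp Hw. destruct (slit_ray _ Hs) as [d [del [Hd [Hdel H]]]]. destruct (Hw d Hd) as [d1 [Hd1 H1]].
destruct (Hp 1%R ltac:(lra)) as [d2 [Hd2 H2]]. set (K := (Cmod (p x) + 1)%R).
exists (Rmin d1 d2), del, (exp (klc K 1 del + K * PI + 20 * (Cmod (w x) + d))). split; [go|]. split; [left; apply exp_pos|]. intros y Hy.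
apply lt_rmin in Hy. specialize (H1 y (proj1 Hy)). specialize (H2 y (proj2 Hy)). have G : good (w y) del by (split; [assumption|go]).
split; [exact G|]. intros j. eapply Rle_trans; [apply (gterm_bound K del); [exact G|apply (near_disc_bound (p x) 1); exact H2]|].
apply Rmult_le_compat_r; [apply pow_le, e1_range|]. now apply gK_loc.
Qed.

Lemma bnd_e1 B : 0 <= B -> bnd (fun j => B * exp (- (1)) ^ j)%R.
Proof. intros H. apply bnd_scal; [exact H|]. apply bnd_geom, e1_range. Qed.

Lemma ct_Gam {X} (dX : X -> X -> R) (p w : X -> C) x : (forall a b, 0 <= dX a b) -> dX x x = 0%R -> slit (w x) ->
  ct dX dC p x -> ct dX dC w x -> ct dX dC (fun x => Gam (p x) (w x)) x.
Proof.
intros Hn Hx Hs Hp Hw. destruct (Gam_near dX p w x Hs Hp Hw) as [e [del [B [He [HB H]]]]].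
apply (ct_SUM dX (fun j x => gterm (p x) (w x) j) _ (fun j => B * exp (- (1)) ^ j)%R); [exact Hx|now apply bnd_e1| |].
- exists e. split; [exact He|]. intros y Hy. destruct (H y Hy) as [G1 G2]. split; [now apply (Gam_spec del)|exact G2].
- intros j. apply (ct_CI dX (fun y s => phi (p y) (w y + (INR j + s)%R)) x Hx).
 + exists e. split; [exact He|]. intros y Hy. apply (ic_phi _ _ del). now apply H.
 + intros t [Ht _]. apply ct_jc, (ct_phi (dP dX dR) (fun q => p (fst q)) (fun q => w (fst q) + (INR j + snd q)%R)).
  * pairs. destruct (H x) as [[_ G] _]; [rewrite Hx; exact He|]. apply G. have P := pos_INR j. lra. * now apply ct_of_fst.
  * now apply ct_ray.
Qed.

Lemma ana_phi (p t : C -> C) r : slit (t r) -> ana p r -> ana t r -> ana (fun r => phi (p r) (t r)) r.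
Proof. intros Hs Hp Ht. have H := ana_clog t r Hs Ht. anat. Qed.

Lemma ana_gterm (p w : C -> C) r e del j : 0 < e -> (forall y, disc r e y -> good (w y) del /\ ana p y /\ ana w y) ->
  ana (fun r => gterm (p r) (w r) j) r.
Proof.
intros He H. have P := pos_INR j.
apply (ana_CI (fun y s => phi (p y) (w y + (INR j + s)%R)) r e He); intros x t Hx [Ht _]; destruct (H x Hx) as [[_ G] [Hp Hw]].
- apply ct_jc, (ct_phi (dP dC dR) (fun q => p (fst q)) (fun q => w (fst q) + (INR j + snd q)%R)).
 + pairs. apply G. lra. + now apply ct_of_fst, ana_ct. + apply ct_ray; [apply dC_ge0|now apply ana_ct].
- apply ana_phi; [apply G; lra|exact Hp|]. apply ana_plus; [exact Hw|apply ana_const].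
Qed.

Lemma ana_Gam (p w : C -> C) r : slit (w r) -> ana p r -> ana w r -> ana (fun r => Gam (p r) (w r)) r.
Proof.
intros Hs Hp Hw. destruct (Gam_near dC p w r Hs (ana_ct _ _ Hp) (ana_ct _ _ Hw)) as [e0 [del [B [He0 [HB H]]]]].
destruct (ana_near _ _ Hp) as [r1 [Hr1 Ap]]. destruct (ana_near _ _ Hw) as [r2 [Hr2 Aw]]. set (e := Rmin e0 (Rmin r1 r2)).
have He : 0 < e by (unfold e; repeat apply rmin_pos; assumption). have Hall : forall y, disc r e y -> dC r y < e0 /\ ana p y /\ ana w y.
{ intros y Hy. apply lt_rmin in Hy as [H1 H2]. apply lt_rmin in H2. split; [exact H1|split; [apply Ap|apply Aw]; apply H2]. }
apply (ana_SUM (fun j r => gterm (p r) (w r) j) _ (fun j => B * exp (- (1)) ^ j)%R r e He); [now apply bnd_e1| |].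
- intros j y Hy. split; [|now apply H, Hall]. destruct (disc_open _ _ _ Hy) as [d3 [Hd3 Hdd]]. apply (ana_gterm p w y d3 del j Hd3).
 intros x Hx. apply Hdd in Hx. split; [now apply H, Hall|now apply Hall].
- intros y Hy. apply (Gam_spec del). now apply H, Hall.
Qed.

(** The derivative is a telescoping sum of boundary terms. *)
Lemma cder_Gam p w : slit w -> cder (Gam p) w (- phi p w).
Proof.
intros Hs. have Ha : ana (Gam p) w by (apply (ana_Gam (fun _ => p) (fun w => w)); [assumption|apply ana_const|apply ana_id]).
eapply wd_eq; [|reflexivity|apply ana_dd, Ha].
destruct (Gam_near dC (fun _ => p) (fun w => w) w Hs (ct_const dC p w) (ct_id dC w)) as [e [del [B [He [HB H]]]]].
have Hw := disc_center w e He. have Hg : forall y j t, disc w e y -> 0 <= t -> slit (y + (INR j + t)%R).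
{ intros y j t Hy Ht. destruct (H y Hy) as [[_ G] _]. apply G. have P := pos_INR j. lra. }
set (dphi := fun t : C => phi p t * (- p * / t - 4 * PI)). have Hphi : forall t, slit t -> cder (phi p) t (dphi t).
{ intros t Ht. unfold phi, dphi.
 wd_by (apply wd_Cexp, wd_minus; [apply wd_mult; [apply wd_const|apply cder_clog, Ht]|apply wd_mult; [apply wd_const|apply (wd_io idC)]]);
  [unfold phi; cring|cring]. } have Hcd : forall t, slit t -> ct dC dC dphi t.
{ intros t Ht. apply ct_mult; [apply ana_ct, (ana_phi (fun _ => p) (fun t => t)); [exact Ht|apply ana_const|apply ana_id]|].
 apply ct_minus; [|apply ct_const]. apply ct_mult; [apply ct_const|]. apply ct_inv; [now apply slit_nz|apply ct_id]. }
have HD : is_sum (fun j => dd (fun y => gterm p y j) w) (dd (Gam p) w).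
{ apply (dd_SUM (fun j y => gterm p y j) (Gam p) (fun j => B * exp (- (1)) ^ j)%R w e He); [now apply bnd_e1| |].
 - intros j y Hy. split; [|now apply H]. destruct (disc_open _ _ _ Hy) as [d3 [Hd3 Hdd]].
  apply (ana_gterm (fun _ => p) (fun w => w) y d3 del j Hd3). intros x Hx. split; [now apply H, Hdd|split; [apply ana_const|apply ana_id]].
 - intros y Hy. apply (Gam_spec del). now apply H. }
have Hdt : forall j, dd (fun y => gterm p y j) w = phi p (w + INR (S j)) - phi p (w + INR j).
{ intros j. apply cder_dd. have E : CI (fun s => dphi (w + (INR j + s)%R)) = phi p (w + INR (S j)) - phi p (w + INR j).
 { rewrite (CI_FTC (fun s => phi p (w + (INR j + s)%R))).
  - rewrite S_INR. do 2 f_equal. go.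
  - intros s [Hs0 _]. wd_by (apply (wd_comp_hol RtoC (phi p) (fun s => w + (INR j + s)%R)); [apply Hphi, Hg; trivial|]).
   3:{ apply (wd_ext RtoC (fun s : R => (w + INR j) + s)); [go|]. apply wd_plus; [apply wd_const|apply (wd_io RtoC)]. }
   + cring. + cring.
  - intros s [Hs0 _]. apply (ct_comp dR dC dC dphi); [|now apply Hcd, Hg].
   apply (ct_ext _ _ (fun s : R => w + (INR j + s))); [intros; now rewrite RtoC_plus|]. ctt. } rewrite <- E.
 apply (cder_CI (fun y s => phi p (y + (INR j + s)%R)) (fun y s => dphi (y + (INR j + s)%R))).
 - take e. intros y Hy. split; [apply (ic_phi p y del), H, Hy|]. intros t [Ht _].
  wd_by (apply (wd_comp_hol idC (phi p) (fun y => y + (INR j + t)%R)); [apply Hphi, Hg; trivial|apply wd_plus; [apply (wd_io idC)|apply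
   wd_const]]); cring.
 - intros t [Ht _]. apply ct_jc. apply (ct_comp (dP dC dR) dC dC dphi (fun q : C * R => fst q + (INR j + snd q)%R)); [|now apply Hcd, Hg].
  apply (ct_ray dC (fun y => y)); [apply dC_ge0|apply ct_id]. }
(* the boundary terms are summable *)
destruct (slit_ray _ Hs) as [d [dl [Hd [Hdl Hr]]]]. have Hb : forall j, Cmod (phi p (w + INR j)) <= gK (Cmod p) dl w * exp (- (1)) ^ j.
{ intros j. have P := pos_INR j. destruct (Hr w (INR j) (disc_center w d Hd) P) as [_ H2].
 eapply Rle_trans; [apply (phi_bound (Cmod p) dl); [lra|go]|]. unfold gK. rewrite <- exp_INR, <- exp_plus. apply exp_mono.
 have T := Cmod_triangle w (INR j). rewrite Cmod_R, (Rabs_pos_eq (INR j)) in T by lra. replace (Re (w + INR j)) with (Re w + INR j)%R by go.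
 have G := PI_gt_3. nra. } have PG : 0 <= gK (Cmod p) dl w by (left; apply exp_pos).
destruct (is_sum_ex (fun j => phi p (w + INR (S j))) (fun j => gK (Cmod p) dl w * exp (- (1)) ^ j)%R) as [T HT]; [now apply bnd_e1| |].
{ intros j. le_by Hb. apply Rmult_le_compat_l; [exact PG|]. have Q := e1_range. have Q2 := pow_le _ j (proj1 Q). simpl. nra. }
apply (is_sum_unique _ _ _ HD). apply is_sum_ext with (f := fun j => phi p (w + INR (S j)) - phi p (w + INR j)); [go|].
replace (- phi p w) with (T - (phi p w + T)) by ring. apply is_sum_minus; [assumption|].
have HT2 := nat_split (fun j => phi p (w + INR j)) T HT. cbv beta in HT2. replace (w + INR 0) with w in HT2 by go. go.
Qed.

(** * The radial parts of the local solution at the cusp *)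

Lemma pos_slit (t : R) : 0 < t -> slit t.
Proof. intros H [_ H2]. unfold Re in H2; simpl in H2. lra. Qed.
Lemma ct_clog_R {X} (dX : X -> X -> R) (y : X -> R) x : 0 < y x -> ct dX dR y x -> ct dX dC (fun x => clog (y x)) x.
Proof. intros H Hy. apply (ct_comp dX dC dC clog); [go|]. now apply ct_clog, pos_slit. Qed.

Lemma ct_R_ring {X} (dX : X -> X -> R) (f : X -> C) (g : X -> R) x : (forall y, f y = RtoC (g y)) -> ct dX dC f x -> ct dX dR g x.
Proof.
intros E H eps He. destruct (H eps He) as [d [Hd H1]]. take d. intros y Hy. specialize (H1 y Hy). rewrite !E in H1. unfold dC in H1.
rewrite Cmod_RtoC_sub in H1. go.
Qed.

Lemma prim_pos (s y : R) : I01 s -> 0 < y -> Rmin 1 y <= 1 + s * (y - 1) /\ 0 < 1 + s * (y - 1).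
Proof. intros [H0 H1] Hy. unfold Rmin. destruct (Rle_dec 1 y); split; nra. Qed.

Lemma prim_rder (g g' : R -> C) : (forall t, 0 < t -> rder g t (g' t)) -> (forall t, 0 < t -> ct dR dC g' t) ->
  forall y, 0 < y -> rder (fun y : R => (y - 1)%R * CI (fun s => g (1 + s * (y - 1))%R)) y (g y).
Proof.
intros Hg Hg' y Hy. have Hc : forall t, 0 < t -> ct dR dC g t.
{ intros t Ht eps He. destruct (wd_ct RtoC g t _ _ (Hg t Ht) eps He) as [d [Hd H]]. take d. intros s Hs. apply H. rewrite Cmod_RtoC_sub. go. }
have Hlin2 : forall u s : R, ct dR dR (fun s : R => 1 + s * u)%R s.
{ intros u s. apply (ct_R_ring dR (fun s : R => 1 + s * u)); [go|]. ctt. }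
have Hic : forall y', 0 < y' -> ic (fun s => g (1 + s * (y' - 1))%R).
{ intros y' Hy' s Hs. apply (ct_comp dR dR dC g); [go|]. now apply Hc, prim_pos. }
have HI : rder (fun y : R => CI (fun s => g (1 + s * (y - 1))%R)) y (CI (fun s => s * g' (1 + s * (y - 1))%R)).
{ apply (rder_CI (fun y s => g (1 + s * (y - 1))%R) (fun y s => s * g' (1 + s * (y - 1))%R)).
 - take y. intros y' Hy'. have P : 0 < y' by (apply Rabs_def2 in Hy'; lra). split; [go|]. intros s Hs.
  wd_by (apply (wd_chain RtoC RtoC g (fun y => 1 + s * (y - 1))%R y'); [apply Hg, prim_pos; assumption|]).
  3:{ apply (wd_ext RtoC (fun y : R => (1 - s) + y * s)).
   - go. - apply rder_lin. }
  + ring. + go.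
 - intros s Hs. apply ct_jc. apply ct_mult; [go|]. apply (ct_comp (dP dR dR) dR dC g' (fun q => 1 + snd q * (fst q - 1))%R).
  + apply (ct_R_ring _ (fun q : R * R => 1 + snd q * (fst q - 1))); [go|]. ctt.
  + now apply Hg', prim_pos. } have E : CI (fun s => g (1 + s * (y - 1))%R) + (y - 1)%R * CI (fun s => s * g' (1 + s * (y - 1))%R) = g y.
{ have Hic' : ic (fun s => s * g' (1 + s * (y - 1))%R).
 { intros s Hs. apply ct_mult; [go|]. apply (ct_comp dR dR dC g'); [go|]. now apply Hg', prim_pos. } rewrite <- CI_scal by go.
 rewrite <- CI_plus by (first [now apply Hic | apply ic_mult; [go|go]]). rewrite (CI_FTC (fun s => s * g (1 + s * (y - 1))%R)).
 - replace (1 + 1 * (y - 1))%R with y by ring. ring.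
 - intros s Hs.
  wd_by (apply wd_mult; [apply (wd_io RtoC)|apply (wd_chain RtoC RtoC g (fun s => 1 + s * (y - 1))%R s); [apply Hg, prim_pos;
   assumption|]]).
  3:{ apply (wd_ext RtoC (fun s : R => 1 + s * (y - 1)%R)).
   - go. - apply rder_lin. }
  + go. + go.
 - apply ic_plus; [go|]. apply ic_mult; [go|go]. } rewrite <- E. wd_by (apply wd_mult; [|exact HI]).
3:{ apply (wd_ext RtoC (fun u : R => (- (1)) + u * 1)); [go|apply rder_lin]. }
- cring. - cring.
Qed.

(** With b = n - r/12 the integrand is t^(-l-r) exp(-4 pi b t). The substitution t -> bt expresses its integral from y
    to infinity by [Gam], and b lies in the slit plane as soon as r avoids [12n, oo). *)
Section Radial.
Variables (l M : Z).

Definition pp (r : C) : C := IZR l + r.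
Definition bb (n : Z) (r : C) : C := IZR n - r / 12.
Definition psi (n : Z) (r : C) (t : R) : C := Cexp (- pp r * clog t - 4 * PI * bb n r * t).
Definition fhi (n : Z) (r : C) (y : R) : C := Cexp ((pp r - 1) * clog (bb n r)) * Gam (pp r) (bb n r * y).
Definition flo (n : Z) (r : C) (y : R) : C := - ((y - 1)%R * CI (fun s => psi n r (1 + s * (y - 1))%R)).
(** For n >= M this is the decaying solution, analytically continued in r across the half-plane Re r >= 12 n. *)
Definition ff (n : Z) (r : C) (y : R) : C := if Z.leb M n then fhi n r y else flo n r y.

Lemma bb_slit n r : slit_plane M r -> (M <= n)%Z -> slit (bb n r).
Proof. intros Hr Hn [H1 H2]. apply Hr. unfold bb, Im, Re in *. simpl in *. apply IZR_le in Hn. go. Qed.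
Lemma slit_scal (y : R) w : 0 < y -> slit w -> slit (w * y).
Proof. intros Hy H [H1 H2]. apply H. unfold Im, Re in *. simpl in *. go. Qed.

Lemma rder_psi n r t : 0 < t -> rder (psi n r) t (psi n r t * (- pp r * / t - 4 * PI * bb n r)).
Proof.
intros Ht. unfold psi.
wd_by (apply wd_Cexp, wd_minus; [apply wd_mult; [apply wd_const|apply (wd_comp_hol RtoC clog RtoC); [apply cder_clog, pos_slit, Ht|apply
 (wd_io RtoC)]]|apply wd_mult; [apply wd_const|apply (wd_io RtoC)]]); cring.
Qed.

Lemma ct_psi {X} (dX : X -> X -> R) n (r : X -> C) (y : X -> R) x : 0 < y x -> ct dX dC r x -> ct dX dR y x ->
  ct dX dC (fun x => psi n (r x) (y x)) x.
Proof. intros H Hr Hy. have Hc := ct_clog_R dX y x H Hy. ctt. Qed.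

Lemma rder_ff n r y : slit_plane M r -> 0 < y -> rder (ff n r) y (- psi n r y).
Proof.
intros Hr Hy. unfold ff. destruct (Z.leb_spec M n) as [H|H].
- have Hb := bb_slit n r Hr H. have Hby := slit_scal y _ Hy Hb. have Hbn := slit_nz _ Hb.
 wd_by (apply wd_mult; [apply wd_const|apply (wd_comp_hol RtoC (Gam (pp r)) (fun y : R => bb n r * y)); [apply cder_Gam, Hby|apply wd_mult;
  [apply wd_const|apply (wd_io RtoC)]]]). 2: cring. unfold psi, phi. replace (bb n r * y) with (y * bb n r) by ring.
 rewrite clog_scale by go. rewrite clog_R by go.
 have E : Cexp ((pp r - 1) * clog (bb n r)) * Cexp (- pp r * (ln y + clog (bb n r)) - 4 * PI * (y * bb n r)) * bb n r = Cexp (- pp r * ln y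
  - 4 * PI * bb n r * y).
 { transitivity (Cexp ((pp r - 1) * clog (bb n r)) * Cexp (- pp r * (ln y + clog (bb n r)) - 4 * PI * (y * bb n r)) * Cexp (clog (bb n r))).
  - now rewrite Cexp_clog. - rewrite <- !Cexp_plus. f_equal. ring. } rewrite <- E. ring.
- have Hp := prim_rder (psi n r) (fun t => psi n r t * (- pp r * / t - 4 * PI * bb n r)) (rder_psi n r).
 wd_by (apply wd_opp, Hp; [|go]); [ring|ring|]. intros t Ht. apply ct_mult; [apply ct_psi; [go|ctt|go]|].
 apply ct_minus; [apply ct_mult; [go|]|go]. apply ct_inv; [go|ctt].
Qed.

Lemma ct_ff {X} (dX : X -> X -> R) n (r : X -> C) (y : X -> R) x : (forall a b, 0 <= dX a b) -> dX x x = 0%R ->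
  slit_plane M (r x) -> 0 < y x -> ct dX dR y x -> ct dX dC r x ->
  (exists d, 0 < d /\ forall x', dX x x' < d -> 0 < y x') -> ct dX dC (fun x => ff n (r x) (y x)) x.
Proof.
intros Hnn Hx Hr Hy Hcy Hcr [d [Hd Hpos]]. unfold ff. destruct (Z.leb_spec M n) as [H|H].
- have Hb := bb_slit n _ Hr H. have Hby := slit_scal _ _ Hy Hb. have Hcb : ct dX dC (fun x => bb n (r x)) x by go.
 have Hcp : ct dX dC (fun x => pp (r x)) x by go. have Hcl := ct_comp dX dC dC clog _ x Hcb (ct_clog _ Hb). apply ct_mult; [ctt|].
 apply (ct_Gam dX (fun x => pp (r x)) (fun x => bb n (r x) * y x)); trivial. ctt.
- apply ct_opp, ct_mult; [apply (ct_ext dX dC (fun x => y x - 1)); [go|ctt]|].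
 apply (ct_CI dX (fun x s => psi n (r x) (1 + s * (y x - 1))%R) x Hx).
 + take d. intros x' Hx' s Hs. apply ct_psi; [now apply prim_pos, Hpos|ctt|].
  apply (ct_R_ring dR (fun s : R => 1 + s * (y x' - 1)%R)); [go|]. ctt.
 + intros s Hs.
  apply ct_jc, (ct_psi (dP dX dR) n (fun q => r (fst q)) (fun q => 1 + snd q * (y (fst q) - 1))%R); [now apply prim_pos|now apply
   ct_of_fst|]. have Hs2 := ct_of_snd dX x s Hnn. have Hy2 := ct_of_fst dX (fun x => RtoC (y x)) x s (ct_RtoC _ _ _ Hcy).
  apply (ct_R_ring _ (fun q : X * R => 1 + snd q * (y (fst q) - 1))); [go|]. ctt.
Qed.

Lemma slit_plane_open r : slit_plane M r -> exists d, 0 < d /\ forall r', disc r d r' -> slit_plane M r'.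
Proof.
intros H. have Hs : slit (12 * IZR M - r). { intros [H1 H2]. apply H. unfold Im, Re in *. simpl in *. go. }
destruct (slit_open _ Hs) as [d [Hd H1]]. take d. intros r' Hr' [H2 H3]. apply (H1 (12 * IZR M - r')).
- unfold disc in *. replace (12 * IZR M - r' - (12 * IZR M - r)) with (- (r' - r)) by ring. now rewrite Cmod_opp.
- unfold Im, Re in *. simpl in *. go.
Qed.

Lemma ana_ff n r y : slit_plane M r -> 0 < y -> ana (fun r => ff n r y) r.
Proof.
intros Hr Hy. unfold ff. have Hab : forall r, ana (bb n) r by go. destruct (Z.leb_spec M n) as [H|H].
- have Hb := bb_slit n _ Hr H. have Hby := slit_scal _ _ Hy Hb. apply ana_mult.
 + apply ana_Cexp, ana_mult; [go|]. now apply ana_clog. + apply ana_Gam; [go|go|]. go.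
- apply ana_opp, ana_mult; [go|]. apply (ana_CI (fun r s => psi n r (1 + s * (y - 1))%R) r 1); [lra| |].
 + intros x s _ Hs. apply ct_jc. apply ct_psi; [now apply prim_pos|ctt|].
  apply (ct_R_ring _ (fun q : C * R => 1 + snd q * (y - 1)%R)); [go|]. ctt.
 + intros x s _ _. apply ana_Cexp, ana_minus; apply ana_mult; try apply ana_const.
  * go. * go.
Qed.

Lemma pp_bound r R0 : Cmod r <= R0 -> Cmod (pp r) <= Rabs (IZR l) + R0.
Proof. intros H. tri. rewrite Cmod_R. lra. Qed.

Lemma bb_bound n r R0 : Cmod r <= R0 -> Cmod (bb n r) <= Rabs (IZR n) + R0 /\ IZR n - R0 <= Re (bb n r).
Proof.
intros H. have H0 := Cmod_ge_0 r. have E : Cmod (r / 12) <= R0.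
{ unfold Cdiv. rewrite Cmod_mult, Cmod_inv, Cmod_R, Rabs_pos_eq by go. lra. } unfold bb. split.
- tri. rewrite Cmod_R, Cmod_opp. lra.
- replace (Re (IZR n - r / 12)) with (IZR n - Re (r / 12))%R by go. have X := re_le_Cmod (r / 12). have Y := Rle_abs (Re (r / 12)). lra.
Qed.

Lemma psi_bound n R0 m r t : 0 <= R0 -> Cmod r <= R0 -> 0 < m <= t ->
  Cmod (psi n r t) <= exp (klc (Rabs (IZR l) + R0) 1 m + (1 + 16 * (Rabs (IZR n) + R0)) * t).
Proof.
intros HR Hr Ht. unfold psi. rewrite Cmod_Cexp. apply exp_mono. have Hp := pp_bound r R0 Hr. destruct (bb_bound n r R0 Hr) as [Hb _].
have P0 := Rabs_pos (IZR l). have P1 := Rabs_pos (IZR n). rewrite clog_R by lra.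
have K1 := klog (Rabs (IZR l) + R0) 1 m t ltac:(lra) ltac:(lra) Ht. have H2 := Re_mult_bound (- pp r) (ln t). rewrite Cmod_opp in H2.
replace (Re (RtoC (ln t))) with (ln t) in H2 by go. replace (Im (RtoC (ln t))) with 0%R in H2 by go. rewrite Rabs_R0, Rplus_0_r in H2.
replace (Re (- pp r * ln t - 4 * PI * bb n r * t)) with (Re (- pp r * ln t) - 4 * PI * Re (bb n r) * t)%R by (unfold Re; simpl; ring).
have X := re_le_Cmod (bb n r). have Y := Rle_abs (- Re (bb n r)). rewrite Rabs_Ropp in Y. have L := Rabs_pos (ln t).
assert (Cmod (pp r) * Rabs (ln t) <= (Rabs (IZR l) + R0) * Rabs (ln t)) by go. have G4 := PI_4. have G0 := PI_RGT_0.
assert (4 * PI * (- Re (bb n r)) * t <= 16 * (Rabs (IZR n) + R0) * t). { apply Rmult_le_compat_r; [lra|]. go. } lra.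
Qed.

Definition ebound (C0 : R) (n : Z) (y : R) : R := exp (C0 + C0 * y - (4 * PI - 2) * IZR n * y).

Lemma ebound_le C0 C1 n y : C0 <= C1 -> 0 < y -> ebound C0 n y <= ebound C1 n y.
Proof. intros H Hy. apply exp_mono. nra. Qed.
Lemma le_exp x : x <= exp x.
Proof. have H := exp_ineq1_le x. lra. Qed.

Lemma ff_bound_one n r0 m : slit_plane M r0 -> 0 < m -> exists d C0, 0 < d /\ forall r y, disc r0 d r -> m <= y ->
  Cmod (ff n r y) <= ebound C0 n y.
Proof.
intros Hr Hm. destruct (slit_plane_open r0 Hr) as [d1 [Hd1 HU]].
destruct (ana_ct _ _ (ana_ff n r0 1 Hr ltac:(lra)) 1%R ltac:(lra)) as [d2 [Hd2 H2]]. set (R0 := (Cmod r0 + 1)%R). set (m' := Rmin 1 m).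
have Hm' : 0 < m' by go. set (c0 := klc (Rabs (IZR l) + R0) 1 m'). set (c1 := (1 + 16 * (Rabs (IZR n) + R0))%R).
set (A0 := (Cmod (ff n r0 1) + 1)%R). have Hc1 : 0 <= c1 by (unfold c1, R0; have P0 := Rabs_pos (IZR n); have P1 := Cmod_ge_0 r0; lra).
exists (Rmin d1 (Rmin d2 1)), (ln 2 + Rabs c0 + 2 * c1 + A0 + 16 * Rabs (IZR n) + 1)%R. split; [repeat apply rmin_pos; lra|].
intros r y Hd Hy. apply lt_rmin in Hd as [Hda Hd]. apply lt_rmin in Hd as [Hdb Hdc].
have Hrb : Cmod r <= R0 by (apply (near_disc_bound r0 1 r); exact Hdc). have HR0 : 0 <= R0 by (unfold R0; have P1 := Cmod_ge_0 r0; lra).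
have Hf1 : Cmod (ff n r 1) <= A0. { specialize (H2 r Hdb). apply (near_disc_bound (ff n r0 1) 1). go. }
have Hmi : Cmod (ff n r y - ff n r 1) <= exp (c0 + c1 * (1 + y)) * (1 + y).
{ have Hps : forall t, m' <= t <= 1 + y -> Cmod (- psi n r t) <= exp (c0 + c1 * (1 + y)).
 { intros t Ht. rewrite Cmod_opp. eapply Rle_trans; [apply (psi_bound n R0 m'); lra|]. apply exp_mono. fold c0 c1. nra. }
 have Q1 := Rmin_l 1 m. have Q2 := Rmin_r 1 m. fold m' in Q1, Q2. have Pe := exp_pos (c0 + c1 * (1 + y)).
 destruct (Rle_lt_dec 1 y) as [H1|H1].
 - have Hi := mvi (ff n r) (fun t => - psi n r t) 1 y (exp (c0 + c1 * (1 + y))) H1. le_by Hi.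
  + intros t Ht. apply rder_ff; [go|lra]. + intros t Ht. apply Hps. lra. + nra.
 - have Hi := mvi (ff n r) (fun t => - psi n r t) y 1 (exp (c0 + c1 * (1 + y))) ltac:(lra). rewrite Cmod_symm. le_by Hi.
  + intros t Ht. apply rder_ff; [go|lra]. + intros t Ht. apply Hps. lra.
  + nra. } have T := Cmod_triangle (ff n r y - ff n r 1) (ff n r 1). replace (ff n r y - ff n r 1 + ff n r 1) with (ff n r y) in T by ring.
have Hx1 : 1 + y <= exp y by apply exp_ineq1_le. have Hb1 : exp (c0 + c1 * (1 + y)) * (1 + y) <= exp (Rabs c0 + 2 * c1 + A0 + c1 * y + y).
{ apply Rle_trans with (exp (c0 + c1 * (1 + y)) * exp y)%R; [apply Rmult_le_compat_l; [go|go]|]. rewrite <- exp_plus. apply exp_mono.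
 have V := Rle_abs c0. have V2 := Cmod_ge_0 (ff n r0 1). unfold A0. nra. } have Hb2 : A0 <= exp (Rabs c0 + 2 * c1 + A0 + c1 * y + y).
{ apply Rle_trans with (exp A0); [apply le_exp|]. apply exp_mono. have V := Rabs_pos c0. nra. }
apply Rle_trans with (exp (ln 2 + (Rabs c0 + 2 * c1 + A0 + c1 * y + y)))%R. { rewrite exp_plus, exp_ln by lra. lra. } apply exp_mono.
have V1 := Rabs_pos c0. have V2 := Rle_abs (IZR n). have V3 := Rabs_pos (IZR n). have V4 := PI_4. have V5 := PI_gt_3.
have Hn1 : (4 * PI - 2) * IZR n * y <= 16 * Rabs (IZR n) * y. { apply Rmult_le_compat_r; [lra|]. go. }
have V6 : 0 < ln 2 by (rewrite <- ln_1; apply ln_increasing; lra). have V7 : 0 <= A0 by (unfold A0; have P := Cmod_ge_0 (ff n r0 1); lra).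
go.
Qed.

Lemma ff_bound_high r0 m : slit_plane M r0 -> 0 < m -> exists n1 d C0, 0 < d /\ forall n r y, (n1 <= n)%Z ->
  disc r0 d r -> m <= y -> Cmod (ff n r y) <= ebound C0 n y.
Proof.
intros Hr Hm. set (R0 := (Cmod r0 + 1)%R). have HR0 : 1 <= R0 by (unfold R0; have P1 := Cmod_ge_0 r0; lra).
destruct Gam_bound as [B [HB HG]]. set (K := (Rabs (IZR l) + R0)%R). have HK : 0 <= K by (unfold K; have P := Rabs_pos (IZR l); lra).
set (c0 := (klc (K + 1) m 1 + (K + 1) * PI + B + klc K 1 m + K * PI)%R). destruct (slit_plane_open r0 Hr) as [d1 [Hd1 HU]].
exists (Z.max M (up (R0 + 1))), (Rmin d1 1), (Rabs c0 + 20 * R0)%R. split; [go|]. intros n r y Hn Hd Hy. apply lt_rmin in Hd as [Hda Hdc].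
have Hrb : Cmod r <= R0 by (apply (near_disc_bound r0 1 r); exact Hdc). have HnR : R0 + 1 <= IZR n.
{ have X := archimed (R0 + 1). have Y : IZR (up (R0 + 1)) <= IZR n by (apply IZR_le; lia). lra. } unfold ff.
destruct (Z.leb_spec M n) as [_|H]; [|lia]. unfold fhi. destruct (bb_bound n r R0 Hrb) as [Hb1 Hb2].
rewrite (Rabs_pos_eq (IZR n)) in Hb1 by lra. set (b := bb n r) in *.
have Hbm : 1 <= Cmod b by (have X := re_le_Cmod b; have Y := Rle_abs (Re b); lra). have Hpb := pp_bound r R0 Hrb. fold K in Hpb.
have Hgood : good (b * y) m.
{ split; [assumption|]. intros t Ht. have E : Re (b * y + t) = (Re b * y + t)%R by (unfold Re; simpl; ring).
 have Hq : m <= Re b * y + t by nra. split.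
 - intros [_ H2]. go.
 - have X := re_le_Cmod (b * y + t). rewrite E in X. have Y := Rle_abs (Re b * y + t). lra. } have HG1 := HG K m (pp r) (b * y) Hgood Hpb.
have Hx : Cmod (Cexp ((pp r - 1) * clog b)) <= exp (m * Cmod b + klc (K + 1) m 1 + (K + 1) * PI).
{ rewrite Cmod_Cexp. apply exp_mono. le_by Re_mult_bound. unfold clog at 1 2. unfold Re, Im. pairs.
 have H1 : Cmod (pp r - 1) <= K + 1. { tri. rewrite Cmod_opp, Cmod_1. lra. } have H2 := klog (K + 1) m 1 (Cmod b) ltac:(lra) Hm ltac:(lra).
 have H3 : Rabs (arg b) <= PI by (apply arg_bound, Cmod_gt_0; lra). have H4 := Rabs_pos (ln (Cmod b)). have H5 := Rabs_pos (arg b). go. }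
rewrite Cmod_mult. apply Rle_trans with (exp (m * Cmod b + klc (K + 1) m 1 + (K + 1) * PI) * (exp B * gK K m (b * y)))%R.
{ apply Rmult_le_compat; try apply Cmod_ge_0; trivial. eapply Rle_trans; [exact HG1|]. apply Rmult_le_compat_r; [go|apply le_exp]. }
unfold gK, ebound. rewrite <- !exp_plus. apply exp_mono. rewrite Cmod_mult, Cmod_R, (Rabs_pos_eq y) by lra.
replace (Re (b * y)) with (Re b * y)%R by (unfold Re; simpl; ring). have V := Rle_abs c0. have V0 := Rabs_pos c0. have V4 := PI_4.
have V3 := PI_gt_3. have Q3 : 4 * PI * ((IZR n - R0) * y) <= 4 * PI * (Re b * y) by (apply Rmult_le_compat_l; [lra|]; nra).
have Q4 : 4 * PI * (R0 * y) <= 16 * (R0 * y) by (apply Rmult_le_compat_r; [nra|lra]). unfold c0 in V at 1. nra.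
Qed.

Lemma ff_bound r0 m (N : Z) : slit_plane M r0 -> 0 < m -> exists d C0, 0 < d /\ 0 <= C0 /\ forall n r y, (- N <= n)%Z ->
  disc r0 d r -> m <= y -> Cmod (ff n r y) <= ebound C0 n y.
Proof.
intros Hr Hm. destruct (ff_bound_high r0 m Hr Hm) as [n1 [d1 [c1 [Hd1 H1]]]].
have Hfin : forall k : nat, exists d C0, 0 < d /\ forall n r y, (- N <= n < - N + Z.of_nat k)%Z -> disc r0 d r -> m <= y -> Cmod (ff n r y)
 <= ebound C0 n y.
{ induction k as [|k [d2 [c2 [Hd2 H2]]]].
 - exists 1%R, 0%R. split; [lra|]. go.
 - destruct (ff_bound_one (- N + Z.of_nat k) r0 m Hr Hm) as [d3 [c3 [Hd3 H3]]]. exists (Rmin d2 d3), (Rmax c2 c3).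
  split; [now apply rmin_pos|]. intros n r y Hn Hd Hy. apply lt_rmin in Hd. destruct (Z.eq_dec n (- N + Z.of_nat k)) as [E|E].
  + subst n. eapply Rle_trans; [apply H3; [go|go]|]. apply ebound_le; [apply Rmax_r|lra].
  + eapply Rle_trans; [apply H2; [lia|go|go]|]. apply ebound_le; [apply Rmax_l|lra]. }
destruct (Hfin (Z.to_nat (n1 + N))) as [d2 [c2 [Hd2 H2]]]. exists (Rmin d1 d2), (Rmax 0 (Rmax c1 c2)). split; [go|]. split; [apply Rmax_l|].
intros n r y Hn Hd Hy. apply lt_rmin in Hd. have M1 : c1 <= Rmax 0 (Rmax c1 c2) by (eapply Rle_trans; [apply (Rmax_l c1 c2)|apply Rmax_r]).
have M2 : c2 <= Rmax 0 (Rmax c1 c2) by (eapply Rle_trans; [apply (Rmax_r c1 c2)|apply Rmax_r]). destruct (Z_le_gt_dec n1 n) as [E|E].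
- eapply Rle_trans; [apply H1; [go|go|go]|]. apply ebound_le; [go|lra].
- eapply Rle_trans; [apply H2; [lia|go|go]|]. apply ebound_le; [go|lra].
Qed.
End Radial.

(** * Fourier coefficients of periodic holomorphic functions *)

Lemma ic_bounded f : ic f -> exists B, 0 <= B /\ forall t, I01 t -> Cmod (f t) <= B.
Proof.
intros H. destruct (bounded_continuity (fun t => Cmod (f t)) 0 1) as [B HB].
- intros t Ht. apply ct_continuous. intros eps He. destruct (H t Ht eps He) as [d [Hd H1]]. take d. intros s Hs. specialize (H1 s Hs).
 unfold dC, dR in *. have T1 := Cmod_tri_inv (f s) (f t). have T2 := Cmod_tri_inv (f t) (f s). rewrite (Cmod_symm (f t) (f s)) in T2.
 apply Rabs_def1; lra.
- exists (Rmax 0 B). split; [apply Rmax_l|]. intros t Ht. specialize (HB t Ht). rewrite Rabs_pos_eq in HB by go. have X := Rmax_r 0 B. lra.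
Qed.

Lemma tube_bound {X} (dX : X -> X -> R) (f : X -> R -> C) x : dX x x = 0%R ->
  (forall t, I01 t -> jc dX f x t) -> exists d B, 0 < d /\ 0 <= B /\
  forall y, dX x y < d -> forall t, I01 t -> Cmod (f y t) <= B.
Proof.
intros Hx H. destruct (tube dX f x Hx H 1 ltac:(lra)) as [d [Hd H1]].
destruct (ic_bounded (f x)) as [B [HB HB2]]; [intros t Ht; apply (jc_ct dX f x t Hx), H, Ht|]. exists d, (1 + B)%R. split; [assumption|].
split; [lra|]. intros y Hy t Ht. specialize (H1 y Hy t Ht). specialize (HB2 t Ht). have T := Cmod_triangle (f y t - f x t) (f x t).
replace (f y t - f x t + f x t) with (f y t) in T by ring. lra.
Qed.

Lemma is_sum_conj {A} (f : A -> C) s : is_sum f s -> is_sum (fun a => Cconj (f a)) (Cconj s).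
Proof.
intros H eps He. destruct (H eps He) as [L0 H0]. exists L0. intros L HL Hi. have E : lsum (fun a => Cconj (f a)) L = Cconj (lsum f L).
{ clear. induction L as [|a L IH]; simpl; [go|]. rewrite IH. go. } rewrite E.
replace (Cconj (lsum f L) - Cconj s) with (Cconj (lsum f L - s)) by go. rewrite Cmod_conj. go.
Qed.

Lemma wd_R_merge (f : R -> C) t a b : wd RtoC f t a b -> rder f t (a + b).
Proof.
intros H eps He. destruct (H eps He) as [d [Hd H1]]. take d. intros y Hy. specialize (H1 y Hy).
replace (Cconj (RtoC y - RtoC t)) with (RtoC y - RtoC t) in * by go.
replace ((y - t) * (a + b) + (y - t) * 0) with ((y - t) * a + (y - t) * b) by ring. go.
Qed.

Lemma wd_horiz (f : C -> C) A B x y : wd idC f (x, y) A B -> rder (fun t : R => f (t, y)) x (A + B).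
Proof.
intros H. have Hl : wd RtoC (fun t : R => idC (t, y)) x 1 0. { apply (wd_ext RtoC (fun t : R => t + Ci * y)); [go|]. go. }
have H2 := wd_R_merge _ _ _ _ (wd_chain RtoC idC f (fun t : R => (t, y)) x A B 1 0 H Hl). eapply wd_eq; [|go|exact H2]. go.
Qed.

Lemma wd_vert (f : C -> C) A B x y : wd idC f (x, y) A B -> rder (fun t : R => f (x, t)) y (Ci * (A - B)).
Proof.
intros H. have Hl : wd RtoC (fun t : R => idC (x, t)) y Ci 0. { apply (wd_ext RtoC (fun t : R => x + Ci * t)); [go|]. go. }
have H2 := wd_R_merge _ _ _ _ (wd_chain RtoC idC f (fun t : R => (x, t)) y A B Ci 0 H Hl). eapply wd_eq; [|go|exact H2]. go.
Qed.

Lemma ct_xy {X} (dX : X -> X -> R) (a b : X -> R) x : ct dX dR a x -> ct dX dR b x -> ct dX dC (fun x => (a x, b x)) x.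
Proof. intros Ha Hb. apply (ct_ext dX dC (fun x => a x + Ci * b x)); [go|]. ctt. Qed.
Lemma upper_xy x y : 0 < y -> upper (x, y).
Proof. go. Qed.
Lemma I01_shift1 (g : C -> C) (x y : R) : (forall z, upper z -> g (z + 1) = g z) -> 0 < y -> g ((x + 1)%R, y) = g (x, y).
Proof. intros H Hy. rewrite <- (H (x, y)) by go. f_equal. go. Qed.
Lemma ic_horiz (g : C -> C) y : (forall x, ct dC dC g (x, y)) -> ic (fun x => g (x, y)).
Proof. intros H x _. apply (ct_comp dR dC dC g (fun x => (x, y))); [apply ct_xy; ctt|go]. Qed.

(** The derivative in y of a horizontal mean is the mean of a derivative in x, which vanishes by periodicity. *)
Lemma per_const (g : C -> C) y1 y2 : (forall z, upper z -> ana g z) -> (forall z, upper z -> g (z + 1) = g z) ->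
  0 < y1 -> 0 < y2 -> CI (fun x => g (x, y1)) = CI (fun x => g (x, y2)).
Proof.
intros Ha Hp. have Hd : forall y, 0 < y -> rder (fun y => CI (fun x => g (x, y))) y 0.
{ intros y Hy. have E : CI (fun x => Ci * dd g (x, y)) = 0.
 { rewrite CI_scal by (apply ic_horiz; intros x; now apply ana_dd, Ha). rewrite (CI_FTC (fun x => g (x, y))).
  - have S := I01_shift1 g 0 y Hp Hy. replace (0 + 1)%R with 1%R in S by ring. rewrite S. ring.
  - intros x _. wd_by (apply (wd_horiz g (dd g (x, y)) 0), ana_dd, Ha; exact Hy); ring.
  - apply ic_horiz. intros x. now apply ana_dd, Ha. } rewrite <- E at 1.
 apply (rder_CI (fun y x => g (x, y)) (fun y x => Ci * dd g (x, y))).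
 - take y. intros y' Hy'. have P : 0 < y' by (apply Rabs_def2 in Hy'; lra). split.
  + apply ic_horiz. intros x. now apply ana_ct, Ha. + intros x _. wd_by (apply (wd_vert g (dd g (x, y')) 0), ana_dd, Ha; exact P); ring.
 - intros x _. apply ct_jc. apply ct_mult; [go|]. apply (ct_comp (dP dR dR) dC dC (dd g) (fun q => (snd q, fst q))); [apply ct_xy; ctt|].
  now apply ana_dd, Ha. } have Hle : forall a b, 0 < a -> a <= b -> CI (fun x => g (x, a)) = CI (fun x => g (x, b)).
{ intros a b H0 Hab. have M := mvi (fun y => CI (fun x => g (x, y))) (fun _ => 0) a b 0 Hab.
 have E : CI (fun x => g (x, b)) - CI (fun x => g (x, a)) = 0.
 { apply Cmod_eq_0. apply Rle_antisym; [|go]. rewrite Rmult_0_l in M. apply M.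
  - intros t Ht. apply Hd. lra. - intros t _. rewrite Cmod_0. lra. }
 replace (CI (fun x => g (x, b))) with (CI (fun x => g (x, b)) - CI (fun x => g (x, a)) + CI (fun x => g (x, a))) by ring. rewrite E. ring. }
intros H1 H2. destruct (Rle_lt_dec y1 y2); [go|symmetry; apply Hle; lra].
Qed.

Definition qcoef (g : C -> C) (n : Z) : C := CI (fun x => g (x, 1%R) * ez (- n) (x, 1%R)).

Lemma ana_ez n z : ana (ez n) z.
Proof. go. Qed.
Lemma ez_per n z : ez n (z + 1) = ez n z.
Proof. unfold ez. replace (IZR n * (z + 1)) with (IZR n * z + IZR n) by ring. rewrite ee_plus, ee_Z. ring. Qed.

Section Periodic.
Variable g : C -> C.
Hypothesis ga : forall z, upper z -> ana g z.
Hypothesis gp : forall z, upper z -> g (z + 1) = g z.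

Lemma qcoef_height n y : 0 < y -> qcoef g n = CI (fun x => g (x, y) * ez (- n) (x, y)).
Proof.
intros Hy. apply (per_const (fun z => g z * ez (- n) z) 1 y); trivial; [| |lra].
- intros z Hz. apply ana_mult; [go|go]. - intros z Hz. now rewrite gp, ez_per.
Qed.

Lemma qcoef_bound n y C0 : 0 < y -> (forall x, I01 x -> Cmod (g (x, y)) <= C0) ->
  Cmod (qcoef g n) <= C0 * exp (2 * PI * IZR n * y).
Proof.
intros Hy H. rewrite (qcoef_height n y Hy). apply CI_bound.
- apply (ic_horiz (fun z => g z * ez (- n) z)). intros x. apply ct_mult; [now apply ana_ct, ga|go].
- intros x Hx. rewrite Cmod_mult, Cmod_ez, opp_IZR. unfold Im. cbn [snd].
 replace (- (2 * PI * - IZR n * y))%R with (2 * PI * IZR n * y)%R by ring. apply Rmult_le_compat_r; [go|go].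
Qed.

Lemma ez_xy n x y : ez n (x, y) = ez n x * ez n (0%R, y).
Proof. rewrite <- ez_add. f_equal. go. Qed.

Lemma qcoef_fc n y : 0 < y -> fc (fun x => g (x, y)) n = qcoef g n * ez n (0%R, y).
Proof.
intros Hy. rewrite (qcoef_height n y Hy), Cmult_comm, <- CI_scal.
- apply CI_ext. intros x _. rewrite (ez_xy (- n) x y), !(ez_opp n (0%R, y)). go.
- apply (ic_horiz (fun z => g z * ez (- n) z)). intros x. apply ct_mult; [now apply ana_ct, ga|go].
Qed.

(** Fourier inversion on a horizontal line; the coefficients do not depend on the line by [per_const]. *)
Lemma qexp z : upper z -> is_sum (fun n => qcoef g n * ez n z) (g z).
Proof.
destruct z as [x y]. intros Hy. have Hd : forall (k : C -> C) x, (forall z, upper z -> ana k z) -> rder (fun x => k (x, y)) x (dd k (x, y)).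
{ intros k t Hk. wd_by (apply (wd_horiz k (dd k (t, y)) 0), ana_dd, Hk; exact Hy); ring. }
have Hic : forall k : C -> C, (forall z, upper z -> ana k z) -> ic (fun x => k (x, y)).
{ intros k Hk. apply ic_horiz. intros t. now apply ana_ct, Hk. }
have Ha1 : forall z, upper z -> ana (dd g) z by (intros; now apply ana_deriv, ga).
have Ha2 : forall z, upper z -> ana (dd (dd g)) z by (intros; now apply ana_deriv, Ha1).
have Hp1 : forall z, upper z -> dd g (z + 1) = dd g z.
{ intros z Hz. have Hz1 : upper (z + 1) by (unfold upper, Im in *; simpl; lra). apply cder_dd.
 apply (wd_ext_loc idC (fun w => g (w + - (1)))).
 - destruct (upper_disc _ Hz1) as [d [Hd0 H]]. take d. intros w Hw. specialize (H w Hw). rewrite <- (gp (w + - (1))); [f_equal; ring|].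
  unfold upper, Im in *; simpl; lra.
 - wd_by (apply (wd_comp_hol idC g (fun w => w + - (1)) (z + 1) (dd g z) 1 0)).
  + ring. + ring. + replace (z + 1 + - (1)) with z by ring. now apply ana_dd, ga.
  + go. } destruct (ic_bounded _ (Hic g ga)) as [B1 [HB1 HB2]]. destruct (ic_bounded _ (Hic _ Ha2)) as [B3 [HB3 HB4]].
have S0 := I01_shift1 g 0 y gp Hy. have S1 := I01_shift1 (dd g) 0 y Hp1 Hy. rewrite Rplus_0_l in S0, S1.
have HF : is_sum (fun n => fc (fun x => g (x, y)) n * ez n x) (g (x, y)).
{ apply (fourier_per (fun x => g (x, y)) (fun x => dd g (x, y)) (fun n => 2 * (B1 + B3) * qz n)%R).
 - intros t. now apply I01_shift1. - go. - go.
 - intros n. apply (fc_decay _ (fun x => dd g (x, y)) (fun x => dd (dd g) (x, y))); auto.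
  + intros t Ht. specialize (HB2 t Ht). lra.
  + intros t Ht. specialize (HB4 t Ht). lra. } apply is_sum_ext with (2 := HF). intros n. rewrite qcoef_fc, (ez_xy n x y) by go. ring.
Qed.
End Periodic.

(** * The local solution at the cusp *)

Lemma sg_bound : exists B, 0 <= B /\ forall z, 1 <= Im z -> Cmod (sg z) <= B.
Proof.
destruct (bnd_qm 1 ltac:(lra)) as [H0 [B HB]]. exists B. split; [apply (HB nil); constructor|]. intros z Hz.
apply (is_sum_le (fun p => qt p z) (qm 1)); [apply sg_spec; unfold upper; lra| |go]. intros p. apply qt_bound; lra.
Qed.

Definition gbd (C0 y : R) (k : nat) (m : R) (n : Z) : R :=
  (exp (C0 + C0 * y) * (Rabs (IZR n) ^ k * exp (- m) ^ Z.abs_nat n))%R.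

Lemma INR_abs_nat n : INR (Z.abs_nat n) = Rabs (IZR n).
Proof. now rewrite INR_IZR_INZ, Zabs2Nat.id_abs, abs_IZR. Qed.

Lemma bnd_gbd C0 y k m : 0 < m -> (k <= 3)%nat -> bnd (gbd C0 y k m).
Proof.
intros Hm Hk. apply bnd_scal; [go|]. have Hx : 0 <= exp (- m) < 1.
{ split; [go|]. have H := exp_increasing (- m) 0 ltac:(lra). now rewrite exp_0 in H. } apply (bnd_le _ _ 1 (bnd_Z _ (bnd_geom_poly _ Hx))).
intros n. rewrite Rmult_1_l, S_INR, INR_abs_nat. have P := Rabs_pos (IZR n). split; [go|]. apply Rmult_le_compat_r; [go|].
apply Rle_trans with ((Rabs (IZR n) + 1) ^ k)%R; [apply pow_incr; lra|]. apply Rle_pow; [lra|lia].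
Qed.

Lemma gbd_le C0 C1 y y' k m n : 0 <= C0 <= C1 -> 0 <= y <= y' -> gbd C0 y k m n <= gbd C1 y' k m n.
Proof. intros H Hy. apply Rmult_le_compat_r. - go. - apply exp_mono. nra. Qed.

Lemma expo (c m y : R) (N n : Z) : (- N <= n)%Z -> (0 <= N)%Z -> 0 < m <= y -> PI + 1 <= c <= 8 ->
  exp (PI * IZR n * m - c * IZR n * y) <= exp (8 * IZR N * y) * exp (- m) ^ Z.abs_nat n.
Proof.
intros Hn HN Hm Hc. rewrite <- exp_INR, <- exp_plus, INR_abs_nat. apply exp_mono. apply IZR_le in Hn. rewrite opp_IZR in Hn.
apply IZR_le in HN. have G3 := PI_gt_3. destruct (Rle_lt_dec 0 (IZR n)) as [H|H].
- rewrite Rabs_pos_eq by go. assert (0 <= 8 * IZR N * y) by nra.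
 assert (IZR n * (PI * m + m) <= IZR n * (c * y)) by (apply Rmult_le_compat_l; [go|nra]). lra.
- rewrite Rabs_left by go. have Q : (- IZR n) * (c * y - PI * m + m) <= IZR N * (8 * y). { apply Rmult_le_compat; try nra. } lra.
Qed.

Lemma wd_lip_disc (g : C -> C) z d M : (forall y, disc z d y -> exists A B, wd idC g y A B /\ Cmod A + Cmod B <= M) ->
  forall y, disc z d y -> Cmod (g y - g z) <= M * Cmod (y - z).
Proof.
intros H y Hy. set (h := y - z). have Hs : forall s, I01 s -> disc z d (z + s * h).
{ intros s [H0 H1]. unfold disc in *. replace (z + s * h - z) with (s * h) by ring. rewrite Cmod_mult, Cmod_R, Rabs_pos_eq by go.
 have P := Cmod_ge_0 h. fold h in Hy. nra. }
have Hex : forall s : R, exists v, I01 s -> rder (fun s : R => g (z + s * h)) s v /\ Cmod v <= M * Cmod h.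
{ intros s. destruct (classical (I01 s)) as [i|i]; [|exists (RtoC 0); intros; contradiction]. destruct (H _ (Hs s i)) as [A [B [HW HM]]].
 exists (A * h + B * Cconj h). intros _. split.
 - have Hl : wd RtoC (fun s : R => idC (z + s * h)) s h 0 by (unfold idC; apply rder_lin).
  have H2 := wd_R_merge _ _ _ _ (wd_chain RtoC idC g (fun s : R => z + s * h) s A B h 0 HW Hl). eapply wd_eq; [|reflexivity|exact H2]. go.
 - tri. rewrite !Cmod_mult, Cmod_conj. have P := Cmod_ge_0 h. nra. }
set (g' := fun s => epsilon (inhabits (RtoC 0)) (fun v => I01 s -> rder (fun s : R => g (z + s * h)) s v /\ Cmod v <= M * Cmod h)).
have Hg' : forall s, I01 s -> rder (fun s : R => g (z + s * h)) s (g' s) /\ Cmod (g' s) <= M * Cmod h.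
{ intros s. exact (epsilon_spec (inhabits (RtoC 0)) _ (Hex s)). }
have Hm := mvi (fun s : R => g (z + s * h)) g' 0 1 (M * Cmod h)%R ltac:(lra). cbv beta in Hm. replace (z + 1%R * h) with y in Hm by go.
replace (z + 0%R * h) with z in Hm by ring. rewrite Rminus_0_r, Rmult_1_r in Hm. apply Hm; intros t Ht; apply Hg'; exact Ht.
Qed.

Lemma wd_Im_inv z : wd idC (fun z => RtoC (Im z)) z (/ (2 * Ci)) (- / (2 * Ci)).
Proof.
apply (wd_ext idC (fun z => / (2 * Ci) * (z - Cconj z))).
- intros w. replace (w - Cconj w) with (2 * Ci * Im w) by go. go.
- wd_by (apply wd_scal, wd_minus; [apply (wd_io idC)|apply wd_conj, (wd_io idC)]); replace (Cconj 1) with (RtoC 1) by (apply C_eq; simpl;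
  ring); replace (Cconj 0) with (RtoC 0) by (apply C_eq; simpl; ring); ring.
Qed.

Lemma wd_sum_R (g g' : R -> C) z : rder g (Im z) (g' (Im z)) ->
  wd idC (fun z => g (Im z)) z (g' (Im z) * / (2 * Ci)) (- (g' (Im z) * / (2 * Ci))).
Proof. intros H. wd_by (apply (wd_chain idC RtoC g (fun z => Im z) z (g' (Im z)) 0 (/ (2 * Ci)) (- / (2 * Ci)) H (wd_Im_inv z))); ring. Qed.

Section Cusp.
Variables (l M : Z) (f : C -> C).
Hypothesis fa : forall z, upper z -> ana f z.
Hypothesis fp : forall z, upper z -> f (z + 1) = f z.
Hypothesis fgr : exists a0 B0 Y0 : R, forall x y, I01 x -> Y0 <= y -> Cmod (f (x, y)) <= B0 * exp (a0 * y).

Definition K0 (s z : C) : C := f z * Cexp (2 * s * sg z).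
Definition af (n : Z) (r : C) : C := Cconj (qcoef (K0 (Cconj r)) n).

Lemma sg_per z : upper z -> sg (z + 1) = sg z.
Proof. intros Hz. exact (sg_shift z 1 Hz). Qed.
Lemma K0_ana s z : upper z -> ana (K0 s) z.
Proof. intros Hz. apply ana_mult; [go|]. apply ana_Cexp, ana_mult; [go|now apply ana_sg]. Qed.
Lemma K0_per s z : upper z -> K0 s (z + 1) = K0 s z.
Proof. intros Hz. unfold K0. now rewrite fp, sg_per. Qed.

Lemma ct_K0 {X} (dX : X -> X -> R) (s z : X -> C) x : upper (z x) -> ct dX dC s x -> ct dX dC z x -> ct dX dC (fun x => K0 (s x) (z x)) x.
Proof.
intros Hz Hs Hc. have H1 := ct_comp dX dC dC f z x Hc (ana_ct _ _ (fa _ Hz)).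
have H2 := ct_comp dX dC dC sg z x Hc (ana_ct _ _ (ana_sg _ Hz)). ctt.
Qed.

Lemma af_bound r0 y0 : 0 < y0 -> exists d C0, 0 < d /\ 0 <= C0 /\ forall r n, disc r0 d r ->
  Cmod (af n r) <= C0 * exp (2 * PI * IZR n * y0).
Proof.
intros Hy. destruct (tube_bound dC (fun r x => K0 (Cconj r) (x, y0)) r0 (dC_refl r0)) as [d [C0 [Hd [HC H]]]].
{ intros t _. apply ct_jc. apply ct_K0; [go|ctt|]. apply ct_xy; ctt. } exists d, C0. split; [assumption|]. split; [assumption|].
intros r n Hr. unfold af. rewrite Cmod_conj. apply qcoef_bound; trivial; [intros z; apply K0_ana|intros z; apply K0_per|]. go.
Qed.

(** Exponential growth of F bounds a_n exp(-2 pi n y) by a fixed exponential of y. *)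
Lemma af_vanish : exists N : Z, (0 <= N)%Z /\ forall n r, (n < - N)%Z -> af n r = 0.
Proof.
destruct fgr as [a0 [B0 [Y0 Hf]]]. destruct sg_bound as [B [HB HS]]. exists (Z.max 0 (up a0)). split; [lia|]. intros n r Hn.
have Hn2 : IZR n + 1 <= - a0.
{ have X := archimed a0. have Y : IZR n + 1 <= - IZR (up a0) by (rewrite <- opp_IZR, <- plus_IZR; apply IZR_le; lia). lra. }
have Hn3 : IZR n + 1 <= 0 by (rewrite <- plus_IZR; apply IZR_le; lia). set (C0 := (Rabs B0 * exp (2 * Cmod r * B))%R).
have Hb : forall y, Rmax 1 Y0 <= y -> Cmod (af n r) <= C0 * exp (- y).
{ intros y Hy. have Q1 := Rmax_l 1 Y0. have Q2 := Rmax_r 1 Y0. unfold af. rewrite Cmod_conj.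
 apply Rle_trans with (C0 * exp (a0 * y) * exp (2 * PI * IZR n * y))%R.
 - apply qcoef_bound; [intros z; apply K0_ana|intros z; apply K0_per|lra|]. intros x Hx. unfold K0. rewrite Cmod_mult.
  have H1 := Hf x y Hx ltac:(lra). have H2 : Cmod (Cexp (2 * Cconj r * sg (x, y))) <= exp (2 * Cmod r * B).
  { rewrite Cmod_Cexp. apply exp_mono. have X := re_le_Cmod (2 * Cconj r * sg (x, y)).
   rewrite !Cmod_mult, Cmod_conj, Cmod_R, (Rabs_pos_eq 2) in X by lra. have Z := Rle_abs (Re (2 * Cconj r * sg (x, y))).
   have Hs1 : 1 <= Im (x, y) by (apply Rle_trans with (1 := Q1); exact Hy). specialize (HS (x, y) Hs1). have P := Cmod_ge_0 r. go. }
  have H3 : Cmod (f (x, y)) <= Rabs B0 * exp (a0 * y). { eapply Rle_trans; [exact H1|]. apply Rmult_le_compat_r; [go|apply Rle_abs]. }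
  unfold C0. replace (Rabs B0 * exp (2 * Cmod r * B) * exp (a0 * y))%R with (Rabs B0 * exp (a0 * y) * exp (2 * Cmod r * B))%R by ring.
  apply Rmult_le_compat; trivial; apply Cmod_ge_0.
 - rewrite Rmult_assoc, <- exp_plus. apply Rmult_le_compat_l; [go|]. apply exp_mono. have G := PI_gt_3.
  assert (2 * PI * IZR n <= IZR n) by nra. nra. } apply Cmod_eq_0. apply Rle_antisym; [|go]. apply le_all_eps. intros eps He.
set (y := Rmax (Rmax 1 Y0) (C0 / eps)%R). eapply Rle_trans; [apply (Hb y), Rmax_l|]. have Hy : C0 / eps <= y by apply Rmax_r.
rewrite exp_Ropp. apply Rmult_le_reg_r with (exp y); [go|]. rewrite Rmult_assoc, Rinv_l, Rmult_1_r by (apply Rgt_not_eq, exp_pos).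
have E := le_exp y. apply Rle_trans with (eps * y)%R; [|go]. apply Rmult_le_reg_r with (/ eps)%R; [go|].
replace (eps * y * / eps)%R with y by (field; lra). go.
Qed.

Lemma ana_af n r : ana (af n) r.
Proof.
have Hc1 : forall x : R, ct dC dC f (x, 1%R) by (intros x; apply ana_ct, fa; unfold upper, Im; cbn; lra).
have Hc2 : forall x : R, ct dC dC sg (x, 1%R) by (intros x; apply ana_ct, ana_sg; unfold upper, Im; cbn; lra).
apply ana_ext_loc with (f := fun r => CI (fun x => Cconj (f (x, 1%R) * ez (- n) (x, 1%R)) * Cexp (2 * r * Cconj (sg (x, 1%R))))).
- exists 1%R. split; [lra|]. intros r' _. unfold af, qcoef. rewrite <- CI_conj.
 + apply CI_ext. intros x _. unfold K0. rewrite !Cmult_conj, <- Cexp_conj, !Cmult_conj.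
  replace (Cconj (Cconj r')) with r' by (destruct r'; apply C_eq; simpl; ring). replace (Cconj 2) with (RtoC 2) by go. ring.
 + apply (ic_horiz (fun z => K0 (Cconj r') z * ez (- n) z)). intros x. apply ct_mult; [|apply ana_ct, ana_ez]. apply ana_ct, K0_ana.
  unfold upper, Im; cbn; lra.
- apply (ana_CI (fun r x => Cconj (f (x, 1%R) * ez (- n) (x, 1%R)) * Cexp (2 * r * Cconj (sg (x, 1%R)))) r 1); [lra| |].
 + intros z t _ _. apply ct_jc. pairs. have Hx : ct (dP dC dR) dC (fun q : C * R => (snd q, 1%R)) (z, t) by (apply ct_xy; ctt).
  have H1 := ct_comp (dP dC dR) dC dC f _ _ Hx (Hc1 t). have H2 := ct_comp (dP dC dR) dC dC sg _ _ Hx (Hc2 t).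
  have H3 := ct_ez _ (- n) _ _ Hx. ctt.
 + go.
Qed.

Definition tv (k : nat) (n : Z) (r z : C) : C := IZR n ^ k * af n r * ez (- n) z * ff l M n r (Im z).
Definition dv (k : nat) (n : Z) (r z : C) : C := IZR n ^ k * af n r * ez (- n) z * psi l n r (Im z).
(** Apart from the terms that come from f_n, differentiation in z multiplies the n-th term by n, so the derivatives of
    [V 0] are expressed by [V 1] and [V 2]; the weight n^k is carried along instead of treating the derivatives
    separately. *)
Definition V (k : nat) (r z : C) : C := SUM (fun n => tv k n r z).

Lemma Cmod_pow_Z n k : Cmod (IZR n ^ k) = (Rabs (IZR n) ^ k)%R.
Proof. induction k as [|k IH]; simpl; [apply Cmod_1|]. now rewrite Cmod_mult, IH, Cmod_R. Qed.

Lemma term_bound r0 m : slit_plane M r0 -> 0 < m -> exists d C0, 0 < d /\ 0 <= C0 /\ forall k n r z,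
  disc r0 d r -> m <= Im z -> Cmod (tv k n r z) <= gbd C0 (Im z) k m n /\ Cmod (dv k n r z) <= gbd C0 (Im z) k m n.
Proof.
intros Hr Hm. destruct af_vanish as [N [HN Hv]]. destruct (ff_bound l M r0 m N Hr Hm) as [d1 [c1 [Hd1 [Hc1 H1]]]].
destruct (af_bound r0 (m / 2)%R ltac:(lra)) as [d2 [c2 [Hd2 [Hc2 H2]]]]. set (R0 := (Cmod r0 + 1)%R).
have HR0 : 0 <= R0 by (unfold R0; have P1 := Cmod_ge_0 r0; lra). set (c3 := (Rabs (klc (Rabs (IZR l) + R0) 1 m) + (1 + 16 * R0))%R).
set (C0 := (c1 + c2 + c3 + 8 * IZR N)%R). have HNR : 0 <= IZR N by now apply IZR_le.
have Hc3 : 0 <= c3 by (unfold c3; have P := Rabs_pos (klc (Rabs (IZR l) + R0) 1 m); lra). exists (Rmin d1 (Rmin d2 1)), C0.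
split; [repeat apply rmin_pos; lra|]. split; [unfold C0; lra|]. intros k n r z Hd Hz. apply lt_rmin in Hd as [Hda Hd].
apply lt_rmin in Hd as [Hdb Hdc]. have Hrb : Cmod r <= R0 by (apply (near_disc_bound r0 1 r); exact Hdc).
destruct (Z_lt_le_dec n (- N)) as [Hn|Hn].
{ have P : 0 <= gbd C0 (Im z) k m n by go. unfold tv, dv. rewrite (Hv n r Hn). vanish (IZR n ^ k * 0 * ez (- n) z).
 rewrite !Cmult_0_l, Cmod_0. go. } specialize (H2 r n Hdb).
have Gen : forall (X : C) c e, 0 <= c <= c1 + c3 -> PI + 1 <= e - 2 * PI <= 8 -> Cmod X <= exp (c + c * Im z - e * IZR n * Im z) -> Cmod
 (IZR n ^ k * af n r * ez (- n) z * X) <= gbd C0 (Im z) k m n.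
{ intros X c e Hc He HX. rewrite !Cmod_mult, Cmod_pow_Z, Cmod_ez, opp_IZR. unfold gbd.
 replace (- (2 * PI * - IZR n * Im z))%R with (2 * PI * IZR n * Im z)%R by ring.
 have E := expo (e - 2 * PI) m (Im z) N n ltac:(lia) HN ltac:(lra) He.
 replace (exp (C0 + C0 * Im z) * (Rabs (IZR n) ^ k * exp (- m) ^ Z.abs_nat n))%R with (Rabs (IZR n) ^ k * (exp (C0 + C0 * Im z) * exp (- m)
  ^ Z.abs_nat n))%R by ring.
 match goal with |- (?a * ?b * ?u * ?v <= _) => replace (a * b * u * v)%R with (a * (b * (u * v)))%R by ring end.
 apply Rmult_le_compat_l; [go|].
 apply Rle_trans with (exp c2 * exp (2 * PI * IZR n * (m / 2)) * (exp (2 * PI * IZR n * Im z) * exp (c + c * Im z - e * IZR n * Im z)))%R.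
 { apply Rmult_le_compat; try apply Cmod_ge_0.
  - go. - eapply Rle_trans; [exact H2|]. apply Rmult_le_compat_r; [go|apply le_exp]. - apply Rmult_le_compat_l; [go|go]. }
 apply Rle_trans with (exp (c2 + c + c * Im z) * (exp (8 * IZR N * Im z) * exp (- m) ^ Z.abs_nat n))%R.
 { apply Rle_trans with (exp (c2 + c + c * Im z) * exp (PI * IZR n * m - (e - 2 * PI) * IZR n * Im z))%R.
  - rewrite <- !exp_plus. right. f_equal. field.
  - apply Rmult_le_compat_l; [go|go]. } rewrite <- Rmult_assoc. apply Rmult_le_compat_r; [go|]. rewrite <- exp_plus. apply exp_mono.
 unfold C0. go. } have G3 := PI_gt_3. have G4 := PI_4. split.
- apply (Gen _ c1 (4 * PI - 2)%R); [lra|lra|]. go.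
- apply (Gen _ c3 (4 * PI)%R); [lra|lra|]. have E : psi l n r (Im z) = psi l 0 r (Im z) * RtoC (exp (- (4 * PI * IZR n * Im z))).
 { unfold psi. rewrite <- Cexp_R, <- Cexp_plus. f_equal. go. } rewrite E, Cmod_mult, Cmod_R, (Rabs_pos_eq (exp _)) by go.
 have B := psi_bound l 0 R0 m r (Im z) HR0 Hrb ltac:(lra). rewrite Rabs_R0, Rplus_0_l in B.
 apply Rle_trans with (exp (c3 + c3 * Im z) * exp (- (4 * PI * IZR n * Im z)))%R.
 + apply Rmult_le_compat_r; [go|]. eapply Rle_trans; [exact B|]. apply exp_mono. have W := Rle_abs (klc (Rabs (IZR l) + R0) 1 m).
  have W2 := Rabs_pos (klc (Rabs (IZR l) + R0) 1 m). unfold c3. go.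
 + rewrite <- exp_plus. go.
Qed.

Lemma V_spec k r z : (k <= 3)%nat -> slit_plane M r -> upper z -> is_sum (fun n => tv k n r z) (V k r z).
Proof.
intros Hk Hr Hz. destruct (term_bound r (Im z) Hr Hz) as [d [C0 [Hd [_ H]]]].
apply (SUM_spec _ (gbd C0 (Im z) k (Im z))); [now apply bnd_gbd|]. intros n. apply H; [now apply disc_center|lra].
Qed.

Lemma V_growth r : slit_plane M r -> exists C0, 0 <= C0 /\ forall z, 1 <= Im z -> Cmod (V 0 r z) <= exp (C0 + C0 * Im z).
Proof.
intros Hr. destruct (term_bound r 1 Hr ltac:(lra)) as [d [C0 [Hd [HC H]]]]. destruct (bnd_gbd 0 0 0 1 ltac:(lra) ltac:(lia)) as [_ [B HB]].
have HB0 : 0 <= B by (apply (HB nil); constructor). exists (C0 + B)%R. split; [lra|]. intros z Hz.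
apply (is_sum_le (fun n => tv 0 n r z) (gbd C0 (Im z) 0 1)); [apply V_spec; trivial; [lia|unfold upper; lra]| |].
- intros n. apply H; [now apply disc_center|go].
- intros L HL. specialize (HB L HL). have E : rsum (gbd C0 (Im z) 0 1) L = (exp (C0 + C0 * Im z) * rsum (gbd 0 0 0 1) L)%R.
 { rewrite <- rsum_scal. f_equal. apply functional_extensionality. intros n. unfold gbd. replace (0 + 0 * 0)%R with 0%R by ring.
  rewrite exp_0. ring. } rewrite E. apply Rle_trans with (exp (C0 + C0 * Im z) * exp B)%R.
 + apply Rmult_le_compat_l; [go|]. eapply Rle_trans; [exact HB|apply le_exp]. + rewrite <- exp_plus. apply exp_mono. nra.
Qed.

Lemma ct_tv k n r z : slit_plane M r -> upper z -> ct (dP dC dC) dC (fun q => tv k n (fst q) (snd q)) (r, z).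
Proof.
intros Hr Hz. have H1 := ct_comp (dP dC dC) dC dC (af n) (fun q => fst q) (r, z) ltac:(ctt) (ana_ct _ _ (ana_af n r)).
have H3 : ct (dP dC dC) dC (fun q => ff l M n (fst q) (Im (snd q))) (r, z).
{ apply ct_ff; trivial.
 - nng. - unfold dP. rewrite !dC_refl. ring. - apply ct_Im. ctt. - ctt.
 - destruct (upper_disc z Hz) as [d [Hd H]]. take d. intros [r' z'] Hq. unfold dP in Hq. cbn [fst snd] in *. apply H. have X := dC_ge0 r r'.
  unfold disc. unfold dC in Hq, X. lra. } go.
Qed.

Lemma V_ct k r z : (k <= 3)%nat -> slit_plane M r -> upper z -> ct (dP dC dC) dC (fun q => V k (fst q) (snd q)) (r, z).
Proof.
intros Hk Hr Hz. have Hm : 0 < Im z / 2 by go. destruct (term_bound r _ Hr Hm) as [d [C0 [Hd [HC H]]]].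
destruct (slit_plane_open M r Hr) as [d1 [Hd1 HU]].
apply (ct_SUM (dP dC dC) (fun n q => tv k n (fst q) (snd q)) _ (gbd C0 (Im z + Im z / 2) k (Im z / 2))).
- unfold dP. rewrite !dC_refl. ring. - now apply bnd_gbd.
- exists (Rmin (Rmin d d1) (Im z / 2)). split; [go|]. intros [r' z'] Hq. unfold dP in Hq. cbn [fst snd] in *.
 apply lt_rmin in Hq as [Hq1 Hq2]. apply lt_rmin in Hq1. have P1 := dC_ge0 r r'. have P2 := dC_ge0 z z'.
 have Hz' : disc z (Im z / 2) z' by (unfold disc; unfold dC in *; lra). have Hr' : disc r d r' by (unfold disc; unfold dC in *; lra).
 destruct (disc_upper z z' Hz Hz') as [Hz1 Hz2]. split.
 + apply V_spec; trivial. apply HU. unfold disc; unfold dC in *; lra.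
 + intros n. eapply Rle_trans; [apply H; assumption|]. apply gbd_le; [lra|]. have X := im_le_Cmod (z' - z).
  replace (Im (z' - z)) with (Im z' - Im z)%R in X by go. have Y := Rle_abs (Im z' - Im z). unfold disc in Hz'. lra.
- intros n. now apply ct_tv.
Qed.

Lemma V_ana k r z : (k <= 3)%nat -> slit_plane M r -> upper z -> ana (fun r => V k r z) r.
Proof.
intros Hk Hr Hz. destruct (term_bound r _ Hr Hz) as [d [C0 [Hd [HC H]]]]. destruct (slit_plane_open M r Hr) as [d1 [Hd1 HU]].
apply (ana_SUM (fun n r => tv k n r z) _ (gbd C0 (Im z) k (Im z)) r (Rmin d d1)); [go|now apply bnd_gbd| |].
- intros n r' Hr'. apply lt_rmin in Hr'. split.
 + apply ana_mult; [apply ana_mult; [apply ana_mult; [go|apply ana_af]|go]|]. apply ana_ff; [now apply HU|go]. + apply H; [go|lra].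
- intros r' Hr'. apply lt_rmin in Hr'. apply V_spec; trivial. now apply HU.
Qed.

(** The series n^k a_n q-bar^n sum to F times a nonvanishing antiholomorphic function, and its derivative. *)
Definition Bk (k : nat) (r z : C) : C :=
  match k with O => Cconj (K0 (Cconj r) z) | _ => Cconj (/ pi2 * dd (K0 (Cconj r)) z) end.

Lemma dd_scal (c : C) g z : ana g z -> dd (fun w => c * g w) z = c * dd g z.
Proof. intros H. apply cder_dd. wd_by (apply wd_scal, ana_dd, H); ring. Qed.
Lemma dd_ez n z : dd (ez n) z = pi2 * IZR n * ez n z.
Proof. apply cder_dd. wd_by (apply wd_ez, (wd_io idC)); unfold pi2; ring. Qed.

Lemma dv_eq k n r z : dv k n r z = psi l 0 r (Im z) * Cconj (IZR n ^ k * (qcoef (K0 (Cconj r)) n * ez n z)).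
Proof.
have E : ez (- n) z * psi l n r (Im z) = psi l 0 r (Im z) * Cconj (ez n z).
{ unfold psi, ez, ee. rewrite <- Cexp_conj, <- !Cexp_plus. f_equal. rewrite opp_IZR, RtoC_opp. go. } unfold dv. rewrite <- Cmult_assoc, E.
unfold af. rewrite !Cmult_conj. have E2 : Cconj (IZR n ^ k) = IZR n ^ k.
{ induction k as [|k IH]; simpl; [go|]. rewrite Cmult_conj, IH. go. } rewrite E2. ring.
Qed.

Lemma dv_sum k r z : (k <= 1)%nat -> slit_plane M r -> upper z -> is_sum (fun n => dv k n r z) (psi l 0 r (Im z) * Bk k r z).
Proof.
intros Hk Hr Hz. apply is_sum_ext with (f := fun n => psi l 0 r (Im z) * Cconj (IZR n ^ k * (qcoef (K0 (Cconj r)) n * ez n z))).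
{ intros n. now rewrite dv_eq. } apply is_sum_scal.
have Hq : forall w, upper w -> is_sum (fun n => qcoef (K0 (Cconj r)) n * ez n w) (K0 (Cconj r) w).
{ intros w Hw. apply qexp; trivial; intros; [now apply K0_ana|now apply K0_per]. } destruct k as [|k].
- apply is_sum_conj. apply is_sum_ext with (2 := Hq z Hz). go.
- assert (k = 0)%nat by lia. subst k. apply is_sum_conj.
 apply is_sum_ext with (f := fun n => / pi2 * dd (fun w => qcoef (K0 (Cconj r)) n * ez n w) z).
 { intros n. rewrite dd_scal by go. rewrite dd_ez. go. } apply is_sum_scal. have Hm : 0 < Im z / 2 by go.
 destruct (term_bound r _ Hr Hm) as [d [C0 [Hd [HC H]]]].
 (* the majorant of the terms psi a_n qbar^n, divided by a lower bound of psi *)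
 have Hps : exists c, 0 < c /\ forall w, disc z (Im z / 4) w -> c <= Cmod (psi l 0 r (Im w)).
 { destruct (ic_bounded (fun t => / psi l 0 r (Im z / 2 + t * Im z)%R)) as [B [HB HB2]].
  { intros t [Ht _]. apply ct_inv; [apply Cexp_nz|]. apply ct_psi; [|ctt|].
   - go. - apply (ct_R_ring dR (fun t : R => (Im z / 2)%R + t * Im z)); [go|]. ctt. } exists (/ (B + 1))%R. split; [go|]. intros w Hw.
  have X := im_le_Cmod (w - z). replace (Im (w - z)) with (Im w - Im z)%R in X by go.
  have Hw1 : Rabs (Im w - Im z) < Im z / 4 by (unfold disc in Hw; lra). apply Rabs_def2 in Hw1. have Hi : I01 ((Im w - Im z / 2) / Im z)%R.
  { split; (apply Rmult_le_reg_r with (Im z); [go|]); replace ((Im w - Im z / 2) / Im z * Im z)%R with (Im w - Im z / 2)%R by (field;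
    unfold upper in Hz; lra); lra. } specialize (HB2 _ Hi).
  replace (Im z / 2 + (Im w - Im z / 2) / Im z * Im z)%R with (Im w) in HB2 by (field; unfold upper in Hz; lra).
  rewrite Cmod_inv in HB2 by apply Cexp_nz. have P : 0 < Cmod (psi l 0 r (Im w)) by (apply Cmod_gt_0, Cexp_nz).
  rewrite <- (Rinv_inv (Cmod (psi l 0 r (Im w)))). apply Rinv_le_contravar; [go|lra]. } destruct Hps as [c [Hc Hps]].
 apply (dd_SUM (fun n w => qcoef (K0 (Cconj r)) n * ez n w) (K0 (Cconj r)) (fun n => / c * gbd C0 (2 * Im z) 0 (Im z / 2) n)%R z (Im z /
  4)).
 + lra. + apply bnd_scal; [go|]. apply bnd_gbd; [go|lia].
 + intros n w Hw. split; [apply ana_mult; [go|go]|]. have X := im_le_Cmod (w - z). replace (Im (w - z)) with (Im w - Im z)%R in X by go.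
  have Hw1 : Rabs (Im w - Im z) < Im z / 4 by (unfold disc in Hw; lra). apply Rabs_def2 in Hw1.
  destruct (H 0%nat n r w (disc_center _ _ Hd) ltac:(lra)) as [_ H2]. rewrite dv_eq, Cmod_mult, Cmod_conj in H2.
  replace (IZR n ^ 0 * (qcoef (K0 (Cconj r)) n * ez n w)) with (qcoef (K0 (Cconj r)) n * ez n w) in H2 by go. specialize (Hps w Hw).
  have H3 := gbd_le C0 C0 (Im w) (2 * Im z) 0 (Im z / 2) n ltac:(lra) ltac:(lra). apply Rmult_le_reg_l with c; [go|].
  replace (c * (/ c * gbd C0 (2 * Im z) 0 (Im z / 2) n))%R with (gbd C0 (2 * Im z) 0 (Im z / 2) n) by (field; lra).
  have P := Cmod_ge_0 (qcoef (K0 (Cconj r)) n * ez n w). go.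
 + intros w Hw. apply Hq. apply (disc_upper z w Hz). unfold disc in *. lra.
Qed.

Lemma V_wd k r z : (k <= 1)%nat -> slit_plane M r -> upper z ->
  wd idC (V k r) z (- pi2 * V (S k) r z - / (2 * Ci) * (psi l 0 r (Im z) * Bk k r z)) (/ (2 * Ci) * (psi l 0 r (Im z) * Bk k r z)).
Proof.
intros Hk Hr Hz. have Hm : 0 < Im z / 2 by go. destruct (term_bound r _ Hr Hm) as [d [C0 [Hd [HC H]]]].
set (Mj := fun n => (Cmod pi2 * gbd C0 (2 * Im z) (S k) (Im z / 2) n + 2 * gbd C0 (2 * Im z) k (Im z / 2) n)%R).
have Hw : forall n w, upper w -> wd idC (tv k n r) w (- pi2 * tv (S k) n r w - / (2 * Ci) * dv k n r w) (/ (2 * Ci) * dv k n r w).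
{ intros n w Hw0. unfold tv.
 wd_by (apply wd_mult; [apply wd_mult; [apply wd_const|apply wd_ez, (wd_io idC)]| apply (wd_sum_R (ff l M n r) (fun y => - psi l n r y));
  now apply rder_ff]).
 - unfold dv. rewrite opp_IZR, RtoC_opp. unfold pi2. simpl. ring. - unfold dv. cring. }
apply (wd_SUM idC (fun n => tv k n r) (fun n => - pi2 * tv (S k) n r z - / (2 * Ci) * dv k n r z) (fun n => / (2 * Ci) * dv k n r z) (V k
 r) Mj z).
- apply bnd_plus; apply bnd_scal; try apply Cmod_ge_0; try lra; apply bnd_gbd; trivial; lia.
- exists (Im z / 2)%R. split; [assumption|]. intros y Hy. destruct (disc_upper z y Hz Hy) as [_ Hy2]. split.
 + apply V_spec; trivial. lia.
 + intros n. apply (wd_lip_disc (tv k n r) z (Im z / 2)); [|go]. intros w Hw1. destruct (disc_upper z w Hz Hw1) as [Hw2 Hw3].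
  exists (- pi2 * tv (S k) n r w - / (2 * Ci) * dv k n r w), (/ (2 * Ci) * dv k n r w). split; [go|]. have X := im_le_Cmod (w - z).
  replace (Im (w - z)) with (Im w - Im z)%R in X by go. have Hw4 : Rabs (Im w - Im z) < Im z / 2 by (unfold disc in Hw1; lra).
  apply Rabs_def2 in Hw4. destruct (H (S k) n r w (disc_center _ _ Hd) Hw2) as [T1 _].
  destruct (H k n r w (disc_center _ _ Hd) Hw2) as [_ T2].
  have G1 := gbd_le C0 C0 (Im w) (2 * Im z) (S k) (Im z / 2) n ltac:(lra) ltac:(unfold upper in Hw3; lra).
  have G2 := gbd_le C0 C0 (Im w) (2 * Im z) k (Im z / 2) n ltac:(lra) ltac:(unfold upper in Hw3; lra).
  have T := Cmod_triangle (- pi2 * tv (S k) n r w) (- (/ (2 * Ci) * dv k n r w)). rewrite Cmod_opp, !Cmod_mult, Cmod_opp in T.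
  rewrite !Cmod_mult. have E : (Cmod (/ (2 * Ci)) = / 2)%R.
  { rewrite Cmod_inv, Cmod_mult, Cmod_R, Rabs_pos_eq, Cmod_Ci, Rmult_1_r by go. go. } rewrite E in *. unfold Mj. have P := Cmod_ge_0 pi2.
  have P1 := Cmod_ge_0 (dv k n r w). assert (Cmod pi2 * Cmod (tv (S k) n r w) <= Cmod pi2 * gbd C0 (2 * Im z) (S k) (Im z / 2) n) by go.
  unfold Cminus in *. lra.
- go. - apply is_sum_minus; apply is_sum_scal; [apply V_spec; trivial; lia|now apply dv_sum]. - apply is_sum_scal. now apply dv_sum.
Qed.
End Cusp.

(** * Smooth families of functions *)

Lemma wd_unique (f : C -> C) z A B A' B' : wd idC f z A B -> wd idC f z A' B' -> A = A' /\ B = B'.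
Proof.
intros H H'. have H0 := wd_minus idC _ _ _ _ _ _ _ H H'.
have Hb : forall eps, 0 < eps -> Cmod (A - A' + (B - B')) <= eps /\ Cmod (A - A' - (B - B')) <= eps.
{ intros eps He. destruct (H0 eps He) as [d [Hd H1]]. set (h := (d / 2)%R). have Hh : 0 < h by go.
 have G : forall e : C, Cmod e = 1%R -> Cmod (e * (A - A') + Cconj e * (B - B')) <= eps.
 { intros e Ee. specialize (H1 (z + h * e)). unfold idC in H1. replace (z + h * e - z) with (h * e) in H1 by ring.
  have Em : Cmod (h * e) = h by (rewrite Cmod_mult, Cmod_R, Rabs_pos_eq, Ee by lra; ring). rewrite Em in H1.
  specialize (H1 ltac:(unfold h; lra)). replace (Cconj (h * e)) with (h * Cconj e) in H1 by go.
  match type of H1 with (Cmod ?X <= _) => replace X with (- (h * (e * (A - A') + Cconj e * (B - B')))) in H1 by ring end.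
  rewrite Cmod_opp, Cmod_mult, Cmod_R, (Rabs_pos_eq h) in H1 by lra. nra. } split.
 - specialize (G 1 Cmod_1). replace (Cconj 1) with (RtoC 1) in G by go.
  replace (1 * (A - A') + 1 * (B - B')) with (A - A' + (B - B')) in G by ring. exact G.
 - specialize (G Ci Cmod_Ci). replace (Cconj Ci) with (- Ci) in G by go.
  replace (Ci * (A - A') + - Ci * (B - B')) with (Ci * (A - A' - (B - B'))) in G by ring. rewrite Cmod_mult, Cmod_Ci, Rmult_1_l in G.
  exact G. } have E1 : A - A' + (B - B') = 0 by (apply Cmod_eq_small; intros eps He; now apply Hb).
have E2 : A - A' - (B - B') = 0 by (apply Cmod_eq_small; intros eps He; now apply Hb). split.
- replace A with (A' + ((A - A' + (B - B')) + (A - A' - (B - B'))) / 2) by field. rewrite E1, E2. field.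
- replace B with (B' + ((A - A' + (B - B')) - (A - A' - (B - B'))) / 2) by field. rewrite E1, E2. field.
Qed.

Section Calc.
Variable U : C -> Prop.
Hypothesis Uo : forall r, U r -> exists d, 0 < d /\ forall r', disc r d r' -> U r'.

Notation dCC := (dP dC dC).

Definition J (f : C -> C -> C) : Prop := forall r z, U r -> upper z -> ct dCC dC (fun q => f (fst q) (snd q)) (r, z).

(** Families of class C^n in z all of whose derivatives are jointly continuous. *)
Fixpoint W (n : nat) (f : C -> C -> C) : Prop :=
  J f /\ match n with
  | O => True
  | S m => exists fa fb, W m fa /\ W m fb /\ forall r z, U r -> upper z -> wd idC (f r) z (fa r z) (fb r z)
  end.

Lemma W_J n f : W n f -> J f.
Proof. destruct n; intros H; apply H. Qed.
Lemma W_S n : forall f, W (S n) f -> W n f.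
Proof. induction n as [|n IH]; intros f [Hj H]. - go. - destruct H as [fa [fb [Ha [Hb Hw]]]]. split; [assumption|]. exists fa, fb. go. Qed.
Lemma W_le n m f : (m <= n)%nat -> W n f -> W m f.
Proof. induction 1; trivial. intros H1. apply IHle. now apply W_S. Qed.
Lemma W_ct_r n f r z : W n f -> U r -> upper z -> ct dC dC (f r) z.
Proof. intros H Hr Hz. apply (ct_comp dC dCC dC (fun q => f (fst q) (snd q)) (fun z => (r, z)) z); [ctt|]. now apply (W_J n). Qed.

Lemma near_pair r z d : U r -> upper z -> 0 < d -> exists e, 0 < e /\ forall q, dCC (r, z) q < e ->
  U (fst q) /\ upper (snd q) /\ disc z d (snd q) /\ disc r d (fst q).
Proof.
intros Hr Hz Hd. destruct (Uo r Hr) as [d1 [Hd1 H1]]. destruct (upper_disc z Hz) as [d2 [Hd2 H2]]. exists (Rmin d (Rmin d1 d2)).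
split; [go|]. intros [r' z'] Hq. unfold dP in Hq. cbn [fst snd] in *. have P1 := dC_ge0 r r'. have P2 := dC_ge0 z z'.
have Q1 : dC r r' < Rmin d (Rmin d1 d2) by lra. have Q2 : dC z z' < Rmin d (Rmin d1 d2) by lra. apply lt_rmin in Q1 as [Q1 Q3].
apply lt_rmin in Q3. apply lt_rmin in Q2 as [Q2 Q4]. apply lt_rmin in Q4. split; [now apply H1|]. split; [now apply H2|]. go.
Qed.

Lemma J_local f : (forall z, upper z -> exists d g, 0 < d /\ J g /\ forall r z', U r -> disc z d z' -> f r z' = g r z') -> J f.
Proof.
intros H r z Hr Hz. destruct (H z Hz) as [d [g [Hd [Hg E]]]]. destruct (near_pair r z d Hr Hz Hd) as [e [He H1]].
apply (ct_ext_loc dCC dC (fun q => g (fst q) (snd q))).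
- take e. intros q Hq. destruct (H1 q Hq) as [U1 [_ [U2 _]]]. symmetry. go. - symmetry. apply E; [go|now apply disc_center]. - go.
Qed.

Lemma W_local n : forall f, (forall z, upper z -> exists d g, 0 < d /\ W n g /\ forall r z', U r -> disc z d z' -> f r z' = g r z') -> W n f.
Proof.
induction n as [|n IH]; intros f H.
- split; [|go]. apply J_local. intros z Hz. destruct (H z Hz) as [d [g [Hd [Hg E]]]]. exists d, g. split; [assumption|].
 split; [apply Hg|go].
- split. { apply J_local. intros z Hz. destruct (H z Hz) as [d [g [Hd [Hg E]]]]. exists d, g. split; [assumption|]. split; [apply Hg|go]. }
 set (fa := fun r z => epsilon (inhabits (RtoC 0)) (fun A => exists B, wd idC (f r) z A B)).
 set (fb := fun r z => epsilon (inhabits (RtoC 0)) (fun B => exists A, wd idC (f r) z A B)).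
 have Hu : forall r z A B, wd idC (f r) z A B -> fa r z = A /\ fb r z = B.
 { intros r z A B HW. have H1 := epsilon_spec (inhabits (RtoC 0)) (fun A => exists B, wd idC (f r) z A B) (ex_intro _ A (ex_intro _ B HW)).
  have H2 := epsilon_spec (inhabits (RtoC 0)) (fun B => exists A, wd idC (f r) z A B) (ex_intro _ B (ex_intro _ A HW)).
  destruct H1 as [B1 H1]. destruct H2 as [A1 H2]. split; [apply (wd_unique _ _ _ _ _ _ H1 HW)|apply (wd_unique _ _ _ _ _ _ H2 HW)]. }
 have Hloc : forall z, upper z -> exists d ga gb, 0 < d /\ W n ga /\ W n gb /\ forall r z', U r -> disc z d z' -> wd idC (f r) z' (ga r z')
  (gb r z').
 { intros z Hz. destruct (H z Hz) as [d [g [Hd [[_ [ga [gb [Ha [Hb Hw]]]]] E]]]]. destruct (upper_disc z Hz) as [d2 [Hd2 H2]].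
  exists (Rmin d d2), ga, gb. split; [now apply rmin_pos|]. split; [assumption|]. split; [assumption|]. intros r z' Hr Hz'.
  apply lt_rmin in Hz' as [Hz1 Hz2]. destruct (disc_open z d z' Hz1) as [e [He H3]]. apply (wd_ext_loc idC (g r)); [|go]. take e.
  intros y Hy. symmetry. go. } exists fa, fb. split; [|split].
 + apply IH. intros z Hz. destruct (Hloc z Hz) as [d [ga [gb [Hd [Ha [Hb Hw]]]]]]. exists d, ga. repeat split; trivial. intros r z' Hr Hz'.
  apply (Hu r z' (ga r z') (gb r z')). go.
 + apply IH. intros z Hz. destruct (Hloc z Hz) as [d [ga [gb [Hd [Ha [Hb Hw]]]]]]. exists d, gb. repeat split; trivial. intros r z' Hr Hz'.
  apply (Hu r z' (ga r z') (gb r z')). go.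
 + intros r z Hr Hz. destruct (Hloc z Hz) as [d [ga [gb [Hd [Ha [Hb Hw]]]]]]. specialize (Hw r z Hr (disc_center z d Hd)).
  destruct (Hu _ _ _ _ Hw) as [-> ->]. go.
Qed.

Lemma W_ext n f g : (forall r z, U r -> upper z -> f r z = g r z) -> W n f -> W n g.
Proof.
intros E Hf. apply W_local. intros z Hz. destruct (upper_disc z Hz) as [d [Hd H]]. exists d, f. repeat split; trivial. intros r z' Hr Hz'.
symmetry. go.
Qed.

Lemma W_const n : forall c, W n (fun _ _ => c).
Proof.
induction n as [|n IH]; intros c; (split; [intros r z _ _; ctt|]); trivial. exists (fun _ _ => RtoC 0), (fun _ _ => RtoC 0).
repeat split; trivial. go.
Qed.

Lemma W_rfun n (k : C -> C) : (forall r, U r -> ct dC dC k r) -> W n (fun r _ => k r).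
Proof.
intros Hk. have Hj : J (fun r _ => k r). { intros r z Hr _. apply (ct_comp dCC dC dC k (fun q => fst q)); [ctt|go]. }
destruct n as [|n]; split; trivial. exists (fun _ _ => RtoC 0), (fun _ _ => RtoC 0). split; [apply W_const|]. split; [apply W_const|]. go.
Qed.

Lemma W_z n : W n (fun _ z => z).
Proof.
destruct n as [|n]; (split; [intros r z _ _; ctt|]); trivial. exists (fun _ _ => RtoC 1), (fun _ _ => RtoC 0). split; [apply W_const|].
split; [apply W_const|]. go.
Qed.

Lemma W_conj n : forall f, W n f -> W n (fun r z => Cconj (f r z)).
Proof.
induction n as [|n IH]; intros f [Hj H]; (split; [intros r z Hr Hz; apply ct_conj; now apply Hj|]); trivial.
destruct H as [fa [fb [Ha [Hb Hw]]]]. exists (fun r z => Cconj (fb r z)), (fun r z => Cconj (fa r z)). repeat split; auto. intros r z Hr Hz.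
apply wd_conj. go.
Qed.

Lemma W_plus n : forall f g, W n f -> W n g -> W n (fun r z => f r z + g r z).
Proof.
induction n as [|n IH]; intros f g [Hj H] [Hj' H']; (split; [intros r z Hr Hz; apply ct_plus; [go|go]|]); trivial.
destruct H as [fa [fb [Ha [Hb Hw]]]]. destruct H' as [ga [gb [Ha' [Hb' Hw']]]].
exists (fun r z => fa r z + ga r z), (fun r z => fb r z + gb r z). repeat split; auto. intros r z Hr Hz. apply wd_plus; auto.
Qed.

Lemma W_mult n : forall f g, W n f -> W n g -> W n (fun r z => f r z * g r z).
Proof.
induction n as [|n IH]; intros f g Hf Hg; have Hjf := W_J _ _ Hf; have Hjg := W_J _ _ Hg; (split; [intros r z Hr Hz; apply ct_mult;
 [go|go]|]); trivial. have Hf1 := W_S _ _ Hf. have Hg1 := W_S _ _ Hg. destruct Hf as [_ [fa [fb [Ha [Hb Hw]]]]].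
destruct Hg as [_ [ga [gb [Ha' [Hb' Hw']]]]].
exists (fun r z => f r z * ga r z + fa r z * g r z), (fun r z => f r z * gb r z + fb r z * g r z). split; [apply W_plus; now apply IH|].
split; [apply W_plus; now apply IH|]. intros r z Hr Hz. wd_by (apply wd_mult; [go|go]; trivial); ring.
Qed.

Lemma W_scal n c f : W n f -> W n (fun r z => c * f r z).
Proof. intros H. apply W_mult; [apply W_const|go]. Qed.
Lemma W_opp n f : W n f -> W n (fun r z => - f r z).
Proof. intros H. apply (W_ext n (fun r z => - (1) * f r z)); [go|now apply W_scal]. Qed.
Lemma W_minus n f g : W n f -> W n g -> W n (fun r z => f r z - g r z).
Proof. intros. apply W_plus; [go|now apply W_opp]. Qed.

Lemma W_Cexp n : forall f, W n f -> W n (fun r z => Cexp (f r z)).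
Proof.
induction n as [|n IH]; intros f Hf; have Hj := W_J _ _ Hf; (split; [intros r z Hr Hz; apply ct_Cexp; now apply Hj|]); trivial.
have Hf1 := W_S _ _ Hf. destruct Hf as [_ [fa [fb [Ha [Hb Hw]]]]].
exists (fun r z => Cexp (f r z) * fa r z), (fun r z => Cexp (f r z) * fb r z). split; [apply W_mult; auto|]. split; [apply W_mult; auto|].
intros r z Hr Hz. apply wd_Cexp. go.
Qed.

Lemma W_inv n : forall f : C -> C -> C, (forall r z, U r -> upper z -> f r z <> 0) -> W n f -> W n (fun r z => / f r z).
Proof.
induction n as [|n IH]; intros f Hn Hf; have Hj := W_J _ _ Hf; (split; [intros r z Hr Hz; apply ct_inv; [go|go]|]); trivial.
have Hf1 := W_S _ _ Hf. destruct Hf as [_ [fa [fb [Ha [Hb Hw]]]]].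
have Hi : W n (fun r z => - (/ f r z * / f r z)) by (apply W_opp, W_mult; now apply IH).
exists (fun r z => - (/ f r z * / f r z) * fa r z), (fun r z => - (/ f r z * / f r z) * fb r z). split; [now apply W_mult|].
split; [now apply W_mult|]. intros r z Hr Hz. wd_by (apply wd_inv; [go|go]); field; now apply Hn.
Qed.

Lemma W_ana n : forall g, (forall z, upper z -> ana g z) -> W n (fun _ z => g z).
Proof.
have Hj : forall g, (forall z, upper z -> ana g z) -> J (fun _ z => g z).
{ intros g Hg r z _ Hz. apply (ct_comp dCC dC dC g (fun q => snd q)); [ctt|now apply ana_ct, Hg]. }
induction n as [|n IH]; intros g Hg; (split; [go|]); trivial. exists (fun _ z => dd g z), (fun _ _ => RtoC 0).
split; [apply IH; intros; now apply ana_deriv, Hg|]. split; [apply W_const|]. intros r z _ Hz. now apply ana_dd, Hg.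
Qed.

Lemma W_lsum n {A} (t : A -> C -> C -> C) L : (forall a, In a L -> W n (t a)) -> W n (fun r z => lsum (fun a => t a r z) L).
Proof.
induction L as [|a L IH]; intros H; simpl; [apply W_const|]. apply W_plus; [apply H; now left|]. apply IH. intros. apply H. now right.
Qed.

Lemma W_Im n : W n (fun _ z => RtoC (Im z)).
Proof.
apply (W_ext n (fun _ z => / (2 * Ci) * (z - Cconj z))).
- intros _ w _ _. replace (w - Cconj w) with (2 * Ci * Im w) by go. go. - apply W_scal, W_minus; [apply W_z|]. apply W_conj, W_z.
Qed.

Lemma W_clog_Im n : W n (fun _ z => clog (Im z)).
Proof.
have Hj : J (fun _ z => clog (Im z)). { intros r z _ Hz. apply (ct_clog_R dCC (fun q => Im (snd q))); [go|]. apply ct_Im. ctt. }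
destruct n as [|n]; split; trivial. have Hi : W n (fun _ z => / RtoC (Im z)).
{ apply (W_inv n (fun _ z => RtoC (Im z))); [|apply W_Im]. go. }
exists (fun _ z => / (2 * Ci) * / RtoC (Im z)), (fun _ z => - / (2 * Ci) * / RtoC (Im z)). split; [now apply W_scal|].
split; [now apply W_scal|]. intros r z _ Hz.
wd_by (apply (wd_comp_hol idC clog (fun z => RtoC (Im z))); [apply cder_clog, pos_slit; exact Hz|apply wd_Im_inv]); ring.
Qed.

(** Truncated powers have as many continuous derivatives as their exponent allows. *)
Definition tp (t : R) : R := Rmax 0 (t - / 2).

Lemma tp_lip s t : Rabs (tp s - tp t) <= Rabs (s - t).
Proof. unfold tp, Rmax. repeat destruct (Rle_dec _ _); unfold Rabs; repeat destruct (Rcase_abs _); lra. Qed.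

Lemma tp_deriv k t : derivable_pt_lim (fun t => tp t ^ S (S k))%R t (INR (S (S k)) * tp t ^ S k)%R.
Proof.
destruct (Rtotal_order t (/ 2)) as [H|[H|H]].
- apply is_derive_Reals. apply (is_derive_ext_loc (fun _ => 0%R)).
 + exists (mkposreal (/ 2 - t) ltac:(lra)). intros s Hs. change (Rabs (s - t) < / 2 - t) in Hs. apply Rabs_def2 in Hs. unfold tp.
  rewrite Rmax_left by lra. simpl. ring.
 + replace (INR (S (S k)) * tp t ^ S k)%R with 0%R by (unfold tp; rewrite Rmax_left by lra; simpl; ring).
  exact (@is_derive_const R_AbsRing R_NormedModule 0%R t).
- intros eps He. exists (mkposreal (Rmin eps 1) (rmin_pos _ _ He Rlt_0_1)). intros h Hh Hd. apply lt_rmin in Hd.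
 have E : tp t = 0%R by (unfold tp; rewrite Rmax_left; lra). rewrite E. have L := tp_lip (t + h) t. rewrite E in L.
 replace (t + h - t)%R with h in L by ring. rewrite Rminus_0_r in L.
 replace ((tp (t + h) ^ S (S k) - 0 ^ S (S k)) / h - INR (S (S k)) * 0 ^ S k)%R with (tp (t + h) ^ S (S k) / h)%R by (simpl; field;
  assumption). unfold Rdiv. rewrite Rabs_mult, Rabs_inv, <- RPow_abs. have Ph : 0 < Rabs h by go. have P := Rabs_pos (tp (t + h)).
 have Q : Rabs (tp (t + h)) ^ S (S k) <= Rabs h * Rabs h.
 { simpl. have Q1 : Rabs (tp (t + h)) ^ k <= 1 by (rewrite <- (pow1 k); apply pow_incr; lra). go. } apply Rle_lt_trans with (Rabs h); [|go].
 apply Rmult_le_reg_r with (Rabs h); [go|]. rewrite Rmult_assoc, Rinv_l by lra. lra.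
- apply is_derive_Reals. apply (is_derive_ext_loc (fun t => (t - / 2) ^ S (S k))%R).
 + exists (mkposreal (t - / 2) ltac:(lra)). intros s Hs. change (Rabs (s - t) < t - / 2) in Hs. apply Rabs_def2 in Hs. unfold tp.
  rewrite Rmax_right by lra. go.
 + unfold tp. rewrite Rmax_right by lra. auto_derive; [go|]. change (match k with 0%nat => 1 | S _ => INR k + 1 end)%R with (INR (S k)).
  rewrite (S_INR (S k)). simpl pow. unfold Rminus. ring.
Qed.

Lemma W_tp n : forall q : C -> C -> R, W n (fun r z => RtoC (q r z)) -> W n (fun r z => RtoC (tp (q r z) ^ S n)%R).
Proof.
induction n as [|n IH]; intros q Hq; have Hj := W_J _ _ Hq.
- split; [|go]. intros r z Hr Hz. apply ct_RtoC. intros eps He. destruct (Hj r z Hr Hz eps He) as [d [Hd H]]. take d. intros y Hy.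
 specialize (H y Hy). unfold dC in H. rewrite Cmod_RtoC_sub in H. eapply Rle_lt_trans; [|exact H]. simpl. rewrite !Rmult_1_r. apply tp_lip.
- split.
 + intros r z Hr Hz. have H1 := W_J _ _ (IH q (W_S _ _ Hq)) r z Hr Hz.
  have H0 : ct dCC dC (fun q0 => RtoC (tp (q (fst q0) (snd q0)))) (r, z).
  { intros eps He. destruct (Hj r z Hr Hz eps He) as [d [Hd H]]. take d. intros y Hy. specialize (H y Hy). unfold dC in *.
   rewrite Cmod_RtoC_sub in *. eapply Rle_lt_trans; [|exact H]. apply tp_lip. }
  apply (ct_ext dCC dC (fun q0 => RtoC (tp (q (fst q0) (snd q0))) * RtoC (tp (q (fst q0) (snd q0)) ^ S n))).
  * go. * go.
 + have Hq1 := IH q (W_S _ _ Hq). destruct Hq as [_ [qa [qb [Ha [Hb Hw]]]]].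
  exists (fun r z => INR (S (S n)) * RtoC (tp (q r z) ^ S n)%R * qa r z), (fun r z => INR (S (S n)) * RtoC (tp (q r z) ^ S n)%R * qb r z).
  split; [apply W_mult; [now apply W_scal|go]|]. split; [apply W_mult; [now apply W_scal|go]|]. intros r z Hr Hz.
  wd_by (apply (wd_real idC (fun t => tp t ^ S (S n))%R (q r) z); [apply tp_deriv|go]); now rewrite RtoC_mult.
Qed.

Lemma W_dx n f : W (S n) f -> exists fx, W n fx /\ forall r x y, U r -> 0 < y -> rder (fun t : R => f r (t, y)) x (fx r (x, y)).
Proof.
intros [_ [fa [fb [Ha [Hb Hw]]]]]. exists (fun r z => fa r z + fb r z). split; [now apply W_plus|]. intros r x y Hr Hy. apply wd_horiz. go.
Qed.

Lemma W_psi0 n l : W n (fun r z => psi l 0 r (Im z)).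
Proof.
apply W_Cexp, W_minus.
- apply W_mult; [|apply W_clog_Im]. apply (W_rfun n (fun r => - (IZR l + r))). go.
- apply W_mult; [|apply W_Im]. apply (W_rfun n (fun r => 4 * PI * (0 - r / 12))). go.
Qed.
End Calc.

(** * Sums over coprime pairs *)

Definition sl_one : SL2Z := mkSL2Z 1 0 0 1 eq_refl.
Lemma sl_mul_det (g h : SL2Z) : ((ga g * ga h + gb g * gc h) * (gc g * gb h + gd g * gd h) -
  (ga g * gb h + gb g * gd h) * (gc g * ga h + gd g * gc h) = 1)%Z.
Proof. transitivity ((ga g * gd g - gb g * gc g) * (ga h * gd h - gb h * gc h))%Z; [ring|]. now rewrite !g_det. Qed.
Definition sl_mul (g h : SL2Z) : SL2Z := mkSL2Z _ _ _ _ (sl_mul_det g h).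

Lemma autj_mul g h z : upper z -> autj (sl_mul g h) z = autj g (mobius h z) * autj h z.
Proof. intros Hz. have N := autj_nz h z Hz. unfold autj, mobius in *. simpl. rewrite !plus_IZR, !mult_IZR, !RtoC_plus, !RtoC_mult. go. Qed.

Lemma mobius_mul g h z : upper z -> mobius (sl_mul g h) z = mobius g (mobius h z).
Proof.
intros Hz. have N := autj_nz h z Hz. have N2 := autj_nz g _ (mobius_upper h z Hz). have E := autj_mul g h z Hz.
have L2 : IZR (ga (sl_mul g h)) * z + IZR (gb (sl_mul g h)) = (IZR (ga g) * mobius h z + IZR (gb g)) * autj h z.
{ unfold mobius, autj in *. simpl. rewrite !plus_IZR, !mult_IZR, !RtoC_plus, !RtoC_mult. go. }
transitivity ((IZR (ga (sl_mul g h)) * z + IZR (gb (sl_mul g h))) / autj (sl_mul g h) z); [go|]. rewrite E, L2.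
transitivity ((IZR (ga g) * mobius h z + IZR (gb g)) / autj g (mobius h z)); [go|go].
Qed.

Lemma mobius_one z : mobius sl_one z = z.
Proof. unfold mobius. simpl. go. Qed.

(** Hence the translate of a periodic function depends on the lower row only, and cosets can be indexed by coprime pairs. *)
Lemma same_row g h : gc g = gc h -> gd g = gd h -> exists n : Z, forall z, upper z -> mobius g z = mobius h z + IZR n.
Proof.
intros Hc Hd. exists (gb g * ga h - ga g * gb h)%Z. intros z Hz. have N := autj_nz h z Hz. have D1 := g_det g. have D2 := g_det h.
unfold mobius, autj in *. rewrite Hc, Hd in *. set (n := (gb g * ga h - ga g * gb h)%Z). have Ea : ga g = (ga h + n * gc h)%Z.
{ unfold n. transitivity (ga g * (ga h * gd h - gb h * gc h))%Z; [rewrite D2; ring|].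
 transitivity (ga h * (ga g * gd h - gb g * gc h) + (gb g * ga h - ga g * gb h) * gc h)%Z; [ring|]. rewrite D1. ring. }
have Eb : gb g = (gb h + n * gd h)%Z.
{ unfold n. transitivity (gb g * (ga h * gd h - gb h * gc h))%Z; [rewrite D2; ring|].
 transitivity (gb h * (ga g * gd h - gb g * gc h) + (gb g * ga h - ga g * gb h) * gd h)%Z; [ring|]. rewrite D1. ring. }
rewrite Ea, Eb, !plus_IZR, !mult_IZR, !RtoC_plus, !RtoC_mult. go.
Qed.

Definition cop (p : Z * Z) : Prop := Z.gcd (fst p) (snd p) = 1%Z.
Definition gam (p : Z * Z) : SL2Z := epsilon (inhabits sl_one) (fun g => gc g = fst p /\ gd g = snd p).

Lemma gam_spec p : cop p -> gc (gam p) = fst p /\ gd (gam p) = snd p.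
Proof.
intros Hp. unfold gam. apply epsilon_spec. destruct (Z.gcd_bezout _ _ _ Hp) as [a [b E]]. have D : (b * snd p - (- a) * fst p = 1)%Z by lia.
now exists (mkSL2Z b (- a) (fst p) (snd p) D).
Qed.

Lemma cop_row g : cop (gc g, gd g).
Proof. unfold cop. simpl. apply Z.bezout_1_gcd. exists (- gb g)%Z, (ga g). have D := g_det g. lia. Qed.

Definition jp (p : Z * Z) (z : C) : C := IZR (fst p) * z + IZR (snd p).
Definition rmul (p : Z * Z) (g : SL2Z) : Z * Z := (fst p * ga g + snd p * gc g, fst p * gb g + snd p * gd g)%Z.
Definition rdiv (p : Z * Z) (g : SL2Z) : Z * Z := (fst p * gd g - snd p * gc g, snd p * ga g - fst p * gb g)%Z.

Lemma rmul_rdiv p g : rmul (rdiv p g) g = p /\ rdiv (rmul p g) g = p.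
Proof.
have D := g_det g. destruct p as [c d]. unfold rmul, rdiv. simpl. split; f_equal.
- transitivity (c * (ga g * gd g - gb g * gc g))%Z; [ring|rewrite D; ring].
- transitivity (d * (ga g * gd g - gb g * gc g))%Z; [ring|rewrite D; ring].
- transitivity (c * (ga g * gd g - gb g * gc g))%Z; [ring|rewrite D; ring].
- transitivity (d * (ga g * gd g - gb g * gc g))%Z; [ring|rewrite D; ring].
Qed.

Lemma cop_rmul p g : cop p -> cop (rmul p g).
Proof. intros Hp. destruct (gam_spec p Hp) as [H1 H2]. have H := cop_row (sl_mul (gam p) g). simpl in H. rewrite H1, H2 in H. exact H. Qed.

Lemma cop_rmul_iff p g : cop (rmul p g) <-> cop p.
Proof.
split; [|apply cop_rmul]. intros H. have D : (gd g * ga g - (- gb g) * (- gc g) = 1)%Z by (rewrite <- (g_det g); ring).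
have H2 := cop_rmul _ (mkSL2Z (gd g) (- gb g) (- gc g) (ga g) D) H. destruct (rmul_rdiv p g) as [_ E]. rewrite <- E. unfold rdiv.
replace (fst (rmul p g) * gd g - snd (rmul p g) * gc g)%Z with (fst (rmul p g) * gd g + snd (rmul p g) * - gc g)%Z by ring.
replace (snd (rmul p g) * ga g - fst (rmul p g) * gb g)%Z with (fst (rmul p g) * - gb g + snd (rmul p g) * ga g)%Z by ring. go.
Qed.

Lemma jp_autj p z : cop p -> jp p z = autj (gam p) z.
Proof. intros Hp. destruct (gam_spec p Hp) as [H1 H2]. unfold jp, autj. now rewrite H1, H2. Qed.
Lemma jp_nz p z : cop p -> upper z -> jp p z <> 0.
Proof. intros Hp Hz. rewrite jp_autj by go. now apply autj_nz. Qed.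

Lemma jp_rmul p g z : upper z -> jp (rmul p g) z = jp p (mobius g z) * autj g z.
Proof.
intros Hz. have N := autj_nz g z Hz. unfold jp, rmul, autj, mobius in *. simpl. rewrite !plus_IZR, !mult_IZR, !RtoC_plus, !RtoC_mult. go.
Qed.

(** The terms of the Poincare series of weight w. *)
Definition pst (w : nat) (phi : C -> C) (p : Z * Z) (z : C) : C :=
  if classical (cop p) then phi (mobius (gam p) z) / jp p z ^ w else 0.
Tactic Notation "case_cop" constr(p) "as" simple_intropattern(H) := unfold pst; destruct (classical (cop p)) as H.

Lemma per_int (phi : C -> C) : (forall z, upper z -> phi (z + 1) = phi z) -> forall n z, upper z -> phi (z + IZR n) = phi z.
Proof.
intros H n z Hz. have P := periodic_Z (fun t : R => phi (z + t)). rewrite <- (Rplus_0_l (IZR n)), P; [f_equal; ring|]. intros t.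
rewrite RtoC_plus, Cplus_assoc. apply H. unfold upper, Im in *. simpl. lra.
Qed.

Lemma pst_rmul w phi p g z : (forall z, upper z -> phi (z + 1) = phi z) -> upper z ->
  pst w phi (rmul p g) z = / autj g z ^ w * pst w phi p (mobius g z).
Proof.
intros Hp Hz. unfold pst.
destruct (classical (cop (rmul p g))) as [H|H]; destruct (classical (cop p)) as [H'|H']; try (apply cop_rmul_iff in H; contradiction); try
 (exfalso; apply H; now apply cop_rmul); [|ring]. have E : phi (mobius (gam (rmul p g)) z) = phi (mobius (gam p) (mobius g z)).
{ rewrite <- mobius_mul by go. destruct (gam_spec _ H) as [H1 H2]. destruct (gam_spec _ H') as [H3 H4].
 destruct (same_row (gam (rmul p g)) (sl_mul (gam p) g)) as [n Hn].
 - rewrite H1. simpl. go. - rewrite H2. simpl. go.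
 - rewrite Hn by go. apply per_int; [go|]. now apply mobius_upper. } rewrite E, jp_rmul, Cpow_mult_l by go. field.
split; apply Cpow_nz; first [now apply autj_nz | apply jp_nz; [go|now apply mobius_upper]].
Qed.

Lemma PS_inv w phi g z s s' : (forall z, upper z -> phi (z + 1) = phi z) -> upper z ->
  is_sum (fun p => pst w phi p z) s -> is_sum (fun p => pst w phi p (mobius g z)) s' -> s' = autj g z ^ w * s.
Proof.
intros Hp Hz H H'. have N : autj g z ^ w <> 0 by (apply Cpow_nz; now apply autj_nz).
have H1 := is_sum_reindex _ (fun p => rmul p g) (fun p => rdiv p g) s (fun p => proj2 (rmul_rdiv p g)) (fun p => proj1 (rmul_rdiv p g)) H.
have H2 : is_sum (fun p => pst w phi p (mobius g z)) (autj g z ^ w * s).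
{ apply is_sum_ext with (f := fun p => autj g z ^ w * pst w phi (rmul p g) z); [|now apply is_sum_scal]. intros p. rewrite pst_rmul by go.
 go. } now apply (is_sum_unique _ _ _ H' H2).
Qed.

Definition qq (p : Z * Z) : R := (qz (fst p) * qz (snd p))%R.
Lemma bnd_qq : bnd qq.
Proof. go. Qed.

Lemma cop_pos p : cop p -> 1 <= IZR (fst p) * IZR (fst p) + IZR (snd p) * IZR (snd p).
Proof.
intros H. rewrite <- !mult_IZR, <- plus_IZR. apply IZR_le.
assert (fst p <> 0 \/ snd p <> 0)%Z by (unfold cop in H; destruct (Z.eq_dec (fst p) 0) as [E|E]; destruct (Z.eq_dec (snd p) 0) as [E2|E2];
 try tauto; rewrite E, E2 in H; discriminate). nia.
Qed.

Lemma jp_low X m p z : 0 < m -> m <= Im z -> Rabs (Re z) <= X ->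
  kap X m * (IZR (fst p) * IZR (fst p) + IZR (snd p) * IZR (snd p)) <= Cmod (jp p z) * Cmod (jp p z).
Proof. intros Hm H1 H2. exact (lattice_low z X m (IZR (fst p)) (IZR (snd p)) Hm H1 H2). Qed.

Lemma jp_inv4 X m p z v : 0 < m -> m <= Im z -> Rabs (Re z) <= X -> cop p -> (2 <= v)%nat ->
  / (Cmod (jp p z) ^ (2 * v)) <= 3 / kap X m ^ v * qq p.
Proof.
intros Hm H1 H2 Hp Hv. have Hk := kap_pos X m Hm. have Hl := jp_low X m p z Hm H1 H2. have Hc := cop_pos p Hp. rewrite pow_mult.
set (a := IZR (fst p)) in *. set (b := IZR (snd p)) in *. set (s := (a * a + b * b)%R) in *. set (k := kap X m) in *. unfold qq, qz.
fold a b. have Ha := Rle_0_sqr a. have Hb := Rle_0_sqr b. unfold Rsqr in Ha, Hb.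
have E : (3 / k ^ v * (/ (1 + a * a) * / (1 + b * b)) = / (k ^ v * ((1 + a * a) * (1 + b * b) / 3)))%R.
{ field. repeat split; try lra. apply pow_nonzero. lra. } rewrite E. apply Rinv_le_contravar.
- apply Rmult_lt_0_compat; [now apply pow_lt|]. go.
- apply Rle_trans with ((k * s) ^ v)%R.
 + rewrite Rpow_mult_distr. apply Rmult_le_compat_l; [left; now apply pow_lt|]. apply Rle_trans with (s ^ 2)%R; [|apply Rle_pow; [go|lia]].
  have Hab : (a * a) * (b * b) <= s * s by (apply Rmult_le_compat; trivial; unfold s; lra). have Hss : s <= s * s by go.
  replace ((1 + a * a) * (1 + b * b))%R with (1 + s + (a * a) * (b * b))%R by (unfold s; ring). lra.
 + apply pow_incr. go.
Qed.

Lemma Im_gam p z : cop p -> upper z -> Im (mobius (gam p) z) = (Im z / (Cmod (jp p z) * Cmod (jp p z)))%R.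
Proof. intros Hp Hz. rewrite Im_mobius, jp_autj by go. go. Qed.
Lemma jp_pos p z : cop p -> upper z -> 0 < Cmod (jp p z) * Cmod (jp p z).
Proof. intros Hp Hz. have H := proj1 (Cmod_gt_0 _) (jp_nz p z Hp Hz). nra. Qed.

Lemma disc_box z0 z : upper z0 -> disc z0 (Im z0 / 2) z ->
  Im z0 / 2 <= Im z /\ Im z <= 2 * Im z0 /\ Rabs (Re z) <= Rabs (Re z0) + Im z0.
Proof.
intros H0 H. destruct (disc_upper z0 z H0 H) as [H1 _]. unfold disc in H. have X := im_le_Cmod (z - z0).
replace (Im (z - z0)) with (Im z - Im z0)%R in X by go. have Y := re_le_Cmod (z - z0).
replace (Re (z - z0)) with (Re z - Re z0)%R in Y by go. have V := Rle_abs (Im z - Im z0). have T := Rabs_triang (Re z - Re z0) (Re z0).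
replace (Re z - Re z0 + Re z0)%R with (Re z) in T by ring. go.
Qed.

Definition box (N : nat) : list (Z * Z) := list_prod (zlist N) (zlist N).

Lemma NoDup_box N : NoDup (box N).
Proof.
have G : forall (U V : list Z), NoDup U -> NoDup V -> NoDup (list_prod U V).
{ intros U V HU HV. induction U as [|u U IH]; simpl; [constructor|]. inversion HU; subst. apply NoDup_app_disj.
 - apply FinFun.Injective_map_NoDup; [|go]. intros x y E. congruence. - go.
 - intros [a b] Ha Hb. apply in_prod_iff in Ha. apply in_map_iff in Hb as [y [Ey _]]. inversion Ey; subst. tauto. }
apply G; apply NoDup_zlist.
Qed.

(** The height of a translate is Im z / |cz+d|^2, and |cz+d| is bounded below by a norm of (c,d), uniformly on the disc.
    *)
Lemma loc_fin z0 : upper z0 -> exists N, forall z p, disc z0 (Im z0 / 2) z -> cop p -> ~ In p (box N) ->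
  Im (mobius (gam p) z) < / 2.
Proof.
intros H0. set (X := (Rabs (Re z0) + Im z0)%R). set (m := (Im z0 / 2)%R). have Hm : 0 < m by go. have Hk := kap_pos X m Hm.
set (k := kap X m) in *. set (N := Z.to_nat (up (4 * Im z0 / k))). exists N. intros z p Hz Hp Hn.
destruct (disc_box z0 z H0 Hz) as [H1 [H2 H3]]. destruct (disc_upper z0 z H0 Hz) as [_ Hu]. rewrite Im_gam by go.
have Hj := jp_pos p z Hp Hu. apply Rmult_lt_reg_r with (Cmod (jp p z) * Cmod (jp p z))%R; [go|].
replace (Im z / (Cmod (jp p z) * Cmod (jp p z)) * (Cmod (jp p z) * Cmod (jp p z)))%R with (Im z) by (field; apply Cmod_gt_0 in Hj || idtac;
 nra). have Hl := jp_low X m p z Hm H1 H3. fold k in Hl. have Hu4 : 4 * Im z0 / k < IZR (Z.of_nat N).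
{ have A := archimed (4 * Im z0 / k). eapply Rlt_le_trans; [apply A|]. apply IZR_le. go. }
have Hbig : IZR (Z.of_nat N) <= IZR (fst p) * IZR (fst p) + IZR (snd p) * IZR (snd p).
{ rewrite <- !mult_IZR, <- plus_IZR. apply IZR_le. destruct p as [c d]. simpl. unfold box in Hn. rewrite in_prod_iff, !in_zlist in Hn. nia. }
assert (4 * Im z0 < k * (IZR (fst p) * IZR (fst p) + IZR (snd p) * IZR (snd p))).
{ apply Rlt_le_trans with (k * IZR (Z.of_nat N))%R; [|go]. apply Rmult_lt_reg_r with (/ k)%R; [go|].
 replace (k * IZR (Z.of_nat N) * / k)%R with (IZR (Z.of_nat N)) by (field; lra). go. } lra.
Qed.

(** * An invariant partition of unity *)

Definition chi (z : C) : C := RtoC (tp (Im z) ^ 4)%R.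

Lemma tp_zero t : t <= / 2 -> tp t = 0%R.
Proof. intros H. unfold tp. rewrite Rmax_left; lra. Qed.
Lemma chi_per z : upper z -> chi (z + 1) = chi z.
Proof. intros _. unfold chi. do 3 f_equal. unfold Im; simpl; ring. Qed.
Lemma chi_zero z : Im z <= / 2 -> chi z = 0.
Proof. intros H. unfold chi. rewrite tp_zero by go. go. Qed.

Definition EE (z : C) : C := SUM (fun p => pst 0 chi p z).

Lemma EE_fin z0 N : (forall z p, disc z0 (Im z0 / 2) z -> cop p -> ~ In p (box N) -> Im (mobius (gam p) z) < / 2) ->
  forall z, disc z0 (Im z0 / 2) z -> is_sum (fun p => pst 0 chi p z) (lsum (fun p => pst 0 chi p z) (box N)).
Proof.
intros H z Hz. apply is_sum_finite; [apply NoDup_box|]. intros p Hp. case_cop p as [Hc|]; [|go].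
rewrite chi_zero; [go|]. left. go.
Qed.

Lemma EE_spec z : upper z -> is_sum (fun p => pst 0 chi p z) (EE z).
Proof.
intros Hz. destruct (loc_fin z Hz) as [N HN]. have Hm : 0 < Im z / 2 by go. have H := EE_fin z N HN z (disc_center z _ Hm). unfold EE.
rewrite (SUM_eq _ _ H). exact H.
Qed.

Lemma EE_inv g z : upper z -> EE (mobius g z) = EE z.
Proof. intros Hz. rewrite (PS_inv 0 chi g z (EE z) (EE (mobius g z)) chi_per Hz (EE_spec z Hz) (EE_spec _ (mobius_upper g z Hz))). go. Qed.

(** Translation to the strip -1/2 <= Re z <= 1/2 followed by inversion doubles a height that is at most 1/2. *)
Lemma reach n : forall z, / 2 ^ S n < Im z -> exists g, / 2 < Im (mobius g z).
Proof.
induction n as [|n IH]; intros z Hz.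
- exists sl_one. rewrite mobius_one. go.
- destruct (Rlt_le_dec (/ 2) (Im z)) as [H|H]; [exists sl_one; now rewrite mobius_one|]. have P2 : 0 < 2 ^ S (S n) by (apply pow_lt; lra).
 have P3 : 0 < / 2 ^ S (S n) by go. have Hu : upper z by (unfold upper; lra). set (k := (up (Re z + / 2) - 1)%Z).
 have D : (0 * - k - (-1) * 1 = 1)%Z by ring. set (g := mkSL2Z 0 (-1) 1 (- k) D). have Hk : Rabs (Re z - IZR k) <= / 2.
 { unfold k. rewrite minus_IZR. have A := archimed (Re z + / 2). apply Rabs_le. lra. } have Hi : 2 * Im z <= Im (mobius g z).
 { rewrite Im_mobius by go. have E : (Cmod (autj g z) * Cmod (autj g z) = (Re z - IZR k) * (Re z - IZR k) + Im z * Im z)%R.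
  { unfold autj, g. cbn [gc gd]. unfold Cmod. rewrite sqrt_sqrt by go. rewrite opp_IZR. unfold Re, Im. simpl. ring. } rewrite E.
  have Ha : (Re z - IZR k) * (Re z - IZR k) <= / 4.
  { have Q := Rle_abs (Re z - IZR k). have Q2 := Rle_abs (- (Re z - IZR k)). rewrite Rabs_Ropp in Q2. nra. }
  have Q := Rle_0_sqr (Re z - IZR k). unfold Rsqr in Q. assert (0 < (Re z - IZR k) * (Re z - IZR k) + Im z * Im z) by nra.
  apply Rmult_le_reg_r with ((Re z - IZR k) * (Re z - IZR k) + Im z * Im z)%R; [go|]. unfold Rdiv.
  rewrite Rmult_assoc, (Rmult_assoc (Im z)), Rinv_l by lra. nra. } destruct (IH (mobius g z)) as [g' Hg'].
 + have E : (/ 2 ^ S n = 2 * / 2 ^ S (S n))%R by (simpl; field; apply pow_nonzero; lra). lra.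
 + exists (sl_mul g' g). now rewrite mobius_mul.
Qed.

Lemma reach_all z : upper z -> exists g, / 2 < Im (mobius g z).
Proof.
intros Hz. destruct (pow_lt_1_zero (/ 2) ltac:(rewrite Rabs_pos_eq; lra) (Im z) Hz) as [N HN]. apply (reach N).
specialize (HN (S N) ltac:(lia)). rewrite Rabs_pos_eq in HN by go. rewrite <- pow_inv. go.
Qed.

Lemma EE_nz z : upper z -> EE z <> 0.
Proof.
intros Hz. destruct (reach_all z Hz) as [g Hg]. rewrite <- (EE_inv g z Hz). have Hz' := mobius_upper g z Hz. set (w := mobius g z) in *.
have HS := EE_spec w Hz'. have Hge : forall p, 0 <= Re (pst 0 chi p w).
{ intros p. unfold pst. destruct (classical (cop p)); [|go].
 replace (chi (mobius (gam p) w) / jp p w ^ 0) with (chi (mobius (gam p) w)) by go. unfold chi. change (Re (RtoC ?x)) with x. go. }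
set (p0 := (0, 1)%Z). have Hc : cop p0 by go. have Hp0 : 0 < Re (pst 0 chi p0 w).
{ unfold pst. destruct (classical (cop p0)); [|go]. replace (chi (mobius (gam p0) w) / jp p0 w ^ 0) with (chi (mobius (gam p0) w)) by go.
 apply pow_lt. rewrite Im_gam by go. replace (jp p0 w) with (RtoC 1) by go. rewrite Cmod_1. unfold tp. rewrite Rmax_right; lra. } intros E.
rewrite E in HS. destruct (HS (Re (pst 0 chi p0 w) / 2)%R ltac:(lra)) as [L0 H0]. destruct (nodup_union L0 (p0 :: nil)) as [U [HU [I1 I2]]].
specialize (H0 U HU I1). have Hsum : Re (pst 0 chi p0 w) <= Re (lsum (fun p => pst 0 chi p w) U).
{ have Hin : In p0 U by (apply I2; now left). clear - Hin Hge. have HRe : forall u v : C, Re (u + v) = (Re u + Re v)%R by go.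
 have Hpos : forall L, 0 <= Re (lsum (fun p => pst 0 chi p w) L).
 { induction L as [|a L IH]; cbn [lsum]; [go|]. rewrite HRe. specialize (Hge a). lra. } induction U as [|a U IH]; [go|]. cbn [lsum].
 rewrite HRe. destruct Hin as [->|Hin].
 - specialize (Hpos U). lra. - specialize (IH Hin). specialize (Hge a). lra. }
replace (lsum (fun p => pst 0 chi p w) U - 0) with (lsum (fun p => pst 0 chi p w) U) in H0 by ring.
have X := re_le_Cmod (lsum (fun p => pst 0 chi p w) U). have Y := Rle_abs (Re (lsum (fun p => pst 0 chi p w) U)). lra.
Qed.

(** A periodic cut-off function divided by the sum of its translates. The fourth power in [chi] makes it of class C^3,
    so that its antiholomorphic derivative is of class C^2, as [s1_bound] requires. *)
Definition pu (z : C) : C := chi z / EE z.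

Lemma mobius_T z : mobius (mkSL2Z 1 1 0 1 eq_refl) z = z + 1.
Proof. unfold mobius. simpl. go. Qed.
Lemma pu_per z : upper z -> pu (z + 1) = pu z.
Proof. intros Hz. unfold pu. rewrite chi_per, <- mobius_T, EE_inv by go. go. Qed.
Lemma pu_zero z : Im z <= / 2 -> pu z = 0.
Proof. intros H. unfold pu. rewrite chi_zero by go. go. Qed.

Lemma pu_sum z : upper z -> is_sum (fun p => pst 0 pu p z) 1.
Proof.
intros Hz. replace (RtoC 1) with (/ EE z * EE z) by (field; now apply EE_nz).
apply is_sum_ext with (f := fun p => / EE z * pst 0 chi p z); [|apply is_sum_scal; now apply EE_spec]. intros p.
case_cop p as [H|H]; [|ring]. unfold pu. rewrite EE_inv by go. go.
Qed.

(** The two rows (0,1) and (0,-1) both contribute [chi], hence the value 1/2. *)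
Lemma pu_cusp z : 2 < Im z -> pu z = / 2.
Proof.
intros H. have Hz : upper z by (unfold upper; lra). have E : EE z = 2 * chi z.
{ have Hf : is_sum (fun p => pst 0 chi p z) (lsum (fun p => pst 0 chi p z) ((0, 1)%Z :: (0, -1)%Z :: nil)).
 { apply is_sum_finite; [repeat constructor; simpl; intuition discriminate|]. intros [c d] Hn. unfold pst.
  destruct (classical (cop (c, d))) as [Hc|]; [|go]. rewrite chi_zero; [go|]. rewrite Im_gam by go. have Hj := jp_pos _ z Hc Hz.
  have Hc0 : c <> 0%Z.
  { intros ->. apply Hn. unfold cop in Hc. cbn [fst snd] in Hc. rewrite Z.gcd_0_l in Hc. simpl.
   assert (d = 1 \/ d = -1)%Z as [->| ->] by lia; auto. } have Hc1 : 1 <= IZR c * IZR c by (rewrite <- mult_IZR; apply IZR_le; nia).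
  have Hj2 : Im z * Im z <= Cmod (jp (c, d) z) * Cmod (jp (c, d) z).
  { have X := im_le_Cmod (jp (c, d) z). replace (Im (jp (c, d) z)) with (IZR c * Im z)%R in X by (unfold jp, Im; simpl; ring).
   have Y : Rabs (IZR c * Im z) * Rabs (IZR c * Im z) <= Cmod (jp (c, d) z) * Cmod (jp (c, d) z) by (apply Rmult_le_compat; trivial; apply
    Rabs_pos). rewrite <- Rabs_mult, Rabs_pos_eq in Y by nra. nra. }
  apply Rmult_le_reg_r with (Cmod (jp (c, d) z) * Cmod (jp (c, d) z))%R; [go|]. unfold Rdiv. rewrite Rmult_assoc, Rinv_l by lra. nra. }
 rewrite (is_sum_unique _ _ _ (EE_spec z Hz) Hf). simpl. have G : forall d : Z, (d = 1 \/ d = -1)%Z -> pst 0 chi (0, d)%Z z = chi z.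
 { intros d Hd. unfold pst. have Hc : cop (0, d)%Z by (destruct Hd as [->| ->]; reflexivity). destruct (classical (cop (0, d)%Z)); [|go].
  replace (chi (mobius (gam (0, d)%Z) z) / jp (0, d)%Z z ^ 0) with (chi (mobius (gam (0, d)%Z) z)) by go. unfold chi. do 3 f_equal.
  rewrite Im_gam by go. replace (jp (0, d)%Z z) with (RtoC (IZR d)) by go. rewrite Cmod_R.
  destruct Hd as [->| ->]; [rewrite Rabs_pos_eq by lra|rewrite Rabs_left by lra]; field. } rewrite !G by auto. ring. }
have Hnz := EE_nz z Hz. unfold pu. rewrite E in *. field. intros E0. apply Hnz. rewrite E0. ring.
Qed.

Section Smooth.
Variable U : C -> Prop.
Hypothesis Uo : forall r, U r -> exists d, 0 < d /\ forall r', disc r d r' -> U r'.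

Lemma W_chi : W U 3 (fun _ z => chi z).
Proof. apply (W_tp U 3 (fun _ z => Im z)). now apply W_Im. Qed.

Lemma W_Im_of n (f : C -> C -> C) : W U n f -> W U n (fun r z => RtoC (Im (f r z))).
Proof.
intros H. apply (W_ext U Uo n (fun r z => / (2 * Ci) * (f r z - Cconj (f r z)))).
- intros r z _ _. set (w := f r z). replace (w - Cconj w) with (2 * Ci * Im w) by go. go.
- apply W_scal, W_minus; trivial. now apply W_conj.
Qed.

Lemma W_pu : W U 3 (fun _ z => pu z).
Proof.
apply W_mult; trivial; [apply W_chi|]. apply W_inv; trivial; [intros; now apply EE_nz|]. apply W_local; trivial. intros z0 Hz0.
destruct (loc_fin z0 Hz0) as [N HN]. exists (Im z0 / 2)%R, (fun _ z => lsum (fun p => pst 0 chi p z) (box N)). split; [go|]. split.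
- apply (W_lsum U 3 (fun p _ z => pst 0 chi p z)). intros p _. case_cop p as [H|H]; [|apply W_const].
 apply (W_ext U Uo 3 (fun _ z => chi (mobius (gam p) z))).
 + go.
 + apply (W_tp U 3 (fun _ z => Im (mobius (gam p) z))). apply (W_Im_of 3 (fun _ z => mobius (gam p) z)). apply W_ana. intros z Hz.
  now apply ana_mobius.
- intros r z _ Hz. destruct (disc_upper z0 z Hz0 Hz) as [_ Hu]. apply (is_sum_unique _ _ _ (EE_spec z Hu)). now apply (EE_fin z0).
Qed.
End Smooth.

(** * The inhomogeneous Cauchy-Riemann equation on the cylinder *)

Lemma rect_bound (h : C -> C -> C) r0 a b :
  (forall x y, I01 x -> a <= y <= b -> ct (dP dC dC) dC (fun q => h (fst q) (snd q)) (r0, (x, y))) ->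
  exists d C0, 0 < d /\ 0 <= C0 /\ forall r x y, disc r0 d r -> I01 x -> a <= y <= b -> Cmod (h r (x, y)) <= C0.
Proof.
intros H.
set (Q := fun (t : R * (R * unit)) (d : R) => exists C0, 0 <= C0 /\ forall r x y, disc r0 d r -> Rabs (x - fst t) < d -> Rabs (y - fst (snd
 t)) < d -> Cmod (h r (x, y)) <= C0). have HQ : forall t, exists d : posreal, I01 (fst t) /\ a <= fst (snd t) <= b -> Q t d.
{ intros [x0 [y0 u]]. destruct (classical (I01 x0 /\ a <= y0 <= b)) as [[Hx Hy]|Hn].
 - destruct (H x0 y0 Hx Hy 1%R ltac:(lra)) as [d [Hd H1]]. have Hd3 : 0 < d / 3 by lra. exists (mkposreal _ Hd3). intros _.
  exists (Cmod (h r0 (x0, y0)) + 1)%R. split; [have P := Cmod_ge_0 (h r0 (x0, y0)); lra|]. cbn [fst snd pos]. intros r x y Hr Hxx Hyy.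
  apply (near_disc_bound (h r0 (x0, y0)) 1). specialize (H1 (r, (x, y))). unfold dP in H1. cbn [fst snd] in H1. apply H1. unfold disc in Hr.
  have B1 := Cmod_le_ReIm ((x, y) - (x0, y0)). simpl in B1. unfold dC. unfold Rminus in Hxx, Hyy. lra.
 - exists (mkposreal 1 Rlt_0_1). go. } set (delta := fun t => proj1_sig (constructive_indefinite_description _ (HQ t))).
have Hdel : forall t, I01 (fst t) /\ a <= fst (snd t) <= b -> Q t (delta t) by (intros t; exact (proj2_sig
 (constructive_indefinite_description _ (HQ t)))). destruct (NNPP _ (compactness_list 2 (0%R, (a, tt)) (1%R, (b, tt)) delta)) as [L HL].
have Hfin : exists d C0, 0 < d /\ 0 <= C0 /\ forall t r x y, In t L -> I01 (fst t) /\ a <= fst (snd t) <= b -> disc r0 d r -> Rabs (x - fst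
 t) < delta t -> Rabs (y - fst (snd t)) < delta t -> Cmod (h r (x, y)) <= C0.
{ clear HL. induction L as [|t L [d [C0 [Hd [HC IH]]]]].
 - exists 1%R, 0%R. repeat split; try lra. go.
 - destruct (classical (I01 (fst t) /\ a <= fst (snd t) <= b)) as [Hi|Hi].
  + destruct (Hdel t Hi) as [C1 [HC1 H1]]. exists (Rmin d (delta t)), (Rmax C0 C1). split; [apply rmin_pos; [go|apply cond_pos]|].
   split; [eapply Rle_trans; [exact HC|apply Rmax_l]|]. intros t' r x y Hin Hb Hr Hx Hy. apply lt_rmin in Hr. destruct Hin as [->|Hin].
   * eapply Rle_trans; [apply H1; trivial; apply Hr|apply Rmax_r].
   * eapply Rle_trans; [apply (IH t' r x y); trivial; apply Hr|apply Rmax_l].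
  + exists d, C0. repeat split; trivial. intros t' r x y [->|Hin] Hb; [go|]. now apply IH. } destruct Hfin as [d [C0 [Hd [HC H1]]]].
exists d, C0. split; [assumption|]. split; [go|]. intros r x y Hr Hx Hy. destruct (HL (x, (y, tt))) as [[tx [ty u]] [Hin [Hb Hc]]].
- go. - simpl in Hb, Hc. apply (H1 (tx, (ty, u)) r x y Hin); trivial; try tauto. go.
Qed.

(** Mean value inequality with a variable bound. *)
Lemma mvi_var (g g' : R -> C) (G G' : R -> R) a b : a <= b -> (forall t, a <= t <= b -> rder g t (g' t)) ->
  (forall t, a <= t <= b -> derivable_pt_lim G t (G' t)) -> (forall t, a <= t <= b -> Cmod (g' t) <= G' t) ->
  Cmod (g b - g a) <= G b - G a.
Proof.
intros Hab Hd HG HM. set (c := g b - g a).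
have HD : forall t, a <= t <= b -> derivable_pt_lim (fun t => Cmod c * G t - Re (Cconj c * g t)%C)%R t (Cmod c * G' t - Re (Cconj c * g'
 t)%C)%R.
{ intros t Ht. apply (derivable_pt_lim_minus (fun t => Cmod c * G t)%R (fun t => Re (Cconj c * g t)%C)).
 - apply (derivable_pt_lim_scal G). go. - apply rder_Re, rder_scal. go. }
destruct (MVT_gen (fun t => Cmod c * G t - Re (Cconj c * g t)%C)%R a b (fun t => Cmod c * G' t - Re (Cconj c * g' t)%C)%R) as [x [Hx Ex]].
- intros t. minmax. intros Ht. apply is_derive_Reals, HD. lra.
- intros t. minmax. intros Ht. apply derivable_continuous_pt. eexists. apply HD. lra.
- rewrite Rmin_left, Rmax_right in Hx by lra. have H : (Cmod c * Cmod c)%R = (Re (Cconj c * g b)%C - Re (Cconj c * g a)%C)%R.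
 { replace (Re (Cconj c * g b)%C - Re (Cconj c * g a)%C)%R with (Re (c * Cconj c)%C).
  - rewrite <- Cmod2_conj. unfold Re; simpl. ring.
  - unfold Re; simpl. ring. } have H1 := re_le_Cmod (Cconj c * g' x). have H3 := Rle_abs (Re (Cconj c * g' x)%C).
 rewrite Cmod_mult, Cmod_conj in H1. have H4 := HM x Hx. have Hc := Cmod_ge_0 c. have H5 : Cmod c * Cmod (g' x) <= Cmod c * G' x by go.
 destruct (Req_dec (Cmod c) 0) as [E|E].
 + rewrite E. destruct (MVT_gen G a b G') as [x2 [Hx2 Ex2]].
  * intros t. minmax. intros Ht. apply is_derive_Reals, HG. lra.
  * intros t. minmax. intros Ht. apply derivable_continuous_pt. eexists. apply HG. lra.
  * rewrite Rmin_left, Rmax_right in Hx2 by lra. rewrite Ex2. apply Rmult_le_pos; [|lra]. have Z := HM x2 Hx2. have Z2 := Cmod_ge_0 (g' x2).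
   lra.
 + go.
Qed.

Lemma II_rder (g : R -> C) a y : 0 < a -> 0 < y -> (forall t, 0 < t -> ct dR dC g t) -> rder (fun y => II g a y) y (g y).
Proof.
intros Ha Hy Hc. have Hcab : forall u v, 0 < u -> 0 < v -> cab g u v.
{ intros u v Hu Hv t [Ht _]. apply Hc. eapply Rlt_le_trans; [|exact Ht]. go. } intros eps He. destruct (Hc y Hy eps He) as [d [Hd H]].
take_min d y. intros y' Hy'. rewrite Cmod_RtoC_sub in Hy'. apply lt_rmin in Hy' as [Hy1 Hy2].
have Hpos : 0 < y' by (apply Rabs_def2 in Hy2; lra). rewrite <- (II_Chasles g a y y') by go. rewrite (II_CI g y y') by go.
replace (II g a y + RtoC (y' - y) * CI (fun s => g (y + s * (y' - y))%R) - II g a y - ((y' - y) * g y + Cconj (y' - y) * 0)) with ((y' - y)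
 * (CI (fun s => g (y + s * (y' - y))%R) - g y)) by go. rewrite Cmod_mult, Rmult_comm. apply Rmult_le_compat_r; [go|].
rewrite <- (CI_const (g y)), <- CI_minus; [|now apply ic_cab, Hcab|go].
apply CI_bound; [apply ic_plus; [now apply ic_cab, Hcab|]; intros t Ht; apply ct_opp, ct_const|]. intros s [Hs0 Hs1]. left.
unfold dC, dR in H. apply H. replace (y + s * (y' - y) - y)%R with (s * (y' - y))%R by ring. rewrite Rabs_mult, (Rabs_pos_eq s) by go.
have P := Rabs_pos (y' - y). nra.
Qed.

Definition dbar (F : C -> C) (z : C) : C := epsilon (inhabits (RtoC 0)) (fun B => exists A, wd idC F z A B).

Lemma dbar_eq F z A B : wd idC F z A B -> dbar F z = B.
Proof.
intros H. have H1 := epsilon_spec (inhabits (RtoC 0)) (fun B => exists A, wd idC F z A B) (ex_intro _ B (ex_intro _ A H)).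
destruct H1 as [A1 H1]. apply (wd_unique _ _ _ _ _ _ H1 H).
Qed.

Lemma wd_shift F z A B : (forall z, upper z -> F (z + 1) = F z) -> upper z -> wd idC F z A B -> wd idC F (z + 1) A B.
Proof.
intros Hp Hz H. have Hz1 : upper (z + 1) by (unfold upper, Im in *; simpl; lra). apply (wd_ext_loc idC (fun w => F (w + - (1)))).
- destruct (upper_disc _ Hz1) as [d [Hd0 H1]]. take d. intros w Hw. specialize (H1 w Hw). rewrite <- (Hp (w + - (1))); [f_equal; ring|].
 unfold upper, Im in *; simpl; lra.
- have Hs : wd idC (fun w : C => idC (w + - (1))) (z + 1) 1 0. { wd_by (apply wd_plus; [apply (wd_io idC)|apply wd_const]); ring. }
 have H' : wd idC F (z + 1 + - (1)) A B by (replace (z + 1 + - (1)) with z by ring; exact H).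
 wd_by (apply (wd_chain idC idC F (fun w => w + - (1)) (z + 1) A B 1 0 H' Hs)); replace (Cconj 1) with (RtoC 1) by (apply C_eq; simpl;
  ring); replace (Cconj 0) with (RtoC 0) by (apply C_eq; simpl; ring); ring.
Qed.

(** A right hand side of class C^2 supported in a horizontal strip has a bounded solution, given termwise by integration
    of its Fourier coefficients. The integration starts below the strip for n >= 0 and above it for n < 0, so that the
    factor exp(2 pi n (t-y)) in the solution stays bounded by 1 for every n and y. *)
Section Cylinder.
Variable U : C -> Prop.
Hypothesis Uo : forall r, U r -> exists d, 0 < d /\ forall r', disc r d r' -> U r'.
Variable g : C -> C -> C.
Hypothesis gW : W U 2 g.
Hypothesis gr : forall r z, U r -> upper z -> ana (fun r => g r z) r.
Hypothesis gp : forall r z, U r -> upper z -> g r (z + 1) = g r z.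
Hypothesis g0 : forall r z, U r -> upper z -> (Im z < / 2 \/ 2 < Im z)%R -> g r z = 0.

Definition gn (n : Z) (r : C) (y : R) : C := fc (fun x => g r (x, y)) n.

Lemma Wf_ct {X} (dX : X -> X -> R) n (h : C -> C -> C) (r z : X -> C) x : W U n h -> U (r x) -> upper (z x) ->
  ct dX dC r x -> ct dX dC z x -> ct dX dC (fun x => h (r x) (z x)) x.
Proof.
intros HW Hr Hz Hcr Hcz. apply (ct_comp dX (dP dC dC) dC (fun q => h (fst q) (snd q)) (fun x => (r x, z x)) x); [go|].
now apply (W_J U n h HW).
Qed.

Lemma W_ic n (h : C -> C -> C) r y : W U n h -> U r -> 0 < y -> ic (fun x => h r (x, y)).
Proof. intros HW Hr Hy x _. apply (Wf_ct dR n h (fun _ => r) (fun x => (x, y)) x HW); trivial; [ctt|apply ct_xy; ctt]. Qed.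
Lemma gn_zero n r y : U r -> 0 < y -> (y < / 2 \/ 2 < y)%R -> gn n r y = 0.
Proof. intros Hr Hy H. unfold gn, fc. rewrite (CI_ext _ (fun _ => RtoC 0)); [apply CI_const|]. intros x _. rewrite g0; trivial. ring. Qed.
Lemma gper_loc (h : C -> C -> C) : (forall r z, U r -> upper z -> h r (z + 1) = h r z) -> forall r x y, U r -> 0 < y -> h r ((x + 1)%R, y) = h r (x, y).
Proof. intros H r x y Hr Hy. rewrite <- (H r (x, y)) by go. f_equal. go. Qed.

Lemma W_fc_bound h : W U 2 h -> (forall r z, U r -> upper z -> h r (z + 1) = h r z) -> forall r0 a b, U r0 -> 0 < a ->
  exists d C0, 0 < d /\ 0 <= C0 /\ forall n r y, disc r0 d r -> a <= y <= b -> Cmod (fc (fun x => h r (x, y)) n) <= C0 * qz n.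
Proof.
intros HW Hp r0 a b Hr0 Ha. destruct HW as [Hj [ha [hb [Wa [Wb Hw]]]]]. have W1 : W U 1 (fun r z => ha r z + hb r z) by now apply W_plus.
have D1 : forall r x y, U r -> 0 < y -> rder (fun t : R => h r (t, y)) x (ha r (x, y) + hb r (x, y)) by (intros; now apply wd_horiz, Hw).
destruct (W_dx U 0 _ W1) as [h2 [W2 D2]]. have Hp1 : forall r z, U r -> upper z -> ha r (z + 1) + hb r (z + 1) = ha r z + hb r z.
{ intros r z Hr Hz. have Hz1 : upper (z + 1) by (unfold upper, Im in *; simpl; lra).
 destruct (wd_unique _ _ _ _ _ _ (Hw r (z + 1) Hr Hz1) (wd_shift (h r) z _ _ (fun w Hu => Hp r w Hr Hu) Hz (Hw r z Hr Hz))) as [-> ->]. go. }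
destruct (rect_bound h r0 a b) as [d1 [c1 [Hd1 [Hc1 B1]]]]; [intros x y _ Hy; apply Hj; [go|apply upper_xy; lra]|].
destruct (rect_bound h2 r0 a b) as [d2 [c2 [Hd2 [Hc2 B2]]]]; [intros x y _ Hy; apply (W_J U 0 h2 W2); [go|apply upper_xy; lra]|].
destruct (Uo r0 Hr0) as [d3 [Hd3 HU]]. exists (Rmin d1 (Rmin d2 d3)), (2 * (c1 + c2))%R. split; [go|]. split; [lra|]. intros n r y Hr Hy.
apply lt_rmin in Hr as [Hr1 Hr]. apply lt_rmin in Hr as [Hr2 Hr3]. have HrU := HU r Hr3. have Hy0 : 0 < y by lra.
have P0 := gper_loc h Hp r 0 y HrU Hy0. have P1 := gper_loc (fun r z => ha r z + hb r z) Hp1 r 0 y HrU Hy0. rewrite Rplus_0_l in P0, P1.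
apply (fc_decay (fun x => h r (x, y)) (fun x => ha r (x, y) + hb r (x, y)) (fun x => h2 r (x, y))); auto.
- now apply (W_ic 0). - intros t Ht. specialize (B1 r t y Hr1 Ht Hy). lra. - intros t Ht. specialize (B2 r t y Hr2 Ht Hy). lra.
Qed.

Lemma gn_bound r0 : U r0 -> exists d C0, 0 < d /\ 0 <= C0 /\ forall n r y, disc r0 d r -> 0 < y -> Cmod (gn n r y) <= C0 * qz n.
Proof.
intros Hr. destruct (W_fc_bound g gW gp r0 (/ 2) 2 Hr ltac:(lra)) as [d [C0 [Hd [HC H]]]]. destruct (Uo r0 Hr) as [d3 [Hd3 HU]].
exists (Rmin d d3), C0. split; [now apply rmin_pos|]. split; [assumption|]. intros n r y Hd' Hy. apply lt_rmin in Hd'.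
destruct (Rlt_le_dec y (/ 2)) as [H1|H1]; [|destruct (Rlt_le_dec 2 y) as [H2|H2]].
- rewrite gn_zero; auto; [|apply HU, Hd']. rewrite Cmod_0. go. - rewrite gn_zero; auto; [|apply HU, Hd']. rewrite Cmod_0. go.
- apply H; [go|lra].
Qed.

Lemma ct_gn {X} (dX : X -> X -> R) n (r : X -> C) (y : X -> R) x : dX x x = 0%R -> U (r x) -> 0 < y x -> ct dX dC r x -> ct dX dR y x ->
  ct dX dC (fun x => gn n (r x) (y x)) x.
Proof.
intros Hx Hr Hy Hcr Hcy. have Hnear : exists d, 0 < d /\ forall x', dX x x' < d -> U (r x') /\ 0 < y x'.
{ destruct (Uo _ Hr) as [d1 [Hd1 HU]]. destruct (Hcr d1 Hd1) as [e1 [He1 H1]]. destruct (Hcy (y x) Hy) as [e2 [He2 H2]].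
 take_min e1 e2 as x' Hx'. split.
 - apply HU. exact (H1 x' (proj1 Hx')). - specialize (H2 x' (proj2 Hx')). apply Rabs_def2 in H2. lra. } destruct Hnear as [d [Hd HN]].
apply (ct_CI dX (fun x t => g (r x) (t, y x) * ez (- n) t) x Hx).
- take d. intros x' Hx'. apply ic_ez. destruct (HN x' Hx'). now apply (W_ic 2).
- intros t _ eps He. have Q : ct (dP (dP dC dR) dR) dC (fun q => g (fst (fst q)) (snd q, snd (fst q)) * ez (- n) (snd q)) ((r x, y x), t).
 { apply ct_mult; [|go]. apply (Wf_ct _ 2 g (fun q => fst (fst q)) (fun q => (snd q, snd (fst q)))); trivial; [ctt|apply ct_xy; ctt]. }
 destruct (Q eps He) as [e [He1 HQ]]. destruct (Hcr (e / 3)%R ltac:(lra)) as [e1 [He2 Hp1]].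
 destruct (Hcy (e / 3)%R ltac:(lra)) as [e2 [He3 Hw1]]. exists (Rmin (e / 3) (Rmin e1 e2)). split; [go|]. intros x' s' Hx' Hs1.
 apply lt_rmin in Hx' as [_ Hx']. apply lt_rmin in Hx'. apply lt_rmin in Hs1. specialize (HQ ((r x', y x'), s')). unfold dP in HQ.
 cbn [fst snd] in HQ. unfold dC, dR in *. specialize (Hp1 x' (proj1 Hx')). specialize (Hw1 x' (proj2 Hx')). go.
Qed.

Lemma ana_gn n r y : U r -> 0 < y -> ana (fun r => gn n r y) r.
Proof.
intros Hr Hy. destruct (Uo r Hr) as [d [Hd HU]]. apply (ana_CI (fun r t => g r (t, y) * ez (- n) t) r d Hd).
- intros z t Hz _. apply ct_jc. apply ct_mult; [|go].
 apply (Wf_ct _ 2 g (fun q => fst q) (fun q => (snd q, y))); trivial; [go|ctt|apply ct_xy; ctt].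
- intros z t Hz _. apply ana_mult; [|go]. go.
Qed.

Definition ebase (n : Z) : R := if Z.leb 0 n then (/ 4)%R else 3%R.
Definition kn (n : Z) (r : C) (t : R) : C := RtoC (exp (2 * PI * IZR n * t)) * gn n r t.
Definition Pn (n : Z) (r : C) (y : R) : C := II (kn n r) (ebase n) y.
Definition Sn (n : Z) (r z : C) : C := - 2 * Ci * (ez n z * Pn n r (Im z)).

Lemma ebase_pos n : 0 < ebase n.
Proof. unfold ebase. destruct (Z.leb 0 n); lra. Qed.

Lemma ct_kn {X} (dX : X -> X -> R) n (r : X -> C) (y : X -> R) x : dX x x = 0%R -> U (r x) -> 0 < y x -> ct dX dC r x -> ct dX dR y x ->
  ct dX dC (fun x => kn n (r x) (y x)) x.
Proof.
intros Hx Hr Hy Hcr Hcy. apply ct_mult; [|now apply ct_gn]. apply (ct_ext dX dC (fun x => Cexp (2 * PI * IZR n * y x))); [|ctt]. intros x'.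
rewrite <- Cexp_R. f_equal. go.
Qed.

Lemma kn_ct n r t : U r -> 0 < t -> ct dR dC (kn n r) t.
Proof. intros Hr Ht. apply (ct_kn dR n (fun _ => r) (fun t => t)); trivial; [apply dR_refl|ctt|ctt]. Qed.
Lemma rder_Pn n r y : U r -> 0 < y -> rder (Pn n r) y (kn n r y).
Proof. intros Hr Hy. apply II_rder; [apply ebase_pos|go|]. intros t Ht. now apply kn_ct. Qed.

Lemma Pn_base n r : U r -> Pn n r (ebase n) = 0.
Proof.
intros Hr. unfold Pn. have P := ebase_pos n. rewrite II_CI.
- go. - intros t Ht. rewrite Rmin_left, Rmax_left in Ht by lra. apply kn_ct; [go|lra].
Qed.

Lemma Pn_CI n r y : U r -> 0 < y -> Pn n r y = RtoC (y - ebase n) * CI (fun s => kn n r (ebase n + s * (y - ebase n))%R).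
Proof.
intros Hr Hy. apply II_CI. intros t [Ht _]. apply kn_ct; [go|]. eapply Rlt_le_trans; [|exact Ht]. apply rmin_pos; [apply ebase_pos|go].
Qed.

Lemma base_pos n s y : I01 s -> 0 < y -> 0 < ebase n + s * (y - ebase n).
Proof. intros [H0 H1] Hy. have P := ebase_pos n. nra. Qed.

(** The exponential weight compensates for one power of n. *)
Lemma Pn_bound n r y C0 : U r -> 0 < y -> 0 <= C0 -> (forall t, 0 < t -> Cmod (gn n r t) <= C0) ->
  exp (- (2 * PI * IZR n * y)) * Cmod (Pn n r y) <= 3 * C0 /\ Rabs (IZR n) * (exp (- (2 * PI * IZR n * y)) * Cmod (Pn n r y)) <= C0.
Proof.
intros Hr Hy HC HB. have G3 := PI_gt_3. have Hk : forall t, 0 < t -> Cmod (kn n r t) <= C0 * exp (2 * PI * IZR n * t).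
{ intros t Ht. unfold kn. rewrite Cmod_mult, Cmod_R, Rabs_pos_eq by go. rewrite Rmult_comm. apply Rmult_le_compat_r; [go|go]. }
have Hk0 : forall t, 0 < t -> (t < / 2 \/ 2 < t)%R -> kn n r t = 0. { intros t Ht H. unfold kn. rewrite gn_zero by go. ring. }
have Hzero : forall a b, 0 < a -> a <= b -> (forall t, a <= t <= b -> (t < / 2 \/ 2 < t)%R) -> Pn n r a = Pn n r b.
{ intros a b Ha Hab Ht. have Mv := mvi (Pn n r) (kn n r) a b 0 Hab (fun t Hi => rder_Pn n r t Hr ltac:(lra)).
 have E : Pn n r b - Pn n r a = 0.
 { apply Cmod_eq_0, Rle_antisym; [|go]. rewrite Rmult_0_l in Mv. apply Mv. intros t Hi. rewrite Hk0 by go. rewrite Cmod_0. lra. }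
 replace (Pn n r b) with (Pn n r b - Pn n r a + Pn n r a) by ring. rewrite E. ring. }
have Hinv : (exp (- (2 * PI * IZR n * y)) * exp (2 * PI * IZR n * y) = 1)%R by (rewrite <- exp_plus, <- exp_0; f_equal; ring).
have He := exp_pos (- (2 * PI * IZR n * y)). have He2 := exp_pos (2 * PI * IZR n * y). set (E := exp (- (2 * PI * IZR n * y))) in *.
set (E' := exp (2 * PI * IZR n * y)) in *. destruct (Z.eq_dec n 0) as [->|Hn0].
-
 (* only a strip of bounded height contributes *)
 have Hk1 : forall t, 0 < t -> Cmod (kn 0 r t) <= C0.
 { intros t Ht. specialize (Hk t Ht). replace (2 * PI * 0 * t)%R with 0%R in Hk by ring. rewrite exp_0 in Hk. lra. }
 have HE : E = 1%R by (unfold E; replace (- (2 * PI * 0 * y))%R with 0%R by ring; apply exp_0). rewrite HE, Rabs_R0, Rmult_0_l.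
 split; [|go]. rewrite Rmult_1_l. have B0 := Pn_base 0 r Hr. change (ebase 0) with (/ 4)%R in B0.
 have Hin : forall b, / 4 <= b <= 5 / 2 -> Cmod (Pn 0 r b) <= 3 * C0.
 { intros b Hb.
  have Mv := mvi (Pn 0 r) (kn 0 r) (/ 4) b C0 ltac:(lra) (fun t Hi => rder_Pn 0 r t Hr ltac:(lra)) (fun t Hi => Hk1 t ltac:(lra)).
  rewrite B0 in Mv. replace (Pn 0 r b - 0) with (Pn 0 r b) in Mv by ring. nra. }
 destruct (Rlt_le_dec y (/ 4)) as [H1|H1]; [|destruct (Rlt_le_dec (5 / 2) y) as [H2|H2]].
 + rewrite (Hzero y (/ 4)%R) by go. apply Hin. lra. + rewrite <- (Hzero (5 / 2)%R y) by go. apply Hin. lra. + go.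
- have Hn1 : 1 <= Rabs (IZR n). { rewrite <- abs_IZR. apply IZR_le. lia. } have Hmain : Rabs (IZR n) * Cmod (Pn n r y) <= C0 * E'.
 { have HG : forall t, derivable_pt_lim (fun t => C0 / (2 * PI * IZR n) * exp (2 * PI * IZR n * t))%R t (C0 * exp (2 * PI * IZR n * t))%R.
  { intros t. auto_derive; [go|]. field. split; [now apply not_0_IZR|lra]. }
  have Hfin : forall a b, 0 < a <= b -> Rabs (IZR n) * Cmod (Pn n r b - Pn n r a) <= C0 * exp (2 * PI * IZR n * (if Z.leb 0 n then b else
   a)).
  { intros a b Hab.
   have Mv := mvi_var (Pn n r) (kn n r) _ (fun t => C0 * exp (2 * PI * IZR n * t))%R a b ltac:(lra) (fun t Hi => rder_Pn n r t Hr
    ltac:(lra)) (fun t _ => HG t) (fun t Hi => Hk t ltac:(lra)).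
   apply Rle_trans with (Rabs (IZR n) * (C0 / (2 * PI * IZR n) * exp (2 * PI * IZR n * b) - C0 / (2 * PI * IZR n) * exp (2 * PI * IZR n *
    a)))%R. { go. } have Hex1 := exp_pos (2 * PI * IZR n * a). have Hex2 := exp_pos (2 * PI * IZR n * b). have Hpi : C0 / (2 * PI) <= C0.
   { apply Rmult_le_reg_r with (2 * PI)%R; [lra|]. replace (C0 / (2 * PI) * (2 * PI))%R with C0 by (field; lra). nra. }
   have Hpi0 : 0 <= C0 / (2 * PI) by go. destruct (Z.leb_spec 0 n) as [Hs|Hs].
   - rewrite Rabs_pos_eq by (now apply IZR_le). have Hnn : IZR n <> 0 by now apply not_0_IZR.
    replace (IZR n * (C0 / (2 * PI * IZR n) * exp (2 * PI * IZR n * b) - C0 / (2 * PI * IZR n) * exp (2 * PI * IZR n * a)))%R with (C0 / (2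
     * PI) * exp (2 * PI * IZR n * b) - C0 / (2 * PI) * exp (2 * PI * IZR n * a))%R by (field; lra). go.
   - have Hneg : IZR n < 0 by (apply IZR_lt; lia). rewrite Rabs_left by go.
    replace (- IZR n * (C0 / (2 * PI * IZR n) * exp (2 * PI * IZR n * b) - C0 / (2 * PI * IZR n) * exp (2 * PI * IZR n * a)))%R with (C0 /
     (2 * PI) * exp (2 * PI * IZR n * a) - C0 / (2 * PI) * exp (2 * PI * IZR n * b))%R by (field; lra). go. } have B0 := Pn_base n r Hr.
  have Hz : (Cmod (Pn n r y) = 0)%R -> Rabs (IZR n) * Cmod (Pn n r y) <= C0 * E' by go. unfold ebase in B0.
  destruct (Z.leb_spec 0 n) as [Hs|Hs].
  - destruct (Rlt_le_dec y (/ 4)) as [H1|H1].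
   + apply Hz. rewrite (Hzero y (/ 4)%R), B0 by go. apply Cmod_0.
   + specialize (Hfin (/ 4)%R y ltac:(lra)). rewrite B0 in Hfin. replace (Pn n r y - 0) with (Pn n r y) in Hfin by ring. go.
  - destruct (Rlt_le_dec 3 y) as [H1|H1].
   + apply Hz. rewrite <- (Hzero 3%R y), B0 by go. apply Cmod_0.
   + specialize (Hfin y 3%R ltac:(lra)). rewrite B0 in Hfin. replace (0 - Pn n r y) with (- Pn n r y) in Hfin by ring.
    rewrite Cmod_opp in Hfin. go. } go.
Qed.

Lemma Sn_bound n r z C0 : U r -> upper z -> 0 <= C0 -> (forall t, 0 < t -> Cmod (gn n r t) <= C0) ->
  Cmod (Sn n r z) <= 6 * C0 /\ Rabs (IZR n) * Cmod (Sn n r z) <= 2 * C0.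
Proof.
intros Hr Hz HC HB. unfold Sn. rewrite !Cmod_mult, Cmod_ez, Cmod_Ci. have E2 : Cmod (-2) = 2%R by (rewrite Cmod_R, Rabs_left; lra).
destruct (Pn_bound n r (Im z) C0 Hr Hz HC HB) as [H1 H2]. go.
Qed.

Definition s1 (r z : C) : C := SUM (fun n => Sn n r z).

Lemma s1_bound r0 : U r0 -> exists d C0, 0 < d /\ 0 <= C0 /\ forall r z, disc r0 d r -> upper z ->
  is_sum (fun n => Sn n r z) (s1 r z) /\ Cmod (s1 r z) <= C0 /\ forall n, Cmod (Sn n r z) <= C0 * qz n.
Proof.
intros Hr. destruct (gn_bound r0 Hr) as [d [C0 [Hd [HC H]]]]. destruct (Uo r0 Hr) as [d3 [Hd3 HU]]. destruct bnd_qz as [Hq [B HB]].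
have HB0 : 0 <= B by (apply (HB nil); constructor). exists (Rmin d d3), (6 * C0 * (1 + B))%R. split; [now apply rmin_pos|]. split; [go|].
intros r z Hd' Hz. apply lt_rmin in Hd'. have Hb : forall n, Cmod (Sn n r z) <= 6 * C0 * qz n.
{ intros n. rewrite Rmult_assoc. apply Sn_bound; [apply HU, Hd'|go|go|]. intros t Ht. apply H; [go|go]. }
have HS : is_sum (fun n => Sn n r z) (s1 r z) by (apply (SUM_spec _ (fun n => 6 * C0 * qz n)%R); trivial; apply bnd_scal; [lra|go]).
split; [assumption|]. split.
- apply (is_sum_le (fun n => Sn n r z) (fun n => 6 * C0 * qz n)%R); trivial. intros L HL. rewrite rsum_scal. specialize (HB L HL). go.
- intros n. le_by Hb. apply Rmult_le_compat_r; [go|]. nra.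
Qed.

Lemma ct_Sn n r z : U r -> upper z -> ct (dP dC dC) dC (fun q => Sn n (fst q) (snd q)) (r, z).
Proof.
intros Hr Hz. apply ct_mult; [go|]. apply ct_mult; [go|]. destruct (near_pair U Uo r z 1 Hr Hz ltac:(lra)) as [e [He H]].
have Hx : dP dC dC (r, z) (r, z) = 0%R by (unfold dP; pairs; rewrite !dC_refl; ring).
have HIm : ct (dP dC dC) dR (fun q => Im (snd q)) (r, z) by (apply ct_Im; ctt).
apply (ct_ext_loc (dP dC dC) dC (fun q => RtoC (Im (snd q) - ebase n) * CI (fun s => kn n (fst q) (ebase n + s * (Im (snd q) - ebase
 n))%R))).
- take e. intros q Hq. destruct (H q Hq) as [H1 [H2 _]]. symmetry. now apply Pn_CI. - symmetry. now apply Pn_CI.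
- apply ct_mult; [apply (ct_ext _ _ (fun q : C * C => Im (snd q) - ebase n)); [go|]; apply ct_minus; [go|go]|].
 apply (ct_CI (dP dC dC) (fun q s => kn n (fst q) (ebase n + s * (Im (snd q) - ebase n))%R) (r, z) Hx).
 + take e. intros q Hq s Hs. destruct (H q Hq) as [H1 [H2 _]].
  apply (ct_kn dR n (fun _ => fst q) (fun s => ebase n + s * (Im (snd q) - ebase n))%R); trivial; [apply dR_refl|now apply base_pos|go|].
  apply (ct_R_ring dR (fun s : R => ebase n + s * (Im (snd q) - ebase n)%R)); [go|]. go.
 + intros s Hs. apply ct_jc. have HI2 : ct (dP (dP dC dC) dR) dR (fun q => Im (snd (fst q))) ((r, z), s) by (apply ct_Im; ctt).
  apply (ct_kn (dP (dP dC dC) dR) n (fun q => fst (fst q)) (fun q => ebase n + snd q * (Im (snd (fst q)) - ebase n))%R).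
  * unfold dP. rewrite !dC_refl, dR_refl. ring. * go. * now apply base_pos. * ctt.
  * apply (ct_R_ring _ (fun q : C * C * R => ebase n + snd q * (Im (snd (fst q)) - ebase n))); [go|]. go.
Qed.

Lemma s1_J : J U s1.
Proof.
intros r z Hr Hz. destruct (s1_bound r Hr) as [d [C0 [Hd [HC H]]]]. destruct (near_pair U Uo r z d Hr Hz Hd) as [e [He Hn]].
apply (ct_SUM (dP dC dC) (fun n q => Sn n (fst q) (snd q)) _ (fun n => C0 * qz n)%R).
- unfold dP; pairs; rewrite !dC_refl; ring. - go.
- take e. intros q Hq. destruct (Hn q Hq) as [_ [H2 [_ H3]]]. destruct (H (fst q) (snd q) H3 H2) as [Ha [_ Hb]]. go.
- intros n. now apply ct_Sn.
Qed.

Lemma s1_ana r z : U r -> upper z -> ana (fun r => s1 r z) r.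
Proof.
intros Hr Hz. destruct (s1_bound r Hr) as [d [C0 [Hd [HC H]]]]. destruct (Uo r Hr) as [d3 [Hd3 HU]].
apply (ana_SUM (fun n r => Sn n r z) _ (fun n => C0 * qz n)%R r (Rmin d d3)); [go|go| |].
- intros n r' Hr'. apply lt_rmin in Hr'. split; [|now apply H]. have HrU := HU r' (proj2 Hr'). destruct (Uo r' HrU) as [d4 [Hd4 HU4]].
 apply ana_mult; [apply ana_const|]. apply ana_mult; [apply ana_const|].
 apply ana_ext_loc with (f := fun r => RtoC (Im z - ebase n) * CI (fun s => kn n r (ebase n + s * (Im z - ebase n))%R)).
 + take d4. intros w Hw. symmetry. apply Pn_CI; [go|go].
 + apply ana_mult; [go|]. apply (ana_CI (fun r s => kn n r (ebase n + s * (Im z - ebase n))%R) r' d4 Hd4).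
  * intros w s Hw Hs. apply ct_jc. apply (ct_kn (dP dC dR) n (fun q => fst q) (fun q => ebase n + snd q * (Im z - ebase n))%R).
   -- unfold dP. rewrite dC_refl, dR_refl. ring. -- go. -- now apply base_pos. -- ctt.
   -- apply (ct_R_ring _ (fun q : C * R => ebase n + snd q * (Im z - ebase n)%R)); [go|]. go.
  * intros w s Hw Hs. apply ana_mult; [go|]. apply ana_gn; [go|now apply base_pos].
- intros r' Hr'. apply lt_rmin in Hr'. now apply H.
Qed.

Lemma s1_per r z : s1 r (z + 1) = s1 r z.
Proof.
unfold s1. f_equal. apply functional_extensionality. intros n. unfold Sn. rewrite ez_per.
replace (Im (z + 1)) with (Im z) by (unfold Im; simpl; ring). go.
Qed.

Lemma Sn_wd n r w : U r -> upper w ->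
  wd idC (Sn n r) w (pi2 * IZR n * Sn n r w - ez n (Re w) * gn n r (Im w)) (ez n (Re w) * gn n r (Im w)).
Proof.
intros Hr Hw. unfold Sn. have E : ez n w * kn n r (Im w) = ez n (Re w) * gn n r (Im w).
{ unfold kn. destruct w as [x y]. unfold Re, Im. pairs. rewrite ez_xy.
 have E2 : ez n (0%R, y) * RtoC (exp (2 * PI * IZR n * y)) = 1. { unfold ez, ee. rewrite <- Cexp_R, <- Cexp_plus, <- Cexp_0. f_equal. go. }
 replace (ez n x * ez n (0%R, y) * (RtoC (exp (2 * PI * IZR n * y)) * gn n r y)) with (ez n x * gn n r y * (ez n (0%R, y) * RtoC (exp (2 *
  PI * IZR n * y)))) by ring. rewrite E2. ring. }
wd_by (apply wd_scal, wd_mult; [apply wd_ez, (wd_io idC)|apply (wd_sum_R (Pn n r) (kn n r)); now apply rder_Pn]).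
- rewrite <- E. unfold pi2. go. - rewrite <- E. go.
Qed.

Lemma Sn_coef n r w C0 : U r -> upper w -> 0 <= C0 -> (forall t, 0 < t -> Cmod (gn n r t) <= C0) ->
  Cmod (pi2 * IZR n * Sn n r w - ez n (Re w) * gn n r (Im w)) + Cmod (ez n (Re w) * gn n r (Im w)) <= (2 * Cmod pi2 + 2) * C0.
Proof.
intros Hr Hu HC HB. destruct (Sn_bound n r w C0 Hr Hu HC HB) as [_ B1]. have B2 := HB (Im w) Hu.
have T := Cmod_triangle (pi2 * IZR n * Sn n r w) (- (ez n (Re w) * gn n r (Im w))). rewrite Cmod_opp in T. unfold Cminus.
have E1 : Cmod (ez n (Re w) * gn n r (Im w)) = Cmod (gn n r (Im w)) by (rewrite Cmod_mult, Cmod_ez_R; ring). rewrite E1 in *.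
rewrite !Cmod_mult, Cmod_R in T. have P := Cmod_ge_0 pi2. go.
Qed.

Lemma g_fourier r (x y : R) : U r -> 0 < y -> is_sum (fun n => ez n x * gn n r y) (g r (x, y)).
Proof.
intros Hr Hy. destruct (gn_bound r Hr) as [d [C0 [Hd [HC H]]]]. destruct gW as [_ [ha [hb [_ [_ Hwd]]]]].
have HF : is_sum (fun n => fc (fun x => g r (x, y)) n * ez n x) (g r (x, y)).
{ apply (fourier_per (fun x => g r (x, y)) (fun x => ha r (x, y) + hb r (x, y)) (fun n => C0 * qz n)%R).
 - intros t. exact (gper_loc g gp r t y Hr Hy). - intros t. exact (wd_horiz (g r) _ _ t y (Hwd r (t, y) Hr Hy)). - go.
 - intros n. exact (H n r y (disc_center r d Hd) Hy). } apply is_sum_ext with (2 := HF). go.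
Qed.

Lemma s1_dbar r z : U r -> upper z -> exists A, wd idC (s1 r) z A (g r z).
Proof.
intros Hr Hz. destruct (gn_bound r Hr) as [d [C0 [Hd [HC H]]]]. destruct (s1_bound r Hr) as [d2 [C2 [Hd2 [HC2 H2]]]].
set (Mj := fun n => ((2 * Cmod pi2 + 2) * C0 * qz n)%R).
have Hab : forall n w, upper w -> Cmod (pi2 * IZR n * Sn n r w - ez n (Re w) * gn n r (Im w)) + Cmod (ez n (Re w) * gn n r (Im w)) <= Mj n.
{ intros n w Hu. unfold Mj. rewrite Rmult_assoc. apply Sn_coef; trivial.
 - go. - intros t Ht. apply H; [now apply disc_center|go]. }
have HbM : bnd Mj by (apply bnd_scal; [apply Rmult_le_pos; [have P := Cmod_ge_0 pi2; lra|go]|go]).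
destruct (is_sum_ex (fun n => pi2 * IZR n * Sn n r z - ez n (Re z) * gn n r (Im z)) Mj HbM) as [sa Hsa].
{ intros n. specialize (Hab n z Hz). have P := Cmod_ge_0 (ez n (Re z) * gn n r (Im z)). lra. } exists sa.
destruct (upper_disc z Hz) as [e [He Hd3]].
apply (wd_SUM idC (fun n => Sn n r) (fun n => pi2 * IZR n * Sn n r z - ez n (Re z) * gn n r (Im z)) (fun n => ez n (Re z) * gn n r (Im z))
 (s1 r) Mj z sa (g r z) HbM).
- take e. intros y Hy. split.
 + apply H2; [now apply disc_center|go].
 + intros n. apply (wd_lip_disc (Sn n r) z e); [|go]. intros w Hw1. have Hu := Hd3 w Hw1.
  exists (pi2 * IZR n * Sn n r w - ez n (Re w) * gn n r (Im w)), (ez n (Re w) * gn n r (Im w)). split; [now apply Sn_wd|go].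
- intros n. now apply Sn_wd. - go. - have HG := g_fourier r (Re z) (Im z) Hr Hz. replace (Re z, Im z) with z in HG by go. go.
Qed.
End Cylinder.

(** * The invariant solution *)

(** Integral powers, in the form in which they occur in the slash actions. *)
Definition zp (w : C) (n : Z) : C := Cexp (IZR n * clog w).

Lemma zp_nat (w : C) n : w <> 0 -> zp w (Z.of_nat n) = w ^ n.
Proof. intros H. unfold zp. rewrite <- INR_IZR_INZ, <- Cexp_pow, Cexp_clog by go. go. Qed.
Lemma zp_plus w a b : zp w (a + b) = zp w a * zp w b.
Proof. unfold zp. rewrite <- Cexp_plus, plus_IZR, RtoC_plus. f_equal. ring. Qed.
Lemma zp_nz w n : zp w n <> 0.
Proof. apply Cexp_nz. Qed.
Lemma Cconj_R (x : R) : Cconj x = x.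
Proof. go. Qed.
Lemma Cconj_invol (z : C) : Cconj (Cconj z) = z.
Proof. go. Qed.

Section Main.
Variables (l M : Z) (f : C -> C) (k v : nat).
Hypothesis fa : forall z, upper z -> ana f z.
Hypothesis fp : forall z, upper z -> f (z + 1) = f z.
Hypothesis fgr : exists a0 B0 Y0 : R, forall x y, I01 x -> Y0 <= y -> Cmod (f (x, y)) <= B0 * exp (a0 * y).
Hypothesis ftr : forall g z, upper z -> f (mobius g z) = zp (autj g z) (2 - l) * f z.
Hypothesis v2 : (2 <= v)%nat.
Hypothesis wt : Z.of_nat (2 * v) = (l + 12 * Z.of_nat k)%Z.

Notation U := (slit_plane M).
Notation Uo := (slit_plane_open M).
Notation W := (W U).

Definition AA (r z : C) : C := Cexp (2 * r * sg z).
Definition uu (r z : C) : C := AA r z * V l M f 0 r z.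
(** The prescribed antiholomorphic derivative of the form of weight l, in closed form in [GG_eq]. *)
Definition GG (r z : C) : C := / (2 * Ci) * (psi l 0 r (Im z) * (AA r z * Bk f 0 r z)).

Lemma W_r n : W n (fun r _ => r).
Proof. apply (W_rfun U n (fun r => r)). go. Qed.
Lemma W_AA n : W n AA.
Proof. apply W_Cexp. apply W_mult; try apply Uo. - apply W_scal, W_r. - apply W_ana. apply ana_sg. Qed.

Lemma W_B0 n : W n (fun r z => Bk f 0 r z).
Proof.
apply (W_ext U Uo n (fun r z => Cconj (f z) * Cexp (2 * r * Cconj (sg z)))).
- intros r z _ _. unfold Bk, K0. rewrite Cmult_conj, <- Cexp_conj, !Cmult_conj, Cconj_invol, Cconj_R. go.
- apply W_mult; [apply W_conj, W_ana, fa|]. apply W_Cexp. apply W_mult; [apply W_scal, W_r|apply W_conj, W_ana, ana_sg].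
Qed.

Lemma W_B1 : W 0 (fun r z => Bk f 1 r z).
Proof.
apply (W_ext U Uo 0 (fun r z => Cconj (/ pi2) * (Cconj (dd f z) * Cexp (2 * r * Cconj (sg z)) + Cconj (f z) * (Cexp (2 * r * Cconj (sg z))
 * (2 * r * Cconj (dd sg z)))))).
- intros r z _ Hz. unfold Bk.
 have E : dd (K0 f (Cconj r)) z = dd f z * Cexp (2 * Cconj r * sg z) + f z * (Cexp (2 * Cconj r * sg z) * (2 * Cconj r * dd sg z)).
 { apply cder_dd. wd_by (apply wd_mult; [apply ana_dd, fa, Hz|apply wd_Cexp, wd_mult; [apply wd_const|apply ana_dd, ana_sg, Hz]]); cring. }
 rewrite E, !Cmult_conj, Cplus_conj, !Cmult_conj, <- !Cexp_conj, !Cmult_conj, Cconj_invol, Cconj_R. go.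
- apply W_scal. apply W_plus.
 + apply W_mult; [apply W_conj, W_ana; intros; now apply ana_deriv, fa|]. apply W_Cexp.
  apply W_mult; [apply W_scal, W_r|apply W_conj, W_ana, ana_sg].
 + apply W_mult; [apply W_conj, W_ana, fa|]. apply W_mult.
  * apply W_Cexp. apply W_mult; [apply W_scal, W_r|apply W_conj, W_ana, ana_sg].
  * apply W_mult; [apply W_scal, W_r|]. apply W_conj, W_ana. intros. now apply ana_deriv, ana_sg.
Qed.

Lemma W_V : W 2 (fun r z => V l M f 0 r z).
Proof.
have Hj : forall j, (j <= 3)%nat -> J U (fun r z => V l M f j r z) by (intros j Hj r z Hr Hz; now apply V_ct).
have H1 : W 1 (fun r z => V l M f 1 r z).
{ split; [go|].
 exists (fun r z => - pi2 * V l M f 2 r z - / (2 * Ci) * (psi l 0 r (Im z) * Bk f 1 r z)), (fun r z => / (2 * Ci) * (psi l 0 r (Im z) * Bk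
  f 1 r z)).
 have Hb : W 0 (fun r z => / (2 * Ci) * (psi l 0 r (Im z) * Bk f 1 r z)) by (apply W_scal, W_mult; [apply W_psi0, Uo|apply W_B1]).
 split; [apply W_minus; [apply Uo| |go]; apply W_scal; split; [go|go]|]. split; [go|]. intros r z Hr Hz. now apply V_wd. } split; [go|].
exists (fun r z => - pi2 * V l M f 1 r z - / (2 * Ci) * (psi l 0 r (Im z) * Bk f 0 r z)), (fun r z => / (2 * Ci) * (psi l 0 r (Im z) * Bk f
 0 r z)). have Hb : W 1 (fun r z => / (2 * Ci) * (psi l 0 r (Im z) * Bk f 0 r z)) by (apply W_scal, W_mult; [apply W_psi0, Uo|apply W_B0]).
split; [apply W_minus; [apply Uo| |go]; now apply W_scal|]. split; [go|]. intros r z Hr Hz. apply V_wd; trivial. lia.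
Qed.

Lemma W_uu : W 2 uu.
Proof. apply (W_mult U 2 AA); [apply W_AA|apply W_V]. Qed.

Lemma uu_per r z : upper z -> uu r (z + 1) = uu r z.
Proof.
intros Hz. unfold uu, AA. rewrite sg_per by go. f_equal. unfold V. f_equal. apply functional_extensionality. intros n. unfold tv.
rewrite ez_per. replace (Im (z + 1)) with (Im z) by (unfold Im; simpl; ring). go.
Qed.

Lemma uu_ana r z : U r -> upper z -> ana (fun r => uu r z) r.
Proof. intros Hr Hz. apply ana_mult; [anat|]. apply V_ana; trivial. lia. Qed.

Lemma uu_wd r z : U r -> upper z -> exists A, wd idC (uu r) z A (GG r z).
Proof.
intros Hr Hz. have HV := V_wd l M f fa fp fgr 0 r z ltac:(lia) Hr Hz. have HA : wd idC (AA r) z (Cexp (2 * r * sg z) * (2 * r * dd sg z)) 0.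
{ wd_by (apply wd_Cexp, wd_scal, ana_dd, ana_sg, Hz); cring. } eexists.
eapply wd_eq; [go| |apply (wd_mult idC (AA r) (V l M f 0 r)); [exact HA|exact HV]]. unfold GG. ring.
Qed.

Lemma GG_eq r z : upper z -> GG r z = / (2 * Ci) * (Cconj (f z) * Cexp (- (IZR l + r) * ln (Im z) - 4 * r * Re (lg z))).
Proof.
intros Hz. unfold GG, AA, Bk, K0, psi, pp, bb. rewrite clog_R by go. rewrite Cmult_conj, <- Cexp_conj, !Cmult_conj, Cconj_invol, Cconj_R.
f_equal. match goal with |- Cexp ?a * (Cexp ?b * (?c * Cexp ?d)) = _ => transitivity (c * (Cexp a * Cexp b * Cexp d)); [ring|] end. f_equal.
rewrite <- !Cexp_plus. f_equal. have E : RtoC (Re (lg z)) = - (PI * Im z / 12) - (sg z + Cconj (sg z)) / 2.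
{ apply C_eq; unfold Re, Im; simpl; field. } rewrite E. field.
Qed.

Lemma GG_inv g r z : upper z -> GG r (mobius g z) = zp (autj g z) l * (Cconj (autj g z) * Cconj (autj g z)) * GG r z.
Proof.
intros Hz. have Hm := mobius_upper g z Hz. have Hn := autj_nz g z Hz. set (j := autj g z) in *. have Hj := proj1 (Cmod_gt_0 _) Hn.
rewrite !GG_eq, ftr, Re_lg_mobius, Im_mobius by go. fold j. have E : ln (Im z / (Cmod j * Cmod j)) = (ln (Im z) - 2 * ln (Cmod j))%R.
{ unfold Rdiv. rewrite ln_mult by go. rewrite ln_Rinv, ln_mult by nra. ring. } rewrite E, Cmult_conj. unfold zp.
rewrite <- Cexp_conj, Cmult_conj, Cconj_R.
have Ej : Cconj j = Cexp (Cconj (clog j)) by (rewrite Cexp_conj, Cexp_clog by assumption; reflexivity). rewrite Ej.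
have Ec : clog j + Cconj (clog j) = 2 * ln (Cmod j) by go. set (c := clog j) in *. set (c' := Cconj c) in *.
match goal with |- ?h * (Cexp ?a * ?F * Cexp ?b) = Cexp ?d * (Cexp ?e * Cexp ?e) * (?h * (?F * Cexp ?o)) => transitivity (h * F * (Cexp a *
 Cexp b)); [ring|]; transitivity (h * F * (Cexp d * Cexp e * Cexp e * Cexp o)); [|ring] end. f_equal. rewrite <- !Cexp_plus. f_equal.
have E2 : RtoC (ln (Cmod j)) = (c + c') / 2 by (rewrite Ec; field). rewrite minus_IZR, !RtoC_minus, !RtoC_plus, !RtoC_mult, RtoC_inv by lra.
rewrite E2. field.
Qed.

Definition DK (z : C) : C := Dl z ^ k.
Definition g0 (r z : C) : C := - (uu r z * (dbar pu z * DK z)).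
(** The correction [s1 g0] cancels the derivative of the cut-off function, see [st_wd]. *)
Definition st (r z : C) : C := pu z * uu r z * DK z + s1 g0 r z.

Lemma ana_Dl z : upper z -> ana Dl z.
Proof. intros Hz. apply ana_Cexp, ana_mult; [go|now apply ana_lg]. Qed.
Lemma ana_DK z : upper z -> ana DK z.
Proof. intros Hz. apply ana_pow. now apply ana_Dl. Qed.
Lemma DK_nz z : DK z <> 0.
Proof. apply Cpow_nz, Cexp_nz. Qed.
Lemma DK_per z : upper z -> DK (z + 1) = DK z.
Proof. intros Hz. unfold DK. f_equal. exact (Dl_shift z 1 Hz). Qed.

Lemma W_dbar_pu : W 2 (fun _ z => dbar pu z).
Proof.
destruct (W_pu U Uo) as [_ [pa [pb [_ [Hb Hw]]]]]. apply (W_ext U Uo 2 pb); [|go]. intros r z Hr Hz. symmetry.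
apply (dbar_eq pu z (pa r z)). go.
Qed.

Lemma pu_wd r z : U r -> upper z -> exists A, wd idC pu z A (dbar pu z).
Proof.
intros Hr Hz. destruct (W_pu U Uo) as [_ [pa [pb [_ [Hb Hw]]]]]. specialize (Hw r z Hr Hz). exists (pa r z).
now rewrite (dbar_eq pu z _ _ Hw).
Qed.

Lemma g0_W : W 2 g0.
Proof.
apply W_opp; [apply Uo|]. apply (W_mult U 2 uu); [apply W_uu|]. apply (W_mult U 2 (fun _ z => dbar pu z)); [apply W_dbar_pu|]. apply W_ana.
apply ana_DK.
Qed.

Lemma g0_ana r z : U r -> upper z -> ana (fun r => g0 r z) r.
Proof. intros Hr Hz. apply ana_opp, ana_mult; [now apply uu_ana|go]. Qed.

Lemma g0_per r z : U r -> upper z -> g0 r (z + 1) = g0 r z.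
Proof.
intros Hr Hz. unfold g0. rewrite uu_per, DK_per by go. destruct (pu_wd r z Hr Hz) as [A HA].
rewrite (dbar_eq pu (z + 1) A (dbar pu z)); [go|]. apply wd_shift; trivial. apply pu_per.
Qed.

Lemma g0_supp r z : U r -> upper z -> (Im z < / 2 \/ 2 < Im z)%R -> g0 r z = 0.
Proof.
intros Hr Hz H. unfold g0. have E : dbar pu z = 0; [|rewrite E; ring]. have Hc : exists c d, 0 < d /\ forall y, disc z d y -> pu y = c.
{ have Hi : forall y, Rabs (Im y - Im z) <= Cmod (y - z). { intros y. have X := im_le_Cmod (y - z). go. } destruct H as [H|H].
 - exists (RtoC 0), (/ 2 - Im z)%R. split; [lra|]. intros y Hy. apply pu_zero. specialize (Hi y). unfold disc in Hy.
  have Q := Rle_abs (Im y - Im z). lra.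
 - exists (/ 2), (Im z - 2)%R. split; [lra|]. intros y Hy. apply pu_cusp. specialize (Hi y). unfold disc in Hy.
  have Q := Rle_abs (- (Im y - Im z)). rewrite Rabs_Ropp in Q. lra. } destruct Hc as [c [d [Hd Hc]]]. apply (dbar_eq pu z 0).
apply (wd_ext_loc idC (fun _ => c)); [|go]. take d. intros y Hy. symmetry. go.
Qed.

Notation S1 P := (P U Uo g0 g0_W g0_ana g0_per g0_supp).

Lemma st_J : J U st.
Proof.
intros r z Hr Hz. apply ct_plus.
- have HW : W 0 (fun r z => pu z * uu r z * DK z).
 { apply W_mult; [apply W_mult|].
  - apply (W_le U 3 0); [lia|apply W_pu, Uo]. - apply (W_le U 2 0); [lia|apply W_uu]. - apply W_ana, ana_DK. } now apply (W_J U 0 _ HW).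
- apply (s1_J U Uo g0 g0_W g0_per g0_supp); assumption.
Qed.

Lemma st_ana r z : U r -> upper z -> ana (fun r => st r z) r.
Proof.
intros Hr Hz. apply ana_plus.
- apply ana_mult; [apply ana_mult; [go|now apply uu_ana]|go]. - apply (s1_ana U Uo g0 g0_W g0_ana g0_per g0_supp); assumption.
Qed.

Lemma st_per r z : upper z -> st r (z + 1) = st r z.
Proof. intros Hz. unfold st. rewrite pu_per, uu_per, DK_per, s1_per by go. go. Qed.

Lemma st_wd r z : U r -> upper z -> exists A, wd idC (st r) z A (pu z * GG r z * DK z).
Proof.
intros Hr Hz. destruct (pu_wd r z Hr Hz) as [A1 H1]. destruct (uu_wd r z Hr Hz) as [A2 H2].
destruct (s1_dbar U Uo g0 g0_W g0_per g0_supp r z Hr Hz) as [A3 H3]. eexists.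
eapply wd_eq; [go| |apply wd_plus; [apply wd_mult; [apply wd_mult; [exact H1|exact H2]|apply ana_dd, ana_DK, Hz]|exact H3]]. unfold g0.
cring.
Qed.

Lemma st_bound r0 Y : U r0 -> exists d C0, 0 < d /\ 0 <= C0 /\ forall r z, disc r0 d r -> upper z -> Im z <= Y ->
  Cmod (st r z) <= C0.
Proof.
intros Hr. destruct (s1_bound U Uo g0 g0_W g0_per g0_supp r0 Hr) as [d1 [c1 [Hd1 [Hc1 H1]]]]. set (h := fun r z => pu z * uu r z * DK z).
have HW : W 0 h.
{ apply W_mult; [apply W_mult|].
 - apply (W_le U 3 0); [lia|apply W_pu, Uo]. - apply (W_le U 2 0); [lia|apply W_uu].
 - apply W_ana, ana_DK. } destruct (rect_bound h r0 (/ 2) Y) as [d2 [c2 [Hd2 [Hc2 H2]]]].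
{ intros x y _ Hy. apply (W_J U 0 h HW); [go|apply upper_xy; lra]. } exists (Rmin d1 d2), (c1 + c2)%R. split; [now apply rmin_pos|].
split; [lra|]. intros r z Hd Hz HY. apply lt_rmin in Hd. tri. have B1 := proj1 (proj2 (H1 r z (proj1 Hd) Hz)).
have B2 : Cmod (h r z) <= c2; [|unfold h in B2; lra]. destruct (Rle_lt_dec (Im z) (/ 2)) as [Hy|Hy].
- unfold h. rewrite pu_zero by go. vanish (0 * uu r z * DK z). now rewrite Cmod_0.
- destruct z as [x y]. unfold Im in *. cbn [snd] in *. have Hp : h r (x, y) = h r (frac_part x, y).
 { have E : (x, y) = (frac_part x, y) + IZR (Int_part x) by (unfold frac_part; apply C_eq; simpl; ring). rewrite E at 1.
  apply (per_int (h r)); [|go]. intros w Hw. unfold h. now rewrite pu_per, uu_per, DK_per. } rewrite Hp. have B := base_fp x.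
 apply H2; [go|unfold I01; lra|lra].
Qed.

Lemma st_growth r : U r -> exists C0, 0 <= C0 /\ forall z, 1 <= Im z -> Cmod (st r z) <= exp (C0 + C0 * Im z).
Proof.
intros Hr. destruct (st_bound r 3 Hr) as [d1 [c1 [Hd1 [Hc1 H1]]]].
destruct (s1_bound U Uo g0 g0_W g0_per g0_supp r Hr) as [d2 [c2 [Hd2 [Hc2 H2]]]]. destruct (V_growth l M f fa fp fgr r Hr) as [c3 [Hc3 H3]].
destruct sg_bound as [B [HB HS]]. set (a := (2 * Cmod r * B + INR k * (24 * B))%R). have Pr := Cmod_ge_0 r. have Pk := pos_INR k.
have Ha : 0 <= a by (unfold a; apply Rplus_le_le_0_compat; apply Rmult_le_pos; lra). exists (c1 + c2 + c3 + a)%R. split; [lra|].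
intros z Hz. have Hu : upper z by (unfold upper; lra). destruct (Rle_lt_dec (Im z) 3) as [H|H].
- le_by ((H1 r z (disc_center r d1 Hd1) Hu H)). le_by le_exp. apply exp_mono. nra.
- unfold st. rewrite pu_cusp by lra. tri. have B1 := proj1 (proj2 (H2 r z (disc_center r d2 Hd2) Hu)). specialize (HS z Hz).
 have BA : Cmod (AA r z) <= exp (2 * Cmod r * B).
 { unfold AA. rewrite Cmod_Cexp. apply exp_mono. have X := re_le_Cmod (2 * r * sg z).
  rewrite !Cmod_mult, Cmod_R, (Rabs_pos_eq 2) in X by lra. have Q := Rle_abs (Re (2 * r * sg z)). go. }
 have BD : Cmod (DK z) <= exp (INR k * (24 * B)).
 { unfold DK, Dl. rewrite Cexp_pow, Cmod_Cexp. apply exp_mono.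
  replace (Re (INR k * (24 * lg z))) with (INR k * (24 * Re (lg z)))%R by (unfold Re; simpl; ring). apply Rmult_le_compat_l; [go|].
  replace (Re (lg z)) with (- (PI * Im z / 12) - Re (sg z))%R by (unfold lg, Re, Im; simpl; field). have X := re_le_Cmod (sg z).
  have Q := Rle_abs (- Re (sg z)). rewrite Rabs_Ropp in Q. have G := PI_RGT_0. go. }
 have Bu : Cmod (/ 2 * uu r z * DK z) <= / 2 * exp (c3 + a + c3 * Im z).
 { unfold uu. rewrite !Cmod_mult, Cmod_inv, Cmod_R, (Rabs_pos_eq 2) by go.
  replace (exp (c3 + a + c3 * Im z)) with (exp (2 * Cmod r * B) * (exp (c3 + c3 * Im z) * exp (INR k * (24 * B))))%R by (rewrite <-
   !exp_plus; f_equal; unfold a; ring).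
  match goal with |- (?x * (?y * ?t) * ?w <= _) => replace (x * (y * t) * w)%R with (x * (y * (t * w)))%R by ring end.
  apply Rmult_le_compat_l; [lra|]. apply Rmult_le_compat; [go|go|go|]. apply Rmult_le_compat; [go|go|go|go]. }
 have E1 : exp (c3 + a + c3 * Im z) <= exp (c1 + c2 + c3 + a + (c1 + c2 + c3 + a) * Im z) by (apply exp_mono; nra).
 have E2 : c2 <= / 2 * exp (c1 + c2 + c3 + a + (c1 + c2 + c3 + a) * Im z).
 { have L := le_exp (c1 + c2 + c3 + a + (c1 + c2 + c3 + a) * Im z). go. } lra.
Qed.

Definition pp_sum (r z : C) : C := SUM (fun p => pst (2 * v) (st r) p z).
Definition hh (r z : C) : C := / DK z * pp_sum r z.

Lemma wt_pow (w : C) : w <> 0 -> w ^ (2 * v) = zp w l * (w ^ 12) ^ k.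
Proof.
intros H. rewrite <- zp_nat, wt, zp_plus by go. f_equal. replace (12 * Z.of_nat k)%Z with (Z.of_nat (12 * k)) by lia. rewrite zp_nat by go.
apply Cpow_mult_r.
Qed.

Lemma pst_le (F : C -> C) X m B p z : 0 < m -> m <= Im z -> Rabs (Re z) <= X -> 0 <= B ->
  (cop p -> Cmod (F (mobius (gam p) z)) <= B) -> Cmod (pst (2 * v) F p z) <= B * (3 / kap X m ^ v) * qq p.
Proof.
intros Hm Hz HX HB HF. have Hu : upper z by (unfold upper; lra). have Hk := kap_pos X m Hm.
have Hq : 0 <= qq p by (apply Rmult_le_pos; left; apply qz_pos).
have Hkv : 0 <= 3 / kap X m ^ v by (apply Rmult_le_pos; [lra|left; apply Rinv_0_lt_compat; now apply pow_lt]). case_cop p as [Hc|Hc].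
2:{ rewrite Cmod_0. apply Rmult_le_pos; [apply Rmult_le_pos|]; assumption. } have Hj := jp_nz p z Hc Hu. unfold Cdiv.
rewrite Cmod_mult, Cmod_inv, Cmod_pow, Rmult_assoc by now apply Cpow_nz. apply Rmult_le_compat; [apply Cmod_ge_0| |auto|now apply jp_inv4].
left. apply Rinv_0_lt_compat, pow_lt, Cmod_gt_0. exact Hj.
Qed.

Lemma pst_bound r0 z0 : U r0 -> upper z0 -> exists d C0, 0 < d /\ 0 <= C0 /\ forall r z p, disc r0 d r -> disc z0 (Im z0 / 2) z ->
  Cmod (pst (2 * v) (st r) p z) <= C0 * qq p.
Proof.
intros Hr Hz0. set (X := (Rabs (Re z0) + Im z0)%R). set (m := (Im z0 / 2)%R). have Hm : 0 < m by go. have Hk := kap_pos X m Hm.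
destruct (st_bound r0 (2 * Im z0 / kap X m)%R Hr) as [d [C0 [Hd [HC H]]]]. exists d, (C0 * (3 / kap X m ^ v))%R. split; [assumption|].
split; [apply Rmult_le_pos; [go|]; apply Rmult_le_pos; [lra|left; apply Rinv_0_lt_compat; now apply pow_lt]|]. intros r z p Hd' Hz.
destruct (disc_box z0 z Hz0 Hz) as [H1 [H2 H3]]. destruct (disc_upper z0 z Hz0 Hz) as [_ Hu]. apply pst_le; trivial. intros Hc.
apply H; [go|now apply mobius_upper|]. rewrite Im_gam by go. have Hl := jp_low X m p z Hm H1 H3. have Hcp := cop_pos p Hc.
have Hjp := jp_pos p z Hc Hu. have Hkj : kap X m <= Cmod (jp p z) * Cmod (jp p z) by nra. apply Rmult_le_compat; [go|go|lra|].
now apply Rinv_le_contravar.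
Qed.

Lemma pp_spec r z : U r -> upper z -> is_sum (fun p => pst (2 * v) (st r) p z) (pp_sum r z).
Proof.
intros Hr Hz. destruct (pst_bound r z Hr Hz) as [d [C0 [Hd [HC H]]]]. apply (SUM_spec _ (fun p => C0 * qq p)%R); [go|]. intros p.
apply H; apply disc_center; trivial. go.
Qed.

Lemma hh_ana r z : U r -> upper z -> ana (fun r => hh r z) r.
Proof.
intros Hr Hz. apply ana_mult; [apply ana_const|]. destruct (pst_bound r z Hr Hz) as [d [C0 [Hd [HC H]]]].
destruct (Uo r Hr) as [d2 [Hd2 HU]]. have Hzz : disc z (Im z / 2) z by (apply disc_center; unfold upper in Hz; lra).
apply (ana_SUM (fun p r => pst (2 * v) (st r) p z) _ (fun p => C0 * qq p)%R r (Rmin d d2)); [go|go| |].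
- intros p r' Hr'. apply lt_rmin in Hr'. split; [|now apply H]. case_cop p as [Hc|Hc]; [|go]. apply ana_mult; [|go].
 apply st_ana; [now apply HU|now apply mobius_upper].
- intros r' Hr'. apply lt_rmin in Hr'. apply pp_spec; [now apply HU|go].
Qed.

Lemma hh_inv g r z : U r -> upper z -> hh r (mobius g z) = zp (autj g z) l * hh r z.
Proof.
intros Hr Hz. have Hn := autj_nz g z Hz. unfold hh.
rewrite (PS_inv (2 * v) (st r) g z (pp_sum r z) (pp_sum r (mobius g z)) (st_per r) Hz (pp_spec r z Hr Hz) (pp_spec r _ Hr (mobius_upper g z
 Hz))), wt_pow by exact Hn. unfold DK. rewrite Dl_mobius, Cpow_mult_l by go. have N1 : Dl z ^ k <> 0 by apply DK_nz.
have N2 : (autj g z ^ 12) ^ k <> 0 by now apply Cpow_nz, Cpow_nz. go.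
Qed.

(** Below the strip the terms are holomorphic; the finitely many others contribute the partition of unity. *)
Lemma hh_wd r z0 : U r -> upper z0 -> exists A, wd idC (hh r) z0 A (GG r z0).
Proof.
intros Hr Hz0. destruct (loc_fin z0 Hz0) as [N HN]. destruct (pst_bound r z0 Hr Hz0) as [d [C0 [Hd [HC H]]]].
set (rho := (Im z0 / 2)%R) in *. have Hrho : 0 < rho by (unfold rho, upper in *; lra).
set (rest := fun p z => if in_dec eqd p (box N) then RtoC 0 else pst (2 * v) (st r) p z).
set (RS := fun z => pp_sum r z - lsum (fun p => pst (2 * v) (st r) p z) (box N)).
have Hrs : forall z, disc z0 rho z -> is_sum (fun p => rest p z) (RS z).
{ intros z Hz. destruct (disc_upper z0 z Hz0 Hz) as [_ Hu].
 apply is_sum_ext with (f := fun p => pst (2 * v) (st r) p z - (if in_dec eqd p (box N) then pst (2 * v) (st r) p z else 0)).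
 - intros p. unfold rest. destruct (in_dec eqd p (box N)); ring.
 - apply is_sum_minus; [now apply pp_spec|]. rewrite (lsum_ext _ (fun p => if in_dec eqd p (box N) then pst (2 * v) (st r) p z else 0)).
  + apply is_sum_finite; [apply NoDup_box|]. intros p Hp. destruct (in_dec eqd p (box N)); [contradiction|reflexivity].
  + intros p Hp. destruct (in_dec eqd p (box N)); [reflexivity|contradiction]. } have HRa : ana RS z0.
{ apply (ana_SUM rest RS (fun p => C0 * qq p)%R z0 rho Hrho); [apply bnd_scal; [assumption|apply bnd_qq]| |exact Hrs]. intros p z Hz.
 destruct (disc_upper z0 z Hz0 Hz) as [_ Hu]. unfold rest. destruct (in_dec eqd p (box N)) as [Hi|Hi].
 - split; [apply ana_const|]. rewrite Cmod_0. apply Rmult_le_pos; [assumption|]. unfold qq. apply Rmult_le_pos; left; apply qz_pos.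
 - split; [|apply H; [now apply disc_center|assumption]]. case_cop p as [Hc|Hc]; [|apply ana_const]. apply ana_div.
  + apply Cpow_nz. now apply jp_nz.
  + have Hlow := HN z p Hz Hc Hi. apply (ana_comp (st r) (mobius (gam p))); [now apply ana_mobius|]. have Hw := mobius_upper (gam p) z Hu.
   set (w := mobius (gam p) z) in *. apply (goursat w (Rmin (Im w / 2) (/ 2 - Im w))); [go|]. intros y Hy. unfold disc in Hy.
   apply lt_rmin in Hy as [Hy1 Hy2]. destruct (disc_upper w y Hw Hy1) as [_ Hyu]. have Hyl : Im y <= / 2.
   { have X := im_le_Cmod (y - w). replace (Im (y - w)) with (Im y - Im w)%R in X by go. have Q := Rle_abs (Im y - Im w). lra. }
   destruct (st_wd r y Hr Hyu) as [A HA]. exists A. rewrite pu_zero in HA by go. replace (0 * GG r y * DK y) with (RtoC 0) in HA by ring.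
   go.
  + go. }
have Hfin : forall L, exists A, wd idC (fun z => lsum (fun p => pst (2 * v) (st r) p z) L) z0 A (lsum (fun p => pst 0 pu p z0 * (GG r z0 *
 DK z0)) L).
{ induction L as [|p L [A IH]]; cbn [lsum]; [exists 0; apply wd_const|].
 have Hp : exists B, wd idC (fun z => pst (2 * v) (st r) p z) z0 B (pst 0 pu p z0 * (GG r z0 * DK z0)).
 { case_cop p as [Hc|Hc].
  - have Hw := mobius_upper (gam p) z0 Hz0. destruct (st_wd r _ Hr Hw) as [B HB].
   have Hm : wd idC (fun z => idC (mobius (gam p) z)) z0 (/ (autj (gam p) z0 * autj (gam p) z0)) 0 by (unfold idC at 2; now apply
    cder_mobius). have Hj := jp_nz p z0 Hc Hz0. have Hja : ana (fun z => / jp p z ^ (2 * v)) z0. { apply ana_inv; [go|]. go. } eexists.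
   eapply wd_eq; [go| |apply (wd_mult idC (fun z => st r (mobius (gam p) z)) (fun z => / jp p z ^ (2 * v))); [apply (wd_chain idC idC (st
    r) (mobius (gam p)) z0 _ _ _ _ HB Hm)|apply ana_dd, Hja]]. rewrite GG_inv by go. rewrite <- jp_autj by go. unfold DK.
   rewrite Dl_mobius, Cpow_mult_l, <- jp_autj by go. cbv beta. rewrite (wt_pow (jp p z0)) by exact Hj.
   have Ec : Cconj (/ (jp p z0 * jp p z0)) = / (Cconj (jp p z0) * Cconj (jp p z0)). { rewrite Cinv_conj by go. now rewrite Cmult_conj. }
   rewrite Ec. have N1 : zp (jp p z0) l <> 0 by apply zp_nz. have N2 : (jp p z0 ^ 12) ^ k <> 0 by go.
   have N3 : Cconj (jp p z0) <> 0 by (intros E0; apply Hj; rewrite <- (Cconj_invol (jp p z0)), E0; apply C_eq; simpl; ring). go.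
  - exists 0. go. } destruct Hp as [B HB]. eexists. apply (wd_plus idC (fun z => pst (2 * v) (st r) p z)); [exact HB|exact IH]. }
destruct (Hfin (box N)) as [A1 HA1]. have Hone : lsum (fun p => pst 0 pu p z0 * (GG r z0 * DK z0)) (box N) = GG r z0 * DK z0.
{ have Hs : is_sum (fun p => pst 0 pu p z0) (lsum (fun p => pst 0 pu p z0) (box N)).
 { apply is_sum_finite; [apply NoDup_box|]. intros p Hp. case_cop p as [Hc|]; [|go]. rewrite pu_zero; [go|]. left. apply HN; trivial.
  now apply disc_center. } have E1 := is_sum_unique _ _ _ Hs (pu_sum z0 Hz0).
 rewrite (lsum_ext _ (fun p => (GG r z0 * DK z0) * pst 0 pu p z0)) by go. rewrite lsum_scal, E1. go. } rewrite Hone in HA1.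
have HA2 := proj1 (ana_dd _ _ HRa). have Hsum : exists A, wd idC (pp_sum r) z0 A (GG r z0 * DK z0).
{ eexists.
 eapply wd_eq; [go| |apply (wd_ext idC (fun z => RS z + lsum (fun p => pst (2 * v) (st r) p z) (box N)) (pp_sum r)); [go|apply wd_plus;
  [exact HA2|exact HA1]]]. ring. } destruct Hsum as [A HA].
have Hinv : ana (fun z => / DK z) z0 by (apply ana_inv; [apply DK_nz|now apply ana_DK]). eexists.
eapply wd_eq; [go| |apply (wd_mult idC (fun z => / DK z) (pp_sum r)); [apply ana_dd, Hinv|exact HA]]. cbv beta. have ND := DK_nz z0. go.
Qed.

(** This shows regularity of [hh]: a difference of two solutions is holomorphic, and [uu] is explicitly smooth. *)
Lemma hh_uu r z : U r -> upper z -> ana (fun z => hh r z - uu r z) z.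
Proof.
intros Hr Hz. destruct (upper_disc z Hz) as [d [Hd H]]. apply (goursat z d); [go|]. intros y Hy. have Hu := H y Hy.
destruct (hh_wd r y Hr Hu) as [A HA]. destruct (uu_wd r y Hr Hu) as [B HB]. exists (A - B).
eapply wd_eq; [go| |apply wd_minus; [exact HA|exact HB]]. ring.
Qed.

Lemma hh_growth r X : U r -> exists C0, 0 <= C0 /\ forall z, 1 <= Im z -> Rabs (Re z) <= X ->
  Cmod (hh r z) <= exp (C0 + C0 * Im z).
Proof.
intros Hr. destruct (st_bound r 1 Hr) as [d1 [c1 [Hd1 [Hc1 H1]]]]. destruct (st_growth r Hr) as [c2 [Hc2 H2]].
destruct sg_bound as [B [HB HS]]. destruct bnd_qq as [_ [Bq HBq]]. have HBq0 : 0 <= Bq by (apply (HBq nil); constructor).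
have Hk := kap_pos X 1 ltac:(lra). set (q := (3 / kap X 1 ^ v)%R).
have Hq : 0 <= q by (apply Rmult_le_pos; [lra|left; apply Rinv_0_lt_compat; now apply pow_lt]). set (e := (INR k * (8 + 24 * B))%R).
have He : 0 <= e by go. exists (e + c1 + c2 + q * Bq)%R. have HqB : 0 <= q * Bq by go. split; [lra|]. intros z Hz HX.
have Hu : upper z by (unfold upper; lra). have Hst : forall p, cop p -> Cmod (st r (mobius (gam p) z)) <= exp (c1 + c2 + c2 * Im z).
{ intros p Hp. have Hjp := jp_pos p z Hp Hu. have HI := Im_gam p z Hp Hu. have Hmu := mobius_upper (gam p) z Hu.
 destruct (Rle_lt_dec (Im (mobius (gam p) z)) 1) as [Hle|Hgt].
 - le_by ((H1 r _ (disc_center r d1 Hd1) Hmu Hle)). le_by le_exp. apply exp_mono. nra.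
 - eapply Rle_trans; [apply H2; lra|]. apply exp_mono. have HIz : Im (mobius (gam p) z) <= Im z; [|nra]. rewrite HI.
  apply Rmult_le_reg_r with (Cmod (jp p z) * Cmod (jp p z))%R; [go|]. unfold Rdiv. rewrite Rmult_assoc, Rinv_l by lra.
  have H1j : 1 <= Cmod (jp p z) * Cmod (jp p z); [|nra]. destruct (Z.eq_dec (fst p) 0) as [E|E].
  + have Hc := cop_pos p Hp. unfold jp. rewrite E. replace (0 * z + IZR (snd p)) with (RtoC (IZR (snd p))) by ring. rewrite E in Hc.
   rewrite Cmod_R, <- Rabs_mult, Rabs_pos_eq by nra. lra.
  + have X1 := im_le_Cmod (jp p z). replace (Im (jp p z)) with (IZR (fst p) * Im z)%R in X1 by (unfold jp, Im; simpl; ring).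
   rewrite Rabs_mult, (Rabs_pos_eq (Im z)) in X1 by lra. have Hf1 : 1 <= Rabs (IZR (fst p)) by (rewrite <- abs_IZR; apply IZR_le; lia).
   have Hf2 : 1 * 1 <= Rabs (IZR (fst p)) * Im z by go. go. } have Hps : Cmod (pp_sum r z) <= exp (c1 + c2 + c2 * Im z) * q * Bq.
{ apply (is_sum_le (fun p => pst (2 * v) (st r) p z) (fun p => exp (c1 + c2 + c2 * Im z) * q * qq p)%R); [now apply pp_spec| |].
 - intros p. apply pst_le; trivial; [lra|left; apply exp_pos|apply Hst].
 - intros L HL. rewrite rsum_scal. apply Rmult_le_compat_l; [go|go]. } unfold hh. rewrite Cmod_mult.
have BD : Cmod (/ DK z) <= exp (e * Im z).
{ unfold DK, Dl. rewrite Cexp_pow, <- Cexp_opp, Cmod_Cexp. apply exp_mono.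
 replace (Re (- (INR k * (24 * lg z)))) with (INR k * (- (24 * Re (lg z))))%R by (unfold Re; simpl; ring). unfold e. rewrite Rmult_assoc.
 apply Rmult_le_compat_l; [go|]. replace (Re (lg z)) with (- (PI * Im z / 12) - Re (sg z))%R by (unfold lg, Re, Im; simpl; field).
 specialize (HS z Hz). have X1 := re_le_Cmod (sg z). have Q := Rle_abs (Re (sg z)). have G := PI_4. nra. }
apply Rle_trans with (exp (e * Im z) * (exp (c1 + c2 + c2 * Im z) * exp (q * Bq)))%R.
- apply Rmult_le_compat; try apply Cmod_ge_0; trivial. eapply Rle_trans; [exact Hps|]. rewrite Rmult_assoc.
 apply Rmult_le_compat_l; [go|apply le_exp].
- rewrite <- !exp_plus. apply exp_mono. nra.
Qed.
End Main.

(** * Derivatives, sums and compact sets in the form used by the statement *)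

Lemma ex_derive_cder (g : C -> C) z : @ex_derive C_AbsRing C_NormedModule g z -> exists l, cder g z l.
Proof.
intros [l [_ H]]. exists l. specialize (H z (fun P HP => HP)). intros eps He. destruct (H (mkposreal eps He)) as [d Hd]. exists d.
split; [apply cond_pos|]. intros y Hy. unfold idC.
replace (g y - g z - ((y - z) * l + Cconj (y - z) * 0)) with (g y - g z - (y - z) * l) by ring. go.
Qed.

Lemma cder_ex_derive (g : C -> C) z l : cder g z l -> @ex_derive C_AbsRing C_NormedModule g z.
Proof.
intros H. exists l. split; [apply (is_linear_scal_l (K := C_AbsRing) (V := C_NormedModule))|]. intros x Hx.
apply (is_filter_lim_locally_unique (K := C_AbsRing) (V := AbsRing_NormedModule C_AbsRing)) in Hx. subst x. intros eps.
destruct (H eps (cond_pos eps)) as [d [Hd H1]]. exists (mkposreal d Hd). intros y Hy. specialize (H1 y Hy). unfold idC in H1.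
replace (g y - g z - ((y - z) * l + Cconj (y - z) * 0)) with (g y - g z - (y - z) * l) in H1 by ring. go.
Qed.

Lemma ana_ex_derive g z : ana g z -> @ex_derive C_AbsRing C_NormedModule g z.
Proof. intros H. apply (cder_ex_derive g z (dd g z)). now apply ana_dd. Qed.

Lemma ct_continuous_C (g : C -> C) z : ct dC dC g z -> continuous g z.
Proof.
intros H. apply filterlim_locally. intros eps. destruct (H eps (cond_pos eps)) as [d [Hd H1]]. have Hd2 : 0 < d / 2 by lra.
exists (mkposreal _ Hd2). intros y Hy. have Hc : Cmod (y - z) < d.
{ destruct Hy as [Hy1 Hy2]. change (Rabs (fst y - fst z) < d / 2) in Hy1. change (Rabs (snd y - snd z) < d / 2) in Hy2.
 eapply Rle_lt_trans; [apply Cmod_le_ReIm|]. simpl. unfold Rminus in *. lra. } specialize (H1 y Hc). split.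
- eapply Rle_lt_trans; [|exact H1]. exact (re_le_Cmod (g y - g z)). - eapply Rle_lt_trans; [|exact H1]. exact (im_le_Cmod (g y - g z)).
Qed.

Lemma wd_partials F z A B : wd idC F z A B -> ex_partials F z /\ partial_x F z = A + B /\ partial_y F z = Ci * (A - B).
Proof.
intros H. replace z with (Re z, Im z) in H by go. have Hx := wd_horiz _ _ _ _ _ H. have Hy := wd_vert _ _ _ _ _ H.
have H1 := proj2 (is_derive_Reals _ _ _) (rder_Re _ _ _ Hx). have H2 := proj2 (is_derive_Reals _ _ _) (rder_Im _ _ _ Hx).
have H3 := proj2 (is_derive_Reals _ _ _) (rder_Re _ _ _ Hy). have H4 := proj2 (is_derive_Reals _ _ _) (rder_Im _ _ _ Hy). split; [|split].
- repeat split; eexists; eassumption. - unfold partial_x. rewrite (is_derive_unique _ _ _ H1), (is_derive_unique _ _ _ H2). go.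
- unfold partial_y. rewrite (is_derive_unique _ _ _ H3), (is_derive_unique _ _ _ H4). go.
Qed.

Lemma wd_dz F z A B : wd idC F z A B -> d_z F z = A /\ d_zbar F z = B.
Proof.
intros H. destruct (wd_partials F z A B H) as [_ [E1 E2]]. unfold d_z, d_zbar. rewrite E1, E2. have Hi : Ci * Ci = - (1) by go. split.
- replace (/ 2 * (A + B - Ci * (Ci * (A - B)))) with (/ 2 * (A + B - (Ci * Ci) * (A - B))) by ring. rewrite Hi. field.
- replace (/ 2 * (A + B + Ci * (Ci * (A - B)))) with (/ 2 * (A + B + (Ci * Ci) * (A - B))) by ring. rewrite Hi. field.
Qed.

Definition anyC (_ : C) : Prop := True.
Lemma anyC_open r : anyC r -> exists d, 0 < d /\ forall r', disc r d r' -> anyC r'.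
Proof. intros _. exists 1%R. split; [lra|]. go. Qed.

Lemma W_fix U n r0 : U r0 -> forall f, W U n f -> W anyC n (fun _ z => f r0 z).
Proof.
intros H0. have Hj : forall f, J U f -> J anyC (fun _ z => f r0 z).
{ intros f Hf r z _ Hz. apply (ct_comp (dP dC dC) (dP dC dC) dC (fun q => f (fst q) (snd q)) (fun q => (r0, snd q)) (r, z)); [ctt|go]. }
induction n as [|n IH]; intros f [Hf H]; (split; [go|]); trivial. destruct H as [fa [fb [Ha [Hb Hw]]]].
exists (fun _ z => fa r0 z), (fun _ z => fb r0 z). go.
Qed.

Lemma W_class_C n : forall F, W anyC n (fun _ z => F z) -> class_C n F.
Proof.
have Hc : forall n F, W anyC n (fun _ z => F z) -> forall z, upper z -> continuous F z.
{ intros m F H z Hz. apply ct_continuous_C. exact (W_ct_r anyC m (fun _ z => F z) 0 z H I Hz). }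
induction n as [|n IH]; intros F H; (split; [now apply (Hc _ F H)|]); trivial. destruct H as [_ [fa [fb [Ha [Hb Hw]]]]].
have Ha0 := W_fix anyC n 0 I fa Ha. have Hb0 := W_fix anyC n 0 I fb Hb.
split; [intros z Hz; apply (wd_partials F z (fa 0 z) (fb 0 z)); now apply Hw|]. split; apply IH.
- apply (W_ext anyC anyC_open n (fun _ z => fa 0 z + fb 0 z)); [|now apply W_plus]. intros r z _ Hz. symmetry.
 apply (wd_partials F z (fa 0 z) (fb 0 z)). now apply Hw.
- apply (W_ext anyC anyC_open n (fun _ z => Ci * (fa 0 z - fb 0 z))); [|apply W_scal, W_minus; trivial; apply anyC_open]. intros r z _ Hz.
 symmetry. apply (wd_partials F z (fa 0 z) (fb 0 z)). now apply Hw.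
Qed.

Lemma bnd_ex_series (a : nat -> R) : bnd a -> ex_series a.
Proof.
intros H. destruct (is_sum_ex (fun n => RtoC (a n)) a H) as [s Hs]. { intros n. rewrite Cmod_R, Rabs_pos_eq; [lra|apply H]. } exists (Re s).
apply is_series_Reals. intros eps He. destruct (nat_sum_lim _ s Hs (eps / 2)%R ltac:(lra)) as [N HN]. exists N. intros n Hn.
specialize (HN n Hn). have E := sum_f_lsum Re (fun n => RtoC (a n)) n (fun u v => eq_refl).
rewrite (sum_eq a (fun k => Re (RtoC (a k))) n (fun i _ => eq_refl)), E.
eapply Rle_lt_trans; [exact (re_le_Cmod (lsum (fun n => RtoC (a n)) (seq 0 (S n)) - s))|]. lra.
Qed.

Lemma is_sum_is_series (a : nat -> C) s : is_sum a s -> @is_series C_AbsRing C_NormedModule a s.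
Proof.
intros H. apply filterlim_locally. intros eps. destruct (nat_sum_lim a s H (eps / 2)%R) as [N HN]; [have P := cond_pos eps; lra|]. exists N.
intros n Hn. specialize (HN n Hn). have E : forall n, sum_n (a : nat -> C_NormedModule) n = lsum a (seq 0 (S n)).
{ induction n0 as [|m IH]; [go|]. rewrite sum_Sn, IH, (lsum_seq_S a (S m)). go. } rewrite E. have P := cond_pos eps.
set (w := lsum a (seq 0 (S n))) in *. split.
- eapply Rle_lt_trans; [exact (re_le_Cmod (w - s))|]. lra. - eapply Rle_lt_trans; [exact (im_le_Cmod (w - s))|]. lra.
Qed.

Lemma is_sum_Z_of (a : Z -> C) M s : bnd M -> (forall n, Cmod (a n) <= M n) -> is_sum a s -> is_sum_Z a s.
Proof.
intros HM Hb Hs. have I1 : bnd (fun n : nat => M (Z.of_nat n)) by (apply (bnd_inj M Z.of_nat); [go|go]).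
have I2 : bnd (fun n : nat => M (- Z.of_nat (S n))%Z) by (apply (bnd_inj M (fun n : nat => - Z.of_nat (S n))%Z); [go|go]). split; [|split].
- apply bnd_ex_series. apply (bnd_le _ _ 1 I1). intros n. split; [go|]. specialize (Hb (Z.of_nat n)). lra.
- apply bnd_ex_series. apply (bnd_le _ _ 1 I2). intros n. split; [go|]. specialize (Hb (- Z.of_nat (S n))%Z). lra.
- destruct (is_sum_ex (fun n => a (Z.of_nat n)) _ I1 (fun n => Hb _)) as [u Hu].
 destruct (is_sum_ex (fun n => a (- Z.of_nat (S n))%Z) _ I2 (fun n => Hb _)) as [w Hw]. exists u, w. split; [now apply is_sum_is_series|].
 split; [now apply is_sum_is_series|]. set (f1 := fun c : Z => if Z.leb 0 c then a c else 0).
 set (f2 := fun c : Z => if Z.ltb c 0 then a c else 0). apply (is_sum_unique _ _ _ Hs). apply is_sum_ext with (f := fun c => f1 c + f2 c).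
 { intros c. unfold f1, f2. destruct (Z.leb_spec 0 c), (Z.ltb_spec c 0); try lia; ring. } apply is_sum_plus.
 + apply (is_sum_inj _ Z.of_nat Z.to_nat); [go| |].
  * intros c. unfold f1. destruct (Z.leb_spec 0 c); [go|go].
  * apply is_sum_ext with (2 := Hu). intros n. unfold f1. destruct (Z.leb_spec 0 (Z.of_nat n)); [go|lia].
 + apply (is_sum_inj _ (fun n : nat => - Z.of_nat (S n))%Z (fun c => Z.to_nat (- c - 1))); [go| |].
  * intros c. unfold f2. destruct (Z.ltb_spec c 0); [go|go]. * go.
Qed.

(** * The harmonic lift *)

Lemma Cexp_Z_ext (a b : C) n : Cexp a = Cexp b -> Cexp (IZR n * a) = Cexp (IZR n * b).
Proof.
intros H. have Hn : forall m, Cexp (INR m * a) = Cexp (INR m * b) by (intros m; now rewrite <- !Cexp_pow, H).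
destruct (Z_le_gt_dec 0 n) as [Hs|Hs].
- rewrite <- (Z2Nat.id n Hs), <- INR_IZR_INZ. go.
- replace n with (- Z.of_nat (Z.to_nat (- n)))%Z by lia. rewrite opp_IZR, <- INR_IZR_INZ, RtoC_opp.
 replace (- INR (Z.to_nat (- n)) * a) with (- (INR (Z.to_nat (- n)) * a)) by ring.
 replace (- INR (Z.to_nat (- n)) * b) with (- (INR (Z.to_nat (- n)) * b)) by ring. now rewrite !Cexp_opp, Hn.
Qed.

Lemma zp_one n : zp 1 n = 1.
Proof. unfold zp. rewrite clog_R by lra. rewrite ln_1. vanish (IZR n * 0). apply Cexp_0. Qed.
Lemma Cexp_clog_low (w : C) : w <> 0 -> Cexp (ln (Cmod w), arg_low w) = w.
Proof. intros H. destruct (arg_low_spec w H) as [_ E]. unfold Cexp, Re, Im. pairs. rewrite exp_ln by now apply Cmod_gt_0. go. Qed.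
Lemma autj_conj g z : autj g (Cconj z) = Cconj (autj g z).
Proof. go. Qed.

(** The two branches of the argument differ by 2 pi, which an integral power does not see. *)
Lemma anti_transform l F : invariant_anti 0 (2 - IZR l) F -> forall g z, upper z ->
  Cconj (F (mobius g z)) = zp (autj g z) (2 - l) * Cconj (F z).
Proof.
intros H g z Hz. have N := autj_nz g z Hz. have Nc : autj g (Cconj z) <> 0.
{ rewrite autj_conj. intros E. apply N. rewrite <- (Cconj_invol (autj g z)), E. go. } specialize (H g z Hz). unfold slash_anti in H.
rewrite mult_sys_0 in H. have E : F (mobius g z) = Cexp (IZR (2 - l) * (ln (Cmod (autj g (Cconj z))), arg_low (autj g (Cconj z)))) * F z.
{ rewrite <- H. unfold cpow_low. set (c := (ln _, arg_low _)). transitivity (Cexp (IZR (2 - l) * c + - (2 - IZR l) * c) * F (mobius g z)).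
 - rewrite minus_IZR, RtoC_minus. vanish ((2 - IZR l) * c + - (2 - IZR l) * c). rewrite Cexp_0. ring.
 - rewrite Cexp_plus. field. } rewrite E, Cmult_conj, <- Cexp_conj, Cmult_conj, Cconj_R. f_equal. apply Cexp_Z_ext.
rewrite Cexp_conj, Cexp_clog_low, Cexp_clog, autj_conj, Cconj_invol by go. go.
Qed.

Section Lift.
Variables (l M : Z) (F : C -> C) (k v : nat).
Notation f := (fun z => Cconj (F z)).
Hypothesis fa : forall z, upper z -> ana f z.
Hypothesis fp : forall z, upper z -> f (z + 1) = f z.
Hypothesis fgr : exists a0 B0 Y0 : R, forall x y, I01 x -> Y0 <= y -> Cmod (f (x, y)) <= B0 * exp (a0 * y).
Hypothesis ftr : forall g z, upper z -> f (mobius g z) = zp (autj g z) (2 - l) * f z.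
Hypothesis v2 : (2 <= v)%nat.
Hypothesis wt : Z.of_nat (2 * v) = (l + 12 * Z.of_nat k)%Z.
Notation U := (slit_plane M).
Notation Uo := (slit_plane_open M).
Notation h := (hh l M f k v).

Definition HH (r z : C) : C := eta_pow r z * h r z.
(** The factor of [HH] that is periodic. *)
Definition PP (r z : C) : C := Cexp (- 2 * r * sg z) * h r z.

Lemma hh_per r z : U r -> upper z -> h r (z + 1) = h r z.
Proof.
intros Hr Hz. rewrite <- mobius_T, (hh_inv l M f k v fa fp fgr v2 wt _ r z Hr Hz).
replace (autj (mkSL2Z 1 1 0 1 eq_refl) z) with (RtoC 1) by go. rewrite zp_one. ring.
Qed.

Lemma W_hh r : U r -> W anyC 2 (fun _ z => h r z).
Proof.
intros Hr. apply (W_ext anyC anyC_open 2 (fun _ z => uu l M f r z + (h r z - uu l M f r z))); [go|].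
apply W_plus; [apply (W_fix U 2 r Hr); exact (W_uu l M f k v fa fp fgr v2 wt)|]. apply W_ana. intros z Hz. now apply (hh_uu l M f k v).
Qed.

Lemma hh_J : J U h.
Proof.
intros r z Hr Hz. apply ct_mult.
- apply (ct_comp (dP dC dC) dC dC (fun z => / DK k z) (fun q => snd q)); [ctt|]. apply ana_ct, ana_inv; [apply DK_nz|now apply ana_DK].
- destruct (pst_bound l M f k v fa fp fgr v2 wt r z Hr Hz) as [d [C0 [Hd [HC H]]]]. have Hm : 0 < Rmin d (Im z / 2) by go.
 destruct (near_pair U Uo r z _ Hr Hz Hm) as [e [He Hn]].
 apply (ct_SUM (dP dC dC) (fun p q => pst (2 * v) (st l M f k (fst q)) p (snd q)) _ (fun p => C0 * qq p)%R).
 + unfold dP; pairs; rewrite !dC_refl; ring. + go.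
 + take e. intros q Hq. destruct (Hn q Hq) as [H1 [H2 [H3 H4]]]. apply lt_rmin in H3. apply lt_rmin in H4. split.
  * now apply pp_spec. * intros p. apply H; [go|go].
 + intros p. case_cop p as [Hc|Hc]; [|go]. apply ct_mult.
  * apply (ct_comp (dP dC dC) (dP dC dC) dC (fun q => st l M f k (fst q) (snd q)) (fun q => (fst q, mobius (gam p) (snd q))) (r, z)).
   -- apply ct_pair; [ctt|]. apply (ct_comp (dP dC dC) dC dC (mobius (gam p)) (fun q => snd q)); [ctt|]. now apply ana_ct, ana_mobius.
   -- apply (st_J l M f k v); trivial. now apply mobius_upper.
  * apply (ct_comp (dP dC dC) dC dC (fun z => / jp p z ^ (2 * v)) (fun q => snd q)); [ctt|].
   apply ana_ct, ana_inv; [now apply Cpow_nz, jp_nz|]. go.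
Qed.

Lemma eta_ana r z : upper z -> ana (eta_pow r) z.
Proof.
intros Hz. apply ana_ext_loc with (f := fun z => Cexp (2 * r * lg z)).
- destruct (upper_disc z Hz) as [d [Hd H]]. take d. intros y Hy. symmetry. now apply eta_pow_lg, H.
- apply ana_Cexp, ana_mult; [go|now apply ana_lg].
Qed.

Lemma HH_PP r z : upper z -> HH r z = ee (r / 12 * z) * PP r z.
Proof. intros Hz. unfold HH, PP. rewrite eta_pow_lg by go. unfold lg, ee. rewrite Cmult_assoc, <- Cexp_plus. f_equal. f_equal. field. Qed.
Lemma W_HH r : U r -> W anyC 2 (fun _ z => HH r z).
Proof. intros Hr. apply W_mult; [apply W_ana; intros; now apply eta_ana|now apply W_hh]. Qed.
Lemma W_PP r : U r -> W anyC 2 (fun _ z => PP r z).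
Proof. intros Hr. apply W_mult; [|now apply W_hh]. apply W_ana. intros z Hz. apply ana_Cexp, ana_mult; [go|now apply ana_sg]. Qed.
Lemma PP_per r z : U r -> upper z -> PP r (z + 1) = PP r z.
Proof. intros Hr Hz. unfold PP. now rewrite sg_per, hh_per. Qed.

Definition TT (r : C) (nu : Z) (z : C) : C := ee (r / 12 * z) * (fc (fun x => PP r (x, Im z)) nu * ez nu (Re z)).

Lemma TT_expansion r : U r -> is_fourier_expansion r (HH r) (TT r).
Proof.
intros Hr. split.
- intros nu z x' Hz. unfold TT. replace (Im (z + x')) with (Im z) by (unfold Im; simpl; ring). set (c := fc (fun x => PP r (x, Im z)) nu).
 have E : ee (r / 12 * (z + x')) * ez nu (Re (z + x')) = Cexp (2 * PI * Ci * (IZR nu + r / 12) * x') * (ee (r / 12 * z) * ez nu (Re z)).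
 { unfold ez, ee. rewrite <- !Cexp_plus. f_equal. go. } transitivity (c * (ee (r / 12 * (z + x')) * ez nu (Re (z + x')))); [ring|].
 rewrite E. ring.
- intros z Hz. rewrite HH_PP by go. have HW := W_PP r Hr.
 have HP : forall (s w : C), anyC s -> upper w -> PP r (w + 1) = PP r w by (intros; now apply PP_per).
 destruct (W_fc_bound anyC anyC_open (fun _ z => PP r z) HW HP 0 (Im z) (Im z) I Hz) as [d [C0 [Hd [HC H]]]].
 have Hb : forall n, Cmod (fc (fun x => PP r (x, Im z)) n) <= C0 * qz n by (intros n; apply (H n 0 (Im z)); [now apply disc_center|lra]).
 apply (is_sum_Z_of _ (fun n => Cmod (ee (r / 12 * z)) * (C0 * qz n))%R).
 + go. + intros n. unfold TT. rewrite Cmod_mult, Cmod_mult, Cmod_ez_R, Rmult_1_r. apply Rmult_le_compat_l; [go|go].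
 + apply is_sum_scal. destruct HW as [_ [ha [hb [_ [_ Hwd]]]]].
  have HF := fourier_per (fun x => PP r (x, Im z)) (fun x => ha 0 (x, Im z) + hb 0 (x, Im z)) (fun n => C0 * qz n)%R (fun t => gper_loc
   anyC (fun _ z => PP r z) HP 0 t (Im z) I Hz) (fun t => wd_horiz (PP r) _ _ t (Im z) (Hwd 0 (t, Im z) I Hz)) (bnd_scal _ C0 HC bnd_qz) Hb
   (Re z). go.
Qed.

Lemma TT_ana nu r z : U r -> upper z -> ana (fun r => TT r nu z) r.
Proof.
intros Hr Hz. destruct (Uo r Hr) as [d [Hd HU]]. unfold TT. apply ana_mult; [unfold Cdiv; anat|]. apply ana_mult; [|apply ana_const].
unfold fc. apply (ana_CI (fun r t => PP r (t, Im z) * ez (- nu) t) r d Hd).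
- intros w t Hw _. apply ct_jc. apply ct_mult; [|apply ct_ez; ctt]. unfold PP. pairs.
 have Hx : ct (dP dC dR) dC (fun q => (snd q, Im z)) (w, t) by (apply ct_xy; ctt). apply ct_mult.
 + have Hs := ct_comp (dP dC dR) dC dC sg _ _ Hx (ana_ct _ _ (ana_sg (t, Im z) Hz)). cbv beta in Hs. ctt.
 + apply (ct_comp (dP dC dR) (dP dC dC) dC (fun q => h (fst q) (snd q)) (fun q => (fst q, (snd q, Im z))) (w, t)); [go|].
  apply hh_J; [go|go].
- intros w t Hw _. apply ana_mult; [|apply ana_const]. apply ana_mult; [anat|]. apply hh_ana; trivial. go.
Qed.

Lemma HH_ana r z : U r -> upper z -> ana (fun r => HH r z) r.
Proof. intros Hr Hz. apply ana_mult; [anat|now apply hh_ana]. Qed.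

(** The antiholomorphic derivative of the lift. *)
Definition KK (r z : C) : C := / (2 * Ci) * (F z * (Cexp (- (IZR l + r) * clog (Im z)) * Cexp (- (2 * r) * Cconj (lg z)))).

Lemma HH_wd r z : U r -> upper z -> exists A, wd idC (HH r) z A (KK r z).
Proof.
intros Hr Hz. destruct (hh_wd l M f k v fa fp fgr ftr v2 wt r z Hr Hz) as [A HA]. eexists.
eapply wd_eq; [go| |apply (wd_mult idC (eta_pow r) (h r)); [apply ana_dd, eta_ana, Hz|exact HA]]. rewrite GG_eq by go.
rewrite eta_pow_lg by go. unfold KK. rewrite Cconj_invol, clog_R by go.
transitivity (/ (2 * Ci) * (F z * (Cexp (2 * r * lg z) * Cexp (- (IZR l + r) * ln (Im z) - 4 * r * Re (lg z))))); [ring|]. f_equal. f_equal.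
rewrite <- !Cexp_plus. f_equal. go.
Qed.

(** Apart from a power of y the function [KK] is antiholomorphic, so the Laplace operator annihilates the lift. *)
Lemma KK_wd r z : upper z -> exists B, wd idC (KK r) z (KK r z * (- (IZR l + r) / (2 * Ci * Im z))) B.
Proof.
intros Hz. have HF : wd idC F z 0 (Cconj (dd f z)).
{ apply (wd_ext idC (fun z => Cconj (f z))); [go|]. wd_by (apply wd_conj, ana_dd, fa, Hz); [go|go]. }
have Hy : wd idC (fun z => clog (Im z)) z (/ Im z * / (2 * Ci)) (/ Im z * - / (2 * Ci)).
{ apply (wd_comp_hol idC clog (fun z => RtoC (Im z))); [apply cder_clog, pos_slit; exact Hz|apply wd_Im_inv]. }
have Hl : wd idC (fun z => Cconj (lg z)) z 0 (Cconj (dd lg z)). { wd_by (apply wd_conj, cder_lg, Hz); [go|go]. } eexists. unfold KK.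
eapply wd_eq; [|go|apply wd_scal, wd_mult; [exact HF|apply wd_mult; [apply wd_Cexp, wd_scal, Hy|apply wd_Cexp, wd_scal, Hl]]]. cbv beta. go.
Qed.

Lemma KK_xi r z : upper z -> 2 * Ci * cpow (Im z) (IZR l + r) * KK r z = F z * eta_bar_pow r z.
Proof.
intros Hz. unfold KK, eta_bar_pow. rewrite log_eta_eq by go. fold (lg z). rewrite cpow_clog.
have E : Cexp ((IZR l + r) * clog (Im z)) * Cexp (- (IZR l + r) * clog (Im z)) = 1. { rewrite <- Cexp_plus, <- Cexp_0. f_equal. ring. }
transitivity (Cexp ((IZR l + r) * clog (Im z)) * Cexp (- (IZR l + r) * clog (Im z)) * (F z * Cexp (- (2 * r) * Cconj (lg z)))).
- go. - rewrite E. ring.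
Qed.

Lemma HH_dzbar r z : U r -> upper z -> d_zbar (HH r) z = KK r z.
Proof. intros Hr Hz. destruct (HH_wd r z Hr Hz) as [A HA]. now apply (wd_dz _ _ A). Qed.

Lemma HH_Laplace r z : U r -> upper z -> Laplace (IZR l + r) (HH r) z = 0.
Proof.
intros Hr Hz. unfold Laplace. rewrite HH_dzbar by go. destruct (KK_wd r z Hz) as [B HB].
have HD : wd idC (d_zbar (HH r)) z (KK r z * (- (IZR l + r) / (2 * Ci * Im z))) B.
{ apply (wd_ext_loc idC (KK r)); [|go]. destruct (upper_disc z Hz) as [d [Hd H]]. take d. intros y Hy. symmetry. now apply HH_dzbar, H. }
rewrite (proj1 (wd_dz _ _ _ _ HD)). set (K := KK r z). set (p := IZR l + r). set (y := RtoC (Im z)) in *.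
transitivity (2 * p * y * K * (1 + Ci * Ci) / Ci); [go|]. go.
Qed.

Lemma HH_inv r : U r -> invariant r (IZR l + r) (HH r).
Proof.
intros Hr g z Hz. unfold slash, HH. destruct (mult_sys_spec r g) as [N H]. rewrite H, (hh_inv l M f k v fa fp fgr v2 wt g r z Hr Hz) by go.
unfold zp. rewrite !cpow_clog.
have E : Cexp (- (IZR l + r) * clog (autj g z)) * (Cexp (r * clog (autj g z)) * Cexp (IZR l * clog (autj g z))) = 1.
{ rewrite <- !Cexp_plus, <- Cexp_0. f_equal. ring. }
transitivity (Cexp (- (IZR l + r) * clog (autj g z)) * (Cexp (r * clog (autj g z)) * Cexp (IZR l * clog (autj g z))) * (eta_pow r z * h r
 z)).
- go. - rewrite E. ring.
Qed.

Lemma HH_growth r : U r -> exp_growth (HH r).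
Proof.
intros Hr. destruct (hh_growth l M f k v fa fp fgr v2 wt r 1 Hr) as [c1 [Hc1 H1]]. destruct sg_bound as [B [HB HS]]. have Pr := Cmod_ge_0 r.
exists (c1 + 2 * Cmod r + 1)%R. split; [lra|]. intros K HK. destruct (compact_P1 K HK) as [m1 [m2 Hb]]. set (X := (Rabs m1 + Rabs m2)%R).
have PX : 0 <= X by (unfold X; have Q1 := Rabs_pos m1; have Q2 := Rabs_pos m2; lra). exists (exp (c1 + 2 * Cmod r * (X + B))), 1%R.
split; [lra|]. intros x y Hx Hy. have Hu : upper (x, y) by (apply upper_xy; lra). have HxX : Rabs x <= X.
{ specialize (Hb x Hx). unfold X. have Q1 := Rle_abs m2. have Q2 := Rle_abs (- m1). rewrite Rabs_Ropp in Q2. have Q3 := Rabs_pos m1.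
 have Q4 := Rabs_pos m2. apply Rabs_le. lra. } have Hh : Cmod (h r (x, y)) <= exp (c1 + c1 * y).
{ have E : h r (x, y) = h r (frac_part x, y).
 { have E : (x, y) = (frac_part x, y) + IZR (Int_part x) by (unfold frac_part; apply C_eq; simpl; ring). rewrite E at 1.
  apply (per_int (h r)); [|exact Hu]. intros w Hw. now apply hh_per. } rewrite E. apply (H1 (frac_part x, y)); [exact Hy|]. unfold Re.
 cbn [fst]. have Q := base_fp x. rewrite Rabs_pos_eq; lra. } have He : Cmod (eta_pow r (x, y)) <= exp (2 * Cmod r * (X + y + B)).
{ rewrite eta_pow_lg by assumption. rewrite Cmod_Cexp. apply exp_mono. have Q := re_le_Cmod (2 * r * lg (x, y)).
 rewrite !Cmod_mult, Cmod_R, (Rabs_pos_eq 2) in Q by lra. have Q2 := Rle_abs (Re (2 * r * lg (x, y))).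
 have Q3 : Cmod (lg (x, y)) <= X + y + B.
 { unfold lg, Cminus. tri. rewrite Cmod_opp. apply Rplus_le_compat; [|apply HS; exact Hy]. unfold Cdiv.
  rewrite !Cmod_mult, Cmod_Ci, Cmod_inv, !Cmod_R, (Rabs_pos_eq PI), (Rabs_pos_eq 12) by (try apply RtoC_nz; try (have G := PI_RGT_0); lra).
  have Z1 := Cmod_le_ReIm (x, y). unfold Re, Im in Z1. cbn [fst snd] in Z1. rewrite (Rabs_pos_eq y) in Z1 by lra. have G := PI_4.
  have G0 := PI_RGT_0. have Z2 := Cmod_ge_0 (x, y). nra. }
 assert (2 * Cmod r * Cmod (lg (x, y)) <= 2 * Cmod r * (X + y + B)) by (apply Rmult_le_compat_l; lra). lra. } unfold HH. rewrite Cmod_mult.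
apply Rle_trans with (exp (2 * Cmod r * (X + y + B)) * exp (c1 + c1 * y))%R.
- apply Rmult_le_compat; trivial; apply Cmod_ge_0. - rewrite <- !exp_plus. apply exp_mono. lra.
Qed.
End Lift.

Theorem theorem1p2 (l : Z) (l_even : Z.Even l) (F : C -> C)
    (HF : Mbar (2 - IZR l) 0 F) :
  exists muF : Z, forall M : Z, (muF <= M)%Z ->
    exists H : C -> C -> C,
      holomorphic_family (slit_plane M) H /\
      forall r : C, slit_plane M r ->
        Hharm (IZR l + r) r (H r) /\
        forall z : C, upper z ->
          xi (IZR l + r) (H r) z = F z * eta_bar_pow r z.
Proof.
destruct HF as [_ [Hanti [Hinv Hgr]]]. have fa : forall z, upper z -> ana (fun z => Cconj (F z)) z.
{ intros z Hz. destruct (upper_disc z Hz) as [d [Hd H]]. apply (goursat z d); [exact Hd|]. intros y Hy. apply ex_derive_cder. apply Hanti.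
 now apply H. } have ftr := anti_transform l F Hinv. have fp : forall z, upper z -> Cconj (F (z + 1)) = Cconj (F z).
{ intros z Hz. rewrite <- mobius_T, (ftr _ z Hz). replace (autj (mkSL2Z 1 1 0 1 eq_refl) z) with (RtoC 1) by (unfold autj; simpl; ring).
 rewrite zp_one. ring. } have fgr : exists a0 B0 Y0 : R, forall x y, I01 x -> Y0 <= y -> Cmod (Cconj (F (x, y))) <= B0 * exp (a0 * y).
{ destruct Hgr as [a [_ H]]. destruct (H _ (compact_P3 0 1)) as [B [Y [_ H2]]]. exists a, B, Y. intros x y Hx Hy. rewrite Cmod_conj.
 now apply H2. } destruct l_even as [l2 El]. set (k := Z.to_nat (Z.abs l + 4)). set (v := Z.to_nat (l2 + 6 * Z.of_nat k)).
have Hk : Z.of_nat k = (Z.abs l + 4)%Z by (unfold k; lia). have v2 : (2 <= v)%nat by (unfold v; lia).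
have wt : Z.of_nat (2 * v) = (l + 12 * Z.of_nat k)%Z by (unfold v; lia). exists 0%Z. intros M _. exists (HH l M F k v). split; [split|].
- intros z Hz r Hr. apply ana_ex_derive. now apply HH_ana.
- exists (TT l M F k v). split; [intros r Hr; now apply TT_expansion|]. intros nu z Hz r Hr. apply ana_ex_derive. now apply TT_ana.
- intros r Hr. split.
 + split; [exists l2; rewrite El, mult_IZR, RtoC_mult; ring|]. split; [apply W_class_C; now apply W_HH|].
  split; [intros z Hz; now apply HH_Laplace|]. split; [now apply HH_inv|now apply HH_growth].
 + intros z Hz. unfold xi. rewrite HH_dzbar by trivial. now apply KK_xi.
Qed.
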